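(* Let $\Gamma=(\mathbb{R}^{>0},\cdot,\le)$, let $\ell$ be a discretely valued Henselian non-archimedean field and $\mathcal{G}$ a smooth affine group scheme over $\ell^\circ$ with connected reductive geometric fibers and generic fiber $G$. Let $\theta\in N^\otimes(\mathcal{G})$ and let $\chi\colon D^{\Gamma/|\ell^*|}_{\ell^\circ}\to\underline{\mathrm{Aut}}^\otimes(\alpha_\theta)$ be a homomorphism which splits $\alpha_\theta$ over $\ell^\circ$. Let $T\in S(\mathcal{G})$ be such that $\theta\in A^\otimes(T)$, with split integral model $\mathcal{T}\subset\mathcal{G}$. Let $\chi'\colon D^\Gamma_{\ell^\circ}\to\mathcal{T}$ be the unique homomorphism with $\theta=\theta_{\chi'}$, and let $\bar\chi'$ be the composition $D^{\Gamma/|\ell^*|}_{\ell^\circ}\to D^\Gamma_{\ell^\circ}\xrightarrow{\chi'}\mathcal{T}$. Then the group schemes $\mathrm{Cent}_{\underline{\mathrm{Aut}}^\otimes(\alpha_\theta)}(\chi)$ and $\mathrm{Cent}_{\mathcal{G}}(\bar\chi')$ over $\ell^\circ$ are inner forms of each other in such a way that the conjugacy classes of $\chi$ and $\bar\chi'$ correspond to each other.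
   Context: Normed spaces. A non-archimedean field is a field $\ell$ with a non-archimedean norm $|\cdot|\colon\ell\to\Gamma\cup\{0\}$; $\ell^\circ=\{|x|\le1\}$, $\ell^{\circ\circ}=\{|x|<1\}$. A norm on an $\ell$-vector space $V$ is $\alpha\colon V\to\Gamma\cup\{0\}$ with $\alpha(v)=0\iff v=0$, $\alpha(\lambda v)=|\lambda|\alpha(v)$, $\alpha(v+w)\le\max(\alpha(v),\alpha(w))$; it is splittable if there is a basis $(e_i)$ (a splitting basis) with $\alpha(\sum\lambda_ie_i)=\max|\lambda_i|\alpha(e_i)$. $V^{\alpha\le\gamma}=\{v:\alpha(v)\le\gamma\}$ and $V^{\alpha<\gamma}=\{v:\alpha(v)<\gamma\}$. $\mathrm{Norm}^\circ(\ell)$: finite-dimensional $\ell$-vector spaces with splittable norm and contractive linear maps. A contractive map $h\colon(V,\alpha)\to(W,\beta)$ is strict if for every $w\in h(V)$, $\min\{\alpha(v):h(v)=w\}$ exists and equals $\beta(w)$; short exact sequences are sequences of strict maps which are short exact on vector spaces; the tensor product norm is the one for which tensor products of splitting bases are splitting with $(\alpha\otimes\beta)(e_i\otimes f_j)=\alpha(e_i)\beta(f_j)$. $N^\otimes(\mathcal{G})$. $\mathrm{Rep}^\circ\mathcal{G}$ is the category of representations of $\mathcal{G}$ on finitely generated projective $\ell^\circ$-modules. $N^\otimes(\mathcal{G})$ is the set of tuples $\theta=(\theta_X)_{X\in\mathrm{Rep}^\circ\mathcal{G}}$ of splittable norms $\theta_X$ on $X_\ell=X\otimes_{\ell^\circ}\ell$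 such that $X\mapsto(X_\ell,\theta_X)$ is an $\ell^\circ$-linear exact tensor functor $\alpha_\theta\colon\mathrm{Rep}^\circ\mathcal{G}\to\mathrm{Norm}^\circ(\ell)$. $\underline{\mathrm{Aut}}^\otimes(\alpha_\theta)$ is the functor (representable by a smooth affine group scheme over $\ell^\circ$ with generic fiber $G$) sending an $\ell^\circ$-algebra $R$ to the group of tuples $(\phi_X^\gamma)_{X\in\mathrm{Rep}^\circ\mathcal{G},\gamma\in\Gamma}$ of $R$-linear automorphisms $\phi_X^\gamma$ of $X_\ell^{\theta_X\le\gamma}\otimes_{\ell^\circ}R$ commuting with the maps induced by morphisms $X\to Y$ and inclusions for $\gamma\le\delta$, with the maps induced by multiplication by $\lambda\in\ell^*$ from level $\gamma$ to level $\gamma|\lambda|$, and with the maps $X_\ell^{\theta_X\le\gamma}\otimes Y_\ell^{\theta_Y\le\delta}\to(X\otimes Y)_\ell^{\theta_{X\otimes Y}\le\gamma\delta}$ (base changed to $R$). Splittings and tori. $D^A$ is the diagonalizable group scheme with character group $A$. A homomorphism $\chi\colon D^{\Gamma/|\ell^*|}_{\ell^\circ}\to\underline{\mathrm{Aut}}^\otimes(\alpha_\theta)$ splits $\alpha_\theta$ over $\ell^\circ$ if for all $X$ and $\gamma$ its only weight on $X_\ell^{\theta_X\le\gamma}/X_\ell^{\theta_X<\gamma}$ is the class of $\gamma$. $S(\mathcal{G})$ is the set of maximal split tori $T$ of $G$ which extend to a split closed subtorus $\mathcal{T}\subset\mathcal{G}$ (whose special fiber is then a maximal split torus of the special fiber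 of $\mathcal{G}$). For $T\in S(\mathcal{G})$ and $\chi'\colon D^\Gamma_{\ell^\circ}\to\mathcal{T}$, let $X=\bigoplus_{w\in\Gamma}X^w$ be the weight decomposition of $X\in\mathrm{Rep}^\circ\mathcal{G}$ under $\chi'$, and let $\theta_{\chi'}\in N^\otimes(\mathcal{G})$ be given by $\theta_{\chi',X}(\sum_wv_w)=\max_w\alpha_{X^w}(v_w)\,w$, where for a lattice $L$ the norm $\alpha_L$ on $L_\ell$ is defined by $\alpha_L(\lambda v)=|\lambda|$ for $v\in L\setminus\ell^{\circ\circ}L$. $A^\otimes(T)=\{\theta_{\chi'}\}$ is the set of all these norms; $\chi'\mapsto\theta_{\chi'}$ is injective. The map $D^{\Gamma/|\ell^*|}\to D^\Gamma$ is induced by the projection $\Gamma\to\Gamma/|\ell^*|$. *)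

(* Defs.v *)
From HB Require Import structures.
From mathcomp Require Import all_boot all_order all_algebra generic_quotient.
From mathcomp Require Import boolp classical_sets reals.
From mathcomp Require Import ring_quotient.

Set Implicit Arguments.
Unset Strict Implicit.
Unset Printing Implicit Defensive.
Import Order.TTheory GRing.Theory Num.Theory.
Local Open Scope ring_scope.
Local Open Scope quotient_scope.

(* For a class C of maps from G to S-modules, umod C is the free S-module   *)
(* on G modulo all the relations between the generators which hold under    *)
(* every map in C.  Tensor products and base changes are instances.         *)
Section UniversalModule.
Variables (S : comPzRingType) (G : choiceType).
Variable C : forall P : lmodType S, (G -> P) -> Prop.
Implicit Type P : lmodType S.

Definition usum (P : lmodType S) (f : G -> P) (s : seq (G * S)) : P :=
  \sum_(p <- s) p.2 *: f p.1.

Definition umod_rel (s t : seq (G * S)) : bool :=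
  `[< forall (P : lmodType S) (f : G -> P), C f -> usum f s = usum f t >].

Lemma umod_rel_class : equiv_class_of umod_rel.
Proof.
split=> [s|s t|s t u]; first exact/asboolP.
- by apply/asboolP/asboolP => h P f Cf; rewrite h.
- by move=> /asboolP h1 /asboolP h2; apply/asboolP => P f Cf; rewrite h1 ?h2.
Qed.

Canonical umod_equiv := EquivRelPack umod_rel_class.
Canonical umod_encModRel := defaultEncModRel umod_rel.

Definition umod := {eq_quot umod_rel}.
HB.instance Definition _ : EqQuotient _ umod_rel umod := EqQuotient.on umod.
HB.instance Definition _ := Choice.on umod.

(* For f in C this is the linear map with uext f (ugen g) = f g.            *)
Definition uext (P : lmodType S) (f : G -> P) (z : umod) : P := usum f (repr z).

Lemma uext_pi P (f : G -> P) s : C f -> uext f (\pi_umod s) = usum f s.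
Proof.
move=> Cf; have /eqmodP/asboolP h : repr (\pi_umod s) = s %[mod umod] by rewrite reprK.
exact: h.
Qed.

Lemma umod_ext (z t : umod) :
  (forall P (f : G -> P), C f -> uext f z = uext f t) -> z = t.
Proof.
by move=> h; rewrite -[z]reprK -[t]reprK; apply/eqmodP/asboolP => P f /h.
Qed.

Definition uadd (z t : umod) : umod := \pi_umod (repr z ++ repr t).
Definition uzero : umod := \pi_umod [::].
Definition uscale (a : S) (z : umod) : umod :=
  \pi_umod [seq (p.1, a * p.2) | p <- repr z].
Definition uopp (z : umod) : umod := uscale (-1) z.

Lemma uext_add P (f : G -> P) z t : C f -> uext f (uadd z t) = uext f z + uext f t.
Proof. by move=> Cf; rewrite uext_pi // /usum big_cat. Qed.

Lemma uext_zero P (f : G -> P) : C f -> uext f uzero = 0.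
Proof. by move=> Cf; rewrite uext_pi // /usum big_nil. Qed.

Lemma uext_scale P (f : G -> P) a z : C f -> uext f (uscale a z) = a *: uext f z.
Proof.
move=> Cf; rewrite uext_pi // /usum big_map scaler_sumr.
by apply: eq_bigr => p _; rewrite scalerA.
Qed.

Lemma uaddA : associative uadd.
Proof. by move=> x y z; apply: umod_ext => P f Cf; rewrite !uext_add // addrA. Qed.
Lemma uaddC : commutative uadd.
Proof. by move=> x y; apply: umod_ext => P f Cf; rewrite !uext_add // addrC. Qed.
Lemma uadd0 : left_id uzero uadd.
Proof.
by move=> x; apply: umod_ext => P f Cf; rewrite uext_add // uext_zero // add0r.
Qed.
Lemma uaddN : left_inverse uzero uopp uadd.
Proof.
move=> x; apply: umod_ext => P f Cf.
by rewrite uext_add // uext_scale // uext_zero // scaleN1r addNr.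
Qed.
HB.instance Definition _ := GRing.isZmodule.Build umod uaddA uaddC uadd0 uaddN.

Lemma uscaleA a b z : uscale a (uscale b z) = uscale (a * b) z.
Proof. by apply: umod_ext => P f Cf; rewrite !uext_scale // scalerA. Qed.
Lemma uscale1 : left_id 1 uscale.
Proof. by move=> z; apply: umod_ext => P f Cf; rewrite uext_scale // scale1r. Qed.
Lemma uscaleDr : right_distributive uscale +%R.
Proof.
move=> a x y; apply: umod_ext => P f Cf.
by rewrite uext_scale // !uext_add // !uext_scale // scalerDr.
Qed.
Lemma uscaleDl z : {morph uscale^~ z : a b / a + b}.
Proof.
move=> a b; apply: umod_ext => P f Cf.
by rewrite uext_scale // uext_add // !uext_scale // scalerDl.
Qed.
HB.instance Definition _ :=
  GRing.Zmodule_isLmodule.Build S umod uscaleA uscale1 uscaleDr uscaleDl.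

Definition ugen (g : G) : umod := \pi_umod [:: (g, 1)].

Lemma uext_gen P (f : G -> P) g : C f -> uext f (ugen g) = f g.
Proof. by move=> Cf; rewrite uext_pi // /usum big_seq1 scale1r. Qed.

Lemma uext_linear P (f : G -> P) : C f -> linear (uext f).
Proof. by move=> Cf a x y; rewrite uext_add // uext_scale. Qed.

Lemma umodE (z : umod) : z = \sum_(p <- repr z) p.2 *: ugen p.1.
Proof.
apply: umod_ext => P f Cf.
have h (s : seq (G * S)) :
    uext f (\sum_(p <- s) p.2 *: ugen p.1) = usum f s.
  elim: s => [|p s IH]; first by rewrite big_nil uext_zero // /usum big_nil.
  by rewrite big_cons uext_add // IH uext_scale // uext_gen // /usum big_cons.
by rewrite h.
Qed.

Lemma umod_ind (K : umod -> Prop) :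
  (forall a g z, K z -> K (a *: ugen g + z)) -> K 0 -> forall z, K z.
Proof.
move=> hK K0 z; rewrite (umodE z); elim: (repr z) => [|p s IH].
  by rewrite big_nil.
by rewrite big_cons; apply: hK.
Qed.

Lemma linear_umod_eq (P : lmodType S) (f g : umod -> P) :
  linear f -> linear g -> (forall x, f (ugen x) = g (ugen x)) -> f =1 g.
Proof.
move=> lf lg h; have z0 (k : umod -> P) : linear k -> k 0 = 0.
  by move=> lk; have := lk (-1) 0 0; rewrite scaleN1r oppr0 addr0 scaleN1r addNr.
by elim/umod_ind=> [a x z IH|]; rewrite ?lf ?lg ?h ?IH ?z0.
Qed.

End UniversalModule.

(* Algebras over k are morphisms k -> R of commutative rings (the zero     *)
(* ring being allowed), so that restriction of scalars is composition.     *)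
Record kalg (k : comPzRingType) := KAlg {
  kring :> comPzRingType;
  kstr : {rmorphism k -> kring} }.

Record khom (k : comPzRingType) (A B : kalg k) := KHom {
  khom_fun :> {rmorphism A -> B};
  khomP : forall a, khom_fun (kstr A a) = kstr B a }.

Section Algebras.
Variable k : comPzRingType.

Definition kself : kalg k := KAlg idfun.
Definition khom_id (A : kalg k) : khom A A := @KHom k A A idfun (fun a => erefl).

Lemma khom_compP (A B C : kalg k) (g : khom B C) (f : khom A B) a :
  (g \o f) (kstr A a) = kstr C a.
Proof. by rewrite /= !khomP. Qed.
Definition khom_comp (A B C : kalg k) (g : khom B C) (f : khom A B) : khom A C :=
  @KHom k A C (g \o f) (khom_compP g f).

Definition kres (A : kalg k) (B : kalg A) : kalg k := KAlg (kstr B \o kstr A).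
Lemma kres_homP (A : kalg k) (B C : kalg A) (f : khom B C) a :
  f (kstr (kres B) a) = kstr (kres C) a.
Proof. exact: khomP. Qed.
Definition kres_hom (A : kalg k) (B C : kalg A) (f : khom B C) :
  khom (kres B) (kres C) := @KHom k (kres B) (kres C) f (kres_homP f).

Definition kover (A B : kalg k) (f : khom A B) : kalg A := KAlg f.
End Algebras.
Arguments kself : clear implicits.

Definition resmod (A B : comPzRingType) (f : {rmorphism A -> B})
  (V : lmodType B) : Type := V.

Section RestrictionOfScalars.
Variables (A B : comPzRingType) (f : {rmorphism A -> B}) (V : lmodType B).
Local Notation resmod := (resmod f V).

HB.instance Definition _ := GRing.Zmodule.copy resmod V.
Definition resmod_scale (a : A) (v : resmod) : resmod := f a *: (v : V).
Lemma resmod_scaleA a b v :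
  resmod_scale a (resmod_scale b v) = resmod_scale (a * b) v.
Proof. by rewrite /resmod_scale scalerA rmorphM. Qed.
Lemma resmod_scale1 : left_id 1 resmod_scale.
Proof. by move=> v; rewrite /resmod_scale rmorph1 scale1r. Qed.
Lemma resmod_scaleDr : right_distributive resmod_scale +%R.
Proof. by move=> a u v; rewrite /resmod_scale -scalerDr. Qed.
Lemma resmod_scaleDl v : {morph resmod_scale^~ v : a b / a + b}.
Proof. by move=> a b; rewrite /resmod_scale rmorphD scalerDl. Qed.
HB.instance Definition _ := GRing.Zmodule_isLmodule.Build A resmod
  resmod_scaleA resmod_scale1 resmod_scaleDr resmod_scaleDl.
End RestrictionOfScalars.

Section BaseChange.
Variable k : comPzRingType.
Implicit Types (R S : kalg k) (M N P : lmodType k).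

Definition semilin R M (P : lmodType R) (f : M -> P) : Prop :=
  (forall x y, f (x + y) = f x + f y) /\
  (forall a x, f (a *: x) = kstr R a *: f x).

Definition bc M R : lmodType R := umod (@semilin R M).
Definition bc_in M R (x : M) : bc M R := ugen (@semilin R M) x.

Definition bilin M N P (b : M -> N -> P) : Prop :=
  (forall y, linear (b^~ y)) /\ (forall x, linear (b x)).

Definition tens M N : lmodType k :=
  umod (fun (P : lmodType k) (f : M * N -> P) => bilin (fun x y => f (x, y))).
Definition tens_in M N (x : M) (y : N) : tens M N :=
  ugen (fun (P : lmodType k) (f : M * N -> P) => bilin (fun x y => f (x, y))) (x, y).

Definition bcmap M N (u : M -> N) R : bc M R -> bc N R :=
  uext (fun x => bc_in R (u x)).
Definition bcpush M R S (f : khom R S) : bc M R -> bc M S :=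
  @uext R M (@semilin R M) (resmod f (bc M S)) (fun x => bc_in S x).
(* the R-bilinear extension of a k-bilinear map b *)
Definition bcbilin M N P (b : M -> N -> P) R (z : bc M R) (t : bc N R) : bc P R :=
  uext (fun x => uext (fun y => bc_in R (b x y)) t) z.

Lemma bc_inP M R : semilin (@bc_in M R).
Proof.
split=> [x y|a x]; apply: umod_ext => P f [fD fZ].
  by rewrite uext_add // !uext_gen.
by rewrite uext_scale // !uext_gen.
Qed.

Lemma tens_inP M N : bilin (@tens_in M N).
Proof.
by split=> [y a x x'|x a y y']; apply: umod_ext => P f Cf;
  rewrite (uext_linear Cf) !uext_gen //; [apply: Cf.1|apply: Cf.2].
Qed.

End BaseChange.

Section BaseChangeTheory.
Variable k : comPzRingType.
Implicit Types (R S : kalg k) (M N P : lmodType k).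

Lemma bcmap_in M N (u : M -> N) R x :
  linear u -> bcmap u (bc_in R x) = bc_in R (u x).
Proof.
move=> lu; rewrite /bcmap uext_gen //; split=> [y z|a y].
  by have := lu 1 y z; rewrite !scale1r => ->; rewrite (bc_inP N R).1.
have u0 : u 0 = 0.
  by have := lu (-1) 0 0; rewrite scaler0 addr0 scaleN1r addNr.
by have := lu a y 0; rewrite u0 !addr0 => ->; rewrite (bc_inP N R).2.
Qed.

Lemma semilin_comp M N (u : M -> N) R (P : lmodType R) (f : N -> P) :
  linear u -> semilin f -> semilin (f \o u).
Proof.
move=> lu [fD fZ]; have u0 : u 0 = 0.
  by have := lu (-1) 0 0; rewrite scaler0 addr0 scaleN1r addNr.
split=> [y z|a y] /=.
  by have := lu 1 y z; rewrite !scale1r => ->.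
by have := lu a y 0; rewrite u0 !addr0 => ->.
Qed.

Lemma bcmap_linear M N (u : M -> N) R : linear u -> linear (@bcmap k M N u R).
Proof. by move=> lu; apply: uext_linear; apply: semilin_comp lu (bc_inP N R). Qed.

Lemma bcpush_semilin M R S (f : khom R S) :
  @semilin k R M (resmod f (bc M S)) (fun x => bc_in S x).
Proof.
split=> [x y|a x]; first exact: (bc_inP M S).1.
by rewrite (bc_inP M S).2 -(khomP f).
Qed.

Lemma bcpush_in M R S (f : khom R S) (x : M) : bcpush f (bc_in R x) = bc_in S x.
Proof. exact: uext_gen (bcpush_semilin M f). Qed.

Lemma bcpush_linear M R S (f : khom R S) a (x y : bc M R) :
  bcpush f (a *: x + y) = f a *: bcpush f x + bcpush f y.
Proof. exact: (uext_linear (bcpush_semilin M f)). Qed.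

Lemma linear0' (A : comPzRingType) (M N : lmodType A) (u : M -> N) :
  linear u -> u 0 = 0.
Proof.
by move=> lu; have := lu (-1) 0 0; rewrite scaler0 addr0 scaleN1r addNr.
Qed.
Lemma linearD' (A : comPzRingType) (M N : lmodType A) (u : M -> N) x y :
  linear u -> u (x + y) = u x + u y.
Proof. by move=> lu; have := lu 1 x y; rewrite !scale1r. Qed.
Lemma linearZ' (A : comPzRingType) (M N : lmodType A) (u : M -> N) a x :
  linear u -> u (a *: x) = a *: u x.
Proof. by move=> lu; have := lu a x 0; rewrite (linear0' lu) !addr0. Qed.

Lemma bcpush0 M R S (f : khom R S) : bcpush f (0 : bc M R) = 0.
Proof.
by have := bcpush_linear f (-1) (0 : bc M R) 0;
  rewrite scaler0 addr0 rmorphN1 scaleN1r addNr.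
Qed.
Lemma bcpushZ M R S (f : khom R S) a (x : bc M R) :
  bcpush f (a *: x) = f a *: bcpush f x.
Proof. by have := bcpush_linear f a x 0; rewrite bcpush0 !addr0. Qed.

Lemma bc_ind M R (K : bc M R -> Prop) :
  (forall a x z, K z -> K (a *: bc_in R x + z)) -> K 0 -> forall z, K z.
Proof. exact: umod_ind. Qed.

Lemma linear_bc_eq M R (Q : lmodType R) (f g : bc M R -> Q) :
  linear f -> linear g -> (forall x, f (bc_in R x) = g (bc_in R x)) -> f =1 g.
Proof. exact: linear_umod_eq. Qed.

Lemma bcbilin_semilin M N P (b : M -> N -> P) R (t : bc N R) : bilin b ->
  semilin (fun x => @uext R N (@semilin k R N) (bc P R) (fun y => bc_in R (b x y)) t).
Proof.
move=> [bl br]; have sb x := semilin_comp (br x) (bc_inP P R).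
have ll x := uext_linear (sb x).
split=> [x y|a x].
  elim/bc_ind: t => [c y0 z IH|]; last by rewrite !(linear0' (ll _)) addr0.
  rewrite !ll IH !uext_gen //=.
  rewrite (linearD' _ _ (bl y0)) (bc_inP P R).1 scalerDr.
  by rewrite addrACA.
elim/bc_ind: t => [c y0 z IH|]; last by rewrite !(linear0' (ll _)) scaler0.
rewrite !ll IH !uext_gen //= (linearZ' _ _ (bl y0)) (bc_inP P R).2.
by rewrite scalerDr !scalerA mulrC.
Qed.

Lemma bcbilin_in M N P (b : M -> N -> P) R x y :
  bilin b -> bcbilin b (bc_in R x) (bc_in R y) = bc_in R (b x y).
Proof.
move=> hb; rewrite /bcbilin uext_gen; last exact: bcbilin_semilin.
by rewrite uext_gen //; apply: semilin_comp (hb.2 x) (bc_inP P R).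
Qed.

Lemma bcbilin_linear1 M N P (b : M -> N -> P) R t :
  bilin b -> linear (fun z => @bcbilin k M N P b R z t).
Proof. by move=> hb; apply: uext_linear; apply: bcbilin_semilin. Qed.

Lemma bcbilin_linear2 M N P (b : M -> N -> P) R z :
  bilin b -> linear (@bcbilin k M N P b R z).
Proof.
move=> hb a t t'; elim/bc_ind: z => [c x z IH|].
  rewrite !(bcbilin_linear1 _ hb) IH /bcbilin !(uext_gen _ (bcbilin_semilin _ hb)).
  have sb := semilin_comp (hb.2 x) (bc_inP P R).
  rewrite (uext_linear sb) !scalerDr !scalerA mulrC.
  by rewrite addrACA.
by rewrite !(linear0' (bcbilin_linear1 _ hb)) scaler0 addr0.
Qed.

Lemma bcpush_bilin M N P (b : M -> N -> P) R S (f : khom R S) z t : bilin b ->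
  bcpush f (bcbilin b z t : bc P R) = bcbilin b (bcpush f z) (bcpush f t).
Proof.
move=> hb; elim/bc_ind: z => [c x z IH|]; last first.
  by rewrite !bcpush0 !(linear0' (bcbilin_linear1 _ hb)) bcpush0.
rewrite (bcbilin_linear1 _ hb) !bcpush_linear (bcbilin_linear1 _ hb) IH bcpush_in.
congr (_ *: _ + _).
elim/bc_ind: t {IH} => [d y t IH|]; last first.
  by rewrite !bcpush0 !(linear0' (bcbilin_linear2 _ hb)) bcpush0.
rewrite (bcbilin_linear2 _ hb) !bcpush_linear (bcbilin_linear2 _ hb) IH bcpush_in.
by rewrite !bcbilin_in // bcpush_in.
Qed.

Lemma bcpush_map M N (u : M -> N) R S (f : khom R S) z : linear u ->
  bcpush f (bcmap u z : bc N R) = bcmap u (bcpush f z).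
Proof.
move=> lu; elim/bc_ind: z => [c x z IH|].
  by rewrite !(bcmap_linear lu, bcpush_linear) IH !(bcmap_in, bcpush_in) //
     (bcmap_linear lu) bcmap_in.
by rewrite !bcpush0 !(linear0' (bcmap_linear lu)) bcpush0.
Qed.

Lemma tens_ind M N (K : tens M N -> Prop) :
  (forall x y z, K z -> K (tens_in x y + z)) -> K 0 -> forall z, K z.
Proof.
move=> hK; apply: umod_ind => a [x y] z /hK h; have := h (a *: x) y.
by rewrite (linearZ' _ _ ((tens_inP M N).1 y)).
Qed.

Definition tens_ext M N P (b : M -> N -> P) : tens M N -> P :=
  uext (fun p => b p.1 p.2).
End BaseChangeTheory.

(* Group functors.  A group scheme which is affine over k is treated as    *)
(* its functor of points on k-algebras; representability is the separate   *)
(* predicate represents.  No bound is imposed on the size of the values.   *)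
Record grpfun (k : comPzRingType) := GrpFun {
  pts :> kalg k -> Type;
  gmul : forall R, pts R -> pts R -> pts R;
  gone : forall R, pts R;
  ginv : forall R, pts R -> pts R;
  gmap : forall R S, khom R S -> pts R -> pts S;
  gmulA : forall R (x y z : pts R), gmul x (gmul y z) = gmul (gmul x y) z;
  gmul1 : forall R (x : pts R), gmul (gone R) x = x;
  gmulV : forall R (x : pts R), gmul (ginv x) x = gone R;
  gmapM : forall R S (f : khom R S) (x y : pts R),
    gmap f (gmul x y) = gmul (gmap f x) (gmap f y);
  gmap_id : forall R (x : pts R), gmap (khom_id R) x = x;
  gmap_comp : forall R S U (g : khom S U) (f : khom R S) (x : pts R),
    gmap (khom_comp g f) x = gmap g (gmap f x) }.

Section GroupTheory.
Variables (k : comPzRingType) (F : grpfun k) (R : kalg k).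
Implicit Types x y z : F R.

Lemma gmulI x y z : gmul x y = gmul x z -> y = z.
Proof. by move=> h; rewrite -[y]gmul1 -[z]gmul1 -(gmulV x) -!gmulA h. Qed.
Lemma gmulx1 x : gmul x (gone F R) = x.
Proof. by apply: (@gmulI (ginv x)); rewrite gmulA gmulV gmul1. Qed.
Lemma gmulxV x : gmul x (ginv x) = gone F R.
Proof. by apply: (@gmulI (ginv x)); rewrite gmulA gmulV gmul1 gmulx1. Qed.
Lemma gmulIr x y z : gmul y x = gmul z x -> y = z.
Proof. by move=> h; rewrite -[y]gmulx1 -[z]gmulx1 -(gmulxV x) !gmulA h. Qed.
End GroupTheory.

Section GroupTheory2.
Variables (k : comPzRingType) (F : grpfun k).
Lemma gmap1 R S (f : khom R S) : gmap f (gone F R) = gone F S.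
Proof. by apply: (@gmulI k F S (gmap f (gone F R))); rewrite -gmapM gmul1 gmulx1. Qed.
Lemma gmapV R S (f : khom R S) (x : F R) : gmap f (ginv x) = ginv (gmap f x).
Proof. by apply: (@gmulI k F S (gmap f x)); rewrite -gmapM !gmulxV gmap1. Qed.
Lemma ginv1 R : ginv (gone F R) = gone F R.
Proof. by rewrite -[LHS]gmulx1 gmulV. Qed.
Lemma ginvM R (x y : F R) : ginv (gmul x y) = gmul (ginv y) (ginv x).
Proof.
apply: (@gmulI k F R (gmul x y)).
by rewrite gmulxV gmulA -[X in _ = gmul X _]gmulA gmulxV gmulx1 gmulxV.
Qed.
End GroupTheory2.

Record ghom (k : comPzRingType) (F G : grpfun k) := GHom {
  ghom_fun :> forall R, F R -> G R;
  ghomM : forall R (x y : F R),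
    ghom_fun (gmul x y) = gmul (ghom_fun x) (ghom_fun y);
  ghom_nat : forall R S (f : khom R S) (x : F R),
    ghom_fun (gmap f x) = gmap f (ghom_fun x) }.
Arguments ghom_fun {k F G} _ R _.

Section Homs.
Variables (k : comPzRingType) (F G H : grpfun k).
Variables (b : ghom G H) (a : ghom F G).

Lemma ghom_compM R (x y : F R) :
  b R (a R (gmul x y)) = gmul (b R (a R x)) (b R (a R y)).
Proof. by rewrite !ghomM. Qed.
Lemma ghom_comp_nat R S (f : khom R S) (x : F R) :
  b S (a S (gmap f x)) = gmap f (b R (a R x)).
Proof. by rewrite !ghom_nat. Qed.
Definition ghom_comp : ghom F H :=
  @GHom k F H (fun R x => b R (a R x)) ghom_compM ghom_comp_nat.
End Homs.

Lemma ghom1 (k : comPzRingType) (F G : grpfun k) (a : ghom F G) R :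
  a R (gone F R) = gone G R.
Proof. by apply: (@gmulI k G R (a R (gone F R))); rewrite -ghomM gmul1 gmulx1. Qed.
Lemma ghomV (k : comPzRingType) (F G : grpfun k) (a : ghom F G) R (x : F R) :
  a R (ginv x) = ginv (a R x).
Proof. by apply: (@gmulI k G R (a R x)); rewrite -ghomM !gmulxV ghom1. Qed.

Record subgrp (k : comPzRingType) (F : grpfun k) := SubGrp {
  smem :> forall R, F R -> Prop;
  smem1 : forall R, smem (gone F R);
  smemM : forall R (x y : F R), smem x -> smem y -> smem (gmul x y);
  smemV : forall R (x : F R), smem x -> smem (ginv x);
  smem_map : forall R S (f : khom R S) (x : F R), smem x -> smem (gmap f x) }.
Arguments smem {k F} _ R _.

Lemma sig_eq (T : Type) (P : T -> Prop) (x y : {z | P z}) : sval x = sval y -> x = y.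
Proof.
by case: x y => [x px] [y py] /= e; rewrite e in px *; rewrite (Prop_irrelevance px py).
Qed.

Section SubFunctor.
Variables (k : comPzRingType) (F : grpfun k) (S : subgrp F).

Definition sub_pts (R : kalg k) := {x : F R | S R x}.
Definition sub_mul R (x y : sub_pts R) : sub_pts R :=
  exist _ (gmul (sval x) (sval y)) (smemM (svalP x) (svalP y)).
Definition sub_one R : sub_pts R := exist _ (gone F R) (smem1 S R).
Definition sub_inv R (x : sub_pts R) : sub_pts R :=
  exist _ (ginv (sval x)) (smemV (svalP x)).
Definition sub_map R R' (f : khom R R') (x : sub_pts R) : sub_pts R' :=
  exist _ (gmap f (sval x)) (smem_map f (svalP x)).

Definition subfun : grpfun k.
refine (@GrpFun k sub_pts sub_mul sub_one sub_inv sub_map _ _ _ _ _ _).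
- by move=> R x y z; apply: sig_eq; apply: gmulA.
- by move=> R x; apply: sig_eq; apply: gmul1.
- by move=> R x; apply: sig_eq; apply: gmulV.
- by move=> R R' f x y; apply: sig_eq; apply: gmapM.
- by move=> R x; apply: sig_eq; apply: gmap_id.
- by move=> R R' U g f x; apply: sig_eq; apply: gmap_comp.
Defined.

Definition subincl : ghom subfun F.
by refine (@GHom k subfun F (fun R x => sval x) _ _).
Defined.
End SubFunctor.

Section Product.
Variables (k : comPzRingType) (I : Type) (F : I -> grpfun k).

Definition prodfun : grpfun k.
refine (@GrpFun k (fun R => forall i, F i R)
  (fun R x y i => gmul (x i) (y i)) (fun R i => gone (F i) R)
  (fun R x i => ginv (x i)) (fun R S f x i => gmap f (x i)) _ _ _ _ _ _).
- by move=> R x y z; apply: functional_extensionality_dep => i; apply: gmulA.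
- by move=> R x; apply: functional_extensionality_dep => i; apply: gmul1.
- by move=> R x; apply: functional_extensionality_dep => i; apply: gmulV.
- by move=> R R' f x y; apply: functional_extensionality_dep => i; apply: gmapM.
- by move=> R x; apply: functional_extensionality_dep => i; apply: gmap_id.
- by move=> R R' U g f x; apply: functional_extensionality_dep => i; apply: gmap_comp.
Defined.
End Product.

Section GroupBaseChange.
Variables (k : comPzRingType) (K : kalg k).

Definition gbc (F : grpfun k) : grpfun K.
refine (@GrpFun K (fun R => F (kres R)) (fun R x y => gmul x y)
  (fun R => gone F _) (fun R x => ginv x)
  (fun R S f x => gmap (kres_hom f) x) _ _ _ _ _ _).
- by move=> R x y z; apply: gmulA.
- by move=> R x; apply: gmul1.
- by move=> R x; apply: gmulV.
- by move=> R R' f x y; apply: gmapM.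
- move=> R x; rewrite -[RHS]gmap_id; congr (gmap _ x).
  by congr KHom; apply: Prop_irrelevance.
- move=> R R' U g f x; rewrite -gmap_comp; congr (gmap _ x).
  by congr KHom; apply: Prop_irrelevance.
Defined.

Definition sub_gbc (F : grpfun k) (S : subgrp F) : subgrp (gbc F).
refine (@SubGrp K (gbc F) (fun R x => S (kres R) x) _ _ _ _).
- by move=> R; apply: smem1.
- by move=> R x y; apply: smemM.
- by move=> R x; apply: smemV.
- by move=> R R' f x; apply: smem_map.
Defined.
End GroupBaseChange.

Record laut (S : comPzRingType) (M : lmodType S) := LAut {
  lfun :> M -> M;
  linv : M -> M;
  lfunP : linear lfun;
  lfunK : cancel lfun linv;
  linvK : cancel linv lfun }.

Section LinearAutomorphisms.
Variables (S : comPzRingType) (M : lmodType S).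

Lemma laut_eq (f g : laut M) : f =1 g -> f = g.
Proof.
case: f g => [f f' lf fK f'K] [g g' lg gK g'K] /= /funext e; move: e => e.
rewrite e in lf fK f'K *.
have e' : f' = g' by apply: funext => x; rewrite -{1}[x]g'K fK.
rewrite e' in fK f'K *.
by rewrite (Prop_irrelevance lf lg) (Prop_irrelevance fK gK) (Prop_irrelevance f'K g'K).
Qed.

Lemma linvP (f : laut M) : linear (linv f).
Proof. by move=> a x y; rewrite -{1}[x](linvK f) -{1}[y](linvK f) -lfunP lfunK. Qed.

Definition laut1 : laut M.
by refine (@LAut S M id id _ _ _).
Defined.
Definition lautM (f g : laut M) : laut M.
refine (@LAut S M (f \o g) (linv g \o linv f) _ _ _).
- by move=> a x y /=; rewrite !lfunP.
- by move=> x /=; rewrite !lfunK.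
- by move=> x /=; rewrite !linvK.
Defined.
Definition lautV (f : laut M) : laut M :=
  LAut (linvP f) (@linvK S M f) (@lfunK S M f).
End LinearAutomorphisms.

Section GL.
Variables (k : comPzRingType) (M : lmodType k).

Lemma gl_map_semilin (R S : kalg k) (f : khom R S) (g : bc M R -> bc M R) :
  linear g -> @semilin k S M (bc M S) (fun x => bcpush f (g (bc_in R x))).
Proof.
move=> lg; split=> [x y|a x].
  rewrite (bc_inP M R).1 (linearD' _ _ lg).
  by have := bcpush_linear f 1 (g (bc_in R x)) (g (bc_in R y)); rewrite rmorph1 !scale1r.
by rewrite (bc_inP M R).2 (linearZ' _ _ lg) bcpushZ khomP.
Qed.

Definition gl_map_fun (R S : kalg k) (f : khom R S) (g : bc M R -> bc M R) :
  bc M S -> bc M S := uext (fun x => bcpush f (g (bc_in R x))).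

Lemma gl_map_push (R S : kalg k) (f : khom R S) (g : bc M R -> bc M R) z :
  linear g -> gl_map_fun f g (bcpush f z) = bcpush f (g z).
Proof.
move=> lg.
have lm : linear (gl_map_fun f g) := uext_linear (gl_map_semilin f lg).
elim/bc_ind: z => [a x z IH|].
  rewrite bcpush_linear lm IH lg bcpush_linear bcpush_in /gl_map_fun uext_gen //.
  exact: gl_map_semilin.
by rewrite bcpush0 (linear0' lg) bcpush0 (linear0' lm).
Qed.

Lemma gl_mapK (R S : kalg k) (f : khom R S) (g h : bc M R -> bc M R) :
  linear g -> linear h -> cancel g h -> cancel (gl_map_fun f g) (gl_map_fun f h).
Proof.
move=> lg lh gK.
apply: (@linear_bc_eq k M S (bc M S) (gl_map_fun f h \o gl_map_fun f g) id).
- move=> a x y /=; rewrite /gl_map_fun !(uext_linear (gl_map_semilin f lg)).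
  by rewrite !(uext_linear (gl_map_semilin f lh)).
- by [].
- by move=> x /=; rewrite -[bc_in S x](bcpush_in f) !gl_map_push // gK.
Qed.

Definition gl_map (R S : kalg k) (f : khom R S) (g : laut (bc M R)) : laut (bc M S) :=
  LAut (uext_linear (gl_map_semilin f (lfunP g)))
    (gl_mapK f (lfunP g) (linvP g) (lfunK g)) (gl_mapK f (linvP g) (lfunP g) (linvK g)).

Lemma gl_mapE (R S : kalg k) (f : khom R S) (g : laut (bc M R)) z :
  gl_map f g (bcpush f z) = bcpush f (g z).
Proof. exact: gl_map_push (lfunP g). Qed.

(* R |-> Aut_R (M tensored with R) *)
Definition GL : grpfun k.
refine (@GrpFun k (fun R => laut (bc M R)) (fun R f g => lautM f g)
  (fun R => laut1 (bc M R)) (fun R f => lautV f) gl_map _ _ _ _ _ _).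
- by move=> R x y z; apply: laut_eq.
- by move=> R x; apply: laut_eq.
- by move=> R x; apply: laut_eq => z /=; rewrite lfunK.
- move=> R S f x y; apply: laut_eq; apply: linear_bc_eq.
  + exact: lfunP.
  + exact: lfunP.
  + move=> m; rewrite -(bcpush_in f) gl_mapE.
    rewrite -[RHS]/(gl_map f x (gl_map f y (bcpush f (bc_in R m)))).
    by rewrite !gl_mapE.
- move=> R x; apply: laut_eq; apply: linear_bc_eq; try exact: lfunP.
  move=> m; rewrite -{1}(bcpush_in (khom_id R)) gl_mapE.
  elim/bc_ind: (x _) => [a y z IH|]; last by rewrite bcpush0.
  by rewrite bcpush_linear IH bcpush_in.
- move=> R S U g f x; apply: laut_eq; apply: linear_bc_eq; try exact: lfunP.
  move=> m; rewrite -{1}(bcpush_in (khom_comp g f)) gl_mapE.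
  rewrite -(bcpush_in g) -(bcpush_in f) !gl_mapE.
  elim/bc_ind: (x _) => [a y z IH|]; last by rewrite !bcpush0.
  by rewrite !bcpush_linear IH !bcpush_in.
Defined.
End GL.

Definition fgproj (k : comPzRingType) (M : lmodType k) : Prop :=
  exists (n : nat) (i : M -> 'rV[k]_n) (p : 'rV[k]_n -> M),
    [/\ linear i, linear p & cancel i p].

Record rep (k : comPzRingType) (G : grpfun k) := Rep {
  rmod :> lmodType k;
  rmodP : fgproj rmod;
  ract : ghom G (GL rmod) }.

Definition rep_mor (k : comPzRingType) (G : grpfun k) (X Y : rep G) (u : X -> Y) :
    Prop :=
  linear u /\
  forall (R : kalg k) (g : G R) (z : bc X R),
    bcmap u (ract X R g z) = ract Y R g (bcmap u z).

Section TensorProduct.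
Variables (k : comPzRingType) (M N : lmodType k).

(* the R-bilinear map (M_R) x (N_R) -> (M tensor N)_R *)
Definition bctens (R : kalg k) (z : bc M R) (t : bc N R) : bc (tens M N) R :=
  bcbilin (@tens_in k M N) z t.

Definition glt_fun R (g : bc M R -> bc M R) (h : bc N R -> bc N R) :
    bc (tens M N) R -> bc (tens M N) R :=
  @uext R (tens M N) (@semilin k R (tens M N)) (bc (tens M N) R)
    (@tens_ext k M N (resmod (kstr R) (bc (tens M N) R))
       (fun x y => bctens (g (bc_in R x)) (h (bc_in R y)))).

Section Fixed.
Variables (R : kalg k).
Implicit Types (g : bc M R -> bc M R) (h : bc N R -> bc N R).

Lemma glt_bilin g h : linear g -> linear h ->
  @bilin k M N (resmod (kstr R) (bc (tens M N) R))
    (fun x y => bctens (g (bc_in R x)) (h (bc_in R y))).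
Proof.
move=> lg lh; have hb := tens_inP M N; split=> [y a x x'|x a y y'] /=.
  rewrite (bc_inP M R).1 (bc_inP M R).2 (lg (kstr R a)).
  by rewrite /bctens (bcbilin_linear1 _ hb).
rewrite (bc_inP N R).1 (bc_inP N R).2 (lh (kstr R a)).
by rewrite /bctens (bcbilin_linear2 _ hb).
Qed.

Lemma glt_semilin g h : linear g -> linear h ->
  @semilin k R (tens M N) (bc (tens M N) R)
    (@tens_ext k M N (resmod (kstr R) (bc (tens M N) R))
       (fun x y => bctens (g (bc_in R x)) (h (bc_in R y)))).
Proof.
move=> lg lh; have lu : linear (@tens_ext k M N (resmod (kstr R) (bc (tens M N) R))
       (fun x y => bctens (g (bc_in R x)) (h (bc_in R y)))).
  exact: (uext_linear (glt_bilin lg lh)).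
split=> [x y|a x]; first exact: (linearD' _ _ lu).
exact: (linearZ' _ _ lu).
Qed.

Lemma glt_linear g h : linear g -> linear h -> linear (glt_fun g h).
Proof. by move=> lg lh; apply: uext_linear; apply: glt_semilin. Qed.

Lemma glt_tens g h z t : linear g -> linear h ->
  glt_fun g h (bctens z t) = bctens (g z) (h t).
Proof.
move=> lg lh; have hb := tens_inP M N; have lt := glt_linear lg lh.
elim/bc_ind: z => [a x z IH|]; last first.
  by rewrite (linear0' lg) /bctens !(linear0' (bcbilin_linear1 _ hb)) (linear0' lt).
rewrite lg /bctens !(bcbilin_linear1 _ hb) lt -/bctens IH; congr (_ *: _ + _).
elim/bc_ind: t {IH} => [a' y t IH|]; last first.
  by rewrite (linear0' lh) /bctens !(linear0' (bcbilin_linear2 _ hb)) (linear0' lt).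
rewrite lh /bctens !(bcbilin_linear2 _ hb) lt -/bctens IH; congr (_ *: _ + _).
rewrite /bctens bcbilin_in // /glt_fun uext_gen; last exact: glt_semilin.
rewrite /tens_ext uext_gen //; exact: glt_bilin.
Qed.

Lemma bctens_eq (Q : lmodType R) (f f' : bc (tens M N) R -> Q) :
  linear f -> linear f' ->
  (forall x y, f (bctens (bc_in R x) (bc_in R y)) = f' (bctens (bc_in R x) (bc_in R y))) ->
  f =1 f'.
Proof.
move=> lf lf' h; apply: linear_bc_eq => // z.
elim/tens_ind: z => [x y z IH|].
  rewrite (bc_inP (tens M N) R).1 (linearD' _ _ lf) (linearD' _ _ lf') IH.
  by have := h x y; rewrite /bctens bcbilin_in; [move=> ->|apply: tens_inP].
have -> : bc_in R (0 : tens M N) = 0.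
  by rewrite -[0](scale0r (0 : tens M N)) (bc_inP _ R).2 rmorph0 scale0r.
by rewrite !linear0'.
Qed.

Lemma gltK g h g' h' : linear g -> linear h -> linear g' -> linear h' ->
  cancel g g' -> cancel h h' -> cancel (glt_fun g h) (glt_fun g' h').
Proof.
move=> lg lh lg' lh' gK hK.
apply: (@bctens_eq _ (glt_fun g' h' \o glt_fun g h) id).
- by move=> a x y /=; rewrite !glt_linear.
- by [].
- by move=> x y /=; rewrite !glt_tens // gK hK.
Qed.

Definition glt (g : laut (bc M R)) (h : laut (bc N R)) : laut (bc (tens M N) R) :=
  LAut (glt_linear (lfunP g) (lfunP h))
    (gltK (lfunP g) (lfunP h) (linvP g) (linvP h) (lfunK g) (lfunK h))
    (gltK (linvP g) (linvP h) (lfunP g) (lfunP h) (linvK g) (linvK h)).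
End Fixed.

Variable G : grpfun k.
Variables (a : ghom G (GL M)) (b : ghom G (GL N)).

Definition tens_act : ghom G (GL (tens M N)).
refine (@GHom k G (GL (tens M N)) (fun R g => glt (a R g) (b R g)) _ _).
- move=> R x y; rewrite !ghomM; apply: laut_eq; apply: bctens_eq; try exact: lfunP.
  move=> m n /=; rewrite !glt_tens //; try exact: lfunP.
  + exact: (lfunP (lautM (a R x) (a R y))).
  + exact: (lfunP (lautM (b R x) (b R y))).
- move=> R S f x; rewrite !ghom_nat; apply: laut_eq; apply: bctens_eq; try exact: lfunP.
  have hb := tens_inP M N.
  move=> m n; rewrite -!(bcpush_in f).
  rewrite [LHS]glt_tens; try exact: lfunP.
  rewrite /bctens -bcpush_bilin // !gl_mapE.
  rewrite -bcpush_bilin //; congr (bcpush f _); symmetry.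
  by apply: glt_tens; exact: lfunP.
Defined.

Lemma tens_fgproj : fgproj M -> fgproj N -> fgproj (tens M N).
Proof.
move=> [m [i [p [li lp ip]]]] [n [j [q [lj lq jq]]]].
pose b1 (x : M) (y : N) : 'rV[k]_(m * n) := mxvec ((i x)^T *m j y).
have hb1 : bilin b1.
  split=> [y c x x'|x c y y'].
    by rewrite /b1 li linearP /= mulmxDl -scalemxAl linearP.
  by rewrite /b1 lj mulmxDr -scalemxAr linearP.
pose pf (v : 'rV[k]_(m * n)) : tens M N :=
  \sum_(s : 'I_m) \sum_(t : 'I_n) vec_mx v s t *:
     tens_in (p (delta_mx 0 s)) (q (delta_mx 0 t)).
have lpf : linear pf.
  move=> c v w; rewrite /pf scaler_sumr -big_split; apply: eq_bigr => s _ /=.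
  rewrite scaler_sumr -big_split; apply: eq_bigr => t _ /=.
  by rewrite linearP !mxE scalerDl scalerA.
exists (m * n)%N, (tens_ext b1), pf; split=> //; first exact: (uext_linear hb1).
have lt : linear (tens_ext b1) by exact: (uext_linear hb1).
have sl (A B : lmodType k) (u : A -> B) I (r : seq I) F :
    linear u -> u (\sum_(l <- r) F l) = \sum_(l <- r) u (F l).
  move=> lu; elim: r => [|l r IH]; first by rewrite !big_nil linear0'.
  by rewrite !big_cons linearD' // IH.
elim/tens_ind => [x y z IH|]; last by rewrite (linear0' lt) (linear0' lpf).
rewrite (linearD' _ _ lt) (linearD' _ _ lpf) IH; congr (_ + _).
rewrite /tens_ext uext_gen //= /b1 /pf.
have hb := tens_inP M N.
rewrite -{2}[x]ip -{2}[y]jq {2}[i x]row_sum_delta (sl _ _ p) //.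
rewrite (sl _ _ (fun x => tens_in x (q (j y)))); last exact: hb.1.
apply: eq_bigr => s _; rewrite (linearZ' _ _ lp) (linearZ' _ _ (hb.1 _)).
rewrite {2}[j y]row_sum_delta (sl _ _ q) // (sl _ _ (tens_in _)); last exact: hb.2.
rewrite scaler_sumr; apply: eq_bigr => t _.
rewrite (linearZ' _ _ lq) (linearZ' _ _ (hb.2 _)) scalerA; congr (_ *: _).
by rewrite mxvecK mxE big_ord1 mxE.
Qed.
End TensorProduct.

Definition rep_tens (k : comPzRingType) (G : grpfun k) (X Y : rep G) : rep G :=
  @Rep k G (tens X Y) (tens_fgproj (@rmodP _ _ X) (@rmodP _ _ Y))
    (tens_act (ract X) (ract Y)).

Section UnitRep.
Variables (k : comPzRingType) (G : grpfun k).

Lemma unit_fgproj : fgproj (k^o : lmodType k).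
Proof.
exists 1%N, (fun x => \row_(i < 1) x), (fun v => v 0 0); split.
- by move=> a x y; apply/rowP => i; rewrite !mxE.
- by move=> a x y; rewrite !mxE.
- by move=> x; rewrite mxE.
Qed.

Definition triv_act (M : lmodType k) : ghom G (GL M).
refine (@GHom k G (GL M) (fun R _ => laut1 (bc M R)) _ _).
- by move=> R x y; apply: laut_eq.
- move=> R S f x; apply: laut_eq; apply: linear_bc_eq; try exact: lfunP.
  by move=> m; rewrite -(bcpush_in f) gl_mapE.
Defined.

Definition rep_unit : rep G := Rep unit_fgproj (triv_act (k^o)).
End UnitRep.

Section AffineSchemes.
Variable k : comPzRingType.
Implicit Types (A B C : kalg k) (F G : grpfun k).

(* a polynomial in n variables, as a finite sum of terms (c, m) = c * x^m *)
Definition peval n (A : kalg k) (p : seq (k * {ffun 'I_n -> nat})) (a : 'I_n -> A) : A :=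
  \sum_(cm <- p) kstr A cm.1 * \prod_(i < n) a i ^+ cm.2 i.

(* The universal property of k[x_1, ..., x_n] / (rels).                     *)
Definition finitely_presented A : Prop :=
  exists (n : nat) (rels : seq (seq (k * {ffun 'I_n -> nat}))) (a : 'I_n -> A),
    (forall p, p \in rels -> peval p a = 0) /\
    forall B (b : 'I_n -> B), (forall p, p \in rels -> peval p b = 0) ->
      exists f : khom A B, (forall i, f (a i) = b i) /\
        forall f' : khom A B, (forall i, f' (a i) = b i) -> f =1 f'.

Definition square_zero_ext B C (p : khom B C) : Prop :=
  (forall c, exists b, p b = c) /\ forall x y, p x = 0 -> p y = 0 -> x * y = 0.

Definition formally_smooth A : Prop :=
  forall B C (p : khom B C), square_zero_ext p ->
    forall f : khom A C, exists g : khom A B, p \o g =1 f.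

Definition formally_etale A : Prop :=
  forall B C (p : khom B C), square_zero_ext p ->
    forall f : khom A C, exists g : khom A B, p \o g =1 f /\
      forall g' : khom A B, p \o g' =1 f -> g =1 g'.

Definition faithfully_flat A : Prop :=
  (forall (M N : lmodType k) (u : M -> N),
     linear u -> injective u -> injective (@bcmap k M N u A)) /\
  (forall M : lmodType k, (forall z : bc M A, z = 0) -> forall x : M, x = 0).

Definition etale_cover A : Prop :=
  [/\ finitely_presented A, formally_etale A & faithfully_flat A].
Definition fppf_cover A : Prop := finitely_presented A /\ faithfully_flat A.

(* F is represented by A, with universal point a *)
Definition represents F A (a : F A) : Prop :=
  forall (R : kalg k) (x : F R), exists f : khom A R, gmap f a = x /\
    forall f' : khom A R, gmap f' a = x -> f =1 f'.

Definition smooth_affine F : Prop :=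
  exists (A : kalg k) (a : F A),
    [/\ represents a, finitely_presented A & formally_smooth A].

Definition connected_affine F : Prop :=
  exists (A : kalg k) (a : F A),
    [/\ represents a, (1 : A) <> 0 & forall e : A, e * e = e -> e = 0 \/ e = 1].

Definition closed_immersion F G (i : ghom F G) : Prop :=
  exists (A : kalg k) (a : G A) (B : kalg k) (b : F B) (f : khom A B),
    [/\ represents a, represents b, gmap f a = i B b & forall y : B, exists x, f x = y].

Definition closed_subgrp G (S : subgrp G) : Prop := closed_immersion (subincl S).

Definition normal_subgrp G (S : subgrp G) : Prop :=
  forall R (g s : G R), S R s -> S R (gmul (gmul g s) (ginv g)).

Section Diagonalizable.
Variable M : zmodType.
(* The values of such a d are units: d a * d (- a) = 1.                     *)
Definition is_char (R : kalg k) (d : M -> R) : Prop :=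
  d 0 = 1 /\ forall a b, d (a + b) = d a * d b.
Definition diag_pts (R : kalg k) := {d : M -> R | is_char d}.
Lemma diag_mulP R (x y : diag_pts R) : is_char (fun a => sval x a * sval y a).
Proof.
case: x y => [x [x0 xD]] [y [y0 yD]]; split=> [|a b] /=; first by rewrite x0 y0 mulr1.
by rewrite xD yD mulrACA.
Qed.
Definition diag_mul R (x y : diag_pts R) : diag_pts R := exist _ _ (diag_mulP x y).
Lemma diag_oneP (R : kalg k) : is_char (fun _ => 1 : R).
Proof. by split=> [//|a b]; rewrite mulr1. Qed.
Definition diag_one R : diag_pts R := exist _ _ (diag_oneP R).
Lemma diag_invP R (x : diag_pts R) : is_char (fun a => sval x (- a)).
Proof. by case: x => [x [x0 xD]]; split=> [|a b] /=; rewrite ?oppr0 ?opprD. Qed.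
Definition diag_inv R (x : diag_pts R) : diag_pts R := exist _ _ (diag_invP x).
Lemma diag_mapP R S (f : khom R S) (x : diag_pts R) : is_char (fun a => f (sval x a)).
Proof.
by case: x => [x [x0 xD]]; split=> [|a b] /=; rewrite ?x0 ?xD ?rmorph1 ?rmorphM.
Qed.
Definition diag_map R S (f : khom R S) (x : diag_pts R) : diag_pts S :=
  exist _ _ (diag_mapP f x).

Definition Dgrp : grpfun k.
refine (@GrpFun k diag_pts diag_mul diag_one diag_inv diag_map _ _ _ _ _ _).
- by move=> R x y z; apply: sig_eq; apply: funext => a; apply: mulrA.
- by move=> R x; apply: sig_eq; apply: funext => a; apply: mul1r.
- move=> R [x [x0 xD]]; apply: sig_eq; apply: funext => a /=.
  by rewrite -xD addNr x0.
- by move=> R S f x y; apply: sig_eq; apply: funext => a; apply: rmorphM.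
- by move=> R x; apply: sig_eq.
- by move=> R S U g f x; apply: sig_eq.
Defined.
End Diagonalizable.

Section DiagonalizableMap.
Variables (M N : zmodType) (h : {additive M -> N}).
Lemma DmapP R (d : Dgrp N R) : is_char (fun a => sval d (h a)).
Proof.
by case: d => [d [d0 dD]]; split=> [|a b] /=; rewrite ?raddf0 ?raddfD ?d0 ?dD.
Qed.
Definition Dmap : ghom (Dgrp N) (Dgrp M).
refine (@GHom k (Dgrp N) (Dgrp M) (fun R d => exist _ _ (DmapP d)) _ _).
- by move=> R x y; apply: sig_eq.
- by move=> R S f x; apply: sig_eq.
Defined.
End DiagonalizableMap.

Definition split_torus G (T : subgrp G) : Prop :=
  exists (n : nat) (i : ghom (Dgrp 'rV[int]_n) G),
    closed_immersion i /\ forall R (g : G R), T R g <-> exists d, i R d = g.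

Definition maximal_split_torus G (T : subgrp G) : Prop :=
  split_torus T /\
  forall T' : subgrp G, split_torus T' ->
    (forall R (g : G R), T R g -> T' R g) -> forall R (g : G R), T' R g -> T R g.

Section Centralizer.
Variables (D H : grpfun k) (chi : ghom D H).

Definition cent_mem R (h : H R) : Prop :=
  forall (S : kalg k) (f : khom R S) (d : D S),
    gmul (gmap f h) (chi S d) = gmul (chi S d) (gmap f h).

Definition cent : subgrp H.
refine (@SubGrp k H cent_mem _ _ _ _).
- by move=> R S f d; rewrite gmap1 gmul1 gmulx1.
- by move=> R x y hx hy S f d; rewrite gmapM -gmulA hy !gmulA hx.
- move=> R x hx S f d; rewrite gmapV; apply: (@gmulI k H S (gmap f x)).
  by rewrite !gmulA gmulxV gmul1 hx -gmulA gmulxV gmulx1.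
- by move=> R S f x hx U g d; rewrite -gmap_comp hx.
Defined.
End Centralizer.

Definition commutative_grp F : Prop := forall R (x y : F R), gmul x y = gmul y x.
Lemma Dgrp_comm (M : zmodType) : commutative_grp (Dgrp M).
Proof. by move=> R x y; apply: sig_eq; apply: funext => a; apply: mulrC. Qed.

Section IntoCentralizer.
Variables (M : zmodType) (H : grpfun k) (chi : ghom (Dgrp M) H).
Lemma into_centP R (d : Dgrp M R) : cent chi R (chi R d).
Proof. by move=> S f d'; rewrite -ghom_nat -!ghomM Dgrp_comm. Qed.
Definition into_cent : ghom (Dgrp M) (subfun (cent chi)).
refine (@GHom k (Dgrp M) (subfun (cent chi))
  (fun R d => exist _ _ (into_centP d)) _ _).
- by move=> R x y; apply: sig_eq; apply: ghomM.
- by move=> R S f x; apply: sig_eq; apply: ghom_nat.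
Defined.
End IntoCentralizer.

(* Isomorphisms F_A -> G_A over an algebra A: the A-algebras are the        *)
(* algebras B together with a homomorphism A -> B.                         *)
Record giso_over (A : kalg k) (F G : grpfun k) := GIsoOver {
  gio : forall B, khom A B -> F B -> G B;
  gioM : forall B (f : khom A B) (x y : F B),
    gio f (gmul x y) = gmul (gio f x) (gio f y);
  gio_nat : forall B C (f : khom A B) (g : khom B C) (x : F B),
    gio (khom_comp g f) (gmap g x) = gmap g (gio f x);
  gio_bij : forall B (f : khom A B), bijective (@gio B f) }.

End AffineSchemes.

Section InnerForms.
Variable k : comPzRingType.

(* psi presents F as an inner form of G: for all p, q : A -> S the          *)
(* automorphism (q^* psi) o (p^* psi)^-1 of G over S is inner, that is      *)
(* fppf-locally on S given by conjugation with a section of G.  The         *)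
(* universal case is S = A (x) A with its two coprojections.               *)
Definition inner_descent (A : kalg k) (F G : grpfun k) (psi : giso_over A F G) : Prop :=
  forall (S : kalg k) (p q : khom A S),
    exists (S' : kalg k) (c : khom S S') (g : G S'),
      fppf_cover (kover c) /\
      forall (B : kalg k) (f : khom S' B) (x : F B),
        gio psi (khom_comp f (khom_comp c q)) x =
        gmul (gmul (gmap f g) (gio psi (khom_comp f (khom_comp c p)) x))
             (ginv (gmap f g)).

(* F and G are inner forms of each other, by an isomorphism over an etale   *)
(* cover under which the conjugacy classes of a and b correspond.          *)
Definition inner_forms_matching (D F G : grpfun k) (a : ghom D F) (b : ghom D G) : Prop :=
  exists (A : kalg k) (psi : giso_over A F G),
    [/\ etale_cover A, inner_descent psi &
      exists g : G A, forall (B : kalg k) (f : khom A B) (d : D B),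
        gio psi f (a B d) = gmul (gmul (gmap f g) (b B d)) (ginv (gmap f g))].
End InnerForms.

Section Reductive.
Variable K : closedFieldType.
Implicit Types (H : grpfun K).

Definition unipotent H : Prop :=
  forall V : rep H, (exists v : V, v <> 0) ->
    exists v : V, v <> 0 /\
      forall (R : kalg K) (h : H R), ract V R h (bc_in R v) = bc_in R v.

Definition connected_reductive H : Prop :=
  [/\ smooth_affine H, connected_affine H &
    forall U : subgrp H, closed_subgrp U -> normal_subgrp U ->
      smooth_affine (subfun U) -> connected_affine (subfun U) ->
      unipotent (subfun U) ->
      forall (R : kalg K) (u : H R), U R u -> u = gone H R].
End Reductive.

Definition reductive_geometric_fibers (k : comPzRingType) (G : grpfun k) : Prop :=
  forall (K : closedFieldType) (s : {rmorphism k -> K}),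
    connected_reductive (gbc (KAlg s) G).

(* The value group is Gamma = (R^{>0}, *, <=), and Gamma u {0} is the set   *)
(* of nonnegative reals.                                                    *)
Record nafield (R : realType) := NAField {
  nafd :> fieldType;
  nabs : nafd -> R;
  nabs_ge0 : forall x, 0 <= nabs x;
  nabs_eq0 : forall x, nabs x = 0 <-> x = 0;
  nabsM : forall x y, nabs (x * y) = nabs x * nabs y;
  nabsD : forall x y, nabs (x + y) <= Num.max (nabs x) (nabs y) }.

Section NonArchimedean.
Variables (R : realType) (l : nafield R).

Lemma nabs0 : nabs (0 : l) = 0. Proof. exact/nabs_eq0. Qed.
Lemma nabs1 : nabs (1 : l) = 1.
Proof.
have h : nabs (1 : l) != 0 by apply/eqP => /nabs_eq0/eqP; rewrite oner_eq0.
by apply: (mulfI h); rewrite -nabsM !mulr1.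
Qed.
Lemma nabsN (x : l) : nabs (- x) = nabs x.
Proof.
have h : nabs (-1 : l) = 1.
  have /eqP := nabsM (-1 : l) (-1); rewrite mulrNN mulr1 nabs1 eq_sym -expr2.
  rewrite sqrf_eq1 => /orP[/eqP//|/eqP e].
  by have := nabs_ge0 (-1 : l); rewrite e oppr_ge0 ler10.
by rewrite -mulN1r nabsM h mul1r.
Qed.

Definition oint_pred : {pred l} := fun x : l => nabs x <= 1.
Lemma oint_subring : subring_closed oint_pred.
Proof.
split=> [|x y|x y]; rewrite !unfold_in.
- by rewrite nabs1.
- move=> hx hy; apply: (le_trans (nabsD _ _)).
  by rewrite ge_max hx nabsN.
- by move=> hx hy; rewrite nabsM mulr_ile1 ?nabs_ge0.
Qed.
HB.instance Definition _ := GRing.isSubringClosed.Build l oint_pred oint_subring.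

Definition oint := {x : l | oint_pred x}.
HB.instance Definition _ := SubChoice.on oint.
HB.instance Definition _ := [SubChoice_isSubComNzRing of oint by <:].

Definition lalg : kalg oint := KAlg (val : {rmorphism oint -> l}).

(* the value group |l^*| is generated by the absolute value of a uniformizer *)
Definition discretely_valued : Prop :=
  exists pi : l, [/\ 0 < nabs pi, nabs pi < 1 &
    forall x : l, x <> 0 -> exists n : int, nabs x = nabs pi ^ n].

Definition henselian : Prop :=
  forall (f : {poly oint}) (a : oint), f \is monic ->
    nabs (val f.[a]) < 1 -> nabs (val f^`().[a]) = 1 ->
    exists b : oint, f.[b] = 0 /\ nabs (val (b - a)) < 1.

End NonArchimedean.

(* Gamma = (R^{>0}, * ) as an abelian group, written additively *)
Section Gamma.
Variable R : realType.

Definition Gamma := {x : R | 0 < x}.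
HB.instance Definition _ := SubChoice.on Gamma.
Definition gamma_mul (x y : Gamma) : Gamma :=
  exist _ (val x * val y) (mulr_gt0 (valP x) (valP y)).
Definition gamma_one : Gamma := exist _ 1 ltr01.
Lemma gamma_inv_gt0 (x : Gamma) : 0 < (val x)^-1.
Proof. by rewrite invr_gt0; exact: (valP x). Qed.
Definition gamma_inv (x : Gamma) : Gamma := exist _ (val x)^-1 (gamma_inv_gt0 x).
Lemma gamma_mulA : associative gamma_mul.
Proof. by move=> x y z; apply: val_inj; apply: mulrA. Qed.
Lemma gamma_mulC : commutative gamma_mul.
Proof. by move=> x y; apply: val_inj; apply: mulrC. Qed.
Lemma gamma_mul1 : left_id gamma_one gamma_mul.
Proof. by move=> x; apply: val_inj; apply: mul1r. Qed.
Lemma gamma_mulV : left_inverse gamma_one gamma_inv gamma_mul.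
Proof.
by move=> x; apply: val_inj; apply: mulVf; rewrite gt_eqF //; exact: (valP x).
Qed.
HB.instance Definition _ :=
  GRing.isZmodule.Build Gamma gamma_mulA gamma_mulC gamma_mul1 gamma_mulV.

Variable l : nafield R.

(* |l^*| as a subgroup of Gamma, and Gamma / |l^*| *)
Definition value_group : {pred Gamma} :=
  fun g => `[< exists x : l, nabs x = val g >].
Lemma value_group_closed : zmod_closed value_group.
Proof.
split=> [|g h].
  by apply/asboolP; exists 1; rewrite nabs1.
move=> /asboolP[x hx] /asboolP[y hy]; apply/asboolP; exists (x / y).
have hy0 : nabs y != 0 by rewrite hy gt_eqF //; exact: (valP h).
have y0 : y != 0 by apply: contra hy0 => /eqP ->; rewrite nabs0.
rewrite nabsM hx /=; congr (_ * _); apply: (mulfI hy0).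
by rewrite -nabsM mulfV // nabs1 -hy mulfV.
Qed.
HB.instance Definition _ :=
  GRing.isZmodClosed.Build Gamma value_group value_group_closed.

Definition Gamma_quot : zmodType := {ideal_quot value_group}.
Definition gamma_class (g : Gamma) : Gamma_quot := \pi_{ideal_quot value_group} g.
Lemma gamma_class_is_zmod : zmod_morphism gamma_class.
Proof. by move=> g h; rewrite /gamma_class !piE. Qed.
HB.instance Definition _ :=
  GRing.isZmodMorphism.Build Gamma Gamma_quot gamma_class gamma_class_is_zmod.
End Gamma.

Record submod (k : comPzRingType) (V : lmodType k) := SubMod {
  smod_mem :> V -> Prop;
  smod0 : smod_mem 0;
  smodL : forall a x y, smod_mem x -> smod_mem y -> smod_mem (a *: x + y) }.

Section SubModule.
Variables (k : comPzRingType) (V : lmodType k) (S : submod V).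
Definition smod_pred : {pred V} := fun v => `[< S v >].
Lemma smod_closed : submod_closed smod_pred.
Proof.
split=> [|a x y]; first exact/asboolP/smod0.
by move=> /asboolP hx /asboolP hy; apply/asboolP/smodL.
Qed.
HB.instance Definition _ := GRing.isSubmodClosed.Build k V smod_pred smod_closed.
Definition smod := {v : V | smod_pred v}.
HB.instance Definition _ := SubChoice.on smod.
HB.instance Definition _ := [SubChoice_isSubLmodule of smod by <:].
End SubModule.

Section Norms.
Variables (R : realType) (l : nafield R).

Record norm (V : lmodType l) := Norm {
  nval :> V -> R;
  nval_ge0 : forall v, 0 <= nval v;
  nval_eq0 : forall v, nval v = 0 <-> v = 0;
  nvalZ : forall a v, nval (a *: v) = nabs a * nval v;
  nvalD : forall v w, nval (v + w) <= Num.max (nval v) (nval w) }.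

Definition is_basis (V : lmodType l) (I : finType) (e : I -> V) : Prop :=
  forall v : V, exists a : I -> l, v = \sum_i a i *: e i /\
    forall a' : I -> l, v = \sum_i a' i *: e i -> a =1 a'.

Definition splitting_basis (V : lmodType l) (n : norm V) (I : finType) (e : I -> V) :
    Prop :=
  is_basis e /\
  forall a : I -> l,
    n (\sum_i a i *: e i) = \big[Num.max/0]_(i : I) (nabs (a i) * n (e i)).

(* for finite-dimensional V *)
Definition splittable (V : lmodType l) (n : norm V) : Prop :=
  exists (I : finType) (e : I -> V), splitting_basis n e.

Definition contractive (V W : lmodType l) (a : norm V) (b : norm W) (h : V -> W) : Prop :=
  forall v, b (h v) <= a v.

Definition strict (V W : lmodType l) (a : norm V) (b : norm W) (h : V -> W) : Prop :=
  contractive a b h /\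
  forall v, exists v', [/\ h v' = h v, a v' = b (h v) &
    forall v'', h v'' = h v -> a v' <= a v''].

(* c is the tensor product of the norms a and b, where t : V x W -> U        *)
(* identifies U with the tensor product of V and W                         *)
Definition is_tensor_norm (V W U : lmodType l) (t : V -> W -> U)
    (a : norm V) (b : norm W) (c : norm U) : Prop :=
  forall (I J : finType) (e : I -> V) (f : J -> W),
    splitting_basis a e -> splitting_basis b f ->
    splitting_basis c (fun ij : I * J => t (e ij.1) (f ij.2)) /\
    forall i j, c (t (e i) (f j)) = a (e i) * b (f j).

(* V^{a <= g} and V^{a < g} as modules over the valuation ring *)
Section Balls.
Variables (V : lmodType l) (a : norm V) (g : Gamma R).
Local Notation V0 := (resmod (kstr (lalg l)) V).

Lemma nval0 : a 0 = 0. Proof. exact/nval_eq0. Qed.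
Lemma ball_bound (c : oint l) (x y : V0) :
  a (c *: x + y) <= Num.max (a x) (a y).
Proof.
apply: (le_trans (nvalD _ _ _)); rewrite le_max2 // nvalZ.
by rewrite ler_piMl ?nval_ge0 //; exact: (valP c).
Qed.

Definition ball_le : submod V0.
refine (@SubMod _ V0 (fun v => a v <= val g) _ _).
- by rewrite nval0 ltW //; exact: (valP g).
- by move=> c x y hx hy; apply: (le_trans (ball_bound _ _ _)); rewrite ge_max hx.
Defined.

Definition ball_lt : submod V0.
refine (@SubMod _ V0 (fun v => a v < val g) _ _).
- by rewrite nval0; exact: (valP g).
- by move=> c x y hx hy; apply: (le_lt_trans (ball_bound _ _ _)); rewrite gt_max hx.
Defined.
End Balls.

(* For a module L over the valuation ring, the span of l^oo L, and the norm *)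
(* of l tensored with L with value |c| at c * v for v in L \ l^oo L        *)
Definition max_ideal_span (L : lmodType (oint l)) (v : L) : Prop :=
  exists s : seq (oint l * L),
    (forall p, p \in s -> nabs (val p.1) < 1) /\ v = \sum_(p <- s) p.1 *: p.2.

Definition lattice_value (L : lmodType (oint l)) (z : bc L (lalg l)) (r : R) : Prop :=
  (z = 0 /\ r = 0) \/
  exists (c : l) (v : L),
    [/\ ~ max_ideal_span v, z = (c : lalg l) *: bc_in (lalg l) v & r = nabs c].

Definition lattice_norm (L : lmodType (oint l)) (z : bc L (lalg l)) : R :=
  xget 0 [set r | lattice_value z r]%classic.

End Norms.

Section NormedFiberFunctors.
Variables (R : realType) (l : nafield R) (G : grpfun (oint l)).
Implicit Types X Y Z : rep G.

Definition Xl X : lmodType l := bc X (lalg l).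
Definition Xl_map X Y (u : X -> Y) : Xl X -> Xl Y := bcmap u (R := lalg l).
Definition Xl_tens X Y : Xl X -> Xl Y -> Xl (rep_tens X Y) :=
  @bctens (oint l) X Y (lalg l).

Definition norm_family : Type := forall X, norm (Xl X).

Definition short_exact (k : comPzRingType) (A B C : lmodType k)
    (u : A -> B) (v : B -> C) : Prop :=
  [/\ injective u, (forall c, exists b, v b = c) &
      forall b, v b = 0 <-> exists a, u a = b].

(* Linearity of the functor X |-> (X_l, theta_X) on morphisms is automatic, *)
(* since it is already a property of X |-> X_l.                             *)
Record in_Ntens (theta : norm_family) : Prop := InNtens {
  Nt_split : forall X, splittable (theta X);
  Nt_functor : forall X Y (u : X -> Y), rep_mor u ->
    contractive (theta X) (theta Y) (Xl_map u);
  Nt_exact : forall X Y Z (u : X -> Y) (v : Y -> Z),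
    rep_mor u -> rep_mor v -> short_exact u v ->
    [/\ short_exact (Xl_map u) (Xl_map v),
        strict (theta X) (theta Y) (Xl_map u) &
        strict (theta Y) (theta Z) (Xl_map v)];
  Nt_tens : forall X Y,
    is_tensor_norm (@Xl_tens X Y) (theta X) (theta Y) (theta (rep_tens X Y));
  Nt_unit : forall c : l,
    theta (rep_unit G) ((c : lalg l) *: bc_in (lalg l) (1 : (oint l)^o)) = nabs c }.

Section AutTensor.
Variable theta : norm_family.

Definition lev X (g : Gamma R) : lmodType (oint l) := smod (ball_le (theta X) g).
Definition lev_lt X (g : Gamma R) : lmodType (oint l) := smod (ball_lt (theta X) g).
Definition lev_val X g (x : lev X g) : Xl X := val x.
Definition lev_lt_val X g (x : lev_lt X g) : Xl X := val x.

Definition lev_family : grpfun (oint l) :=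
  prodfun (fun p : rep G * Gamma R => GL (lev p.1 p.2)).

(* The maps between the modules lev X g are specified by their effect on    *)
(* X_l, which determines them.  The sum g + h in the last clause is the     *)
(* product in Gamma.                                                        *)
Record aut_tensor_mem (S : kalg (oint l)) (phi : lev_family S) : Prop := AutTensorMem {
  at_mor : forall X Y (f : X -> Y), rep_mor f ->
    forall g (u : lev X g -> lev Y g), linear u ->
      (forall x, lev_val (u x) = Xl_map f (lev_val x)) ->
      forall z, phi (Y, g) (bcmap u z) = bcmap u (phi (X, g) z);
  at_incl : forall X g h, val g <= val h ->
    forall u : lev X g -> lev X h, linear u ->
      (forall x, lev_val (u x) = lev_val x) ->
      forall z, phi (X, h) (bcmap u z) = bcmap u (phi (X, g) z);
  at_scale : forall X g h (c : l), c <> 0 -> val h = val g * nabs c ->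
    forall u : lev X g -> lev X h, linear u ->
      (forall x, lev_val (u x) = c *: lev_val x) ->
      forall z, phi (X, h) (bcmap u z) = bcmap u (phi (X, g) z);
  at_tens : forall X Y g h (b : lev X g -> lev Y h -> lev (rep_tens X Y) (g + h)),
    bilin b ->
    (forall x y, lev_val (b x y) = Xl_tens (lev_val x) (lev_val y)) ->
    forall z t, phi (rep_tens X Y, g + h) (bcbilin b z t) =
      bcbilin b (phi (X, g) z) (phi (Y, h) t) }.

Section Intertwining.
Variables (S : kalg (oint l)).

Lemma gl_inter_inv (M N : lmodType (oint l)) (u : M -> N)
    (f : GL M S) (g : GL N S) :
  (forall z, g (bcmap u z) = bcmap u (f z)) ->
  forall z, ginv g (bcmap u z) = bcmap u (ginv f z).
Proof.
by move=> h z; rewrite /= -{1}[z](linvK f) -h lfunK.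
Qed.

Lemma gl_inter_map (S' : kalg (oint l)) (c : khom S S') (M N : lmodType (oint l))
    (u : M -> N) (f : GL M S) (g : GL N S) : linear u ->
  (forall z, g (bcmap u z) = bcmap u (f z)) ->
  forall z, gmap c g (bcmap u z) = bcmap u (gmap c f z).
Proof.
move=> lu h; apply: (@linear_bc_eq _ M S' (bc N S')
  (fun z => gmap c g (bcmap u z)) (fun z => bcmap u (gmap c f z))).
- by move=> a x y; rewrite (bcmap_linear lu) (lfunP (gmap c g)).
- by move=> a x y; rewrite (lfunP (gmap c f)) (bcmap_linear lu).
- move=> x; rewrite -(bcpush_in c) -bcpush_map //.
  by rewrite [LHS]gl_mapE [gmap c f _]gl_mapE h bcpush_map.
Qed.

Lemma gl_bil_inv (M N P : lmodType (oint l)) (b : M -> N -> P)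
    (f : GL M S) (g : GL N S) (h : GL P S) :
  (forall z t, h (bcbilin b z t) = bcbilin b (f z) (g t)) ->
  forall z t, ginv h (bcbilin b z t) = bcbilin b (ginv f z) (ginv g t).
Proof.
by move=> e z t; rewrite /= -{1}[z](linvK f) -{1}[t](linvK g) -e lfunK.
Qed.

Lemma gl_bil_map (S' : kalg (oint l)) (c : khom S S') (M N P : lmodType (oint l))
    (b : M -> N -> P) (f : GL M S) (g : GL N S) (h : GL P S) : bilin b ->
  (forall z t, h (bcbilin b z t) = bcbilin b (f z) (g t)) ->
  forall z t, gmap c h (bcbilin b z t) = bcbilin b (gmap c f z) (gmap c g t).
Proof.
move=> hb e z t; move: z; apply: (@linear_bc_eq _ M S' (bc P S')
  (fun z => gmap c h (bcbilin b z t)) (fun z => bcbilin b (gmap c f z) (gmap c g t))).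
- by move=> a x y; rewrite (bcbilin_linear1 _ hb) (lfunP (gmap c h)).
- by move=> a x y; rewrite (lfunP (gmap c f)) (bcbilin_linear1 _ hb).
move=> x; move: t; apply: (@linear_bc_eq _ N S' (bc P S')
  (fun t => gmap c h (bcbilin b (bc_in S' x) t))
  (fun t => bcbilin b (gmap c f (bc_in S' x)) (gmap c g t))).
- by move=> a y z; rewrite (bcbilin_linear2 _ hb) (lfunP (gmap c h)).
- by move=> a y z; rewrite (lfunP (gmap c g)) (bcbilin_linear2 _ hb).
move=> y; rewrite -!(bcpush_in c) -bcpush_bilin // [LHS]gl_mapE e bcpush_bilin //.
by rewrite [gmap c f _]gl_mapE [gmap c g _]gl_mapE.
Qed.
End Intertwining.

Definition aut_tensor_sub : subgrp lev_family.
refine (@SubGrp _ lev_family aut_tensor_mem _ _ _ _).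
- by move=> S; split.
- move=> S x y [x1 x2 x3 x4] [y1 y2 y3 y4]; split.
  + move=> X Y f hf g u lu hu z; rewrite -[LHS]/(x (Y, g) (y (Y, g) _)).
    by rewrite (y1 _ _ _ hf) // (x1 _ _ _ hf).
  + move=> X g h gh u lu hu z; rewrite -[LHS]/(x (X, h) (y (X, h) _)).
    by rewrite (y2 _ _ _ gh) // (x2 _ _ _ gh).
  + move=> X g h c c0 gh u lu hu z; rewrite -[LHS]/(x (X, h) (y (X, h) _)).
    by rewrite (y3 _ _ _ _ c0 gh) // (x3 _ _ _ _ c0 gh).
  + move=> X Y g h b hb eb z t.
    rewrite -[LHS]/(x (rep_tens X Y, g + h) (y (rep_tens X Y, g + h) _)).
    by rewrite y4 // x4.
- move=> S x [x1 x2 x3 x4]; split.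
  + by move=> X Y f hf g u lu hu; apply: gl_inter_inv; apply: (x1 _ _ _ hf).
  + by move=> X g h gh u lu hu; apply: gl_inter_inv; apply: (x2 _ _ _ gh).
  + by move=> X g h c c0 gh u lu hu; apply: gl_inter_inv; apply: (x3 _ _ _ _ c0 gh).
  + by move=> X Y g h b hb eb; apply: gl_bil_inv; apply: x4.
- move=> S S' c x [x1 x2 x3 x4]; split.
  + by move=> X Y f hf g u lu hu; apply: gl_inter_map => //; apply: (x1 _ _ _ hf).
  + by move=> X g h gh u lu hu; apply: gl_inter_map => //; apply: (x2 _ _ _ gh).
  + by move=> X g h d d0 gh u lu hu; apply: gl_inter_map => //; apply: (x3 _ _ _ _ d0 gh).
  + by move=> X Y g h b hb eb; apply: gl_bil_map => //; apply: x4.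
Defined.

Definition aut_tensor : grpfun (oint l) := subfun aut_tensor_sub.

(* On (V^{<= g} / V^{< g}) tensored with S, which is the quotient of         *)
(* V^{<= g} tensored with S by the image of V^{< g} tensored with S, the    *)
(* only weight is the class of g.                                          *)
Definition splits (chi : ghom (Dgrp (oint l) (Gamma_quot l)) aut_tensor) : Prop :=
  forall X (g : Gamma R) (i : lev_lt X g -> lev X g),
    linear i -> (forall x, lev_val (i x) = lev_lt_val x) ->
    forall (S : kalg (oint l)) (d : Dgrp (oint l) (Gamma_quot l) S) (z : bc (lev X g) S),
      exists y : bc (lev_lt X g) S,
        sval (chi S d) (X, g) z - sval d (gamma_class l g) *: z = bcmap i y.
End AutTensor.

(* T belongs to S(G), and Tint is its split integral model.                *)
Definition in_SG (T : subgrp (gbc (lalg l) G)) (Tint : subgrp G) : Prop :=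
  [/\ maximal_split_torus T, split_torus Tint &
    forall (S : kalg l) (t : gbc (lalg l) G S), T S t <-> sub_gbc (lalg l) Tint S t].

Section Apartment.
Variables (Tint : subgrp G) (chi : ghom (Dgrp (oint l) (Gamma R)) (subfun Tint)).

Definition weight_mem X (w : Gamma R) (x : X) : Prop :=
  forall (S : kalg (oint l)) (d : Dgrp (oint l) (Gamma R) S),
    ract X S (sval (chi S d)) (bc_in S x) = sval d w *: bc_in S x.

Definition weight_sub X (w : Gamma R) : submod X.
refine (@SubMod _ X (@weight_mem X w) _ _).
- move=> S d; have -> : bc_in S (0 : X) = 0.
    by rewrite -[0 : X](scale0r (0 : X)) (bc_inP X S).2 rmorph0 scale0r.
  by rewrite scaler0 (linear0' (lfunP _)).
- move=> a x y hx hy S d; rewrite (bc_inP X S).1 (bc_inP X S).2.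
  rewrite (lfunP (ract X S _)) hx hy.
  by rewrite scalerDr !scalerA [_ * sval d w]mulrC.
Defined.
Definition weight_space X (w : Gamma R) : lmodType (oint l) := smod (weight_sub X w).
Definition weight_incl X (w : Gamma R) (x : weight_space X w) : X := val x.

Definition is_theta (theta : norm_family) : Prop :=
  forall X (ws : seq (Gamma R)) (v : forall w, bc (weight_space X w) (lalg l)),
    uniq ws ->
    theta X (\sum_(w <- ws) bcmap (@weight_incl X w) (v w)) =
    \big[Num.max/0]_(w <- ws) (lattice_norm (v w) * val w).
End Apartment.

(* the composition D^(Gamma/|l^*|) -> D^Gamma -> Tint -> G *)
Definition bar_chi (Tint : subgrp G) (chi : ghom (Dgrp (oint l) (Gamma R)) (subfun Tint)) :
    ghom (Dgrp (oint l) (Gamma_quot l)) G :=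
  ghom_comp (subincl Tint) (ghom_comp chi (Dmap (oint l) (gamma_class l))).

End NormedFiberFunctors.

(* Main.v *)
(** The weight vectors of [chi'] form splitting bases, so each ball of [X_l] is obtained
    from [X] by multiplying the weight spaces by powers of a uniformizer; up to a common
    factor these powers only depend on the classes of the weights in [Gamma / |l^*|].
    Transport along this rescaling identifies the centralizer of [bar chi'] in [G] with
    the centralizer in [Aut(alpha_theta)] of the homomorphism [chi0] transported from
    [bar chi']; surjectivity is Tannaka reconstruction over the valuation ring.

    It remains to conjugate [chi0] to [chi] over an etale cover.  On a faithful
    representation, projecting the weight vectors of [chi'] to the weight spaces of [chi]
    gives a matrix [U] which is congruent to the identity, and a conjugating point is
    [u n^-1] for a matrix [n] commuting with [bar chi'] in the translate of [G] by [U].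
    In rescaled coordinates the equations of [G] and of its translate are both integral and
    homogeneous for [Gamma / |l^*|], and they agree modulo the uniformizer.  As [G] is
    smooth, the translate is smooth near the identity of the special fibre, and so is its
    part of degree zero; cutting the latter down by a Jacobian slice gives an etale cover
    with a section [n]. *)
Require Import Defs.
From HB Require Import structures.
From mathcomp Require Import all_boot all_order all_algebra generic_quotient.
From mathcomp Require Import ring_quotient.
From mathcomp Require Import boolp classical_sets reals.

Set Implicit Arguments.
Unset Strict Implicit.
Unset Printing Implicit Defensive.
Import Order.TTheory GRing.Theory Num.Theory.
Local Open Scope ring_scope.
Local Open Scope quotient_scope.

(** Everything over the valuation ring is tested on the generic fibre. A torsion-free algebra [A]
    embeds in its tensor product with [l]; there all balls of [X_l] coincide and a tensor
    automorphism is just a point of [G]. Conversely such a point extends to an automorphism over [A]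
    as soon as its matrices and those of its inverse are bounded in the bases of weight vectors. The
    conjugating automorphism is built in this way, as a bounded point over the generic fibre of the
    cover. The obstacle is that the exponent [kap] of the rescaling, a rounded logarithm, is only
    subadditive, so rescaling polynomials by it is not a ring map. On a part which is homogeneous
    for the value classes the defect is one fixed power of the uniformizer. Hence each ideal of
    equations has to be stable under taking homogeneous components, and this stability is deduced
    from group actions: conjugation by [chi'] on the group, and [chi] and [bar_chi] acting on the
    two sides of the translate. Flatness is always handled as absence of torsion: the equational
    criterion makes torsion-free algebras flat, and smooth algebras are torsion-free by an
    Artin-Rees argument. *)

Lemma linear_sum' (A : comPzRingType) (M N : lmodType A) (u : M -> N) I (r : seq I)
    (P : pred I) F :
  linear u -> u (\sum_(i <- r | P i) F i) = \sum_(i <- r | P i) u (F i).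
Proof.
move=> lu; apply: (big_morph u); last exact: linear0'.
by move=> x y; apply: linearD'.
Qed.

Lemma linearB' (A : comPzRingType) (M N : lmodType A) (u : M -> N) x y :
  linear u -> u (x - y) = u x - u y.
Proof. by move=> lu; rewrite -scaleN1r addrC lu scaleN1r addrC. Qed.

(** * Quotients of modules and rings *)

Section QuotientModule.
Variables (A : comPzRingType) (V : lmodType A) (K : submod V).

Definition lquot : Type := {ideal_quot (smod_pred K)}.
HB.instance Definition _ := GRing.Zmodule.on lquot.
Definition lpi (x : V) : lquot := \pi_{ideal_quot (smod_pred K)} x.

Lemma lpiD x y : lpi (x + y) = lpi x + lpi y.
Proof. by rewrite /lpi !piE. Qed.

Lemma lpi_eq x y : lpi x = lpi y <-> K (x - y).
Proof.
split=> [/eqP|/asboolP h]; first by rewrite -Quotient.idealrBE => /asboolP.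
by apply/eqP; rewrite -Quotient.idealrBE.
Qed.

Lemma lpi_surj z : exists x, z = lpi x.
Proof. by exists (repr (z : {ideal_quot (smod_pred K)})); rewrite /lpi reprK. Qed.

Lemma submodB x y : K x -> K y -> K (x - y).
Proof. by move=> hx hy; rewrite -scaleN1r addrC; apply: smodL. Qed.
Lemma submodZ a x : K x -> K (a *: x).
Proof. by move=> hx; rewrite -[_ *: _]addr0; apply: smodL => //; apply: smod0. Qed.
Lemma submodD x y : K x -> K y -> K (x + y).
Proof. by move=> hx hy; rewrite -[x]scale1r; apply: smodL. Qed.
Lemma submodN x : K x -> K (- x).
Proof. by move=> hx; rewrite -scaleN1r; apply: submodZ. Qed.
Lemma submod_sum I (r : seq I) (P : pred I) F :
  (forall i, P i -> K (F i)) -> K (\sum_(i <- r | P i) F i).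
Proof. by move=> h; elim/big_ind: _ => //; [apply: smod0|apply: submodD]. Qed.

Definition lscale (a : A) (z : lquot) : lquot :=
  lpi (a *: repr (z : {ideal_quot (smod_pred K)})).
Lemma lscale_pi a x : lscale a (lpi x) = lpi (a *: x).
Proof.
apply/lpi_eq; rewrite -scalerBr; apply: submodZ.
by apply/lpi_eq; rewrite {1}/lpi reprK.
Qed.

Lemma lscaleA a b z : lscale a (lscale b z) = lscale (a * b) z.
Proof. by have [x ->] := lpi_surj z; rewrite !lscale_pi scalerA. Qed.
Lemma lscale1 : left_id 1 lscale.
Proof. by move=> z; have [x ->] := lpi_surj z; rewrite lscale_pi scale1r. Qed.
Lemma lscaleDr : right_distributive lscale +%R.
Proof.
move=> a z t; have [x ->] := lpi_surj z; have [y ->] := lpi_surj t.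
by rewrite -lpiD !lscale_pi scalerDr lpiD.
Qed.
Lemma lscaleDl z : {morph lscale^~ z : a b / a + b}.
Proof. by move=> a b; have [x ->] := lpi_surj z; rewrite !lscale_pi scalerDl lpiD. Qed.
HB.instance Definition _ :=
  GRing.Zmodule_isLmodule.Build A lquot lscaleA lscale1 lscaleDr lscaleDl.

Lemma lpi_linear : linear lpi.
Proof. by move=> a x y; rewrite lpiD -lscale_pi. Qed.
Lemma lpi_eq0 x : lpi x = 0 <-> K x.
Proof. by rewrite -(linear0' lpi_linear) lpi_eq subr0. Qed.
End QuotientModule.

Notation ideal A := (submod (A^o : lmodType A)).

Section QuotientRing.
Variables (A : comPzRingType) (I : ideal A).
Lemma idmMl a x : I x -> I (a * x).
Proof. exact: (@submodZ A (A^o) I a x). Qed.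
Lemma idmMr a x : I x -> I (x * a).
Proof. by rewrite mulrC; apply: idmMl. Qed.

Definition rquot : Type := lquot I.
HB.instance Definition _ := GRing.Zmodule.on rquot.
Definition rpi0 (x : A) : rquot := @lpi A (A^o) I x.
Definition rmul (z t : rquot) : rquot :=
  rpi0 (repr (z : {ideal_quot (smod_pred I)}) * repr (t : {ideal_quot (smod_pred I)})).
Lemma rpi0_surj z : exists x, z = rpi0 x. Proof. exact: (@lpi_surj A (A^o) I). Qed.
Lemma rpi0_eq x y : rpi0 x = rpi0 y <-> I (x - y). Proof. exact: (@lpi_eq A (A^o) I). Qed.
Lemma rpi0D x y : rpi0 (x + y) = rpi0 x + rpi0 y. Proof. exact: (@lpiD A (A^o) I). Qed.
Lemma rmul_pi x y : rmul (rpi0 x) (rpi0 y) = rpi0 (x * y).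
Proof.
have h z : I (repr (rpi0 z : {ideal_quot (smod_pred I)}) - z).
  by apply/rpi0_eq; rewrite {1}/rpi0 /lpi reprK.
rewrite /rmul; apply/rpi0_eq; set x' := repr _; set y' := repr _.
have -> : x' * y' - x * y = (x' - x) * y' + x * (y' - y).
  by rewrite mulrBl mulrBr addrA addrNK.
apply: submodD; first exact/idmMr/h.
exact/idmMl/h.
Qed.
Lemma rmulA : associative rmul.
Proof.
move=> z t u; have [x ->] := rpi0_surj z; have [y ->] := rpi0_surj t.
by have [w ->] := rpi0_surj u; rewrite !rmul_pi mulrA.
Qed.
Lemma rmulC : commutative rmul.
Proof.
move=> z t; have [x ->] := rpi0_surj z; have [y ->] := rpi0_surj t.
by rewrite !rmul_pi mulrC.
Qed.
Lemma rmul1 : left_id (rpi0 1) rmul.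
Proof. by move=> z; have [x ->] := rpi0_surj z; rewrite rmul_pi mul1r. Qed.
Lemma rmulDl : left_distributive rmul +%R.
Proof.
move=> z t u; have [x ->] := rpi0_surj z; have [y ->] := rpi0_surj t.
by have [w ->] := rpi0_surj u; rewrite -rpi0D !rmul_pi mulrDl rpi0D.
Qed.
HB.instance Definition _ := GRing.Zmodule_isComPzRing.Build rquot
  rmulA rmulC rmul1 rmulDl.
Definition rpi (x : A) : rquot := rpi0 x.
Lemma rpi_zmod : zmod_morphism rpi.
Proof. by move=> x y; rewrite /rpi /rpi0; apply: (linearB' _ _ (lpi_linear I)). Qed.
Lemma rpi_monoid : monoid_morphism rpi.
Proof. by split=> // x y; rewrite /rpi -rmul_pi. Qed.
HB.instance Definition _ := GRing.isZmodMorphism.Build A rquot rpi rpi_zmod.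
HB.instance Definition _ := GRing.isMonoidMorphism.Build A rquot rpi rpi_monoid.
Lemma rpi_surj z : exists x, z = rpi x. Proof. exact: (@lpi_surj A (A^o) I). Qed.
Lemma rpi_eq x y : rpi x = rpi y <-> I (x - y). Proof. exact: (@lpi_eq A (A^o) I). Qed.
Lemma rpi_eq0 x : rpi x = 0 <-> I x. Proof. exact: (@lpi_eq0 A (A^o)). Qed.
End QuotientRing.

Section RingHom.
Variables (A B : comPzRingType) (f : A -> B).
Hypotheses (fD : forall x y, f (x + y) = f x + f y)
  (fM : forall x y, f (x * y) = f x * f y) (f1 : f 1 = 1).
Lemma mk_rhom_zmod : zmod_morphism f.
Proof. by move=> x y; apply/eqP; rewrite eq_sym subr_eq -fD subrK. Qed.
Lemma mk_rhom_monoid : monoid_morphism f. Proof. by split. Qed.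
Definition rhom_fun := f.
HB.instance Definition _ := GRing.isZmodMorphism.Build A B rhom_fun mk_rhom_zmod.
HB.instance Definition _ := GRing.isMonoidMorphism.Build A B rhom_fun mk_rhom_monoid.
Definition rhom : {rmorphism A -> B} := rhom_fun.
Lemma rhomE x : rhom x = f x. Proof. by []. Qed.
End RingHom.

Lemma rquot_lift (A B : comPzRingType) (I : ideal A) (f : {rmorphism A -> B}) :
  (forall x, I x -> f x = 0) -> exists g : {rmorphism rquot I -> B}, forall x, g (rpi I x) = f x.
Proof.
move=> h; pose g (z : rquot I) := f (repr (z : {ideal_quot (smod_pred I)})).
have gE x : g (rpi I x) = f x.
  apply/eqP; rewrite -subr_eq0 -rmorphB; apply/eqP/h/rpi_eq.
  by rewrite {1}/rpi /rpi0 /lpi reprK.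
have gD x y : g (x + y) = g x + g y.
  have [{}x ->] := rpi_surj x; have [{}y ->] := rpi_surj y.
  by rewrite -rmorphD !gE rmorphD.
have gM x y : g (x * y) = g x * g y.
  have [{}x ->] := rpi_surj x; have [{}y ->] := rpi_surj y.
  by rewrite -rmorphM !gE rmorphM.
have g1 : g 1 = 1 by rewrite -(rmorph1 (rpi I)) gE rmorph1.
by exists (rhom gD gM g1) => x; rewrite rhomE gE.
Qed.

(* The monoid algebra of an additive monoid: polynomial rings for M = N^n,  *)
(* group algebras for M an abelian group.                                   *)
Section MonoidAlgebra.
Variables (k : comPzRingType) (M : nmodType).

Definition malg : Type := umod (fun (P : lmodType k) (f : M -> P) => True).
HB.instance Definition _ := GRing.Lmodule.on malg.
Definition me (m : M) : malg := ugen (fun (P : lmodType k) (f : M -> P) => True) m.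
Definition mlin (P : lmodType k) (f : M -> P) : malg -> P := uext f.

Lemma mlin_linear (P : lmodType k) (f : M -> P) : linear (mlin f).
Proof. exact: uext_linear. Qed.
Lemma mlin_e (P : lmodType k) (f : M -> P) m : mlin f (me m) = f m.
Proof. exact: uext_gen. Qed.
Lemma mlin_eq (P : lmodType k) (f g : malg -> P) :
  linear f -> linear g -> (forall m, f (me m) = g (me m)) -> f =1 g.
Proof. exact: linear_umod_eq. Qed.

Definition mmul (z t : malg) : malg := mlin (fun x => mlin (fun y => me (x + y)) t) z.
Lemma mmul_l t : linear (mmul^~ t). Proof. exact: mlin_linear. Qed.
Lemma mmul_e x y : mmul (me x) (me y) = me (x + y).
Proof. by rewrite /mmul !mlin_e. Qed.
Lemma mmulC : commutative mmul.
Proof.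
have lr z : linear (mmul z).
  move=> a t t'; apply: (mlin_eq (f := mmul^~ (a *: t + t'))
    (g := fun z => a *: mmul z t + mmul z t')); first exact: mmul_l.
    by move=> b x y; rewrite !mmul_l !scalerDr !scalerA mulrC addrACA.
  by move=> m; rewrite /mmul !mlin_e mlin_linear.
move=> z t; apply: (mlin_eq (f := mmul^~ t) (g := mmul t)) => //.
  exact: mmul_l.
move=> x; apply: (mlin_eq (f := mmul (me x)) (g := mmul^~ (me x))) => //.
  exact: mmul_l.
by move=> y; rewrite !mmul_e addrC.
Qed.
Lemma mmul_r z : linear (mmul z).
Proof. by move=> a x y; rewrite !(mmulC z) mmul_l. Qed.
Lemma mmulA : associative mmul.
Proof.
move=> z t u; apply: (mlin_eq (f := fun z => mmul z (mmul t u))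
  (g := fun z => mmul (mmul z t) u)); rewrite -/(mmul _).
- by move=> a x y; rewrite !mmul_l.
- by move=> a x y; rewrite !mmul_l.
move=> x {z}; apply: (mlin_eq (f := fun t => mmul (me x) (mmul t u))
  (g := fun t => mmul (mmul (me x) t) u)).
- by move=> a y z; rewrite mmul_l !mmul_r.
- by move=> a y z; rewrite mmul_r !mmul_l.
move=> y {t}; apply: (mlin_eq (f := fun u => mmul (me x) (mmul (me y) u))
  (g := fun u => mmul (mmul (me x) (me y)) u)).
- by move=> a z t; rewrite !mmul_r.
- by move=> a z t; rewrite mmul_r.
by move=> z; rewrite !mmul_e addrA.
Qed.
Lemma mmul1 : left_id (me 0) mmul.
Proof.
apply: mlin_eq => [||m]; [exact: mmul_r|by []|by rewrite mmul_e add0r].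
Qed.
Lemma mmulDl : left_distributive mmul +%R.
Proof. by move=> x y z; rewrite (linearD' _ _ (mmul_l z)). Qed.
HB.instance Definition _ := GRing.Zmodule_isComPzRing.Build malg mmulA mmulC mmul1 mmulDl.

Lemma meM x y : me x * me y = me (x + y). Proof. exact: mmul_e. Qed.
Lemma me0 : me 0 = 1. Proof. by []. Qed.
Lemma meX m n : me m ^+ n = me (m *+ n).
Proof. by elim: n => [|n IH]; rewrite ?expr0 ?mulr0n ?me0 // exprS IH meM mulrS. Qed.
Lemma malgZl a (x y : malg) : (a *: x) * y = a *: (x * y).
Proof. exact: (linearZ' _ _ (mmul_l y)). Qed.
Lemma malgZr a (x y : malg) : x * (a *: y) = a *: (x * y).
Proof. exact: (linearZ' _ _ (mmul_r x)). Qed.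

Definition mconst (a : k) : malg := a *: me 0.
Lemma mconst_zmod : zmod_morphism mconst.
Proof. by move=> x y; rewrite /mconst scalerBl. Qed.
Lemma mconst_monoid : monoid_morphism mconst.
Proof.
split=> [|x y]; first by rewrite /mconst scale1r.
by rewrite /mconst malgZl malgZr scalerA meM addr0.
Qed.
HB.instance Definition _ := GRing.isZmodMorphism.Build k malg mconst mconst_zmod.
HB.instance Definition _ := GRing.isMonoidMorphism.Build k malg mconst mconst_monoid.
Lemma mconstM a (x : malg) : mconst a * x = a *: x.
Proof. by rewrite /mconst malgZl me0 mul1r. Qed.

Definition mcoef (m : M) : malg -> k := mlin (fun x => (x == m)%:R : k^o).
Lemma mcoef_linear m : linear (mcoef m : malg -> k^o). Proof. exact: mlin_linear. Qed.
Lemma mcoefD m x y : mcoef m (x + y) = mcoef m x + mcoef m y.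
Proof. exact: (linearD' _ _ (mcoef_linear m)). Qed.
Lemma mcoefB m x y : mcoef m (x - y) = mcoef m x - mcoef m y.
Proof. exact: (linearB' _ _ (mcoef_linear m)). Qed.
Lemma mcoefZ m a x : mcoef m (a *: x) = a * mcoef m x.
Proof. exact: (linearZ' _ _ (mcoef_linear m)). Qed.
Lemma mcoef0 m : mcoef m 0 = 0.
Proof. exact: (linear0' (mcoef_linear m)). Qed.
Lemma mcoef_sum m I (r : seq I) (P : pred I) F :
  mcoef m (\sum_(i <- r | P i) F i) = \sum_(i <- r | P i) mcoef m (F i).
Proof. exact: (linear_sum' _ _ _ (mcoef_linear m)). Qed.
Lemma mcoef_e m x : mcoef m (me x) = (x == m)%:R.
Proof. by rewrite /mcoef mlin_e. Qed.

Lemma malg_supp (z : malg) : exists s : seq M, uniq s /\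
  z = \sum_(m <- s) mcoef m z *: me m.
Proof.
pose r := repr z; exists (undup [seq p.1 | p <- r]); split; first exact: undup_uniq.
have zE : z = \sum_(p <- r) p.2 *: me p.1 by rewrite [LHS]umodE.
have cE m : mcoef m z = \sum_(p <- r | p.1 == m) p.2.
  rewrite {1}zE mcoef_sum [RHS]big_mkcond; apply: eq_bigr => p _.
  by rewrite mcoefZ mcoef_e; case: eqP => _; rewrite ?mulr1 ?mulr0.
rewrite {1}zE.
under [RHS]eq_bigr => m _ do rewrite cE scaler_suml.
rewrite (exchange_big_dep predT) //=; apply: eq_big_seq => p pr.
rewrite -big_filter; set s := filter _ _.
suff -> : s = [:: p.1] by rewrite big_seq1.
rewrite /s -(@filter_pred1_uniq _ (undup [seq p.1 | p <- r]) p.1) ?undup_uniq //.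
  by apply: eq_filter => x /=; rewrite eq_sym.
by rewrite mem_undup map_f.
Qed.

Lemma mcoef_inj z t : (forall m, mcoef m z = mcoef m t) -> z = t.
Proof.
move=> h; apply/eqP; rewrite -subr_eq0; apply/eqP.
have [s [_ ->]] := malg_supp (z - t).
by rewrite big1 // => m _; rewrite mcoefB h subrr scale0r.
Qed.

Lemma malg_ind (K : malg -> Prop) :
  (forall a m z, K z -> K (a *: me m + z)) -> K 0 -> forall z, K z.
Proof. exact: umod_ind. Qed.

Section Universal.
Variables (B : comPzRingType) (phi : {rmorphism k -> B}) (f : M -> B).
Hypotheses (f0 : f 0 = 1) (fD : forall x y, f (x + y) = f x * f y).

Definition mhom_fun (z : malg) : B := mlin (f : M -> resmod phi (B^o)) z.
Lemma mhom_funL a x y : mhom_fun (a *: x + y) = phi a * mhom_fun x + mhom_fun y.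
Proof. exact: (mlin_linear (f : M -> resmod phi (B^o))). Qed.
Lemma mhom_funD x y : mhom_fun (x + y) = mhom_fun x + mhom_fun y.
Proof. exact: (linearD' _ _ (mlin_linear (f : M -> resmod phi (B^o)))). Qed.
Lemma mhom_fun0 : mhom_fun 0 = 0.
Proof. exact: (linear0' (mlin_linear (f : M -> resmod phi (B^o)))). Qed.
Lemma mhom_fun_e m : mhom_fun (me m) = f m.
Proof. exact: (mlin_e (f : M -> resmod phi (B^o))). Qed.
Lemma mhom_funM x y : mhom_fun (x * y) = mhom_fun x * mhom_fun y.
Proof.
elim/malg_ind: x => [a m z IH|]; last by rewrite mul0r !mhom_fun0 mul0r.
rewrite mulrDl mhom_funL malgZl mhom_funL IH mulrDl; congr (_ + _).
rewrite -mulrA; congr (_ * _); elim/malg_ind: y {IH} => [b n y IH|].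
  by rewrite mulrDr malgZr !mhom_funL IH meM !mhom_fun_e fD mulrDr mulrCA.
by rewrite mulr0 !mhom_fun0 mulr0.
Qed.
Lemma mhom_fun1 : mhom_fun 1 = 1. Proof. by rewrite -me0 mhom_fun_e. Qed.
Definition mhom : {rmorphism malg -> B} := rhom mhom_funD mhom_funM mhom_fun1.
Lemma mhom_e m : mhom (me m) = f m. Proof. exact: mhom_fun_e. Qed.
Lemma mhomZ a z : mhom (a *: z) = phi a * mhom z.
Proof. by rewrite -[_ *: _]addr0 [LHS]mhom_funL mhom_fun0 addr0. Qed.
Lemma mhomC a : mhom (mconst a) = phi a.
Proof. by rewrite /mconst mhomZ me0 rmorph1 mulr1. Qed.
End Universal.

End MonoidAlgebra.
Arguments me {k M} m.

(** * Tensor products of algebras *)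

Definition amod (k : comPzRingType) (A : kalg k) : lmodType k := resmod (kstr A) (A^o).
Section TensorAlgebra.
Variables (k : comPzRingType) (A S : kalg k).
Local Notation T := (bc (amod A) S).
Definition amul (x y : amod A) : amod A := (x : A) * (y : A).
Lemma amul_bilin : bilin amul.
Proof.
split=> [y a x x'|x a y y']; rewrite /amul.
  by rewrite mulrDl; congr (_ + _); rewrite -[LHS]mulrA.
by rewrite mulrDr; congr (_ + _); rewrite [LHS]mulrCA.
Qed.
Definition ctmul (z t : T) : T := bcbilin amul z t.
Let cl t := @bcbilin_linear1 k _ _ _ amul S t amul_bilin.
Let cr z := @bcbilin_linear2 k _ _ _ amul S z amul_bilin.
Lemma ctmul_in (x y : amod A) : ctmul (bc_in S x) (bc_in S y) = bc_in S (amul x y).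
Proof. exact: bcbilin_in amul_bilin. Qed.
Lemma ctmulC : commutative ctmul.
Proof.
move=> z t; apply: (linear_bc_eq (f := ctmul^~ t) (g := ctmul t)).
- exact: cl.
- exact: cr.
move=> x; apply: (linear_bc_eq (f := ctmul (bc_in S x)) (g := ctmul^~ (bc_in S x))).
- exact: cr.
- exact: cl.
by move=> y; rewrite !ctmul_in /amul mulrC.
Qed.
Lemma ctmulA : associative ctmul.
Proof.
move=> z t u; apply: (linear_bc_eq (f := fun z => ctmul z (ctmul t u))
  (g := fun z => ctmul (ctmul z t) u)).
- by move=> a x y; rewrite /ctmul !cl.
- by move=> a x y; rewrite /ctmul !cl.
move=> x {z}; apply: (linear_bc_eq (f := fun t => ctmul (bc_in S x) (ctmul t u))
  (g := fun t => ctmul (ctmul (bc_in S x) t) u)).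
- by move=> a y z; rewrite /ctmul cl !cr.
- by move=> a y z; rewrite /ctmul cr !cl.
move=> y {t}; apply: (linear_bc_eq
  (f := fun u => ctmul (bc_in S x) (ctmul (bc_in S y) u))
  (g := fun u => ctmul (ctmul (bc_in S x) (bc_in S y)) u)).
- by move=> a z t; rewrite /ctmul !cr.
- by move=> a z t; rewrite /ctmul !cr.
by move=> z; rewrite !ctmul_in /amul mulrA.
Qed.
Lemma ctmul1 : left_id (@bc_in k (amod A) S (1 : A)) ctmul.
Proof.
apply: linear_bc_eq => [||x]; [exact: cr|by []|by rewrite ctmul_in /amul mul1r].
Qed.
Lemma ctmulDl : left_distributive ctmul +%R.
Proof. by move=> x y z; apply: (linearD' _ _ (cl z)). Qed.

Definition ctens_ring : Type := T.
HB.instance Definition _ := GRing.Lmodule.on ctens_ring.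
HB.instance Definition _ :=
  GRing.Zmodule_isComPzRing.Build ctens_ring ctmulA ctmulC ctmul1 ctmulDl.
Definition ct_in (s : S) (x : A) : ctens_ring := s *: bc_in S (x : amod A).
Lemma ct_inM s t x y : ct_in s x * ct_in t y = ct_in (s * t) (x * y).
Proof.
rewrite /ct_in -[LHS]/(ctmul _ _) /ctmul.
by rewrite (linearZ' _ _ (cl _)) (linearZ' _ _ (cr _)) scalerA bcbilin_in //; apply: amul_bilin.
Qed.
Lemma ct_inDr s x y : ct_in s (x + y) = ct_in s x + ct_in s y.
Proof. by rewrite /ct_in (bc_inP (amod A) S).1 scalerDr. Qed.
Lemma ct_inDl s t x : ct_in (s + t) x = ct_in s x + ct_in t x.
Proof. by rewrite /ct_in scalerDl. Qed.
Lemma ct_inZ a s x : ct_in s (kstr A a * x) = ct_in (kstr S a * s) x.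
Proof. by rewrite /ct_in (bc_inP (amod A) S).2 scalerA mulrC. Qed.
Lemma ct_in1 : ct_in 1 1 = 1. Proof. by rewrite /ct_in scale1r. Qed.
Lemma ctZ s (z : ctens_ring) : s *: (z : T) = ct_in s 1 * z.
Proof.
rewrite -[RHS]/(ctmul _ _) /ctmul /ct_in (linearZ' _ _ (cl _)).
by congr (_ *: _); rewrite -[RHS]/(ctmul _ _) ctmul1.
Qed.

Definition ctl : {rmorphism A -> ctens_ring}.
refine (@rhom A ctens_ring (ct_in 1) _ _ _).
- by move=> x y; apply: ct_inDr.
- by move=> x y; rewrite ct_inM mulr1.
- exact: ct_in1.
Defined.
Definition ctr : {rmorphism S -> ctens_ring}.
refine (@rhom S ctens_ring (ct_in^~ 1) _ _ _).
- by move=> x y; apply: ct_inDl.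
- by move=> x y; rewrite ct_inM mulr1.
- exact: ct_in1.
Defined.
Definition ctens : kalg k := @KAlg k ctens_ring (ctr \o kstr S).
Lemma ctlP a : ctl (kstr A a) = kstr ctens a.
Proof. by rewrite -[LHS]/(ct_in 1 _) -[kstr A a]mulr1 ct_inZ mulr1. Qed.
Fact ct_key : unit. Proof. by []. Qed.
Definition ctL : khom A ctens := locked_with ct_key (@KHom k A ctens ctl ctlP).
Definition ctR : khom S ctens :=
  locked_with ct_key (@KHom k S ctens ctr (fun a => erefl)).
Lemma ctZE s (z : ctens_ring) : s *: (z : T) = ctR s * z.
Proof. by rewrite /ctR [locked_with _ _]unlock; apply: ctZ. Qed.
Lemma ctLE x : ctL x = bc_in S (x : amod A).
Proof. by rewrite /ctL [locked_with _ _]unlock -[LHS]/(ct_in 1 x) /ct_in scale1r. Qed.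
Lemma ctens_ind (K : ctens_ring -> Prop) :
  (forall s x z, K z -> K (ctR s * ctL x + z)) -> K 0 -> forall z, K z.
Proof.
by move=> h h0; apply: bc_ind => // a x z Kz; rewrite ctZE -ctLE; apply: h.
Qed.
Lemma ctens_lift (B : kalg k) (f : khom A B) (g : khom S B) :
  exists h : khom ctens B, (forall x, h (ctL x) = f x) /\ (forall s, h (ctR s) = g s).
Proof.
pose F : amod A -> resmod g (B^o) := fun x => f x.
have sF : @semilin k S (amod A) (resmod g (B^o)) F.
  split=> [x y|a x]; first exact: rmorphD.
  rewrite /F -[LHS]/(f (kstr A a * x)) rmorphM khomP.
  by rewrite -[RHS]/(g (kstr S a) * f x) khomP.
pose h (z : ctens_ring) : B := uext F z.
have hL s z t : h (ctR s * z + t) = g s * h z + h t.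
  by rewrite -ctZE; apply: (uext_linear sF).
have h0 : h 0 = 0 by have := uext_zero sF.
have hl x : h (ctL x) = f x by rewrite ctLE /h uext_gen.
have hr s : h (ctR s) = g s.
  by rewrite -[ctR s]mulr1 -[ctR s * 1]addr0 hL h0 addr0 -(rmorph1 ctL) hl rmorph1 mulr1.
have hD x y : h (x + y) = h x + h y.
  by rewrite -{1}[x]mul1r -{1}(rmorph1 ctR) hL rmorph1 mul1r.
have hM x y : h (x * y) = h x * h y.
  elim/ctens_ind: x => [s x z IH|]; last by rewrite mul0r h0 mul0r.
  rewrite mulrDl -mulrA !hL IH mulrDl hl -mulrA; congr (_ * _ + _).
  elim/ctens_ind: y {IH} => [t y w IH|]; last by rewrite mulr0 h0 mulr0.
  rewrite mulrDr mulrCA -rmorphM !hL IH mulrDr !hl rmorphM mulrCA.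
  by congr (_ + _); rewrite mulrCA.
have h1 : h 1 = 1 by rewrite -(rmorph1 ctL) hl rmorph1.
have hk a : rhom hD hM h1 (kstr ctens a) = kstr B a.
  by rewrite -(khomP ctR) rhomE hr khomP.
exists (@KHom k ctens B (@rhom ctens B h hD hM h1) hk).
by split=> [x|s]; [exact: hl|exact: hr].
Qed.
End TensorAlgebra.

(** * Modules over a discrete valuation ring *)

Definition is_unit (A : comPzRingType) (x : A) : Prop := exists y, x * y = 1.

Lemma is_unitM (A : comPzRingType) (x y : A) : is_unit x -> is_unit y -> is_unit (x * y).
Proof. by move=> [x' hx] [y' hy]; exists (x' * y'); rewrite mulrACA hx hy mulr1. Qed.
Lemma is_unitMl (A : comPzRingType) (x y : A) : is_unit (x * y) -> is_unit x.
Proof. by move=> [z hz]; exists (y * z); rewrite mulrA. Qed.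
Lemma is_unitMI (A : comPzRingType) (x y z : A) : is_unit x -> x * y = x * z -> y = z.
Proof. by move=> [x' hx] h; rewrite -[y]mul1r -[z]mul1r -hx mulrAC h mulrAC. Qed.

Record is_dvr (k : comNzRingType) (p : k) : Prop := IsDvr {
  dvr_dom : forall x y : k, x * y = 0 -> x = 0 \/ y = 0;
  dvr_fac : forall x : k, x <> 0 -> exists u n, is_unit u /\ x = u * p ^+ n;
  dvr_nu : ~ is_unit p;
  dvr_p0 : p <> 0 }.

Definition inspan (k : comPzRingType) (M : lmodType k) n (e : 'I_n -> M) (x : M) : Prop :=
  exists a : 'I_n -> k, x = \sum_i a i *: e i.
Definition indep (k : comPzRingType) (M : lmodType k) n (e : 'I_n -> M) : Prop :=
  forall a : 'I_n -> k, \sum_i a i *: e i = 0 -> forall i, a i = 0.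

Section Span.
Variables (k : comPzRingType) (M : lmodType k).
Lemma inspan_mem n (e : 'I_n -> M) i : inspan e (e i).
Proof.
exists (fun j => (j == i)%:R); rewrite (bigD1 i) //= eqxx scale1r big1 ?addr0 // => j /negPf ->.
by rewrite scale0r.
Qed.
Lemma inspan0 n (e : 'I_n -> M) : inspan e 0.
Proof. by exists (fun=> 0); rewrite big1 // => i _; rewrite scale0r. Qed.
Lemma inspanL n (e : 'I_n -> M) a x y : inspan e x -> inspan e y -> inspan e (a *: x + y).
Proof.
move=> [b ->] [c ->]; exists (fun i => a * b i + c i).
rewrite scaler_sumr -big_split; apply: eq_bigr => i _ /=.
by rewrite scalerDl scalerA.
Qed.
Lemma inspanZ n (e : 'I_n -> M) a x : inspan e x -> inspan e (a *: x).
Proof. by move=> h; rewrite -[_ *: _]addr0; apply: inspanL => //; apply: inspan0. Qed.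
Lemma inspanD n (e : 'I_n -> M) x y : inspan e x -> inspan e y -> inspan e (x + y).
Proof. by move=> hx hy; rewrite -[x]scale1r; apply: inspanL. Qed.
Lemma inspan_sum n (e : 'I_n -> M) I (r : seq I) (P : pred I) F :
  (forall i, P i -> inspan e (F i)) -> inspan e (\sum_(i <- r | P i) F i).
Proof. by move=> h; elim/big_ind: _ => //; [apply: inspan0|apply: inspanD]. Qed.
Lemma inspan_trans n m (e : 'I_n -> M) (f : 'I_m -> M) x :
  inspan e x -> (forall i, inspan f (e i)) -> inspan f x.
Proof. by move=> [a ->] h; apply: inspan_sum => i _; apply: inspanZ. Qed.
Lemma indep_inj n (e : 'I_n -> M) a b : indep e ->
  \sum_i a i *: e i = \sum_i b i *: e i -> a =1 b.
Proof.
move=> he h i; apply/eqP; rewrite -subr_eq0; apply/eqP.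
apply: (he (fun i => a i - b i)); under eq_bigr do rewrite scalerBl.
by rewrite sumrB h subrr.
Qed.
End Span.

Section DVR.
Variables (k : comNzRingType) (p : k) (hk : is_dvr p).

(** Torsion by [p] alone is excluded, which suffices because a nonzero scalar is a unit times a
    power of [p] ([tf_mul]). Over a discrete valuation ring this is the working form of flatness. *)
Definition tf (M : lmodType k) : Prop := forall x : M, p *: x = 0 -> x = 0.

Lemma dvr_mulI (x y z : k) : x <> 0 -> x * y = x * z -> y = z.
Proof.
move=> x0 h; have /(dvr_dom hk) : x * (y - z) = 0 by rewrite mulrBr h subrr.
by case=> // /eqP; rewrite subr_eq0 => /eqP.
Qed.

Lemma dvr_local (x : k) : is_unit x \/ exists y, x = p * y.
Proof.
have [->|/eqP x0] := eqVneq x 0; first by right; exists 0; rewrite mulr0.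
have [u [[|n] [hu ->]]] := dvr_fac hk x0; first by left; rewrite expr0 mulr1.
by right; exists (u * p ^+ n); rewrite exprS mulrCA.
Qed.

Lemma tf_mul (M : lmodType k) (x : M) a : tf M -> a <> 0 -> a *: x = 0 -> x = 0.
Proof.
move=> tM a0; have [u [n [[v uv] ->]]] := dvr_fac hk a0; rewrite mulrC => h.
have hn m (y : M) : p ^+ m *: y = 0 -> y = 0.
  by elim: m => [|m IH]; rewrite ?expr0 ?scale1r // exprS -scalerA => /tM.
by apply: (hn n); rewrite -[_ *: x]scale1r -uv mulrC -scalerA [u *: _]scalerA mulrC h scaler0.
Qed.

(** Descent on the valuation of the nonzero entry [a i0]: as long as no entry is a unit, all of them
    are divisible by [p], and dividing by [p] lowers this valuation by one. *)
Lemma common_power n (a : 'I_n -> k) i0 : a i0 <> 0 ->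
  exists m b, (forall i, a i = p ^+ m * b i) /\ exists i, is_unit (b i).
Proof.
move=> h0; have [u [m [hu e]]] := dvr_fac hk h0.
elim: m a h0 e => [|m IH] a h0 e.
  by exists 0%N, a; split=> [i|]; [rewrite mul1r|exists i0; rewrite e mulr1].
have [hx|hx] := EM (exists i, is_unit (a i)).
  by exists 0%N, a; split=> // i; rewrite mul1r.
have /choice [b hb] : forall i, exists y, a i = p * y.
  by move=> i; case: (dvr_local (a i)) => // ha; case: hx; exists i.
have e' : b i0 = u * p ^+ m.
  by apply: (dvr_mulI (dvr_p0 hk)); rewrite -hb e exprS mulrCA.
have b0 : b i0 <> 0 by move=> b0; apply: h0; rewrite hb b0 mulr0.
have [n' [c [hc hu']]] := IH b b0 e'.
by exists n'.+1, c; split=> // i; rewrite hb hc exprS mulrA.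
Qed.

(* A nontrivial relation can be divided by a power of p until one of its   *)
(* coefficients is a unit, and then the corresponding vector is redundant. *)
Lemma tf_span_basis (M : lmodType k) : tf M -> forall n (m : 'I_n -> M),
  exists r (e : 'I_r -> M), [/\ indep e, forall i, inspan e (m i) & forall j, inspan m (e j)].
Proof.
move=> hM; elim=> [|n IH] m.
  by exists 0%N, m; split=> [a _ []||] // i; apply: inspan_mem.
have [hi|] := EM (indep m).
  by exists n.+1, m; split=> // i; apply: inspan_mem.
move=> /existsNP[a /not_implyP[a0 /existsNP[i0 ai0]]].
have [d [b [hb [i1 [v hv]]]]] := common_power ai0.
have hb0 : \sum_i b i *: m i = 0.
  apply: (tf_mul hM (a := p ^+ d)).
    by move=> pd0; apply: ai0; rewrite hb pd0 mul0r.
  by rewrite scaler_sumr -[RHS]a0; apply: eq_bigr => i _; rewrite scalerA -hb.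
have [r [e [he h1 h2]]] := IH (fun j => m (lift i1 j)).
have hm1 : inspan (fun j => m (lift i1 j)) (m i1).
  exists (fun j => - (v * b (lift i1 j))).
  rewrite -[LHS]scale1r -hv mulrC -scalerA.
  have -> : b i1 *: m i1 = - \sum_j b (lift i1 j) *: m (lift i1 j).
    apply/eqP; rewrite -addr_eq0; apply/eqP; rewrite -[RHS]hb0.
    rewrite (bigD1_ord i1) //=.
  by rewrite scalerN scaler_sumr -sumrN; apply: eq_bigr => j _; rewrite scalerA scaleNr.
exists r, e; split=> // [i|j].
  case: (unliftP i1 i) => [j|] ->; first exact: h1.
  by apply: inspan_trans hm1 _.
by apply: inspan_trans (h2 j) _ => i; apply: inspan_mem.
Qed.

(** Induction on the number of generators. The elements of [K] without component along [g ord0] are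
    handled by the induction hypothesis; the coefficients along [g ord0] form an ideal, and an
    element of [K] whose coefficient has least valuation is the only further generator required. *)
Lemma submod_fg (M : lmodType k) n (g : 'I_n -> M) (K : submod M) :
  (forall x, K x -> inspan g x) ->
  exists r (e : 'I_r -> M), (forall j, K (e j)) /\ forall x, K x -> inspan e x.
Proof.
elim: n g K => [|n IH] g K hg.
  exists 0%N, g; split=> [[]|x /hg] //.
pose g' j := g (lift ord0 j).
have gE a : \sum_i a i *: g i = a ord0 *: g ord0 + \sum_j a (lift ord0 j) *: g' j.
  by rewrite big_ord_recl.
have K'0 : K 0 /\ inspan g' 0 by split; [exact: smod0|exact: inspan0].
have K'L a x y : K x /\ inspan g' x -> K y /\ inspan g' y ->
    K (a *: x + y) /\ inspan g' (a *: x + y).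
  by move=> [? ?] [? ?]; split; [apply: smodL|apply: inspanL].
have [r [e [he1 he2]]] := IH g' (SubMod K'0 K'L) (fun x hx => hx.2).
pose L a := exists x, K x /\ inspan g' (x - a *: g ord0).
have [hL|hL] := EM (exists a, a <> 0 /\ L a); last first.
  exists r, e; split=> [j|x Kx]; first by have [] := he1 j.
  apply: he2; split=> //; have [a ax] := hg x Kx.
  suff a0 : a ord0 = 0 by rewrite ax gE a0 scale0r add0r; exists (fun j => a (lift ord0 j)).
  apply: contrapT => a0; apply: hL; exists (a ord0); split=> //; exists x; split=> //.
  by rewrite ax gE addrAC subrr add0r; exists (fun j => a (lift ord0 j)).
have hv : exists m, `[< exists a u, [/\ is_unit u, a = u * p ^+ m & L a] >].
  have [a [a0 La]] := hL; have [u [m [hu e']]] := dvr_fac hk a0.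
  by exists m; apply/asboolP; exists a, u.
case: (ex_minnP hv) => m /asboolP[a [u [[v uv] ae [x [Kx hx]]]]] hmin.
exists r.+1, (fun j => if unlift ord0 j is Some j' then e j' else x).
split=> [j|y Ky].
  by case: unliftP => [j'|] //; have [] := he1 j'.
have [b yb] := hg y Ky.
have [c bc] : exists c, b ord0 = c * a.
  have [->|/eqP b0] := eqVneq (b ord0) 0; first by exists 0; rewrite mul0r.
  have [w [m' [hw bE]]] := dvr_fac hk b0.
  have hm : (m <= m')%N.
    apply: hmin; apply/asboolP; exists (b ord0), w; split=> //; exists y; split=> //.
    by rewrite yb gE addrAC subrr add0r; exists (fun j => b (lift ord0 j)).
  exists (w * v * p ^+ (m' - m)); rewrite bE ae -[m' in LHS](subnK hm) exprD.
  by rewrite mulrACA -[w * v * u]mulrA [v * u]mulrC uv mulr1.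
have hyx : inspan e (y - c *: x).
  apply: he2; split; first by apply: submodB => //; apply: submodZ.
  have -> : y - c *: x = (- c) *: (x - a *: g ord0) + \sum_j b (lift ord0 j) *: g' j.
    rewrite {1}yb gE bc scalerBr scalerA mulNr !scaleNr opprK.
    by rewrite addrAC [_ - c *: x]addrC.
  by apply: inspanL => //; exists (fun j => b (lift ord0 j)).
have [d hd] := hyx.
exists (fun j => if unlift ord0 j is Some j' then d j' else c).
rewrite big_ord_recl unlift_none -[LHS](subrK (c *: x)) hd addrC; congr (_ + _).
by apply: eq_bigr => j _; rewrite liftK.
Qed.

Lemma submod_basis (M : lmodType k) n (g : 'I_n -> M) (K : submod M) : tf M ->
  (forall x, K x -> inspan g x) ->
  exists r (e : 'I_r -> M),
    [/\ indep e, forall j, K (e j) & forall x, K x -> inspan e x].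
Proof.
move=> hM /submod_fg[r [e [he1 he2]]]; have [s [f [hf h1 h2]]] := tf_span_basis hM e.
exists s, f; split=> // [j|x /he2 hx]; last exact: inspan_trans hx h1.
by have [a ->] := h2 j; apply: submod_sum => i _; apply: submodZ.
Qed.
End DVR.

Lemma mcoef_sumZ (k : comPzRingType) (M : nmodType) I (r : seq I) (a : I -> k)
    (n : I -> M) m :
  mcoef m (\sum_(i <- r) a i *: me (n i)) = \sum_(i <- r) a i * (n i == m)%:R.
Proof. by rewrite mcoef_sum; apply: eq_bigr => i _; rewrite mcoefZ mcoef_e. Qed.

Lemma bcE (k : comPzRingType) (N : lmodType k) (S : kalg k) (z : bc N S) :
  exists r (a : 'I_r -> S) (n : 'I_r -> N), z = \sum_i a i *: bc_in S (n i).
Proof.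
pose s := repr z; exists (size s), (fun i => (tnth (in_tuple s) i).2),
  (fun i => (tnth (in_tuple s) i).1).
by rewrite [LHS]umodE -/s big_tnth.
Qed.

(** * Torsion-free algebras over a discrete valuation ring are flat *)

Section Flatness.
Variables (k : comNzRingType) (p : k) (hk : is_dvr p).

Section ZeroTensor.
Variables (N : lmodType k) (A : kalg k) (hA : tf p (amod A)).

(** The tensor product of [N] and [A] is compared with the free [A]-module on the set [N] modulo
    [tzero], the span of those relations which already hold in [N] over [k]. This makes explicit why
    a tensor vanishes. *)
Definition trel (t : seq (N * k)) : malg A N := \sum_(q <- t) kstr A q.2 *: me q.1.
Definition tzero (z : malg A N) : Prop := exists s : seq (A * seq (N * k)),
  (forall t, t \in s -> \sum_(q <- t.2) q.2 *: q.1 = 0) /\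
  z = \sum_(t <- s) t.1 *: trel t.2.
Lemma tzero0 : tzero 0. Proof. by exists [::]; rewrite big_nil. Qed.
Lemma tzeroL a x y : tzero x -> tzero y -> tzero (a *: x + y).
Proof.
move=> [s [hs ->]] [t [ht ->]]; exists ([seq (a * u.1, u.2) | u <- s] ++ t); split.
  by move=> u; rewrite mem_cat => /orP[/mapP[v /hs hv ->] //|/ht].
rewrite big_cat big_map scaler_sumr; congr (_ + _); apply: eq_bigr => u _.
by rewrite scalerA.
Qed.
Definition tzero_sub : submod (malg A N) := SubMod tzero0 tzeroL.
Lemma tzero_rel t : \sum_(q <- t) q.2 *: q.1 = 0 -> tzero (trel t).
Proof.
move=> h; exists [:: (1, t)]; split=> [u|]; last by rewrite big_seq1 scale1r.
by rewrite inE => /eqP ->.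
Qed.

Lemma tensor_semilin : semilin (R := A) (fun x : N => lpi tzero_sub (me x)).
Proof.
split=> [x y|a x]; rewrite -?lpiD -?(linearZ' _ _ (lpi_linear tzero_sub)); apply/lpi_eq.
  have -> : me (x + y) - (me x + me y) = trel [:: (x + y, 1); (x, -1); (y, -1)].
    by rewrite /trel !big_cons big_nil /= rmorphN1 rmorph1 !scaleN1r scale1r addr0 opprD.
  apply: tzero_rel; rewrite !big_cons big_nil /= !scaleN1r scale1r addr0.
  by rewrite -opprD subrr.
have -> : me (a *: x) - kstr A a *: me x = trel [:: (a *: x, 1); (x, - a)].
  by rewrite /trel !big_cons big_nil /= rmorph1 rmorphN scale1r scaleNr addr0.
apply: tzero_rel; rewrite !big_cons big_nil /= scale1r scaleNr addr0.
by rewrite subrr.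
Qed.

(* The equational criterion: a torsion-free algebra is flat. *)
Lemma bc_zero r (n : 'I_r -> N) (a : 'I_r -> A) : \sum_i a i *: bc_in A (n i) = 0 ->
  exists s (e : 'I_s -> amod A) (c : 'I_r -> 'I_s -> k),
    (forall i, a i = \sum_j c i j *: e j :> amod A) /\
    forall j, \sum_i c i j *: n i = 0.
Proof.
move=> h0; have : lpi tzero_sub (\sum_i a i *: me (n i)) = 0.
  have lu := uext_linear tensor_semilin.
  rewrite (linear_sum' _ _ _ (lpi_linear _)) -[RHS](linear0' lu) -h0.
  rewrite (linear_sum' _ _ _ lu); apply: eq_bigr => i _.
  rewrite (linearZ' _ _ (lpi_linear _)) (linearZ' _ _ lu).
  by rewrite uext_gen //; apply: tensor_semilin.
move=> /lpi_eq0[s [hs e0]].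
(* All scalars of [A] in sight, the [a i] and the coefficients of the relations, are expanded in one
   [k]-independent family [e]. Comparing coefficients along [e] replaces the identity over [A] by
   one identity over [k] for each [j], which is then evaluated in [N]. *)
pose L : seq (amod A) := [seq a i | i <- enum 'I_r] ++ [seq t.1 | t <- s].
have [q [e [he h1 _]]] := tf_span_basis hk hA (fun i : 'I_(size L) => tnth (in_tuple L) i).
have hL x : x \in L -> inspan e x.
  by move=> /(tnthP (in_tuple L))[i ->]; apply: h1.
have /choice[c hc] : forall i, exists b : 'I_q -> k, a i = \sum_j b j *: e j :> amod A.
  by move=> i; apply: hL; rewrite mem_cat map_f // mem_enum.
have /choice[d hd] : forall t, exists b : 'I_q -> k,
    t \in s -> t.1 = \sum_j b j *: e j :> amod A.
  move=> t; have [ts|] := boolP (t \in s); last by exists (fun=> 0).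
  by have [|b hb] := hL t.1; [rewrite mem_cat map_f ?orbT|exists b].
exists q, e, c; split=> // j.
pose X j : malg k N := \sum_i c i j *: me (n i).
pose Y j : malg k N := \sum_(t <- s) d t j *: \sum_(u <- t.2) u.2 *: me u.1.
have XY : X j = Y j.
  apply: mcoef_inj => m; move: j; apply: (indep_inj he).
  have /(congr1 (mcoef m)) := e0; rewrite mcoef_sumZ mcoef_sum.
  have -> : \sum_i a i * (n i == m)%:R = \sum_j mcoef m (X j) *: e j :> amod A.
    under [RHS]eq_bigr do rewrite mcoef_sumZ scaler_suml.
    rewrite exchange_big; apply: eq_bigr => i _ /=; rewrite hc.
    rewrite [LHS]mulr_suml; apply: eq_bigr => j _; rewrite -scalerA.
    by rewrite -[LHS]mulrA [_ *: e j]mulrC; congr (_ * (_ * _)); rewrite rmorph_nat.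
  move=> ->; under [RHS]eq_bigr do rewrite mcoef_sum scaler_suml.
  rewrite exchange_big [LHS]big_seq [RHS]big_seq; apply: eq_bigr => t /hd {1}-> /=.
  rewrite mcoefZ [LHS]mulr_suml; apply: eq_bigr => j _.
  rewrite mcoefZ -scalerA -[LHS]mulrA [_ *: e j]mulrC; congr (_ * (_ * _)).
  rewrite !mcoef_sum rmorph_sum; apply: eq_bigr => u _.
  by rewrite !mcoefZ !mcoef_e rmorphM rmorph_nat.
have := congr1 (mlin (id : N -> N)) XY.
rewrite !(linear_sum' _ _ _ (mlin_linear id)) => e1.
transitivity (\sum_i mlin (id : N -> N) (c i j *: me (n i))).
  by apply: eq_bigr => i _; rewrite (linearZ' _ _ (mlin_linear _)) mlin_e.
rewrite e1 big_seq big1 // => t ts.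
rewrite (linearZ' _ _ (mlin_linear _)) (linear_sum' _ _ _ (mlin_linear id)).
rewrite (eq_bigr (fun u => u.2 *: u.1)) ?hs ?scaler0 // => u _.
by rewrite (linearZ' _ _ (mlin_linear _)) mlin_e.
Qed.

Lemma bc_in_zero (x : N) : bc_in A x = 0 -> exists s (e : 'I_s -> amod A) (c : 'I_s -> k),
  (1 : A) = \sum_j c j *: e j :> amod A /\ forall j, c j *: x = 0.
Proof.
move=> h; have [|s [e [c [hc hn]]]] := @bc_zero 1 (fun=> x) (fun=> 1 : A).
  by rewrite big_ord1 scale1r.
exists s, e, (c ord0); split=> [|j]; first exact: hc.
by rewrite -(hn j) big_ord1.
Qed.

Lemma bc_indep r (n : 'I_r -> N) (a : 'I_r -> A) : indep n ->
  \sum_i a i *: bc_in A (n i) = 0 -> forall i, a i = 0.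
Proof.
move=> hn /bc_zero[s [e [c [hc h]]]] i; rewrite hc big1 // => j _.
by rewrite (hn _ (h j)) scale0r.
Qed.
End ZeroTensor.

(** Used with [S = l]: a torsion-free algebra embeds in its generic fibre, so identities over [A]
    can be checked there. *)
Lemma ctL_inj (A S : kalg k) : tf p (amod A) -> tf p (amod S) -> (1 : S) <> 0 ->
  forall x, ctL A S x = 0 -> x = 0.
Proof.
move=> hA hS S1 x; rewrite ctLE => /(bc_in_zero hS)[s [e [c [h1 h]]]].
apply: contrapT => x0; apply: S1; rewrite [LHS]h1 big1 // => j _.
suff -> : c j = 0 by rewrite scale0r.
by apply: contrapT => cj; apply: x0; apply: (tf_mul hk hA cj (h j)).
Qed.

(** If [p z = 0], the equational criterion produces relations between the elements [p *: n i]. Since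
    [A] is torsion-free, the same relations hold between the [n i], and they make [z] vanish. *)
Lemma ctens_tf (A S : kalg k) : tf p (amod A) -> tf p (amod S) -> tf p (amod (ctens A S)).
Proof.
move=> hA hS z; have [r [a [n zE]]] := bcE (z : bc (amod A) S).
rewrite -[p *: z]/(kstr (ctens A S) p * z) -(khomP (ctR A S)) -ctZE zE.
rewrite scaler_sumr => h.
have h' : \sum_i a i *: bc_in S (p *: n i) = 0.
  rewrite -[RHS]h; apply: eq_bigr => i _.
  by rewrite (bc_inP (amod A) S).2 !scalerA mulrC.
have [s [e [c [hc hn]]]] := bc_zero hS h'.
transitivity (\sum_j (e j : S) *: bc_in S (\sum_i c i j *: n i)); last first.
  rewrite big1 // => j _; have -> : \sum_i c i j *: n i = 0.
    apply: hA; rewrite scaler_sumr -[RHS](hn j); apply: eq_bigr => i _.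
    by rewrite !scalerA mulrC.
  have -> : bc_in S (0 : amod A) = 0.
    by rewrite -[0 : amod A](scale0r (0 : amod A)) (bc_inP _ S).2 rmorph0 scale0r.
  by rewrite scaler0.
have bs (F : 'I_r -> amod A) : bc_in S (\sum_i F i) = \sum_i bc_in S (F i).
  apply: big_morph => [x y|]; first exact: (bc_inP _ S).1.
  by rewrite -[0 : amod A](scale0r (0 : amod A)) (bc_inP _ S).2 rmorph0 scale0r.
under [RHS]eq_bigr do rewrite bs scaler_sumr.
rewrite exchange_big; apply: eq_bigr => i _ /=; rewrite hc scaler_suml.
by apply: eq_bigr => j _; rewrite (bc_inP _ S).2 scalerA mulrC.
Qed.

(** Flatness is the equational criterion. For faithfulness, the vanishing of the image of [x] writes
    1 as a combination of the [e j] with coefficients [c j] that kill [x]: either some [c j] is a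
    unit and [x = 0], or all are divisible by [p], and so is 1 in [A]. *)
Lemma tf_faithfully_flat (A : kalg k) : tf p (amod A) ->
  (~ exists x, 1 = kstr A p * x) -> faithfully_flat A.
Proof.
move=> hA h1; split=> [M N u lu iu z t|M hM x].
  move=> e; apply/eqP; rewrite -subr_eq0; apply/eqP.
  have : bcmap u (z - t) = 0 by rewrite (linearB' _ _ (bcmap_linear lu)) e subrr.
  move: (z - t) => w; have [r [a [n ->]]] := bcE w.
  rewrite (linear_sum' _ _ _ (bcmap_linear lu)) => h.
  have h' : \sum_i a i *: bc_in A (u (n i)) = 0.
    rewrite -[RHS]h; apply: eq_bigr => i _.
    by rewrite (linearZ' _ _ (bcmap_linear lu)) bcmap_in.
  have [s [e' [c [hc hn]]]] := bc_zero hA h'.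
  under eq_bigr => i _ do rewrite hc scaler_suml.
  rewrite exchange_big big1 // => j _ /=.
  transitivity ((e' j : A) *: bc_in A (\sum_i c i j *: n i)).
    have bs (F : 'I_r -> M) : bc_in A (\sum_i F i) = \sum_i bc_in A (F i).
      apply: big_morph => [v v'|]; first exact: (bc_inP _ A).1.
      by rewrite -[0 : M](scale0r (0 : M)) (bc_inP _ A).2 rmorph0 scale0r.
    rewrite bs scaler_sumr; apply: eq_bigr => i _.
    by rewrite (bc_inP _ A).2 scalerA mulrC.
  have -> : \sum_i c i j *: n i = 0.
    apply: iu; rewrite (linear0' lu) -[RHS](hn j) (linear_sum' _ _ _ lu).
    by apply: eq_bigr => i _; rewrite (linearZ' _ _ lu).
  have -> : bc_in A (0 : M) = 0.
    by rewrite -[0 : M](scale0r (0 : M)) (bc_inP _ A).2 rmorph0 scale0r.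
  by rewrite scaler0.
have /(bc_in_zero hA)[s [e [c [e1 hc]]]] := hM (bc_in A x).
have [[j [v hv]]|hu] := EM (exists j, is_unit (c j)).
  by rewrite -[x]scale1r -hv mulrC -scalerA hc scaler0.
have /choice[d hd] : forall j, exists y, c j = p * y.
  by move=> j; case: (dvr_local hk (c j)) => // ?; case: hu; exists j.
case: h1; exists (\sum_j d j *: e j : amod A); rewrite [LHS]e1.
rewrite -[RHS]/(p *: (\sum_j d j *: e j : amod A)) scaler_sumr.
by apply: eq_bigr => j _; rewrite hd scalerA.
Qed.
End Flatness.

(** * Coordinates in a basis, and their base change *)

Definition isbasis (k : comPzRingType) (M : lmodType k) n (e : 'I_n -> M) : Prop :=
  indep e /\ forall x, inspan e x.

Section Coordinates.
Variables (k : comPzRingType) (M : lmodType k) (n : nat) (e : 'I_n -> M) (he : isbasis e).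

Definition crd (x : M) : 'rV[k]_n := \row_i (sval (cid (he.2 x)) i).
Lemma crdE x : x = \sum_i crd x 0 i *: e i.
Proof. by rewrite {1}(svalP (cid (he.2 x))); apply: eq_bigr => i _; rewrite mxE. Qed.
Lemma crd_sum (a : 'I_n -> k) : crd (\sum_i a i *: e i) = \row_i a i.
Proof.
apply/rowP => i; rewrite mxE; move: i; apply: (indep_inj he.1).
by rewrite -crdE.
Qed.
Lemma crd_linear : linear crd.
Proof.
move=> a x y; rewrite {1}[x]crdE {1}[y]crdE scaler_sumr -big_split /=.
under eq_bigr do rewrite scalerA -scalerDl.
by rewrite (crd_sum (fun i => a * crd x 0 i + crd y 0 i)); apply/rowP => i; rewrite !mxE.
Qed.
Lemma crd_e i : crd (e i) = delta_mx 0 i.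
Proof.
have -> : e i = \sum_j (j == i)%:R *: e j.
  by rewrite (bigD1 i) //= eqxx scale1r big1 ?addr0 // => j /negPf ->; rewrite scale0r.
by rewrite crd_sum; apply/rowP => j; rewrite !mxE eqxx.
Qed.

Section BC.
Variable S : kalg k.
Definition bcr_f (x : M) : 'rV[S]_n := map_mx (kstr S) (crd x).
Lemma bcr_semilin : semilin (R := S) (bcr_f : M -> ('rV[S]_n : lmodType S)).
Proof.
split=> [x y|a x]; rewrite /bcr_f.
  by rewrite (linearD' _ _ crd_linear); apply/rowP => i; rewrite !mxE rmorphD.
by rewrite (linearZ' _ _ crd_linear); apply/rowP => i; rewrite !mxE rmorphM.
Qed.
Definition bcr (z : bc M S) : 'rV[S]_n := uext (bcr_f : M -> ('rV[S]_n : lmodType S)) z.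
Lemma bcr_linear : linear bcr. Proof. exact: (uext_linear bcr_semilin). Qed.
Lemma bcr_in x : bcr (bc_in S x) = map_mx (kstr S) (crd x).
Proof. exact: (uext_gen _ bcr_semilin). Qed.
Lemma bcr_in_e i : bcr (bc_in S (e i)) = delta_mx 0 i.
Proof. by rewrite bcr_in crd_e map_delta_mx. Qed.
Definition bcv (v : 'rV[S]_n) : bc M S := \sum_i v 0 i *: bc_in S (e i).
Lemma bcv_linear : linear bcv.
Proof.
move=> a x y; rewrite /bcv scaler_sumr -big_split; apply: eq_bigr => i _ /=.
by rewrite !mxE scalerDl scalerA.
Qed.
Lemma bcvK : cancel bcv bcr.
Proof.
move=> v; rewrite /bcv (linear_sum' _ _ _ bcr_linear) [RHS]row_sum_delta.
by apply: eq_bigr => i _; rewrite (linearZ' _ _ bcr_linear) bcr_in_e.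
Qed.
Lemma bcrK : cancel bcr bcv.
Proof.
apply: (linear_bc_eq (f := bcv \o bcr) (g := id)) => [a x y||x] //=.
  by rewrite bcr_linear bcv_linear.
rewrite bcr_in /bcv [x in RHS]crdE.
have -> : bc_in S (\sum_i crd x 0 i *: e i) = \sum_i bc_in S (crd x 0 i *: e i).
  apply: big_morph => [u v|]; first exact: (bc_inP _ S).1.
  by rewrite -[0 : M](scale0r (0 : M)) (bc_inP _ S).2 rmorph0 scale0r.
by apply: eq_bigr => i _; rewrite (bc_inP _ S).2 mxE.
Qed.
Lemma bcr_inj : injective bcr. Proof. exact: can_inj bcrK. Qed.
End BC.
Arguments bcr_linear S : clear implicits.
Arguments bcv_linear S : clear implicits.

Lemma bcr_push (S S' : kalg k) (f : khom S S') z : bcr (bcpush f z) = map_mx f (@bcr S z).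
Proof.
elim/bc_ind: z => [a x z IH|]; last first.
  by rewrite bcpush0 !(linear0' (bcr_linear _)) map_mx0.
rewrite bcpush_linear !bcr_linear IH map_mxD map_mxZ bcpush_in !bcr_in -map_mx_comp.
by congr (_ *: _ + _); apply: eq_map_mx => b; apply/esym/khomP.
Qed.
End Coordinates.
Arguments crd_linear {k M n e} he : rename.
Arguments bcr_linear {k M n e} he S : rename.
Arguments bcv_linear {k M n e} S : rename.

(** * Polynomial rings and noetherian rings *)

Section NonzeroMonoidAlgebra.
Variables (k : comNzRingType) (M : nmodType).
Lemma malg_nz : (1 : malg k M) != 0.
Proof.
apply/eqP => h; have /eqP := congr1 (mcoef 0) h.
by rewrite -me0 mcoef_e eqxx mcoef0 oner_eq0.
Qed.
HB.instance Definition _ := GRing.PzSemiRing_isNonZero.Build (malg k M) malg_nz.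
End NonzeroMonoidAlgebra.

Notation mon n := {ffun 'I_n -> nat}.
Notation mpol k n := (malg k (mon n)).

Section Polynomials.
Variables (k : comPzRingType) (n : nat).
Definition mvar (i : 'I_n) : mon n := [ffun j => (j == i : nat)].
Definition mX (i : 'I_n) : mpol k n := me (mvar i).

Lemma mon_sum (m : mon n) : m = \sum_i mvar i *+ m i.
Proof.
apply/ffunP => j; rewrite sum_ffunE (bigD1 j) //= ffunMnE ffunE eqxx.
rewrite big1 ?addr0; first by rewrite -[RHS]/(1%N *+ m j) -mulr_natr mul1r natn.
by move=> i /negPf ij; rewrite ffunMnE ffunE eq_sym ij mul0rn.
Qed.
Lemma me_prod (m : mon n) : me m = \prod_i mX i ^+ m i :> mpol k n.
Proof.
have hM : {morph (me : mon n -> mpol k n) : x y / x + y >-> x * y}.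
  by move=> x y; rewrite meM.
rewrite [m in LHS]mon_sum (big_morph _ hM (me0 _ _)).
by apply: eq_bigr => i _; rewrite -meX.
Qed.

Section Evaluation.
Variables (B : comPzRingType) (phi : {rmorphism k -> B}) (b : 'I_n -> B).
Definition monval (m : mon n) : B := \prod_i b i ^+ m i.
Lemma monval0 : monval 0 = 1.
Proof. by rewrite /monval big1 // => i _; rewrite ffunE. Qed.
Lemma monvalD x y : monval (x + y) = monval x * monval y.
Proof. by rewrite -big_split; apply: eq_bigr => i _; rewrite ffunE exprD. Qed.
Fact pev_key : unit. Proof. by []. Qed.
Definition pev : {rmorphism mpol k n -> B} :=
  locked_with pev_key (mhom phi monval0 monvalD).
Lemma pev_e m : pev (me m) = monval m.
Proof. by rewrite /pev [locked_with _ _]unlock; apply: mhom_e. Qed.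
Lemma pevZ c q : pev (c *: q) = phi c * pev q.
Proof. by rewrite /pev [locked_with _ _]unlock; apply: mhomZ. Qed.
Lemma pevC c : pev (mconst _ c) = phi c.
Proof. by rewrite /pev [locked_with _ _]unlock; apply: mhomC. Qed.
Lemma pevX i : pev (mX i) = b i.
Proof.
rewrite pev_e /monval (bigD1 i) //= ffunE eqxx big1 ?mulr1 // => j /negPf ij.
by rewrite ffunE ij.
Qed.
End Evaluation.

Lemma mpol_ind (K : mpol k n -> Prop) :
  (forall c, K (mconst _ c)) -> (forall i, K (mX i)) ->
  (forall x y, K x -> K y -> K (x + y)) -> (forall x y, K x -> K y -> K (x * y)) ->
  forall q, K q.
Proof.
move=> hC hX hD hM; have h1 : K 1 by have := hC 1; rewrite rmorph1.
elim/malg_ind => [c m z Kz|]; last by have := hC 0; rewrite rmorph0.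
apply: hD => //; rewrite -mconstM; apply: (hM _ _) => //; rewrite me_prod.
apply: (big_ind K); [exact: h1|exact: hM|move=> i _]; elim: (m i) => [|r IH]; rewrite ?expr0 // exprS.
exact: hM.
Qed.

Lemma mpol_rmorph_eq (B : comPzRingType) (f g : {rmorphism mpol k n -> B}) :
  (forall c, f (mconst _ c) = g (mconst _ c)) -> (forall i, f (mX i) = g (mX i)) ->
  f =1 g.
Proof.
move=> hC hX; elim/mpol_ind => // x y hx hy; rewrite ?rmorphD ?rmorphM ?hx ?hy //.
Qed.

Definition mpol_of (s : seq (k * mon n)) : mpol k n := \sum_(c <- s) c.1 *: me c.2.
Lemma pev_peval (A : kalg k) (a : 'I_n -> A) s : pev (kstr A) a (mpol_of s) = peval s a.
Proof. by rewrite rmorph_sum; apply: eq_bigr => c _; rewrite pevZ pev_e. Qed.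
Lemma mpol_ofP q : exists s, q = mpol_of s.
Proof.
have [s [_ qE]] := malg_supp q; exists [seq (mcoef m q, m) | m <- s].
by rewrite {1}qE /mpol_of big_map.
Qed.
End Polynomials.

(** Generation is expressed by all ideals containing [s], so that a membership proof only has to
    exhibit a suitable ideal; [idgen_span] recovers explicit coefficients. *)
Definition idgen (A : comPzRingType) (s : seq A) (x : A) : Prop :=
  forall J : ideal A, (forall y, y \in s -> J y) -> J x.
Definition noeth (A : comPzRingType) : Prop := forall I : ideal A,
  exists s : seq A, (forall y, y \in s -> I y) /\ forall x, I x -> idgen s x.

Section Ideals.
Variables (A : comPzRingType).
Definition mk_ideal (I : A -> Prop) (h0 : I 0) (hD : forall x y, I x -> I y -> I (x + y))
  (hM : forall a x, I x -> I (a * x)) : ideal A.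
by refine (@SubMod A (A^o) I h0 _) => a x y hx hy; apply: hD => //; apply: hM.
Defined.
Definition spani n (g : 'I_n -> A) : ideal A :=
  @SubMod A (A^o) (@inspan A (A^o) n g) (@inspan0 A (A^o) n g) (@inspanL A (A^o) n g).
Lemma idgen_span (s : seq A) x : idgen s x ->
  spani (fun i : 'I_(size s) => tnth (in_tuple s) i) x.
Proof.
by apply => y /(tnthP (in_tuple s))[i ->]; apply: (@inspan_mem A (A^o)).
Qed.
Lemma noeth_span (I : ideal A) : noeth A ->
  exists n (g : 'I_n -> A), (forall i, I (g i)) /\ forall x, I x -> spani g x.
Proof.
move=> /(_ I)[s [h1 h2]]; exists (size s), (fun i => tnth (in_tuple s) i).
by split=> [i|x /h2]; [apply/h1/mem_tnth|apply: idgen_span].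
Qed.
Lemma spani_sub n (g : 'I_n -> A) (I : ideal A) x :
  (forall i, I (g i)) -> spani g x -> I x.
Proof. by move=> h [a ->]; apply: submod_sum => i _; apply: idmMl. Qed.

Definition isq_mem (I : ideal A) (x : A) : Prop := exists s : seq (A * A),
  (forall t, t \in s -> I t.1 /\ I t.2) /\ x = \sum_(t <- s) t.1 * t.2.
Definition isq (I : ideal A) : ideal A.
refine (@mk_ideal (isq_mem I) _ _ _).
- by exists [::]; rewrite big_nil.
- move=> x y [s [hs ->]] [t [ht ->]]; exists (s ++ t); rewrite big_cat; split=> // u.
  by rewrite mem_cat => /orP[/hs|/ht].
- move=> a x [s [hs ->]]; exists [seq (a * t.1, t.2) | t <- s]; split.
    by move=> t /mapP[u /hs[h1 h2] ->]; split=> //; apply: idmMl.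
  by rewrite big_map mulr_sumr; apply: eq_bigr => t _; rewrite mulrA.
Defined.
Lemma isqM (I : ideal A) x y : I x -> I y -> isq I (x * y).
Proof.
move=> hx hy; exists [:: (x, y)]; rewrite big_seq1; split=> // t.
by rewrite inE => /eqP ->.
Qed.
Lemma isq_le (I : ideal A) x : isq I x -> I x.
Proof.
move=> [s [hs ->]]; rewrite big_seq; apply: submod_sum => t /hs[h1 _].
exact: idmMr.
Qed.
Lemma isq_min (I J : ideal A) x :
  (forall y z, I y -> I z -> J (y * z)) -> isq I x -> J x.
Proof.
move=> h [s [hs ->]]; rewrite big_seq; apply: submod_sum => t /hs[h1 h2].
exact: h.
Qed.
End Ideals.

Lemma noeth_surj (A B : comPzRingType) (f : {rmorphism A -> B}) :
  noeth A -> (forall y, exists x, f x = y) -> noeth B.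
Proof.
move=> hA hf I.
unshelve epose (I' := @mk_ideal A (fun x => I (f x)) _ _ _); cbv beta.
  - by rewrite rmorph0; apply: smod0.
  - by move=> x y hx hy; rewrite rmorphD; apply: submodD.
  - by move=> a x hx; rewrite rmorphM; apply: idmMl.
have [s [h1 h2]] := hA I'; exists (map f s); split=> [_ /mapP[x /h1 hx ->] //|y Iy].
have [x xy] := hf y; rewrite -xy in Iy *; move=> J hJ.
unshelve epose (J' := @mk_ideal A (fun x => J (f x)) _ _ _); cbv beta.
  - by rewrite rmorph0; apply: smod0.
  - by move=> u v hu hv; rewrite rmorphD; apply: submodD.
  - by move=> a u hu; rewrite rmorphM; apply: idmMl.
by apply: (h2 x Iy J') => z zs; apply: hJ; apply: map_f.
Qed.

Lemma dvr_noeth (k : comNzRingType) (p : k) : is_dvr p -> noeth k.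
Proof.
move=> hk I.
have [|r [e [h1 h2]]] := @submod_fg k p hk (k^o) 1 (fun=> 1 : k) I.
  by move=> x _; exists (fun=> x); rewrite big_ord1 [RHS]mulr1.
exists (codom e); split=> [y /codomP[j ->] //|x /h2[a ->] J hJ].
by apply: submod_sum => i _; apply: idmMl; apply/hJ/codom_f.
Qed.

(** * Hilbert's basis theorem *)

Section Hilbert.
Variables (A : comNzRingType) (hA : noeth A).
Implicit Types (I J : ideal {poly A}).

Definition lead_id I (n : nat) : ideal A.
refine (@mk_ideal A (fun a => exists q : {poly A}, [/\ I q, (size q <= n.+1)%N & q`_n = a])
  _ _ _).
- by exists 0; rewrite size_poly0 coef0; split=> //; apply: smod0.
- move=> _ _ [q [Iq sq <-]] [r [Ir sr <-]]; exists (q + r); split; last by rewrite coefD.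
    exact: submodD.
  by apply: (leq_trans (size_polyD _ _)); rewrite geq_max sq.
- move=> a _ [q [Iq sq <-]]; exists (a%:P * q); split; last by rewrite coefCM.
    exact: idmMl.
  by rewrite mul_polyC; apply: leq_trans (size_scale_leq _ _) sq.
Defined.
Lemma lead_idS I (n d : nat) a : lead_id I n a -> lead_id I (d + n) a.
Proof.
move=> [q [Iq sq <-]]; exists ('X^d * q); split; first exact: idmMl.
  have [->|q0] := eqVneq q 0; first by rewrite mulr0 size_poly0.
  apply: (leq_trans (size_polyMleq _ _)).
  by rewrite size_polyXn /= -addnS leq_add2l.
by rewrite coefXnM ltnNge leq_addr /= addKn.
Qed.

Definition ideal_cap I J : ideal {poly A}.
refine (@mk_ideal _ (fun x => I x /\ J x) _ _ _).
- by split; apply: smod0.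
- by move=> x y [? ?] [? ?]; split; apply: submodD.
- by move=> a x [? ?]; split; apply: idmMl.
Defined.

(** The ideals [lead_id I n] increase with [n] and their union is finitely generated, hence attained
    at some [d]. Polynomials realizing generators of [lead_id I n] for [n <= d] generate [I]: any
    [q] in [I] has the leading term of a combination of them, and the difference has smaller
    size. *)
Lemma hilbert : noeth {poly A}.
Proof.
move=> I.
unshelve epose (L := @mk_ideal A (fun a => exists n, lead_id I n a) _ _ _); cbv beta.
  - by exists 0%N; apply: smod0.
  - move=> x y [n hx] [m hy]; exists (n + m)%N; apply: submodD; last exact: lead_idS.
    by rewrite addnC; apply: lead_idS.
  - by move=> a x [n hx]; exists n; apply: idmMl.
have [t [tL tg]] := hA L.
have [d hd] : exists d, forall y, y \in t -> lead_id I d y.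
  elim: t tL {tg} => [|y t IH] tL; first by exists 0%N.
  have [|d hd] := IH; first by move=> z zt; apply: tL; rewrite inE zt orbT.
  have [n hn] := tL y (mem_head _ _); exists (d + n)%N => z; rewrite inE.
  by move=> /orP[/eqP ->|/hd]; [|rewrite addnC]; apply: lead_idS.
have /choice[T hT] : forall n, exists s : seq A,
    (forall y, y \in s -> lead_id I n y) /\ forall x, lead_id I n x -> idgen s x.
  by move=> n; apply: hA.
have /choice[S hS] : forall n, exists s : seq {poly A},
    (forall q, q \in s -> I q) /\ forall y, y \in T n -> exists q,
    [/\ q \in s, (size q <= n.+1)%N & q`_n = y].
  move=> n; have [h1 _] := hT n; elim: (T n) h1 => [|y s IH] h1.
    by exists [::].
  have [|u [hu1 hu2]] := IH; first by move=> z zs; apply: h1; rewrite inE zs orbT.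
  have [q [Iq sq qy]] := h1 y (mem_head _ _).
  exists (q :: u); split=> [r|z]; rewrite inE => /orP[/eqP ->|h] //; first exact: hu1.
    by exists q; rewrite mem_head.
  by have [r [ru sr rz]] := hu2 z h; exists r; rewrite inE ru orbT.
exists (flatten [seq S n | n <- iota 0 d.+1]); split=> [q /flatten_mapP[n _]|q Iq J hJ].
  by have [h _] := hS n; apply: h.
have hL n a : (n <= d)%N -> lead_id I n a -> lead_id (ideal_cap I J) n a.
  move=> nd /(hT n).2; apply=> y /(hS n).2[r [rs sr ry]].
  exists r; split=> //; split; first exact: (hS n).1.
  by apply: hJ; apply/flatten_mapP; exists n; rewrite // mem_iota.
have [m] := ubnP (size q); elim: m q Iq => // m IH q Iq; rewrite ltnS => sq.
have [->|q0] := eqVneq q 0; first exact: smod0.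
have sz : size q = (size q).-1.+1 by rewrite prednK // size_poly_gt0.
have [r [[Ir Jr] sr rq]] : lead_id (ideal_cap I J) (size q).-1 (lead_coef q).
  have hq : lead_id I (size q).-1 (lead_coef q) by exists q; rewrite -sz.
  case: (leqP (size q).-1 d) => [h|/ltnW h]; first exact: hL.
  rewrite -(subnK h); apply: lead_idS.
  have /tg : L (lead_coef q) by exists (size q).-1.
  by apply=> y /hd; apply: hL.
rewrite -(subrK r q); apply: submodD => //; apply: IH; first exact: submodB.
apply: leq_trans sq; rewrite sz ltnS; apply/leq_sizeP => j; rewrite leq_eqVlt.
move=> /orP[/eqP <-|hj]; first by rewrite coefB rq subrr.
rewrite coefB !nth_default ?subrr //; first by apply: leq_trans sr _.
by rewrite sz.
Qed.
End Hilbert.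

Fixpoint ipoly (k : comNzRingType) n : comNzRingType :=
  if n is n'.+1 then {poly (ipoly k n')} else k.

Lemma ipoly_noeth (k : comNzRingType) n : noeth k -> noeth (ipoly k n).
Proof. by move=> hk; elim: n => //= n IH; apply: hilbert. Qed.

Lemma ipoly_gen (k B : comNzRingType) (phi : {rmorphism k -> B}) n (b : 'I_n -> B) :
  exists f : {rmorphism ipoly k n -> B},
    (forall c, exists x, f x = phi c) /\ forall i, exists x, f x = b i.
Proof.
elim: n b => [|n IH] b.
  by exists phi; split=> [c|[]//]; exists c.
have [f [h1 h2]] := IH (fun i => b (lift ord0 i)).
have cf : commr_rmorph f (b ord0) by move=> x; apply: mulrC.
exists (horner_morph cf); split=> [c|i].
  by have [x <-] := h1 c; exists x%:P; apply: horner_morphC.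
case: (unliftP ord0 i) => [j|] ->; last by exists 'X; apply: horner_morphX.
by have [x <-] := h2 j; exists x%:P; apply: horner_morphC.
Qed.

(** A surjection from the iterated polynomial ring is enough to transport the property, so no
    isomorphism between the two polynomial rings is needed. *)
Lemma mpol_noeth (k : comNzRingType) n : noeth k -> noeth (mpol k n).
Proof.
move=> hk; have [f [h1 h2]] := ipoly_gen (mconst (mon n) : {rmorphism k -> mpol k n}) (@mX k n).
apply: (noeth_surj (f := f)); first exact: ipoly_noeth.
elim/mpol_ind => // x y [x' <-] [y' <-].
  by exists (x' + y'); rewrite rmorphD.
by exists (x' * y'); rewrite rmorphM.
Qed.

(** * A weak Artin-Rees lemma *)

Section ArtinRees.
Variables (P : comNzRingType) (hP : noeth P) (p : P) (hp : forall x, p * x = 0 -> x = 0).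
Variables (m : nat) (g : 'I_m -> P).

(** The image is the Rees algebra of the ideal generated by [g]; accordingly [ipow n], read off at
    the monomial of degree [n], is the [n]-th power of this ideal. *)
Definition rees : {rmorphism mpol P m -> {poly P}} :=
  pev (polyC : {rmorphism P -> {poly P}}) (fun i => (g i)%:P * 'X).

Definition ipow (n : nat) : ideal P.
refine (@mk_ideal P (fun x : P => exists F, rees F = x%:P * 'X^n) _ _ _).
- by exists 0; rewrite rmorph0 mul0r.
- by move=> x y [F hF] [F' hF']; exists (F + F'); rewrite rmorphD hF hF' polyCD mulrDl.
- by move=> a x [F hF]; exists (mconst _ a * F); rewrite rmorphM pevC hF polyCM mulrA.
Defined.
Lemma ipow1 i : ipow 1 (g i). Proof. by exists (mX _ i); rewrite pevX expr1. Qed.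
Lemma ipowM n n' x y : ipow n x -> ipow n' y -> ipow (n + n') (x * y).
Proof.
by move=> [F hF] [F' hF']; exists (F * F'); rewrite rmorphM hF hF' polyCM exprD mulrACA.
Qed.
Lemma rees_coef F n : spani g (rees F)`_n.+1.
Proof.
move: n; elim/mpol_ind: F => [c|i|x y hx hy|x y hx hy] n.
- by rewrite pevC coefC; apply: smod0.
- rewrite pevX coefMX coefC; case: (n == 0%N); last exact: smod0.
  exact: (@inspan_mem P (P^o)).
- by rewrite rmorphD coefD; apply: submodD.
rewrite rmorphM coefM; apply: (@submod_sum P (P^o)) => -[[|i] hi] _.
  by rewrite subn0; apply: (@idmMl P (spani g) _ _ (hy n)).
exact: (@idmMr P (spani g) _ _ (hx i)).
Qed.

(** Let [I] be the ideal spanned by [g]. The elements of [mpol P m] whose Rees image is divisible by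
    [p] form a finitely generated ideal; take [c] beyond the degrees of the images of its
    generators. In any combination of them, a coefficient of index at least [c] lies in [p I]:
    generators have no coefficient of such an index, and multiplying one of smaller index brings in
    a factor of positive degree, which lies in [I]. Finally [p] can be cancelled. *)
Lemma artin_rees : exists c, forall n x, (c <= n)%N -> ipow n (p * x) -> spani g x.
Proof.
pose pI x := exists2 y, spani g y & x = p * y.
have pI0 : pI 0 by exists 0; [apply: smod0|rewrite mulr0].
have pID x y : pI x -> pI y -> pI (x + y).
  by move=> [x' hx ->] [y' hy ->]; exists (x' + y'); [apply: submodD|rewrite mulrDr].
have pIM a x : pI x -> pI (a * x).
  by move=> [x' hx ->]; exists (a * x'); [apply: idmMl|rewrite mulrCA].
have pIs n (F : 'I_n -> P) : (forall i, pI (F i)) -> pI (\sum_i F i).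
  by move=> h; apply: (big_ind pI).
have divs n (F : 'I_n -> P) : (forall i, exists y, F i = p * y) ->
    exists y, \sum_i F i = p * y.
  move=> h; elim/big_ind: _ => // [|x y [x' ->] [y' ->]]; first by exists 0; rewrite mulr0.
  by exists (x' + y'); rewrite mulrDr.
have hJ c : exists J : ideal (mpol P m), forall F, J F <->
    (forall n, exists y, (rees F)`_n = p * y) /\ forall n, (c <= n)%N -> pI (rees F)`_n.
  unshelve eexists (@mk_ideal _ (fun F => (forall n, exists y, (rees F)`_n = p * y) /\
    forall n, (c <= n)%N -> pI (rees F)`_n) _ _ _); last by []; cbv beta.
  - rewrite rmorph0; split=> n; first by exists 0; rewrite coef0 mulr0.
    by rewrite coef0.
  - move=> F F' [h1 h2] [h1' h2']; rewrite rmorphD; split=> n; rewrite coefD.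
      have [y ->] := h1 n; have [y' ->] := h1' n.
      by exists (y + y'); rewrite mulrDr.
    by move=> cn; apply: pID; [apply: h2|apply: h2'].
  - move=> G F [h1 h2]; rewrite rmorphM; split=> n; rewrite coefM.
      apply: divs => i; have [y ->] := h1 (n - i)%N.
      by exists ((rees G)`_i * y); rewrite mulrCA.
    move=> cn; apply: pIs => -[[|i] hi] /=; first by apply/pIM/h2; rewrite subn0.
    have [y ->] := h1 (n - i.+1)%N; exists ((rees G)`_i.+1 * y); last by rewrite mulrCA.
    by apply: idmMr; apply: rees_coef.
unshelve epose (J0 := @mk_ideal _ (fun F => forall n, exists y, (rees F)`_n = p * y) _ _ _); cbv beta.
  - by move=> n; rewrite rmorph0 coef0; exists 0; rewrite mulr0.
  - move=> F F' h h' n; have [y e] := h n; have [y' e'] := h' n.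
    by exists (y + y'); rewrite rmorphD coefD e e' mulrDr.
  - move=> G F h n; rewrite rmorphM coefM; apply: divs => i.
    by have [y ->] := h (n - i)%N; exists ((rees G)`_i * y); rewrite mulrCA.
have [s [sJ sg]] := @mpol_noeth P m hP J0.
pose c := (\max_(F <- s) size (rees F))%N.
exists c => n x cn [F hF].
have [J JE] := hJ c.
have /JE[_ /(_ n cn)] : J F.
  apply: (sg F).
    move=> i; rewrite hF coefMXn coefC; case: ifP => _; first by exists 0; rewrite mulr0.
    by case: ifP => _; [exists x|exists 0; rewrite mulr0].
  move=> G Gs; apply/JE; split=> [|i ci]; first exact: sJ.
  rewrite nth_default //; apply: leq_trans ci.
  exact: (@leq_bigmax_seq _ s predT (fun F => size (rees F)) G).
rewrite hF coefMXn ltnn subnn coefC eqxx => -[y hy /eqP].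
by rewrite -subr_eq0 -mulrBr => /eqP/hp/eqP; rewrite subr_eq0 => /eqP ->.
Qed.
End ArtinRees.

(** * Smooth algebras and etale slices *)

Section Presentations.
Variables (k : comNzRingType).

Definition qalg n (I : ideal (mpol k n)) : kalg k := @KAlg k (rquot I) (rpi I \o mconst (mon n)).
Definition qpi n (I : ideal (mpol k n)) : {rmorphism mpol k n -> qalg I} := rpi I.

(** The mapping property asks only for existence; uniqueness is automatic because the [a i] generate
    [A]. *)
Definition presents (A : kalg k) n (a : 'I_n -> A) m (g : 'I_m -> mpol k n) : Prop :=
  [/\ forall x, exists q, pev (kstr A) a q = x,
      forall q, pev (kstr A) a q = 0 <-> spani g q &
      forall (B : kalg k) (b : 'I_n -> B), (forall j, pev (kstr B) b (g j) = 0) ->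
        exists f : khom A B, forall i, f (a i) = b i].

Lemma pev_khom (A B : kalg k) n (a : 'I_n -> A) (f : khom A B) q :
  f (pev (kstr A) a q) = pev (kstr B) (fun i => f (a i)) q.
Proof.
apply: (mpol_rmorph_eq (f := f \o pev (kstr A) a) (g := pev (kstr B) (fun i => f (a i)))).
  by move=> c; rewrite /= !pevC khomP.
by move=> i; rewrite /= !pevX.
Qed.

Lemma pev_ext (A : kalg k) n (a b : 'I_n -> A) q : a =1 b ->
  pev (kstr A) a q = pev (kstr A) b q.
Proof.
move=> ab; apply: mpol_rmorph_eq => [c|i]; first by rewrite !pevC.
by rewrite !pevX.
Qed.

Lemma pev_qpi n (I : ideal (mpol k n)) m (y : 'I_m -> mpol k n) q :
  pev (kstr (qalg I)) (fun i => qpi I (y i)) q = qpi I (pev (mconst (mon n)) y q).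
Proof.
apply: (mpol_rmorph_eq (f := pev (kstr (qalg I)) (fun i => qpi I (y i)))
  (g := qpi I \o pev (mconst (mon n)) y)) => [c|i]; first by rewrite /= !pevC.
by rewrite /= !pevX.
Qed.
Lemma pev_id n q : pev (mconst (mon n)) (@mX k n) q = q.
Proof.
apply: (mpol_rmorph_eq (f := pev (mconst (mon n)) (@mX k n)) (g := idfun)) => [c|i].
  by rewrite pevC.
by rewrite pevX.
Qed.
Lemma pev_qpiX n (I : ideal (mpol k n)) q :
  pev (kstr (qalg I)) (fun i => qpi I (mX k i)) q = qpi I q.
Proof. by rewrite pev_qpi pev_id. Qed.

Lemma spani_eq0 (A : kalg k) n (a : 'I_n -> A) m (g : 'I_m -> mpol k n) q :
  (forall j, pev (kstr A) a (g j) = 0) -> spani g q -> pev (kstr A) a q = 0.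
Proof.
move=> h [c ->]; rewrite rmorph_sum big1 // => j _.
by transitivity (pev (kstr A) a (c j * g j)); rewrite // rmorphM h mulr0.
Qed.

(** The universal property gives a map from [A] to the quotient by the relations, and evaluation at
    [a] gives one back. The composite on [A] fixes the generators, hence is the identity; both the
    surjectivity of evaluation and its kernel follow. *)
Lemma fp_presents (A : kalg k) : finitely_presented A ->
  exists n (a : 'I_n -> A) m (g : 'I_m -> mpol k n), presents a g.
Proof.
move=> [n [rels [a [ha hu]]]]; exists n, a, (size rels).
pose g (j : 'I_(size rels)) := mpol_of (tnth (in_tuple rels) j); exists g.
have rg (B : kalg k) (b : 'I_n -> B) : (forall j, pev (kstr B) b (g j) = 0) ->
    forall q, q \in rels -> peval q b = 0.
  by move=> h q /(tnthP (in_tuple rels))[j ->]; rewrite -pev_peval; apply: (h j).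
have ag j : pev (kstr A) a (g j) = 0 by rewrite pev_peval ha // mem_tnth.
have [|f [fa _]] := hu (qalg (spani g)) (fun i => qpi (spani g) (mX k i)).
  by apply: rg => j; rewrite pev_qpiX; apply/rpi_eq0; apply: (@inspan_mem _ (_^o)).
have fE q : f (pev (kstr A) a q) = qpi (spani g) q.
  by rewrite pev_khom (pev_ext _ fa) pev_qpiX.
have [h hE] := @rquot_lift (mpol k n) A (spani g) (pev (kstr A) a)
  (fun q => spani_eq0 ag).
have hk c : h (kstr (qalg (spani g)) c) = kstr A c by rewrite hE pevC.
pose hh := @KHom k (qalg (spani g)) A h hk.
have [f0 [_ fu]] := hu A a ha.
have hf x : h (f x) = x.
  have e1 := fu (khom_comp hh f); rewrite -[LHS]/(khom_comp hh f x) -e1; last first.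
    by move=> i; rewrite /= fa hE pevX.
  by rewrite (fu (khom_id A)).
split=> [x|q|B b hb].
- by have [q qE] := rpi_surj (f x); exists q; rewrite -hE -qE hf.
- split=> [h0|]; last exact: spani_eq0.
  by apply/rpi_eq0; rewrite -[LHS]fE h0 rmorph0.
by have [f' [hf' _]] := hu B b (rg _ _ hb); exists f'.
Qed.

Lemma presents_fp n m (g : 'I_m -> mpol k n) : finitely_presented (qalg (spani g)).
Proof.
pose I := spani g.
have /choice[s hs] : forall j, exists t, g j = mpol_of t by move=> j; apply: mpol_ofP.
exists n, (codom s), (fun i => qpi I (mX k i)); split.
  move=> q /codomP[j ->]; rewrite -pev_peval -hs pev_qpiX.
  by apply/rpi_eq0; apply: (@inspan_mem _ (_^o)).
move=> B b hb; have gb j : pev (kstr B) b (g j) = 0.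
  by rewrite hs pev_peval hb // codom_f.
have [h hE] := @rquot_lift (mpol k n) B I (pev (kstr B) b) (fun q => spani_eq0 gb).
have hk c : h (kstr (qalg I) c) = kstr B c by rewrite hE pevC.
exists (@KHom k (qalg I) B h hk); split=> [i|f' hf' x]; first by rewrite /= hE pevX.
have [q ->] := rpi_surj x; rewrite [LHS]hE -[rpi I q]pev_qpiX pev_khom.
exact/esym/pev_ext.
Qed.

Lemma isq_square_zero n (I : ideal (mpol k n)) :
  exists p : khom (qalg (isq I)) (qalg I), square_zero_ext p /\
    forall q, p (qpi (isq I) q) = qpi I q.
Proof.
have [|h hE] := @rquot_lift _ (qalg I) (isq I) (qpi I).
  by move=> x /isq_le hx; apply/rpi_eq0.
exists (@KHom k (qalg (isq I)) (qalg I) h (fun c => hE _)); split=> //; split.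
  by move=> c; have [q ->] := rpi_surj c; exists (qpi (isq I) q); rewrite /= hE.
move=> x y; have [q ->] := rpi_surj x; have [r ->] := rpi_surj y.
rewrite /= !hE => /rpi_eq0 hq /rpi_eq0 hr; rewrite -rmorphM.
exact/rpi_eq0/isqM.
Qed.

(* Lifting A -> P/J to P/J^2, where P/I = A and J is contained in I. *)
Lemma smooth_lift (A : kalg k) n (a : 'I_n -> A) m (g : 'I_m -> mpol k n)
    (J : ideal (mpol k n)) (y : 'I_n -> mpol k n) :
  presents a g -> formally_smooth A ->
  (forall q, spani g q -> J (pev (mconst (mon n)) y q)) ->
  exists y' : 'I_n -> mpol k n, (forall i, J (y' i - y i)) /\
    forall q, spani g q -> isq J (pev (mconst (mon n)) y' q).
Proof.
move=> [_ hker hu] hs hy; have [p [hp pE]] := isq_square_zero J.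
have [|f fE] := hu (qalg J) (fun i => qpi J (y i)).
  by move=> j; rewrite pev_qpi; apply/rpi_eq0/hy; apply: (@inspan_mem _ (_^o)).
have [h hE] := hs _ _ p hp f.
have /choice[y' hy'] : forall i, exists q, h (a i) = qpi (isq J) q.
  by move=> i; have [q qE] := rpi_surj (h (a i)); exists q.
exists y'; split=> [i|q hq].
  by apply/rpi_eq; rewrite -[LHS]pE -hy' -fE -hE.
apply/rpi_eq0; rewrite -[LHS]pev_qpi -(pev_ext _ hy') -pev_khom.
by rewrite (hker q).2 // rmorph0.
Qed.

End Presentations.

Section Smooth.
Variables (k : comNzRingType) (p : k) (hk : is_dvr p).

(** Let [A = P / I]. Lifting the identity through the quotients by the iterated squares of [I] gives
    substitutions [y j], congruent to the variables modulo [I], which send [I] into its power of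
    exponent [2 ^ j]. If [p q] lies in [I], then for large [j] Artin-Rees puts [q (y j)] in [I], and
    [q] is congruent to it modulo [I]. The index [j = c] suffices as [c < 2 ^ c]. *)
Lemma fsmooth_tf (A : kalg k) : finitely_presented A -> formally_smooth A ->
  tf p (amod A).
Proof.
move=> /fp_presents[n [a [m [g hg]]]] hs x hx; have [hsurj hker _] := hg.
pose I := spani g; pose Q j := iter j (@isq _) I.
have Qpow j q : Q j q -> ipow g (2 ^ j) q.
  elim: j q => [|j IH] q.
    by move=> hq; apply: spani_sub hq => i; apply: ipow1.
  rewrite expnS mul2n -addnn; apply: isq_min => u v /IH hu /IH hv.
  exact: ipowM.
have QI j q : Q j q -> I q by elim: j q => //= j IH q /isq_le/IH.
have /choice[y hy] : forall j, exists y : 'I_n -> mpol k n,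
    (forall i, I (y i - mX k i)) /\ forall q, I q -> Q j (pev (mconst (mon n)) y q).
  elim=> [|j [y [hy1 hy2]]].
    exists (@mX k n); split=> [i|q hq]; first by rewrite subrr; apply: smod0.
    by rewrite pev_id.
  have [y' [h1 h2]] := smooth_lift hg hs hy2; exists y'; split=> // i.
  rewrite -(subrK (y i) (y' i)) -addrA; apply: submodD => //.
  exact: (QI j _ (h1 i)).
have pinj (z : mpol k n) : mconst (mon n) p * z = 0 -> z = 0.
  rewrite mconstM => h; apply: mcoef_inj => r; rewrite mcoef0.
  have := congr1 (mcoef r) h; rewrite mcoefZ mcoef0 => /(dvr_dom hk)[|//].
  by move=> p0; case: (dvr_p0 hk p0).
have [c hc] := artin_rees (mpol_noeth (n := n) (dvr_noeth hk)) pinj g.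
have [q qE] := hsurj x.
have Ipq : I (mconst (mon n) p * q).
  by apply/hker; rewrite rmorphM pevC qE.
have [hy1 hy2] := hy c; have := hy2 _ Ipq; rewrite rmorphM pevC => /Qpow/(hc _ _ (ltnW (ltn_expl c (ltnSn 1)))).
move=> hI; rewrite -qE; apply/hker; rewrite -(subKr (pev (mconst (mon n)) (y c) q) q).
apply: submodB => //; apply/rpi_eq; rewrite -[LHS](pev_qpi _ (y c)) -[RHS](pev_qpiX I).
by apply: (@pev_ext k (qalg I) n) => i; apply/rpi_eq; apply: hy1.
Qed.
End Smooth.

Section Derivation.
Variables (k : comNzRingType) (n : nat).
(** The truncated subtraction is harmless: where [m i = 0], the factor [(m i)%:R] in [pd] is
    zero. *)
Definition dmon (i : 'I_n) (m : mon n) : mon n := [ffun j => (m j - (j == i))%N].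
Definition pd (i : 'I_n) : mpol k n -> mpol k n :=
  mlin (fun m : mon n => (m i)%:R *: me (dmon i m)).
Lemma pd_linear i : linear (pd i). Proof. exact: mlin_linear. Qed.
Lemma pd_e i (m : mon n) : pd i (me m) = (m i)%:R *: me (dmon i m). Proof. exact: mlin_e. Qed.
Lemma pdD i x y : pd i (x + y) = pd i x + pd i y. Proof. exact: (linearD' _ _ (pd_linear i)). Qed.
Lemma pdB i x y : pd i (x - y) = pd i x - pd i y. Proof. exact: (linearB' _ _ (pd_linear i)). Qed.
Lemma pdZ i c x : pd i (c *: x) = c *: pd i x. Proof. exact: (linearZ' _ _ (pd_linear i)). Qed.
Lemma pd0 i : pd i 0 = 0. Proof. exact: (linear0' (pd_linear i)). Qed.
Lemma pdX i j : pd i (mX k j) = (i == j)%:R.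
Proof.
rewrite pd_e ffunE; case: eqP => [->|_]; last by rewrite scale0r.
rewrite scale1r -[RHS]me0; congr me; apply/ffunP => l; rewrite !ffunE.
by rewrite subnn.
Qed.
Lemma pdXX i : pd i (mX k i) = 1. Proof. by rewrite pdX eqxx. Qed.
Lemma pdXn i j : i != j -> pd i (mX k j) = 0. Proof. by rewrite pdX => /negPf ->. Qed.
Lemma pdC i c : pd i (mconst _ c) = 0.
Proof. by rewrite /mconst pdZ pd_e ffunE scale0r scaler0. Qed.
Lemma pdM i x y : pd i (x * y) = pd i x * y + x * pd i y.
Proof.
elim/malg_ind: x => [a m x IH|]; last by rewrite mul0r pd0 !mul0r addr0.
rewrite mulrDl !pdD IH !mulrDl addrACA; congr (_ + _); rewrite malgZl !pdZ !malgZl -scalerDr.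
congr (_ *: _) => {IH}.
elim/malg_ind: y => [b m' y IH|]; last by rewrite !(mulr0, pd0) addr0.
rewrite !mulrDr !pdD IH !mulrDr addrACA; congr (_ + _).
rewrite pdZ !malgZr pdZ -scalerDr; congr (_ *: _) => {IH}.
rewrite meM !pd_e malgZl malgZr !meM ffunE natrD scalerDl.
congr (_ + _).
  case: (posnP (m i)) => [->|mi]; first by rewrite !scale0r.
  congr (_ *: me _); apply/ffunP => j; rewrite !ffunE.
  by case: eqP => [->|_]; rewrite ?subn0 //; apply/esym/addnBAC.
case: (posnP (m' i)) => [->|mi]; first by rewrite !scale0r.
congr (_ *: me _); apply/ffunP => j; rewrite !ffunE.
by case: eqP => [->|_]; rewrite ?subn0 //; apply/esym/addnBA.
Qed.

Lemma taylor (B : comPzRingType) (phi : {rmorphism k -> B}) (x e : 'I_n -> B) q :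
  (forall i j, e i * e j = 0) ->
  pev phi (fun i => x i + e i) q = pev phi x q + \sum_i pev phi x (pd i q) * e i.
Proof.
move=> he; elim/mpol_ind: q => [c|j|y z hy hz|y z hy hz].
- by rewrite !pevC big1 ?addr0 // => i _; rewrite pdC rmorph0 mul0r.
- rewrite !pevX (bigD1 j isT) pdXX rmorph1 mul1r big1 /= ?addr0 // => i ij.
  by rewrite pdXn // rmorph0 mul0r.
- rewrite !rmorphD hy hz addrACA -big_split; congr (_ + _); apply: eq_bigr => i _.
  by rewrite pdD rmorphD mulrDl.
rewrite !rmorphM hy hz mulrDl !mulrDr -addrA; congr (_ + _).
have -> : (\sum_i pev phi x (pd i y) * e i) * (\sum_i pev phi x (pd i z) * e i) = 0.
  rewrite mulr_suml big1 // => i _; rewrite mulr_sumr big1 // => j _.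
  by rewrite mulrACA he mulr0.
rewrite addr0 mulr_sumr mulr_suml -big_split; apply: eq_bigr => i _ /=.
by rewrite pdM rmorphD !rmorphM mulrDl addrC mulrAC -!mulrA.
Qed.
End Derivation.

Lemma pd_pev (k : comNzRingType) n r (x : 'I_n -> mpol k r) (l : 'I_r) q :
  pd l (pev (mconst (mon r)) x q) = \sum_i pev (mconst (mon r)) x (pd i q) * pd l (x i).
Proof.
elim/mpol_ind: q => [c|j|y z hy hz|y z hy hz].
- by rewrite pevC pdC big1 // => i _; rewrite pdC rmorph0 mul0r.
- rewrite pevX (bigD1 j isT) pdXX rmorph1 mul1r big1 /= ?addr0 // => i ij.
  by rewrite pdXn // rmorph0 mul0r.
- rewrite !rmorphD pdD hy hz -big_split; apply: eq_bigr => i _.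
  by rewrite pdD rmorphD mulrDl.
rewrite rmorphM pdM hy hz mulr_sumr mulr_suml -big_split; apply: eq_bigr => i _ /=.
by rewrite pdM rmorphD !rmorphM mulrDl mulrAC -!mulrA.
Qed.

Lemma rmorph_pev (k B C : comPzRingType) (phi : {rmorphism k -> B}) (f : {rmorphism B -> C})
    n (b : 'I_n -> B) q :
  f (pev phi b q) = pev (f \o phi) (fun i => f (b i)) q.
Proof.
apply: (mpol_rmorph_eq (f := f \o pev phi b) (g := pev (f \o phi) (fun i => f (b i)))).
  by move=> c; rewrite /= !pevC.
by move=> i; rewrite /= !pevX.
Qed.

Lemma pev_eq (k B : comPzRingType) (phi psi : {rmorphism k -> B}) n (a b : 'I_n -> B) q :
  phi =1 psi -> a =1 b -> pev phi a q = pev psi b q.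
Proof.
move=> e ab; apply: mpol_rmorph_eq => [c|i]; first by rewrite !pevC.
by rewrite !pevX.
Qed.

Lemma qalg_presents (k : comNzRingType) n m (g : 'I_m -> mpol k n) :
  presents (fun i => qpi (spani g) (mX k i)) g.
Proof.
split=> [x|q|B b hb].
- by have [q ->] := rpi_surj x; exists q; rewrite pev_qpiX.
- by rewrite pev_qpiX; apply: rpi_eq0.
have [h hE] := @rquot_lift (mpol k n) B (spani g) (pev (kstr B) b) (fun q => spani_eq0 hb).
have hk c : h (kstr (qalg (spani g)) c) = kstr B c by rewrite hE pevC.
by exists (@KHom k (qalg (spani g)) B h hk) => i; rewrite /= hE pevX.
Qed.

Lemma presents_ext (k : comNzRingType) (A B : kalg k) n (a : 'I_n -> A) m
    (g : 'I_m -> mpol k n) (f f' : khom A B) :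
  presents a g -> (forall i, f (a i) = f' (a i)) -> f =1 f'.
Proof.
move=> [hs _ _] h x; have [q <-] := hs x; rewrite !pev_khom.
exact: pev_ext.
Qed.

(** * Étale algebras cut out by a Jacobian *)

Section EtaleSlice.
Variables (k : comNzRingType) (p : k) (hk : is_dvr p).
Variables (r : nat) (F : 'I_r -> mpol k r) (h : mpol k r).
Definition jac : 'M[mpol k r]_r := \matrix_(l, i) pd i (F l).
Local Notation H := (h * \det jac).
Variables (s0 : 'I_r -> k).
Hypotheses (hF : forall l, exists y, pev idfun s0 (F l) = p * y)
  (hH : is_unit (pev idfun s0 H)).

Let w (q : mpol k r) : mpol k r.+1 :=
  pev (mconst (mon r.+1)) (fun l => mX k (lift ord0 l)) q.
(** The extra variable [ord0] is an inverse of [H]. The slice is thus the zero locus of [F] with the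
    Jacobian determinant and [h] made invertible. *)
Definition slice_rel (j : 'I_r.+1) : mpol k r.+1 :=
  if unlift ord0 j is Some l then w (F l) else mX k ord0 * w H - 1.
Definition slice : kalg k := qalg (spani slice_rel).
Let a (j : 'I_r.+1) : slice := qpi (spani slice_rel) (mX k j).
Let hA : presents a slice_rel := qalg_presents slice_rel.

Let pev_w (B : kalg k) (b : 'I_r.+1 -> B) q :
  pev (kstr B) b (w q) = pev (kstr B) (fun l => b (lift ord0 l)) q.
Proof.
rewrite rmorph_pev; apply: pev_eq => [c|i] /=; first by rewrite pevC.
by rewrite pevX.
Qed.

Let slice_hom (B : kalg k) (b : 'I_r -> B) (t : B) :
  (forall l, pev (kstr B) b (F l) = 0) -> t * pev (kstr B) b H = 1 ->
  exists f : khom slice B, f (a ord0) = t /\ forall l, f (a (lift ord0 l)) = b l.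
Proof.
move=> hb ht; pose b' j := if unlift ord0 j is Some l then b l else t.
have b'w q : pev (kstr B) b' (w q) = pev (kstr B) b q.
  by rewrite pev_w; apply: pev_eq => // l; rewrite /b' liftK.
have [_ _ hu] := hA; have [|f hf] := hu B b'.
  move=> j; rewrite /slice_rel; case: (unliftP ord0 j) => [l|] _; first by rewrite b'w.
  by rewrite rmorphB rmorphM rmorph1 b'w pevX /b' unlift_none ht subrr.
exists f; split=> [|l]; rewrite hf /b'; first by rewrite unlift_none.
by rewrite liftK.
Qed.

Let slice_pt (B : kalg k) (f : khom slice B) :
  (forall l, pev (kstr B) (fun l => f (a (lift ord0 l))) (F l) = 0) /\
  f (a ord0) * pev (kstr B) (fun l => f (a (lift ord0 l))) H = 1.
Proof.
have [_ hker _] := hA.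
have fr j : pev (kstr B) (fun j => f (a j)) (slice_rel j) = 0.
  by rewrite -pev_khom (hker _).2 ?rmorph0 //; apply: (@inspan_mem _ (_^o)).
split=> [l|]; first by have := fr (lift ord0 l); rewrite /slice_rel liftK pev_w.
have := fr ord0; rewrite /slice_rel unlift_none rmorphB rmorphM rmorph1 pevX pev_w.
by move/eqP; rewrite subr_eq0 => /eqP.
Qed.

Let jac_inv (B : kalg k) (b : 'I_r -> B) : is_unit (pev (kstr B) b H) ->
  exists W : 'M[B]_r, W *m map_mx (pev (kstr B) b) jac = 1%:M /\
    map_mx (pev (kstr B) b) jac *m W = 1%:M.
Proof.
rewrite rmorphM mulrC => /is_unitMl; rewrite -det_map_mx => -[d hd].
exists (d *: \adj (map_mx (pev (kstr B) b) jac)).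
by rewrite -scalemxAl -scalemxAr mul_adj_mx mul_mx_adj scale_scalar_mx mulrC hd.
Qed.

Let pev_jac (B : kalg k) (b e : 'I_r -> B) l : (forall i j, e i * e j = 0) ->
  pev (kstr B) (fun i => b i + e i) (F l) =
  pev (kstr B) b (F l) + (map_mx (pev (kstr B) b) jac *m \col_i e i) l 0.
Proof.
move=> he; rewrite taylor // mxE; congr (_ + _); apply: eq_bigr => i _.
by rewrite !mxE.
Qed.

(** One Newton step. An arbitrary lift [b] of the coordinates is corrected by minus the inverse
    Jacobian applied to [F b]; this is exact because products of elements of the kernel vanish. Two
    solutions differ by a vector killed by the invertible Jacobian, whence uniqueness. *)
Lemma slice_etale : formally_etale slice.
Proof.
move=> B C q [qs q0] f; have [fF fH] := slice_pt f.
have /choice[b hb] : forall l, exists y, q y = f (a (lift ord0 l)) by move=> l; apply: qs.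
have qb Q : q (pev (kstr B) b Q) = pev (kstr C) (fun l => f (a (lift ord0 l))) Q.
  by rewrite pev_khom; apply: pev_eq.
(* Units lift along a square-zero extension: with [x * y = 1 + d] and [d * d = 0], the inverse of
   [x] is [y * (1 - d)]. *)
have unitL x t : q x * t = 1 -> is_unit x.
  move=> xt; have [y hy] := qs t; pose d := x * y - 1.
  have d0 : d * d = 0 by apply: q0; rewrite rmorphB rmorphM hy xt rmorph1 subrr.
  exists (y * (1 - d)); rewrite mulrA -[x * y](subrK 1) -/d mulrBr mulr1.
  by rewrite mulrDl d0 add0r mul1r addrC addKr.
have hHb : is_unit (pev (kstr B) b H).
  by apply: (unitL _ (f (a ord0))); rewrite qb mulrC.
have [W [W1 W2]] := jac_inv hHb.
pose e i := - (W *m \col_l pev (kstr B) b (F l)) i 0.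
have qe i : q (e i) = 0.
  rewrite /e mxE rmorphN rmorph_sum big1 ?oppr0 // => l _.
  by rewrite mxE rmorphM qb fF mulr0.
have ee i j : e i * e j = 0 by apply: q0.
pose b' i := b i + e i.
have qb' l : q (b' l) = f (a (lift ord0 l)) by rewrite /b' rmorphD qe addr0 hb.
have b'F l : pev (kstr B) b' (F l) = 0.
  rewrite pev_jac //; have -> : \col_i e i = - (W *m \col_l pev (kstr B) b (F l)).
    by apply/colP => i; rewrite !mxE /e mxE.
  by rewrite mulmxN mulmxA W2 mul1mx !mxE subrr.
have [t ht] : is_unit (pev (kstr B) b' H).
  apply: (unitL _ (f (a ord0))); rewrite pev_khom mulrC -[RHS]fH; congr (_ * _).
  exact: pev_eq.
have [g [g0 g1]] := slice_hom b'F (etrans (mulrC _ _) ht).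
exists g; split=> [|g' hg'].
  apply: (presents_ext (f := khom_comp q g) hA) => j /=.
  case: (unliftP ord0 j) => [l|] ->; first by rewrite g1.
  rewrite g0; apply: (is_unitMI (x := pev (kstr C) (fun l => f (a (lift ord0 l))) H)).
    by exists (f (a ord0)); rewrite mulrC.
  rewrite [RHS]mulrC fH -(pev_eq H (frefl _) qb') -pev_khom -rmorphM.
  by rewrite ht rmorph1.
have [g'F g'H] := slice_pt g'.
pose d i := g' (a (lift ord0 i)) - b' i.
have dE i : g' (a (lift ord0 i)) = b' i + d i by rewrite addrC subrK.
have dd i j : d i * d j = 0.
  by apply: q0; rewrite rmorphB qb' -(hg' (a _)) subrr.
have [W' [W'1 _]] := jac_inv (ex_intro _ t ht).
have d0 : \col_i d i = 0.
  rewrite -[LHS]mul1mx -W'1 -mulmxA; apply/(@eq_trans _ _ (W' *m 0)); last exact: mulmx0.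
  congr (_ *m _); apply/colP => l; rewrite [RHS]mxE -[RHS](g'F l).
  by rewrite (pev_eq _ (frefl _) dE) pev_jac // b'F add0r.
have g'b l : g' (a (lift ord0 l)) = b' l.
  by rewrite dE; have /colP/(_ l) := d0; rewrite !mxE => ->; rewrite addr0.
apply: (presents_ext hA) => j; case: (unliftP ord0 j) => [l|] ->; first by rewrite g1 g'b.
rewrite g0; apply: (is_unitMI (x := pev (kstr B) b' H)); first by exists t.
by rewrite ht mulrC -(pev_eq H (frefl _) g'b) g'H.
Qed.

(** The slice is étale, hence smooth and torsion-free. It is faithfully flat because [s0] gives a
    point of it with values in [k / p], so that [p] cannot be invertible in it. *)
Lemma etale_slice : exists (A : kalg k) (s : 'I_r -> A),
  [/\ etale_cover A, tf p (amod A), forall l, pev (kstr A) s (F l) = 0 &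
      is_unit (pev (kstr A) s H)].
Proof.
have hfp : finitely_presented slice by apply: presents_fp.
have hsm : formally_smooth slice.
  by move=> B C q hq f; have [g [hg _]] := slice_etale hq f; exists g.
have htf := fsmooth_tf hk hfp hsm.
have [sF sH] := slice_pt (khom_id slice).
exists slice, (fun l => a (lift ord0 l)); split=> //; last first.
  by exists (a ord0); rewrite mulrC; apply: sH.
split=> //; first exact: slice_etale.
apply: (tf_faithfully_flat hk htf) => -[x hx].
pose I : ideal k := spani (fun _ : 'I_1 => p).
have Ip y : I (p * y) by exists (fun=> y); rewrite big_ord1 /= mulrC.
pose C : kalg k := @KAlg k (rquot I) (rpi I).
have Cp y : kstr C (p * y) = 0 by apply/rpi_eq0.
have Cpev q : pev (kstr C) (fun l => kstr C (s0 l)) q = kstr C (pev idfun s0 q).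
  by rewrite rmorph_pev; apply: pev_eq.
have [u hu] := hH.
have [||f _] := @slice_hom C (fun l => kstr C (s0 l)) (kstr C u).
- by move=> l; have [y hy] := hF l; rewrite Cpev hy Cp.
- by rewrite Cpev -rmorphM mulrC hu rmorph1.
have h1 : kstr C 1 = 0.
  by rewrite rmorph1 -(rmorph1 f) hx rmorphM khomP -[p]mulr1 Cp mul0r.
have /rpi_eq0[c] := h1.
rewrite big_ord1 => e; apply: (dvr_nu hk); exists (c ord0).
by rewrite [RHS]e mulrC.
Qed.
End EtaleSlice.

Lemma spaniE (A : comPzRingType) n (g : 'I_n -> A) x :
  spani g x -> exists c : 'I_n -> A, x = \sum_i c i * g i.
Proof. by move=> [c ->]; exists c. Qed.

(** * Maximal minors modulo the uniformizer *)

Section Minors.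
Variables (k : comNzRingType) (p : k) (hk : is_dvr p) (m n : nat) (D : 'M[k]_(m, n)).
Variables (R : pred 'I_m) (C : pred 'I_n).

Definition unit_minor r (s : 'I_r -> 'I_m) (t : 'I_r -> 'I_n) : Prop :=
  [/\ forall l, R (s l), forall l, C (t l) & is_unit (\det (mxsub s t D))].

Lemma unit_minor_injl r (s : 'I_r -> 'I_m) t : unit_minor s t -> injective s.
Proof.
move=> [_ _ hu] i j ij; apply: contrapT => /eqP nij.
have [y hy] := hu; have /eqP := hy; rewrite (determinant_alternate nij).
  by rewrite mul0r eq_sym oner_eq0.
by move=> l; rewrite !mxE ij.
Qed.
Lemma unit_minor_injr r s (t : 'I_r -> 'I_n) : unit_minor s t -> injective t.
Proof.
move=> [_ _ hu] i j ij; apply: contrapT => /eqP nij.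
have [y hy] := hu; have /eqP := hy; rewrite -det_tr (determinant_alternate nij).
  by rewrite mul0r eq_sym oner_eq0.
by move=> l; rewrite !mxE ij.
Qed.

(** Take a unit minor of largest size and let [c] express row [j] through its rows on its columns.
    Bordering the minor by row [j] and a column [i] multiplies its determinant by the Schur
    complement [D j i - \sum_l c l * D (s l) i], which by maximality is not a unit. *)
Lemma maximal_minor : exists r (s : 'I_r -> 'I_m) (t : 'I_r -> 'I_n),
  unit_minor s t /\ forall j, R j -> exists c : 'I_r -> k, forall i, C i ->
    exists y, D j i - \sum_l c l * D (s l) i = p * y.
Proof.
pose ok r := `[< exists (s : 'I_r -> 'I_m) (t : 'I_r -> 'I_n), unit_minor s t >].
have ok0 : exists r, ok r.
  exists 0%N; apply/asboolP.
  exists (fun i : 'I_0 => let: Ordinal _ h := i in False_rect _ (notF h)).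
  exists (fun i : 'I_0 => let: Ordinal _ h := i in False_rect _ (notF h)).
  by split=> [[]//|[]//|]; exists 1; rewrite det_mx00 mulr1.
have okm r : ok r -> (r <= m)%N.
  by move=> /asboolP[s [t /unit_minor_injl hs]]; have := leq_card _ hs; rewrite !card_ord.
case: (ex_maxnP ok0 okm) => r /asboolP[s [t hst]] hmax; exists r, s, t; split=> // j Rj.
have [hs ht [d hd]] := hst; set W := mxsub s t D in hd.
pose Wi := d *: \adj W.
have WW : W *m Wi = 1%:M by rewrite -scalemxAr mul_mx_adj scale_scalar_mx mulrC hd.
pose c := (\row_l D j (t l)) *m Wi.
exists (fun l => c 0 l) => i Ci; case: (dvr_local hk (D j i - \sum_l c 0 l * D (s l) i)) => // hu.
suff /hmax : ok (r + 1)%N by rewrite addn1 ltnn.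
apply/asboolP; exists (fun x => match split x with inl l => s l | inr _ => j end).
exists (fun x => match split x with inl l => t l | inr _ => i end); split.
- by move=> x; case: splitP.
- by move=> x; case: splitP.
pose b : 'cV[k]_r := \col_l D (s l) i.
set N := mxsub _ _ D.
have -> : N = block_mx W b (\row_l D j (t l)) (D j i)%:M.
  apply/matrixP => x y; rewrite !mxE.
  by case: (split x) => a; rewrite !mxE; case: (split y) => a'; rewrite !mxE ?ord1 ?eqxx.
have /(congr1 determinant) : block_mx 1%:M 0 (- c) 1%:M *m
    block_mx W b (\row_l D j (t l)) (D j i)%:M =
    block_mx W b 0 (D j i - \sum_l c 0 l * D (s l) i)%:M.
  have -> : (D j i - \sum_l c 0 l * D (s l) i)%:M = - c *m b + (D j i)%:M :> 'M_1.
    apply/matrixP => x y; rewrite !ord1 !mxE /= !mulr1n addrC; congr (_ + _).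
    by rewrite -sumrN; apply: eq_bigr => l _; rewrite !mxE mulNr.
  rewrite mulmx_block !mul1mx !mul0mx !addr0; congr block_mx.
  have WiW : Wi *m W = 1%:M by rewrite -scalemxAl mul_adj_mx scale_scalar_mx mulrC hd.
  by rewrite mulNmx -mulmxA WiW mulmx1 addNr.
rewrite det_mulmx det_lblock !det1 !mul1r det_ublock det_scalar1 => ->.
by apply: is_unitM => //; exists d.
Qed.
End Minors.

(** * Homogeneous components of polynomials *)

Section Homogeneous.
Variables (k : comNzRingType) (n : nat) (M : zmodType) (deg : 'I_n -> M).
Definition mdegr (m : mon n) : M := \sum_i deg i *+ m i.
Definition homc (c : M) : mpol k n -> mpol k n :=
  mlin (fun m => if mdegr m == c then me m else 0).
Lemma homc_linear c : linear (homc c). Proof. exact: mlin_linear. Qed.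
Lemma homc_e c m : homc c (me m) = if mdegr m == c then me m else 0.
Proof. exact: mlin_e. Qed.
Lemma homc_coef c q m : mcoef m (homc c q) = if mdegr m == c then mcoef m q else 0.
Proof.
elim/malg_ind: q => [a m' z IH|].
  rewrite homc_linear !mcoefD IH !mcoefZ homc_e !mcoef_e.
  case: (eqVneq m' m) => [->|mm']; first by case: eqP; rewrite ?mcoef_e ?eqxx ?mcoef0 ?mulr0 ?add0r.
  rewrite mulr0 !add0r; case: (_ == c); rewrite ?mcoef_e ?(negPf mm') ?mcoef0 ?mulr0 ?add0r //.
by rewrite (linear0' (homc_linear c)) !mcoef0; case: eqP.
Qed.
Lemma homc_id c q : homc c (homc c q) = homc c q.
Proof. by apply: mcoef_inj => m; rewrite !homc_coef; case: eqP. Qed.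
Lemma homc_sum q : exists s : seq M, q = \sum_(c <- s) homc c q.
Proof.
have [s [_ qE]] := malg_supp q; exists (undup [seq mdegr m | m <- s]).
apply: mcoef_inj => m; rewrite mcoef_sum; under eq_bigr do rewrite homc_coef.
rewrite -big_mkcond -big_filter; set t := filter _ _.
have [ms|ms] := boolP (m \in s).
  have -> : t = [:: mdegr m].
    rewrite /t (eq_filter (a2 := pred1 (mdegr m))); last by move=> x /=; rewrite eq_sym.
    by rewrite filter_pred1_uniq ?undup_uniq // mem_undup map_f.
  by rewrite big_seq1.
suff -> : mcoef m q = 0 by rewrite big1.
rewrite qE mcoef_sum big_seq big1 // => m' m's; rewrite mcoefZ mcoef_e.
by case: eqP m's => [->|_]; rewrite ?(negPf ms) ?mulr0.
Qed.

Lemma mdegrD m m' : mdegr (m + m') = mdegr m + mdegr m'.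
Proof. by rewrite -big_split; apply: eq_bigr => i _; rewrite ffunE mulrnDr. Qed.
Lemma mdegr_var i : mdegr (mvar i) = deg i.
Proof.
rewrite /mdegr (bigD1 i isT) ffunE eqxx mulr1n big1 /= ?addr0 // => j ij.
by rewrite ffunE (negPf ij).
Qed.
Lemma mdegr_dmon i (m : mon n) : (0 < m i)%N -> mdegr (dmon i m) = mdegr m - deg i.
Proof.
move=> mi; apply/eqP; rewrite -subr_eq opprK -mdegr_var -mdegrD; apply/eqP; congr mdegr.
apply/ffunP => j; rewrite !ffunE; case: eqP => [->|_]; last by rewrite subn0 addr0.
exact: subnK.
Qed.

Variables (B : comPzRingType) (phi : {rmorphism k -> B}) (x : 'I_n -> B).
Hypothesis hx : forall i, deg i <> 0 -> x i = 0.
Lemma monval_deg (m : mon n) : mdegr m <> 0 -> monval x m = 0.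
Proof.
move=> hm; have [[i [mi di]]|h] := EM (exists i, (0 < m i)%N /\ deg i <> 0).
  by rewrite /monval (bigD1 i isT) /= hx // -(prednK mi) exprS !mul0r.
case: hm; apply: big1 => i _; case: (posnP (m i)) => [->|mi]; first by rewrite mulr0n.
have -> : deg i = 0 by apply: contrapT => di; apply: h; exists i.
by rewrite mul0rn.
Qed.
Lemma pev_homc c q : c <> 0 -> pev phi x (homc c q) = 0.
Proof.
move=> c0; elim/malg_ind: q => [a m z IH|].
  rewrite homc_linear rmorphD IH addr0 pevZ homc_e; case: eqP => [mc|_].
    by rewrite pev_e monval_deg ?mulr0 // mc.
  by rewrite rmorph0 mulr0.
by rewrite (linear0' (homc_linear c)) rmorph0.
Qed.
(** The derivative along the [i]-th variable has degree [c - deg i], and a polynomial of nonzero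
    degree vanishes at a point of degree 0. At such a point the Jacobian matrix of homogeneous
    equations is therefore block diagonal. *)
Lemma pev_pd_homc i c q : c <> deg i -> pev phi x (pd i (homc c q)) = 0.
Proof.
move=> ci; elim/malg_ind: q => [a m z IH|].
  rewrite homc_linear pdD rmorphD IH addr0 pdZ pevZ homc_e; case: eqP => [mc|_]; last first.
    by rewrite pd0 rmorph0 mulr0.
  rewrite pd_e pevZ pev_e; case: (posnP (m i)) => [->|mi].
    by rewrite rmorph0 mul0r mulr0.
  rewrite monval_deg ?mulr0 // mdegr_dmon // mc => /eqP.
  by rewrite subr_eq0 => /eqP.
by rewrite (linear0' (homc_linear c)) pd0 rmorph0.
Qed.
End Homogeneous.

(* J_F and J_R agree modulo p, and P/J_R is smooth.  Fibrewise flatness and *)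
(* the Jacobian criterion show that P/J_F is smooth near x0, and the part   *)
(* of degree 0 can then be cut down to an etale cover of the base.          *)
Section TwistedSlice.
Variables (k : comNzRingType) (p : k) (hk : is_dvr p).
Variables (n : nat) (M : zmodType) (deg : 'I_n -> M).
Local Notation P := (mpol k n).
Local Notation C := (mconst (mon n)).
Variables (JR JF : ideal P).
Hypotheses (JF_sat : forall q, JF (p *: q) -> JF q)
  (JFR : forall q, JF q -> exists q' z, JR q' /\ q = q' + p *: z)
  (JRF : forall q, JR q -> exists q' z, JF q' /\ q = q' + p *: z)
  (JF_hom : forall c q, JF q -> JF (homc deg c q)).
Variables (rr : 'I_n -> P) (hrr : forall i, JR (rr i)).
(** The Jacobian form of smoothness: sending the differential of the [i]-th variable to [rr i]
    splits the map from [JR] modulo its square to the differentials. *)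
Hypothesis hsm : forall q, JR q -> isq JR (q - \sum_i pd i q * rr i).
Variables (x0 : 'I_n -> k) (h : P).
Hypotheses (hx0 : forall q, JR q -> exists y, pev idfun x0 q = p * y)
  (hdeg : forall i, deg i <> 0 -> x0 i = 0) (hh : is_unit (pev idfun x0 h)).

Let pdiv (q : P) : Prop := exists y, pev idfun x0 q = p * y.
Let pdiv0 : pdiv 0. Proof. by exists 0; rewrite rmorph0 mulr0. Qed.
Let pdivD q q' : pdiv q -> pdiv q' -> pdiv (q + q').
Proof. by move=> [y hy] [y' hy']; exists (y + y'); rewrite rmorphD hy hy' mulrDr. Qed.
Let pdivM a q : pdiv q -> pdiv (a * q).
Proof. by move=> [y hy]; exists (pev idfun x0 a * y); rewrite rmorphM hy mulrCA. Qed.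
Let pdivZ q : pdiv (p *: q).
Proof. by exists (pev idfun x0 q); rewrite pevZ. Qed.

Let JF_pdiv q : JF q -> pdiv q.
Proof. by move=> /JFR[q' [z [/hx0 hq' ->]]]; apply: pdivD. Qed.

Let modp : exists (Q : comPzRingType) (f : {rmorphism P -> Q}),
  forall x y, f x = f y <-> exists z, x = y + p *: z.
Proof.
exists (rquot (spani (fun _ : 'I_1 => C p))), (rpi _) => x y; split.
  move=> /rpi_eq[c]; rewrite big_ord1 => e; exists (c ord0).
  by rewrite -mconstM [C p * _]mulrC -[_ * C p]e addrC subrK.
move=> [z ->]; apply/rpi_eq; exists (fun=> z); rewrite big_ord1 addrC addKr.
by rewrite -mconstM mulrC.
Qed.

(** Reducing modulo [p] carries the splitting from [JR] to [JF]: the ideals have the same reduction,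
    and derivatives and products are compatible with it. The error is [p v] with [p v] in [JF], and
    saturation then puts [v] itself in [JF]. *)
Let smooth_twist : exists r : 'I_n -> P, (forall i, JF (r i)) /\
  forall q, JF q -> exists u v,
    [/\ isq JF u, JF v & q = \sum_i pd i q * r i + u + p *: v].
Proof.
have [Q [f fE]] := modp.
have /choice[r hr] : forall i, exists r, JF r /\ f (rr i) = f r.
  by move=> i; have [r [z [h1 h2]]] := JRF (hrr i); exists r; split=> //; apply/fE; exists z.
exists r; split=> [i|q hq]; first by case: (hr i).
have [q' [z [hq' qE]]] := JFR hq.
have fq : f q = f q' by apply/fE; exists z.
have fpd i : f (pd i q) = f (pd i q').
  by apply/fE; exists (pd i z); rewrite qE pdD pdZ.
have sq y : isq JR y -> exists u, isq JF u /\ f y = f u.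
  move=> [s [hs ->]]; elim: s hs => [|[a b] s IH] hs.
    by exists 0; rewrite big_nil; split=> //; apply: smod0.
  have [|u [hu e]] := IH; first by move=> t ts; apply: hs; rewrite inE ts orbT.
  have [/JRF[a' [za [ha' ae]]] /JRF[b' [zb [hb' be]]]] := hs (a, b) (mem_head _ _).
  exists (a' * b' + u); split; first by apply: submodD => //; apply: isqM.
  rewrite big_cons !rmorphD !rmorphM e; congr (_ * _ + _); apply/fE; first by exists za.
  by exists zb.
have [u [hu uE]] := sq _ (hsm hq').
have fS : f (\sum_i pd i q * r i) = f (\sum_i pd i q' * rr i).
  rewrite !rmorph_sum; apply: eq_bigr => i _; rewrite !rmorphM fpd; congr (_ * _).
  by case: (hr i).
have [v hv] : exists v, q - (\sum_i pd i q * r i + u) = 0 + p *: v.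
  apply/fE; rewrite rmorph0 rmorphB rmorphD -uE rmorphB fq fS [X in _ - X]addrC.
  by rewrite subrK subrr.
exists u, v; split=> //; last by rewrite -[p *: v]add0r -hv addrC subrK.
apply: JF_sat; rewrite -[p *: v]add0r -hv; apply: submodB => //; apply: submodD.
  by apply: submod_sum => i _; apply: idmMl; case: (hr i).
exact: isq_le.
Qed.

Lemma twisted_slice : exists (A : kalg k) (xi : 'I_n -> A),
  [/\ etale_cover A, tf p (amod A), forall i, deg i <> 0 -> xi i = 0,
      forall q, JF q -> pev (kstr A) xi q = 0 & is_unit (pev (kstr A) xi h)].
Proof.
have [r [hrF hsmF]] := smooth_twist.
have [m [G [dg [Ghom [GF Ggen]]]]] : exists m (G : 'I_m -> P) (dg : 'I_m -> M),
    (forall j, homc deg (dg j) (G j) = G j) /\ (forall j, JF (G j)) /\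
    forall q, JF q -> spani G q.
  have [s [sF sg]] := mpol_noeth (n := n) (dvr_noeth hk) JF.
  have [sup hsup] := choice (@homc_sum k n M deg).
  pose L := flatten [seq [seq (c, homc deg c q) | c <- sup q] | q <- s].
  pose T (j : 'I_(size L)) := tnth (in_tuple L) j.
  have TL j : T j \in L by apply: mem_tnth.
  have LP t : t \in L -> homc deg t.1 t.2 = t.2 /\ JF t.2.
    move=> /flatten_mapP[q qs /mapP[c _ ->]] /=; rewrite homc_id; split=> //.
    exact/JF_hom/sF.
  exists (size L), (fun j => (T j).2), (fun j => (T j).1).
  split=> [j|]; first by case: (LP _ (TL j)).
  split=> [j|q /sg]; first by case: (LP _ (TL j)).
  apply=> y ys; rewrite [y]hsup big_seq; apply: submod_sum => c cs.
  have /(tnthP (in_tuple L))[j e] : (c, homc deg c y) \in L.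
    by apply/flatten_mapP; exists y => //; apply: map_f.
  by rewrite -[homc deg c y]/((c, homc deg c y).2) e; apply: (@inspan_mem _ (_^o)).
pose D : 'M[k]_(m, n) := \matrix_(j, i) pev idfun x0 (pd i (G j)).
have D0 j i : dg j <> deg i -> D j i = 0.
  by move=> h'; rewrite mxE -Ghom pev_pd_homc.
(* By [D0] the Jacobian at [x0] has a block of degree 0 and a complementary block. A maximal unit
   minor is chosen in each separately, so that the equations selected in degree 0 have an invertible
   Jacobian in variables of degree 0 alone. *)
have [r0 [s0 [t0 [hst0 hD0]]]] := maximal_minor hk D (fun j => dg j == 0) (fun i => deg i == 0).
have [r1 [s1 [t1 [hst1 hD1]]]] := maximal_minor hk D (fun j => dg j != 0) (fun i => deg i != 0).
pose f (l : 'I_(r0 + r1)) := match split l with inl a => G (s0 a) | inr a => G (s1 a) end.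
have f0 a : f (lshift r1 a) = G (s0 a) by rewrite /f (unsplitK (inl a)).
have f1 a : f (rshift r0 a) = G (s1 a) by rewrite /f (unsplitK (inr a)).
have fF l : JF (f l) by rewrite /f; case: (split l).
have red j : exists w, spani f w /\ forall i, pdiv (pd i (G j - w)).
  have [R0|R0] := boolP (dg j == 0).
    have [c hc] := hD0 j R0; exists (\sum_l C (c l) * G (s0 l)); split.
      apply: submod_sum => l _; rewrite -f0; apply: idmMl.
      exact: (@inspan_mem _ (_^o)).
    move=> i; have [/hc[y hy]|Ci] := boolP (deg i == 0).
      exists y; rewrite -hy pdB rmorphB mxE; congr (_ - _).
      rewrite (linear_sum' _ _ _ (pd_linear i)) rmorph_sum; apply: eq_bigr => l _.
      by rewrite mconstM pdZ pevZ mxE.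
    exists 0; rewrite mulr0 pdB rmorphB -[X in X - _](mxE matrix_key (fun j i => _) j i) -/D D0.
      rewrite (linear_sum' _ _ _ (pd_linear i)) rmorph_sum big1 ?subrr // => l _.
      rewrite mconstM pdZ pevZ; have := D0 (s0 l) i; rewrite mxE => -> //.
        by rewrite mulr0.
      by have [/(_ l)/eqP -> _ _] := hst0; move=> /esym/eqP; apply/negP.
    by rewrite (eqP R0) => /esym/eqP; apply/negP.
  have [c hc] := hD1 j R0; exists (\sum_l C (c l) * G (s1 l)); split.
    apply: submod_sum => l _; rewrite -f1; apply: idmMl.
    exact: (@inspan_mem _ (_^o)).
  move=> i; have [/hc[y hy]|/negPn/eqP Ci] := boolP (deg i != 0).
    exists y; rewrite -hy pdB rmorphB mxE; congr (_ - _).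
    rewrite (linear_sum' _ _ _ (pd_linear i)) rmorph_sum; apply: eq_bigr => l _.
    by rewrite mconstM pdZ pevZ mxE.
  exists 0; rewrite mulr0 pdB rmorphB -[X in X - _](mxE matrix_key (fun j i => _) j i) -/D D0.
    rewrite (linear_sum' _ _ _ (pd_linear i)) rmorph_sum big1 ?subrr // => l _.
    rewrite mconstM pdZ pevZ; have := D0 (s1 l) i; rewrite mxE => -> //.
      by rewrite mulr0.
    by have [/(_ l)/eqP h' _ _] := hst1; rewrite Ci.
  by rewrite Ci; apply/eqP.
have /choice[w hw] := red.
pose G' j := G j - w j.
have wF j : JF (w j) by apply: spani_sub (proj1 (hw j)).
have G'F j : JF (G' j) by apply: submodB.
(* [K] is the span of the selected equations [f] plus the multiples of the [G'] by functions
   vanishing at [x0] modulo [p]. Showing that it contains every [G' j] prepares Nakayama's lemma. *)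
pose K q := exists E : 'I_m -> P, (forall l, pdiv (E l)) /\ spani f (q - \sum_l E l * G' l).
have K0 : K 0.
  exists (fun=> 0); split=> // ; rewrite big1 => [|l _]; last by rewrite mul0r.
  by rewrite subr0; apply: smod0.
have KD x y : K x -> K y -> K (x + y).
  move=> [E [h1 h2]] [E' [h1' h2']]; exists (fun l => E l + E' l); split.
    by move=> l; apply: pdivD.
  under eq_bigr do rewrite mulrDl.
  by rewrite big_split opprD addrACA; apply: submodD.
have KM a q : pdiv a -> JF q -> K (a * q).
  move=> ha /Ggen/spaniE[c ->]; exists (fun l => a * c l); split.
    by move=> l; rewrite mulrC; apply: pdivM.
  rewrite mulr_sumr -sumrB; apply: submod_sum => l _.
  rewrite mulrA -mulrBr /G' opprB addrCA subrr addr0.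
  by apply: idmMl; case: (hw l).
(* [G' j] has zero differential at [x0] modulo [p], so each of the three terms given by
   [smooth_twist] has a factor in [JF] and another one vanishing at [x0] modulo [p]. *)
have KG j : K (G' j).
  have [u [v [hu hv ->]]] := hsmF _ (G'F j).
  apply: (KD); first apply: (KD).
  - apply: big_ind => // i _; apply: KM => //; by case: (hw j).
  - have [t [ht ->]] := hu; rewrite big_seq; apply: big_ind => // x /ht[h1 h2].
    by apply: KM => //; apply: JF_pdiv.
  - rewrite -mconstM; apply: KM => //.
    by exists 1; rewrite pevC mulr1.
have /choice[E hE] := KG.
(* The determinant trick: [h1] is 1 at [x0] modulo [p] and multiplies [JF] into the span of [f].
   Inverting [h1] leaves only the selected equations. *)
pose EM : 'M[P]_m := \matrix_(j, l) E j l.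
pose h1 := \det (1%:M - EM).
have h1G l : spani f (h1 * G' l).
  have e : \adj (1%:M - EM) *m (1%:M - EM) = h1%:M by rewrite mul_adj_mx.
  have -> : h1 * G' l = (\adj (1%:M - EM) *m ((1%:M - EM) *m \col_j G' j)) l 0.
    by rewrite mulmxA e mul_scalar_mx !mxE.
  rewrite mxE; apply: submod_sum => j _; apply: idmMl.
  rewrite mulmxBl mul1mx !mxE; have [_] := hE j; congr (spani f (_ - _)).
  by apply: eq_bigr => i _; rewrite !mxE.
have h1F q : JF q -> spani f (h1 * q).
  move=> /Ggen/spaniE[c ->]; rewrite mulr_sumr; apply: submod_sum => l _.
  rewrite mulrCA; apply: idmMl.
  rewrite -[G l](subrK (w l)) mulrDr; apply: submodD; first exact: h1G.
  by apply: idmMl; case: (hw l).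
have h1u : is_unit (pev idfun x0 h1).
  have /choice[e he] : forall jl : 'I_m * 'I_m, exists y, pev idfun x0 (E jl.1 jl.2) = p * y.
    by move=> [j l]; have [h' _] := hE j; apply: h'.
  pose e' : 'M[k]_m := \matrix_(j, l) e (j, l).
  have -> : pev idfun x0 h1 = \det (1%:M - p *: e').
    rewrite -det_map_mx; congr determinant; apply/matrixP => j l.
    by rewrite !mxE rmorphB rmorph_nat (he (j, l)).
  (* This determinant is 1 modulo [p]; were it divisible by [p], then [p] would be a unit. *)
  case: (dvr_local hk (\det (1%:M - p *: e'))) => // -[y hy]; case: (dvr_nu hk).
  pose pI : ideal k := spani (fun _ : 'I_1 => p).
  have [ff fp ff0] : exists2 g : {rmorphism k -> rquot pI}, forall z, g (p * z) = 0 &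
      forall z, g z = 0 -> pI z.
    exists (rpi pI) => [z|z /rpi_eq0 //]; apply/rpi_eq0; exists (fun=> z).
    by rewrite big_ord1 mulrC.
  have : ff 1 = 0.
    rewrite -[RHS](fp y) -hy -det_map_mx rmorph1 -(det1 _ m); congr determinant.
    by apply/matrixP => j l; rewrite !mxE rmorphB rmorph_nat fp subr0.
  by move=> /ff0[c]; rewrite big_ord1 => e1; exists (c ord0); rewrite [RHS]e1 mulrC.
have [_ t0d u0] := hst0; have t0i := unit_minor_injr hst0.
(* Only the [r0] variables selected by [t0] remain free; all others are frozen at their value at
   [x0], which is 0 in nonzero degree. This leaves as many equations as unknowns. *)
pose xs (i : 'I_n) : mpol k r0 :=
  if [pick l | t0 l == i] is Some l then mX k l else mconst _ (x0 i).
have xst l : xs (t0 l) = mX k l.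
  rewrite /xs; case: pickP => [l' /eqP/t0i -> //|/(_ l)].
  by rewrite eqxx.
have xsd i : deg i <> 0 -> xs i = mconst _ 0.
  move=> di; rewrite /xs; case: pickP => [l /eqP e|_]; last by rewrite hdeg.
  by case: di; rewrite -e; apply/eqP.
have pdxs l i : pd l (xs i) = (i == t0 l)%:R.
  rewrite /xs; case: pickP => [l' /eqP <-|h'].
    by rewrite pdX (inj_eq t0i) eq_sym.
  by rewrite pdC; have := h' l; rewrite eq_sym => ->.
pose F l := pev (mconst (mon r0)) xs (G (s0 l)).
pose H := pev (mconst (mon r0)) xs (h * h1).
pose z0 l := x0 (t0 l).
have pz q : pev idfun z0 (pev (mconst (mon r0)) xs q) = pev idfun x0 q.
  rewrite rmorph_pev; apply: pev_eq => [c|i] /=; first by rewrite pevC.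
  by rewrite /xs; case: pickP => [l /eqP <-|_]; rewrite ?pevX ?pevC.
have [||A [s [hA tA sF sH]]] := @etale_slice k p hk r0 F H z0.
- by move=> l; rewrite pz; apply: JF_pdiv.
- rewrite rmorphM pz rmorphM; apply: is_unitM; first exact: is_unitM hh h1u.
  rewrite -det_map_mx.
  have -> : map_mx (pev idfun z0) (jac F) = mxsub s0 t0 D; last exact: u0.
  apply/matrixP => l i; rewrite !mxE pd_pev.
  rewrite rmorph_sum (bigD1 (t0 i) isT) rmorphM pz pdxs eqxx rmorph1 mulr1.
  rewrite big1 /= ?addr0 // => j /negPf ji; rewrite rmorphM pdxs ji rmorph0 mulr0.
  by [].
pose xi i := pev (kstr A) s (xs i).
have pxi q : pev (kstr A) xi q = pev (kstr A) s (pev (mconst (mon r0)) xs q).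
  by rewrite rmorph_pev; apply: pev_eq => // c; rewrite /= pevC.
have xid i : deg i <> 0 -> xi i = 0.
  by move=> di; rewrite /xi xsd // pevC rmorph0.
have [uH uH1] : is_unit (pev (kstr A) xi h) /\ is_unit (pev (kstr A) xi h1).
  move: sH; rewrite rmorphM => /is_unitMl; rewrite -pxi rmorphM => hu.
  split; first exact: is_unitMl hu.
  by move: hu; rewrite mulrC => /is_unitMl.
exists A, xi; split=> // q /h1F/spaniE[c hc]; apply: (is_unitMI uH1).
rewrite -rmorphM hc mulr0 rmorph_sum big1 // => l _.
rewrite rmorphM /f; case: (split l) => a.
  have -> : pev (kstr A) xi (G (s0 a)) = 0 by rewrite pxi; apply: sF.
  by rewrite mulr0.
(* An equation of nonzero degree holds at every point of degree 0, so only the equations selected by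
   [s0] had to be imposed. *)
have -> : pev (kstr A) xi (G (s1 a)) = 0; last by rewrite mulr0.
by rewrite -Ghom pev_homc //; have [/(_ a)/eqP ? _ _] := hst1.
Qed.
End TwistedSlice.

(** * Representations and Tannaka reconstruction *)

Lemma khom_eq (k : comPzRingType) (A B : kalg k) (f g : khom A B) : f =1 g -> f = g.
Proof.
case: f g => [f ef] [g eg] /= fg.
have e : f = g.
  case: f g fg {ef eg} => [f [[f1] [f2]]] [g [[g1] [g2]]] /= /funext fg.
  by subst g; rewrite (Prop_irrelevance f1 g1) (Prop_irrelevance f2 g2).
by subst g; rewrite (Prop_irrelevance ef eg).
Qed.

Lemma bc_in0 (k : comPzRingType) (M : lmodType k) (S : kalg k) : bc_in S (0 : M) = 0.
Proof. by rewrite -[0](scale0r (0 : M)) (bc_inP M S).2 rmorph0 scale0r. Qed.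
Lemma bc_inD (k : comPzRingType) (M : lmodType k) (S : kalg k) (x y : M) :
  bc_in S (x + y) = bc_in S x + bc_in S y.
Proof. exact: (bc_inP M S).1. Qed.
Lemma bc_inZ (k : comPzRingType) (M : lmodType k) (S : kalg k) a (x : M) :
  bc_in S (a *: x) = kstr S a *: bc_in S x.
Proof. exact: (bc_inP M S).2. Qed.
Lemma bc_in_sum (k : comPzRingType) (M : lmodType k) (S : kalg k) I (r : seq I)
    (P : pred I) (F : I -> M) :
  bc_in S (\sum_(i <- r | P i) F i) = \sum_(i <- r | P i) bc_in S (F i).
Proof. exact: (big_morph _ (@bc_inD k M S) (@bc_in0 k M S)). Qed.

Section MatrixRep.
Variables (k : comPzRingType) (G : grpfun k) (n : nat).
Variable C : forall S : kalg k, G S -> 'M[S]_n.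
Arguments C {S} _.
(** Coordinates are row vectors on which matrices act from the right; this reverses the order of the
    factors, here and for [Cm] below. *)
Hypotheses (CM : forall S (g h : G S), C (gmul g h) = C h *m C g)
  (C1 : forall S, C (gone G S) = 1%:M)
  (Cmap : forall S S' (f : khom S S') (g : G S), C (gmap f g) = map_mx f (C g)).

Lemma rV_basis : isbasis (fun i : 'I_n => delta_mx 0 i : 'rV[k]_n).
Proof.
have sE (a : 'I_n -> k) : \sum_i a i *: (delta_mx 0 i : 'rV[k]_n) = \row_i a i.
  by rewrite [RHS]row_sum_delta; apply: eq_bigr => i _; rewrite mxE.
split=> [a h i|x]; last by exists (fun i => x 0 i); rewrite sE; apply/rowP => i; rewrite mxE.
by have := congr1 (fun v : 'rV_n => v 0 i) h; rewrite sE !mxE.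
Qed.
Let V : lmodType k := 'rV[k]_n.
Lemma rV_fgproj : fgproj V.
Proof. by exists n, id, id. Qed.
Let r S := @bcr k V n _ rV_basis S.
Let v S := @bcv k V n (fun i : 'I_n => delta_mx 0 i : 'rV[k]_n) S.

Definition mxact_fun S (g : G S) (z : bc V S) : bc V S := v (r z *m C g).
Lemma mxact_linear S (g : G S) : linear (mxact_fun g).
Proof.
move=> a x y; rewrite /mxact_fun /r /v (bcr_linear rV_basis S) mulmxDl -scalemxAl.
exact: bcv_linear.
Qed.
Lemma mxactK S (g h : G S) : gmul h g = gone G S -> cancel (mxact_fun g) (mxact_fun h).
Proof.
by move=> gh z; rewrite /mxact_fun /r /v bcvK -mulmxA -CM gh C1 mulmx1 bcrK.
Qed.
Definition mxact S (g : G S) : GL V S :=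
  LAut (mxact_linear g) (mxactK (gmulV g)) (mxactK (gmulxV g)).
Lemma mxact_r S (g : G S) z : r (mxact g z) = r z *m C g.
Proof. by rewrite /= /mxact_fun /r /v bcvK. Qed.
Definition matrix_act : ghom G (GL V).
refine (@GHom k G (GL V) mxact _ _).
- move=> S g h; apply: laut_eq => z; apply: (@bcr_inj k V n _ rV_basis S).
  by rewrite [LHS]mxact_r CM mulmxA -!mxact_r.
- move=> S S' f g; apply: laut_eq.
  apply: (@linear_bc_eq k V S' (bc V S') (mxact (gmap f g) : laut _)
    (gmap f (mxact g) : laut _)) => [||x]; [exact: Defs.lfunP|exact: Defs.lfunP|].
  apply: (@bcr_inj k V n _ rV_basis S'); rewrite [LHS]mxact_r Cmap.
  transitivity (r (bcpush f (mxact g (bc_in S x)))).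
    by rewrite -(bcpush_in f) /r !bcr_push -map_mxM; congr map_mx; apply/esym/mxact_r.
  by rewrite -gl_mapE bcpush_in.
Defined.
Definition matrix_rep : rep G := @Rep k G V rV_fgproj matrix_act.
Lemma matrix_repE S (g : G S) z :
  @bcr k matrix_rep n _ rV_basis S (ract matrix_rep S g z) =
  @bcr k matrix_rep n _ rV_basis S z *m C g.
Proof. exact: mxact_r. Qed.
End MatrixRep.

Section CommonFactors.
Variables (k : comNzRingType) (p : k) (hk : is_dvr p).
Variables (A T : kalg k) (hA : tf p (amod A)) (L R : khom A T).
Hypothesis gen : forall z : T, exists n (a b : 'I_n -> A), z = \sum_i L (a i) * R (b i).

(** The right factors of finitely many tensors span a torsion-free module of finite type, which has
    a basis; expanding in it collects the left factors. *)
Lemma common_factors (zs : seq T) : exists n (h : 'I_n -> amod A), indep h /\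
  forall z, z \in zs -> exists w : 'I_n -> A, z = \sum_i L (w i) * R (h i : A).
Proof.
have [n [h hh]] : exists n (h : 'I_n -> amod A), forall z, z \in zs ->
    exists w : 'I_n -> A, z = \sum_i L (w i) * R (h i : A).
  elim: zs => [|z zs [n [h IH]]]; first by exists 0%N, (fun=> 0).
  have [m [a [b zE]]] := gen z.
  exists (m + n)%N, (fun i => match split i with inl j => b j | inr j => h j end) => z'.
  rewrite inE => /orP[/eqP ->|/IH[w ->]].
    exists (fun i => match split i with inl j => a j | inr j => 0 end).
    rewrite big_split_ord /= [X in _ = _ + X]big1 ?addr0.
      by rewrite zE; apply: eq_bigr => i _; rewrite (unsplitK (inl i)).
    by move=> i _; rewrite (unsplitK (inr i)) rmorph0 mul0r.
  exists (fun i => match split i with inl j => 0 | inr j => w j end).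
  rewrite big_split_ord /= [X in _ = X + _]big1 ?add0r.
    by apply: eq_bigr => i _; rewrite (unsplitK (inr i)).
  by move=> i _; rewrite (unsplitK (inl i)) rmorph0 mul0r.
have [q [e [he h1 _]]] := tf_span_basis hk hA h.
have [c hc] := choice h1.
exists q, e; split=> // z /hh[w ->]; exists (fun j => \sum_i kstr A (c i j) * w i).
under [RHS]eq_bigr do rewrite rmorph_sum mulr_suml.
rewrite exchange_big; apply: eq_bigr => i _; rewrite hc rmorph_sum mulr_sumr.
apply: eq_bigr => j _; rewrite -[c i j *: e j]/(kstr A (c i j) * (e j : A)).
by rewrite !rmorphM !khomP -mulrA mulrCA.
Qed.
End CommonFactors.

Lemma fgproj_basis (k : comNzRingType) (p : k) (hk : is_dvr p) (M : lmodType k) :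
  fgproj M -> exists n (e : 'I_n -> M), isbasis e.
Proof.
move=> [n [i [q [li lq iK]]]].
have tM : tf p M.
  move=> x hx; apply: (can_inj iK); rewrite (linear0' li); apply/rowP => j.
  have := congr1 (fun v : 'rV_n => v 0 j) (congr1 i hx).
  rewrite (linearZ' _ _ li) (linear0' li) !mxE => /(dvr_dom hk)[p0|//].
  by case: (dvr_p0 hk).
have [r [e [he h1 _]]] := tf_span_basis hk tM (fun j => q (delta_mx 0 j)).
exists r, e; split=> // x; rewrite -[x]iK [i x]row_sum_delta (linear_sum' _ _ _ lq).
by apply: inspan_sum => j _; rewrite (linearZ' _ _ lq); apply: inspanZ.
Qed.

Section Represented.
Variables (k : comNzRingType) (p : k) (hk : is_dvr p) (G : grpfun k).
Variables (O : kalg k) (a : G O) (ha : represents a) (tO : tf p (amod O)).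

Definition kh S (g : G S) : khom O S := sval (cid (ha g)).
Lemma khP S (g : G S) : gmap (kh g) a = g.
Proof. by rewrite /kh; case: (cid _) => f []. Qed.
Lemma kh_uniq S (g : G S) (f : khom O S) : gmap f a = g -> kh g =1 f.
Proof. by rewrite /kh; case: (cid _) => f' [h1 h2] /=; apply: h2. Qed.
Lemma kh_gmap S S' (f : khom S S') (g : G S) x : kh (gmap f g) x = f (kh g x).
Proof.
by rewrite (@kh_uniq _ (gmap f g) (khom_comp f (kh g))) // gmap_comp khP.
Qed.
Lemma kh_of S (f : khom O S) x : kh (gmap f a) x = f x.
Proof. exact: kh_uniq. Qed.
Lemma kh_inj S (g h : G S) : kh g =1 kh h -> g = h.
Proof. by move=> /khom_eq e; rewrite -(khP g) -(khP h) e. Qed.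

Local Notation T2 := (ctens O O).
Definition gx (A S : kalg k) (g : G A) : G (ctens A S) := gmap (ctL A S) g.
Definition gy (A S : kalg k) (g : G S) : G (ctens A S) := gmap (ctR A S) g.
(** The function [kh univ2] is the comultiplication of [O]. Working with points, coassociativity is
    [gmulA] at three universal points and the counit is evaluation at [gone]. *)
Definition univ2 : G T2 := gmul (gx O a) (gy O a).
Lemma spec2 S (g h : G S) : exists f : khom T2 S,
  (forall x y, f (ctL O O x * ctR O O y) = kh g x * kh h y) /\ gmap f univ2 = gmul g h.
Proof.
have [f [f1 f2]] := ctens_lift (kh g) (kh h); exists f.
split=> [x y|]; first by rewrite rmorphM f1 f2.
rewrite /univ2 /gx /gy gmapM -!gmap_comp; congr gmul; rewrite -[RHS]khP.
  by congr (gmap _ a); apply: khom_eq.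
by congr (gmap _ a); apply: khom_eq.
Qed.

Lemma ctens_gen (A S : kalg k) (z : ctens A S) : exists n (x : 'I_n -> A) (y : 'I_n -> S),
  z = \sum_i ctL A S (x i) * ctR A S (y i).
Proof.
have [n [y [x ->]]] := bcE (z : bc (amod A) S); exists n, x, y.
by apply: eq_bigr => i _; rewrite mulrC -ctZE ctLE.
Qed.

(** As functions on the group, the right translates of the [m j] are combinations of the [m i], with
    coefficients the functions [c j i]: a finite subcomodule of the regular representation. *)
Definition stable n (m : 'I_n -> O) (c : 'I_n -> 'I_n -> O) : Prop :=
  forall S (g h : G S) j, kh (gmul g h) (m j) = \sum_i kh g (m i) * kh h (c j i).

(** Local finiteness of the regular representation. Let [P] be left factors of the comultiplications
    of [xs], and [E] the module of functions whose comultiplication has left factors in the span of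
    [P]. The counit puts [E] inside this span, so [E] is free of finite rank; coassociativity and
    flatness show that it is stable. *)
Lemma stable_basis (xs : seq O) : exists n (m : 'I_n -> amod O) (c : 'I_n -> 'I_n -> O),
  [/\ indep m, stable m c & forall x, x \in xs -> inspan m x].
Proof.
pose D x := kh univ2 x.
have Dl (x y : amod O) b : D (b *: x + y) = kstr T2 b * D x + D y.
  transitivity (kh univ2 (kstr O b * (x : O) + (y : O))); first by [].
  by rewrite rmorphD rmorphM khomP.
have genL (z : T2) : exists n (x y : 'I_n -> O), z = \sum_i ctR O O (x i) * ctL O O (y i).
  have [n [x [y ->]]] := ctens_gen z; exists n, y, x.
  by apply: eq_bigr => i _; rewrite mulrC.
have [s [P [hP PD]]] := common_factors hk tO genL [seq D x | x <- xs].
pose inP (z : T2) := exists q : 'I_s -> O, z = \sum_t ctL O O (P t : O) * ctR O O (q t).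
have inP0 : inP 0 by exists (fun=> 0); rewrite big1 // => t _; rewrite rmorph0 mulr0.
have inPL b z z' : inP z -> inP z' -> inP (kstr T2 b * z + z').
  move=> [q ->] [q' ->]; exists (fun t => kstr O b * q t + q' t).
  rewrite mulr_sumr -big_split; apply: eq_bigr => t _ /=.
  by rewrite rmorphD rmorphM (khomP (ctR O O)) mulrDr mulrCA.
have E0 : inP (D 0) by rewrite /D rmorph0.
have EL b (x y : amod O) : inP (D x) -> inP (D y) -> inP (D (b *: x + y)).
  by move=> hx hy; rewrite Dl; apply: inPL.
pose E : submod (amod O) := @SubMod _ (amod O) (fun x => inP (D x)) E0 EL.
have hE x : E x -> inspan P x.
  move=> [q hq]; have [f [f1 f2]] := spec2 a (gone G O).
  have xE : x = f (D x) by rewrite /D -kh_gmap f2 gmulx1 (@kh_uniq _ a (khom_id O)) // gmap_id.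
  pose eps := kh (gone G (kself k)); exists (fun t => eps (q t)).
  have g1 y : kh (gone G O) y = kstr O (eps y).
    pose u : khom (kself k) O := @KHom k (kself k) O (kstr O) (fun=> erefl).
    by rewrite -(gmap1 G u) kh_gmap.
  rewrite [LHS]xE hq rmorph_sum; apply: eq_bigr => t _; rewrite f1 g1 mulrC.
  by congr (_ * _); rewrite (@kh_uniq _ a (khom_id O)) // gmap_id.
have [n [m [hm mE mspan]]] := submod_basis hk tO hE.
have key j : exists c : 'I_n -> O, D (m j) = \sum_i ctL O O (m i : O) * ctR O O (c i).
  have [q hq] := mE j.
  have [V [h [hh hw]]] := common_factors hk tO (@ctens_gen O O)
    ([seq D (q t) | t <- enum 'I_s] ++ [seq ctR O O (q t) | t <- enum 'I_s]).
  have /choice[w wE] : forall t, exists w : 'I_V -> O,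
      D (q t) = \sum_v ctL O O (w v) * ctR O O (h v : O).
    by move=> t; apply: hw; rewrite mem_cat; apply/orP; left; apply: (map_f (fun t => D (q t))); rewrite mem_enum.
  have [q' q'E] : exists q' : 'I_s -> 'I_V -> k, forall t, q t = \sum_v kstr O (q' t v) * (h v : O).
    pose eps := kh (gone G (kself k)).
    have /choice[u uE] : forall t, exists u : 'I_V -> O,
        ctR O O (q t) = \sum_v ctL O O (u v) * ctR O O (h v : O).
      by move=> t; apply: hw; rewrite mem_cat; apply/orP; right; apply: (map_f (fun t => ctR O O (q t))); rewrite mem_enum.
    (* Applying the counit to the left factor turns the coefficients of [q t] along [h] into
       scalars. *)
    exists (fun t v => eps (u t v)) => t.
    pose i0 : khom (kself k) O := @KHom k (kself k) O (kstr O) (fun=> erefl).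
    have [f [f1 f2]] := ctens_lift (khom_comp i0 eps) (khom_id O).
    rewrite -[LHS]f2 uE rmorph_sum; apply: eq_bigr => v _.
    by rewrite rmorphM f1 f2.
  pose f' v : amod O := \sum_t q' t v *: P t.
  have mjE : D (m j) = \sum_v ctL O O (f' v : O) * ctR O O (h v : O).
    rewrite hq; under [RHS]eq_bigr do rewrite rmorph_sum mulr_suml.
    rewrite exchange_big; apply: eq_bigr => t _ /=; rewrite q'E rmorph_sum mulr_sumr.
    apply: eq_bigr => v _; rewrite -[q' t v *: P t]/(kstr O (q' t v) * (P t : O)).
    by rewrite !rmorphM !khomP mulrCA mulrA.
  pose N v : amod T2 := \sum_t ctL O O (P t : O) * ctR O O (w t v).
  pose T3 := ctens T2 O.
  (* Coassociativity: the two ways of applying the comultiplication twice to [m j] are compared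
     along the last factors [h v]. *)
  have e0 : \sum_v (h v : O) *: bc_in O ((D (f' v) : amod T2) - N v) = 0.
    pose gX : G T3 := gx O (gx O a); pose gY : G T3 := gx O (gy O a).
    pose gZ : G T3 := gy T2 a.
    have D3 x : kh (gmul gX gY) x = ctL T2 O (D x) by rewrite -gmapM kh_gmap.
    have sp (g1 g2 : G T3) x n' (b c : 'I_n' -> O) :
        D x = \sum_i ctL O O (b i) * ctR O O (c i) ->
        kh (gmul g1 g2) x = \sum_i kh g1 (b i) * kh g2 (c i).
      move=> xE; have [f [f1 f2]] := spec2 g1 g2; rewrite -f2 kh_gmap -/(D x) xE rmorph_sum.
      by apply: eq_bigr => i _; rewrite f1.
    have e1 := sp (gmul gX gY) gZ _ _ _ _ mjE.
    have e2 := sp gX (gmul gY gZ) _ _ _ _ hq.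
    have hZ x : kh gZ x = ctR T2 O x by rewrite kh_gmap (@kh_uniq _ a (khom_id O)) // gmap_id.
    have hX x : kh gX x = ctL T2 O (ctL O O x).
      by rewrite !kh_gmap (@kh_uniq _ a (khom_id O)) // gmap_id.
    have hY x : kh gY x = ctL T2 O (ctR O O x).
      by rewrite !kh_gmap (@kh_uniq _ a (khom_id O)) // gmap_id.
    rewrite gmulA e1 in e2.
    transitivity (\sum_v ctL T2 O (D (f' v)) * ctR T2 O (h v : O) -
                  \sum_v ctL T2 O (N v : T2) * ctR T2 O (h v : O)).
      rewrite -sumrB; apply: eq_bigr => v _.
      by rewrite -mulrBl -rmorphB mulrC -ctZE ctLE.
    apply/eqP; rewrite subr_eq0; apply/eqP.
    transitivity (\sum_i kh (gmul gX gY) (f' i) * kh gZ (h i : O)).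
      by apply: eq_bigr => v _; rewrite D3 hZ.
    rewrite e2; under eq_bigr => t _ do rewrite (sp gY gZ _ _ _ _ (wE t)) mulr_sumr.
    rewrite exchange_big; apply: eq_bigr => v _ /=; rewrite rmorph_sum mulr_suml.
    by apply: eq_bigr => t _; rewrite hX hY hZ mulrA -rmorphM.
  (* The equational criterion rearranges the sum so that each new left factor [f'' l] has a
     comultiplication with left factors in the span of [P]; these left factors lie in [E]. *)
  have [r [e [d [hd dN]]]] := bc_zero hk tO e0.
  pose f'' l : amod O := \sum_v d v l *: f' v.
  have f''E l : E (f'' l).
    have -> : smod_mem E (f'' l) = inP (D (f'' l)) by [].
    have -> : D (f'' l) = \sum_v kstr T2 (d v l) * (N v : T2).
      have DZ b (x : amod O) : D (b *: x) = kstr T2 b * D x.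
        by have := Dl x 0 b; rewrite addr0 => ->; rewrite {2}/D rmorph0 addr0.
      have Ds (F : 'I_V -> amod O) : D (\sum_v F v) = \sum_v D (F v) by rewrite /D rmorph_sum.
      rewrite Ds; apply/eqP; rewrite -subr_eq0 -sumrB; apply/eqP; rewrite -[RHS](dN l).
      by apply: eq_bigr => v _; rewrite DZ -mulrBr.
    apply: big_ind => // [x y hx hy|v _].
      by have := inPL 1 _ _ hx hy; rewrite rmorph1 mul1r.
    rewrite -[X in inP X]addr0; apply: inPL => //.
    by exists (fun t => w t v).
  have /choice[b hb] : forall l, exists b : 'I_n -> k, f'' l = \sum_i b i *: m i.
    by move=> l; apply: mspan.
  exists (fun i => \sum_l kstr O (b l i) * (e l : O)); rewrite mjE.
  transitivity (\sum_l ctL O O (f'' l : O) * ctR O O (e l : O)).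
    under [RHS]eq_bigr do rewrite rmorph_sum mulr_suml.
    rewrite exchange_big; apply: eq_bigr => v _ /=; rewrite hd [ctR O O _]rmorph_sum mulr_sumr.
    apply: eq_bigr => l _; rewrite -[d v l *: f' v]/(kstr O (d v l) * (f' v : O)).
    rewrite -[d v l *: e l]/(kstr O (d v l) * (e l : O)).
    by rewrite !rmorphM !khomP mulrCA mulrA.
  under [RHS]eq_bigr do rewrite rmorph_sum mulr_sumr.
  rewrite [RHS]exchange_big; apply: eq_bigr => l _ /=; rewrite hb rmorph_sum mulr_suml.
  apply: eq_bigr => i _; rewrite -[b l i *: m i]/(kstr O (b l i) * (m i : O)).
  by rewrite !rmorphM !khomP mulrCA mulrA.
have [c hc] := choice key.
exists n, m, c; split=> // [S g h j|x xs'].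
  have [f [f1 f2]] := spec2 g h; rewrite -f2 kh_gmap -/(D (m j)) hc rmorph_sum.
  by apply: eq_bigr => i _; rewrite f1.
apply: mspan; have [w wE] := PD _ (map_f D xs').
exists w; rewrite wE; apply: eq_bigr => t _; exact: mulrC.
Qed.
End Represented.

Lemma linear_bc_basis (k : comPzRingType) (M : lmodType k) n (e : 'I_n -> M)
    (he : isbasis e) (S : kalg k) (Q : lmodType S) (f g : bc M S -> Q) :
  linear f -> linear g -> (forall i, f (bc_in S (e i)) = g (bc_in S (e i))) -> f =1 g.
Proof.
move=> lf lg h z; rewrite -[z](bcrK he) /bcv (linear_sum' _ _ _ lf) (linear_sum' _ _ _ lg).
by apply: eq_bigr => i _; rewrite (linearZ' _ _ lf) (linearZ' _ _ lg) h.
Qed.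

Section Tannaka.
Variables (k : comNzRingType) (p : k) (hk : is_dvr p) (G : grpfun k).
Variables (O : kalg k) (a : G O) (ha : represents a) (tO : tf p (amod O)).
Local Notation kh := (kh ha).
Local Notation T2 := (ctens O O).

(* theta : X -> O is viewed as a family of functions on G; evx theta g is   *)
(* its value at the point g.                                                *)
Section Equivariant.
Variables (X : rep G) (theta : X -> amod O) (lt : linear theta).
Definition evx_f S (g : G S) (x : X) : S^o := kh g (theta x : O).
Lemma evx_semilin S (g : G S) : semilin (R := S) (evx_f g).
Proof.
split=> [x y|b x]; rewrite /evx_f.
  by rewrite (linearD' _ _ lt); apply: (rmorphD (kh g)).
rewrite (linearZ' _ _ lt); transitivity (kh g (kstr O b * (theta x : O))); first by [].
by rewrite rmorphM khomP.
Qed.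
Definition evx S (g : G S) (z : bc X S) : S := uext (evx_f g) z.
Lemma evx_in S (g : G S) x : evx g (bc_in S x) = kh g (theta x : O).
Proof. exact: (uext_gen _ (evx_semilin g)). Qed.
Lemma evx_linear S (g : G S) : linear (evx g : bc X S -> S^o).
Proof. exact: (uext_linear (evx_semilin g)). Qed.
Lemma evxL S (g : G S) s z t : evx g (s *: z + t) = s * evx g z + evx g t.
Proof. exact: (uext_linear (evx_semilin g)). Qed.
Lemma evx0 S (g : G S) : evx g 0 = 0.
Proof. exact: (linear0' (@evx_linear S g)). Qed.
Lemma evx_push S S' (f : khom S S') (g : G S) z :
  evx (gmap f g) (bcpush f z) = f (evx g z).
Proof.
elim/bc_ind: z => [s x z IH|]; last by rewrite bcpush0 !evx0 rmorph0.
by rewrite bcpush_linear !evxL IH bcpush_in !evx_in kh_gmap rmorphD rmorphM.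
Qed.
(** [theta] is a morphism to the regular representation, on which the group acts by right
    translation of functions. *)
Definition equivar : Prop := forall S (g h : G S) z,
  evx g (ract X S h z) = evx (gmul g h) z.
End Equivariant.
Arguments evx {X} theta {S} g z.
Arguments evx_in {X theta} lt {S} g x.
Arguments evx_linear {X theta} lt S g : rename.
Arguments evxL {X theta} lt {S} g s z t.
Arguments evx0 {X theta} lt {S} g.
Arguments evx_push {X theta} lt {S S'} f g z.
Arguments equivar {X} theta.

(** The matrix [C] of the functions [c j i] is shown to be a representation at universal points:
    both sides of [CM] and [C1] are coefficients along the family [m], which stays independent over
    a torsion-free algebra ([sum0]). Other points are specializations. *)
Lemma stable_rep (xs : seq O) : exists (E : rep G) (theta : E -> amod O),
  [/\ linear theta, injective theta, equivar theta &
      forall x, x \in xs -> exists e, theta e = x].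
Proof.
have [n [m [c [hm hc hx]]]] := stable_basis hk ha tO xs.
pose C S (g : G S) : 'M[S]_n := \matrix_(j, i) kh g (c j i).
have tT2 : tf p (amod T2) := ctens_tf hk tO tO.
pose T3 := ctens O T2.
have hxO (x : O) : kh a x = x by rewrite (kh_uniq ha (f := khom_id O)) // gmap_id.
have sum0 (A : kalg k) (tA : tf p (amod A)) (u v : 'I_n -> A) :
    \sum_i ctL O A (m i : O) * ctR O A (u i) = \sum_i ctL O A (m i : O) * ctR O A (v i) ->
    u =1 v.
  move=> e i; apply/eqP; rewrite -subr_eq0; apply/eqP; move: i.
  apply: (bc_indep hk tA (n := m) (a := fun i => u i - v i) hm).
  transitivity (\sum_i ctL O A (m i : O) * ctR O A (u i) -
                \sum_i ctL O A (m i : O) * ctR O A (v i)); last by rewrite e subrr.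
  rewrite -sumrB; apply: eq_bigr => i _.
  by rewrite -mulrBr -rmorphB mulrC -ctZE ctLE.
have CM S (g h : G S) : C S (gmul g h) = C S h *m C S g.
  have e : C T2 (gmul (gx O a) (gy O a)) = C T2 (gy O a) *m C T2 (gx O a).
    apply/matrixP => j l; rewrite [LHS]mxE; move: l.
    pose X : G T3 := gmap (ctL O T2) a.
    pose Y : G T3 := gmap (ctR O T2) (gx O a).
    pose Z : G T3 := gmap (ctR O T2) (gy O a).
    have hX x : kh X x = ctL O T2 x by rewrite kh_gmap hxO.
    apply: (sum0 T2 tT2) => /=.
    transitivity (kh (gmul X (gmul Y Z)) (m j : O)).
      rewrite hc; apply: eq_bigr => i _; rewrite hX -kh_gmap gmapM.
      by [].
    rewrite gmulA hc.
    transitivity (\sum_i (\sum_l kh X (m l : O) * kh Y (c i l)) * kh Z (c j i)).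
      by apply: eq_bigr => i _; rewrite -hc.
    under [LHS]eq_bigr => i _ do rewrite mulr_suml.
    rewrite exchange_big; apply: eq_bigr => l _ /=; rewrite mxE rmorph_sum mulr_sumr.
    apply: eq_bigr => i _; rewrite !mxE rmorphM -!kh_gmap hX.
    by rewrite -mulrA [X in _ * X]mulrC.
  have [f [f1 f2]] := ctens_lift (kh g) (kh h).
  have fX : gmap f (gx O a) = g.
    rewrite -gmap_comp -[RHS](khP ha); congr (gmap _ a).
    by apply: khom_eq => x; apply: f1.
  have fY : gmap f (gy O a) = h.
    rewrite -gmap_comp -[RHS](khP ha); congr (gmap _ a).
    by apply: khom_eq => x; apply: f2.
  have Cf (g' : G T2) : C S (gmap f g') = map_mx f (C T2 g').
    by apply/matrixP => i j; rewrite !mxE kh_gmap.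
  by rewrite -fX -fY -gmapM Cf e map_mxM -!Cf.
have Cmap S S' (f : khom S S') (g : G S) : C S' (gmap f g) = map_mx f (C S g).
  by apply/matrixP => i j; rewrite !mxE kh_gmap.
have C1 S : C S (gone G S) = 1%:M.
  have CO : C O (gone G O) = 1%:M.
    apply/matrixP => j l; rewrite [LHS]mxE [RHS]mxE; move: l; apply: (sum0 O tO).
    transitivity (kh (gmul (gmap (ctL O O) a) (gone G T2)) (m j : O)).
      rewrite hc; apply: eq_bigr => i _; rewrite kh_gmap hxO -(gmap1 G (ctR O O)) kh_gmap.
      by [].
    rewrite gmulx1 kh_gmap hxO (bigD1 j isT) eqxx rmorph1 mulr1 big1 /= ?addr0 // => i ij.
    by rewrite eq_sym (negPf ij) rmorph0 mulr0.
  pose eps := kh (gone G (kself k)); pose io S : khom (kself k) S := @KHom k (kself k) S (kstr S) (fun=> erefl).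
  have hS S' : C S' (gone G S') = map_mx (io S') (C (kself k) (gone G (kself k))).
    by rewrite -Cmap gmap1.
  have hk0 : C (kself k) (gone G (kself k)) = map_mx eps (C O (gone G O)).
    by rewrite -Cmap gmap1.
  by rewrite hS hk0 CO !map_mx1.
pose E := matrix_rep CM C1 Cmap.
pose bE := rV_basis k n.
pose theta (x : E) : amod O := \sum_i (x : 'rV[k]_n) 0 i *: m i.
have lt : linear theta.
  move=> b x y; rewrite /theta scaler_sumr -big_split; apply: eq_bigr => i _ /=.
  by rewrite !mxE scalerDl scalerA.
have te j : theta (delta_mx 0 j) = m j.
  rewrite /theta (bigD1 j isT) !mxE !eqxx scale1r big1 /= ?addr0 // => i ij.
  by rewrite !mxE (negPf ij) scale0r.
exists E, theta; split=> //.
- move=> x y xy; apply/rowP; exact: (indep_inj hm xy).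
- move=> S g h z; apply: (@linear_bc_basis k E n _ bE S (S^o)
    (fun z => evx theta g (ract E S h z)) (evx theta (gmul g h))).
  + by move=> b x y; rewrite (Defs.lfunP (ract E S h)); apply: evx_linear.
  + exact: evx_linear.
  move=> j; rewrite (evx_in lt) te hc.
  have -> : ract E S h (bc_in S (delta_mx 0 j : E)) =
      \sum_i C S h j i *: bc_in S (delta_mx 0 i : E).
    apply: (bcr_inj (he := bE)); rewrite matrix_repE bcr_in_e -rowE.
    rewrite (linear_sum' _ _ _ (bcr_linear bE S)); apply/rowP => i; rewrite summxE mxE.
    rewrite (bigD1 i isT) (linearZ' _ _ (bcr_linear bE S)) bcr_in_e !mxE !eqxx mulr1.
    rewrite big1 /= ?addr0 // => l li.
    by rewrite (linearZ' _ _ (bcr_linear bE S)) bcr_in_e !mxE eq_sym (negPf li) mulr0.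
  rewrite (linear_sum' _ _ _ (evx_linear lt S g)); apply: eq_bigr => i _.
  rewrite (linearZ' _ _ (evx_linear lt S g)) (evx_in lt) te mxE.
  exact: mulrC.
move=> x /hx[b xE]; exists (\row_i b i); rewrite xE /theta; apply: eq_bigr => i _.
by rewrite mxE.
Qed.

(** As [O] is torsion-free, the functions of a basis of [E] stay independent after base change to
    [O] ([inj2]). Hence the equivariance of [u] can be tested on functions at the universal point,
    where it is the equivariance of [tX] and [tE]. *)
Lemma factor_rep (X E : rep G) (tX : X -> amod O) (tE : E -> amod O)
    (lX : linear tX) (lE : linear tE) :
  equivar tX -> equivar tE -> injective tE -> (forall x, exists e, tE e = tX x) ->
  exists u : X -> E, rep_mor u /\ forall x, tE (u x) = tX x.
Proof.
move=> eX eE iE hXE; have [u hu] := choice hXE.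
have lu : linear u by move=> b x y; apply: iE; rewrite [LHS]hu [LHS]lX [RHS]lE -!hu.
have evu S (g : G S) z : evx tE g (bcmap u z) = evx tX g z.
  apply: (@linear_bc_eq k X S (S^o) (fun z => evx tE g (bcmap u z)) (evx tX g)).
  - by move=> b x y; rewrite (bcmap_linear lu); apply: evx_linear.
  - exact: evx_linear.
  - by move=> x; rewrite bcmap_in // (evx_in lE) (evx_in lX) hu.
have [n [e he]] := fgproj_basis hk (@rmodP _ _ E).
have hind : indep (fun i => tE (e i)).
  move=> b; under eq_bigr do rewrite -(linearZ' _ _ lE).
  by rewrite -(linear_sum' _ _ _ lE) -(linear0' lE) => /iE; apply: he.1.
have inj2 (d : bc E O) : evx tE (gx O a) (bcpush (ctR O O) d) = 0 -> d = 0.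
  rewrite -[d](bcrK he) /bcv; set v := bcr he d => h.
  suff v0 i : v 0 i = 0 by rewrite big1 // => i _; rewrite v0 scale0r.
  apply: (bc_indep hk tO (n := fun i => tE (e i)) (a := fun i => v 0 i) hind).
  rewrite -[RHS]h; elim/big_rec2: _ => [|j y z _ ->]; first by rewrite bcpush0 (evx0 lE).
  rewrite bcpush_linear (evxL lE) bcpush_in (evx_in lE) kh_gmap; congr (_ + _).
  by rewrite (kh_uniq ha (f := khom_id O)) ?gmap_id // ctZE -ctLE.
exists u; split=> //; split=> // S h z.
have key x : bcmap u (ract X O a (bc_in O x)) = ract E O a (bcmap u (bc_in O x)).
  apply/eqP; rewrite -subr_eq0; apply/eqP/inj2.
  rewrite (_ : bcpush (ctR O O) _ = bcpush (ctR O O) (bcmap u (ract X O a (bc_in O x))) -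
     bcpush (ctR O O) (ract E O a (bcmap u (bc_in O x)))); last first.
    by rewrite -scaleN1r addrC bcpush_linear rmorphN1 scaleN1r addrC.
  rewrite (linearB' _ _ (evx_linear lE _ _)) bcpush_map //.
  have pa (Y : rep G) z' : bcpush (ctR O O) (ract Y O a z') = ract Y T2 (gy O a) (bcpush (ctR O O) z').
    by rewrite /gy ghom_nat; symmetry; apply: gl_mapE.
  by rewrite !pa evu eX eE bcpush_map // evu subrr.
apply: (@linear_bc_eq k X S (bc E S) (fun z => bcmap u (ract X S h z))
  (fun z => ract E S h (bcmap u z))).
- by move=> b x y; rewrite (Defs.lfunP (ract X S h)) (bcmap_linear lu).
- by move=> b x y; rewrite (bcmap_linear lu) (Defs.lfunP (ract E S h)).
move=> x; rewrite -(khP ha h); set f := kh h.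
have pa (Y : rep G) z' : ract Y S (gmap f a) (bcpush f z') = bcpush f (ract Y O a z').
  by rewrite ghom_nat; apply: gl_mapE.
by rewrite -(bcpush_in f) pa -bcpush_map // key -pa bcpush_map.
Qed.

Section Unit.
Definition theta1 (x : rep_unit G) : amod O := kstr O (x : k).
Lemma theta1_linear : linear theta1.
Proof. by move=> b x y; rewrite /theta1 rmorphD rmorphM. Qed.
Lemma theta1_equivar : equivar theta1.
Proof.
move=> S g h z.
apply: (@linear_bc_eq k (rep_unit G) S (S^o) (evx theta1 g) (evx theta1 (gmul g h))).
- exact: (evx_linear theta1_linear).
- exact: (evx_linear theta1_linear).
by move=> x; rewrite !(evx_in theta1_linear) /theta1 !khomP.
Qed.
End Unit.

Section TensorFunctions.
Variables (X Y : rep G) (tX : X -> amod O) (tY : Y -> amod O).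
Hypotheses (lX : linear tX) (lY : linear tY) (eX : equivar tX) (eY : equivar tY).
Definition thetaM_bil (x : X) (y : Y) : amod O := (tX x : O) * (tY y : O).
Lemma thetaM_bilin : bilin thetaM_bil.
Proof.
split=> [y b x x'|x b y y']; rewrite /thetaM_bil.
  rewrite lX; transitivity ((kstr O b * (tX x : O) + (tX x' : O)) * (tY y : O)); first by [].
  by rewrite mulrDl -mulrA.
rewrite lY; transitivity ((tX x : O) * (kstr O b * (tY y : O) + (tY y' : O))); first by [].
by rewrite mulrDr mulrCA.
Qed.
Definition thetaM : rep_tens X Y -> amod O := tens_ext thetaM_bil.
Lemma thetaM_linear : linear thetaM. Proof. exact: (uext_linear thetaM_bilin). Qed.
Lemma thetaM_in x y : thetaM (tens_in x y) = thetaM_bil x y.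
Proof. exact: (uext_gen _ thetaM_bilin). Qed.
Lemma evx_tens S (g : G S) z t :
  evx thetaM g (bctens z t) = evx tX g z * evx tY g t.
Proof.
have hb := tens_inP X Y.
elim/bc_ind: z => [b x z IH|]; last first.
  by rewrite /bctens (linear0' (bcbilin_linear1 _ hb)) (evx0 thetaM_linear) (evx0 lX) mul0r.
rewrite /bctens (bcbilin_linear1 _ hb) -/bctens (evxL thetaM_linear) (evxL lX) mulrDl -IH -mulrA; congr (_ * _ + _).
elim/bc_ind: t {IH} => [b' y t IH|]; last first.
  by rewrite /bctens (linear0' (bcbilin_linear2 _ hb)) (evx0 thetaM_linear) (evx0 lY) mulr0.
rewrite /bctens (bcbilin_linear2 _ hb) -/bctens (evxL thetaM_linear) (evxL lY) mulrDr -IH mulrCA; congr (_ * _ + _).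
by rewrite /bctens bcbilin_in // (evx_in thetaM_linear) (evx_in lX) (evx_in lY) [thetaM _]thetaM_in /thetaM_bil rmorphM.
Qed.
Lemma thetaM_equivar : equivar thetaM.
Proof.
move=> S g h z; apply: (@bctens_eq k X Y S (S^o)
  (fun z => evx thetaM g (ract (rep_tens X Y) S h z)) (evx thetaM (gmul g h))).
- by move=> b x y; rewrite (Defs.lfunP (ract (rep_tens X Y) S h)); apply: (evx_linear thetaM_linear).
- exact: (evx_linear thetaM_linear).
move=> x y.
have -> : ract (rep_tens X Y) S h (bctens (bc_in S x) (bc_in S y)) =
    bctens (ract X S h (bc_in S x)) (ract Y S h (bc_in S y)).
  by apply: glt_tens; apply: Defs.lfunP.
by rewrite !evx_tens eX eY.
Qed.
End TensorFunctions.

Section Coefficient.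
Variables (X : rep G) (xi : X -> k) (lxi : linear (xi : X -> k^o)).
Definition ext_f (S : kalg k) (x : X) : S^o := kstr S (xi x).
Lemma ext_semilin S : semilin (R := S) (ext_f S).
Proof.
split=> [x y|b x]; rewrite /ext_f; first by rewrite (linearD' _ _ lxi) rmorphD.
by rewrite (linearZ' _ _ lxi) rmorphM.
Qed.
Definition ext (S : kalg k) (z : bc X S) : S := uext (ext_f S) z.
Lemma ext_in S x : ext (bc_in S x) = kstr S (xi x).
Proof. exact: (uext_gen _ (ext_semilin S)). Qed.
Lemma ext_linear S : linear (@ext S : bc X S -> S^o).
Proof. exact: (uext_linear (ext_semilin S)). Qed.
Lemma ext_push S S' (f : khom S S') z : ext (bcpush f z) = f (ext z).
Proof.
elim/bc_ind: z => [s x z IH|].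
  rewrite bcpush_linear [LHS](@ext_linear S') [ext (s *: _ + z)](@ext_linear S).
  by rewrite IH bcpush_in !ext_in rmorphD rmorphM khomP.
by rewrite bcpush0 [ext 0](linear0' (@ext_linear S')) [ext 0](linear0' (@ext_linear S)) rmorph0.
Qed.
Definition thetaC (x : X) : amod O := ext (ract X O a (bc_in O x)).
Lemma thetaC_linear : linear thetaC.
Proof.
move=> b x y; rewrite /thetaC bc_inD bc_inZ (Defs.lfunP (ract X O a)).
exact: ext_linear.
Qed.
Lemma evx_thetaC S (g : G S) z : evx thetaC g z = ext (ract X S g z).
Proof.
apply: (@linear_bc_eq k X S (S^o) (evx thetaC g) (fun z => ext (ract X S g z))).
- exact: (evx_linear thetaC_linear).
- by move=> b x y; rewrite (Defs.lfunP (ract X S g)); apply: ext_linear.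
move=> x; rewrite (evx_in thetaC_linear) /thetaC -ext_push; congr ext.
by rewrite -[in RHS](khP ha g) ghom_nat -(bcpush_in (kh g)); symmetry; apply: gl_mapE.
Qed.
Lemma thetaC_equivar : equivar thetaC.
Proof. by move=> S g h z; rewrite !evx_thetaC ghomM. Qed.
End Coefficient.

Lemma rep_ext S (g h : G S) :
  (forall (X : rep G) z, ract X S g z = ract X S h z) -> g = h.
Proof.
move=> e; apply: (kh_inj (ha := ha)) => x.
have [E [th [lt _ et hx]]] := stable_rep [:: x].
have [y <-] := hx x (mem_head _ _).
rewrite -!(evx_in lt) -[g in LHS]gmul1 -[h in RHS]gmul1 -!et e.
by [].
Qed.

(* phi acts on the unit object by an idempotent scalar. *)
Lemma unit_comp S (phi : forall X : rep G, bc X S -> bc X S) :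
  (forall X, linear (phi X)) ->
  (forall (X Y : rep G) (u : X -> Y), rep_mor u ->
     forall z, phi Y (bcmap u z) = bcmap u (phi X z)) ->
  (forall (X Y : rep G) z t, phi (rep_tens X Y) (bctens z t) = bctens (phi X z) (phi Y t)) ->
  injective (phi (rep_unit G)) -> forall z, phi (rep_unit G) z = z.
Proof.
move=> lphi nphi tphi iphi; set U := rep_unit G in iphi *.
pose e : bc U S := bc_in S ((1 : k) : U).
have inE (x : U) : bc_in S x = kstr S (x : k) *: e.
  by rewrite /e -bc_inZ; congr bc_in; rewrite [RHS]mulr1.
have zE (z : bc U S) : exists s, z = s *: e.
  elim/bc_ind: z => [b x z [s ->]|]; last by exists 0; rewrite scale0r.
  by exists (b * kstr S (x : k) + s); rewrite inE scalerA scalerDl.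
pose m (x y : U) : U := (x : k) * (y : k).
pose mu : rep_tens U U -> U := tens_ext m.
have bmu : bilin m.
  split=> [y b x x'|x b y y']; rewrite /m.
    by transitivity ((b * (x : k) + x') * y); rewrite // mulrDl -mulrA.
  by transitivity ((x : k) * (b * (y : k) + y')); rewrite // mulrDr mulrCA.
have lmu : linear mu by apply: (uext_linear bmu).
have hb := tens_inP U U.
have mmu : rep_mor mu.
  split=> // S' g z; congr bcmap.
  apply: (@bctens_eq k U U S' (bc (rep_tens U U) S') (ract (rep_tens U U) S' g) id) => //.
    exact: Defs.lfunP.
  by move=> x y; rewrite [LHS]glt_tens.
have muee : bcmap mu (bctens e e) = e.
  rewrite /bctens /e bcbilin_in // bcmap_in // /mu /tens_ext uext_gen //=.
  by congr bc_in; apply: mulr1.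
have [s se] := zE (phi U e).
have ss : s *: e = s *: phi U e.
  rewrite -[LHS]se -{1}muee nphi // tphi se /bctens (linearZ' _ _ (bcbilin_linear1 _ hb)).
  by rewrite (linearZ' _ _ (bcbilin_linear2 _ hb)) !(linearZ' _ _ (bcmap_linear lmu)) muee.
have pe : phi U e = e by apply: iphi; rewrite {1}se (linearZ' _ _ (lphi U)) -ss -se.
by move=> z; have [c ->] := zE z; rewrite (linearZ' _ _ (lphi U)) pe.
Qed.

(** A function [f = th e] is sent to the value at the identity of [th] on [phi E e]. Naturality
    makes this independent of [E], [th] and [e], compatibility with tensor products makes it
    multiplicative, and the unit object makes it [k]-linear. The resulting algebra map from [O] to
    [S] is the desired point; matrix coefficients recover [phi]. *)
Lemma tannaka S (phi : forall X : rep G, bc X S -> bc X S) :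
  (forall X, linear (phi X)) ->
  (forall (X Y : rep G) (u : X -> Y), rep_mor u ->
     forall z, phi Y (bcmap u z) = bcmap u (phi X z)) ->
  (forall (X Y : rep G) z t, phi (rep_tens X Y) (bctens z t) = bctens (phi X z) (phi Y t)) ->
  injective (phi (rep_unit G)) ->
  exists g : G S, forall X z, ract X S g z = phi X z.
Proof.
move=> lphi nphi tphi iphi; have uphi := unit_comp lphi nphi tphi iphi.
pose rel (f : O) (s : S) := exists (E : rep G) (th : E -> amod O) (lt : linear th) e,
  [/\ equivar th, th e = f & s = evx th (gone G S) (phi E (bc_in S e))].
have evmap (X Y : rep G) (tX : X -> amod O) (tY : Y -> amod O) (lX : linear tX)
    (lY : linear tY) (u : X -> Y) : linear u -> (forall x, tY (u x) = tX x) ->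
    forall (g : G S) z, evx tY g (bcmap u z) = evx tX g z.
  move=> lu hu g z; apply: (@linear_bc_eq k X S (S^o) (fun z => evx tY g (bcmap u z)) (evx tX g)).
  - by move=> b x y; rewrite (bcmap_linear lu); apply: evx_linear.
  - exact: evx_linear.
  - by move=> x; rewrite bcmap_in // (evx_in lY) (evx_in lX) hu.
have rel_fun f s s' : rel f s -> rel f s' -> s = s'.
  move=> [E [th [lt [e [et the ->]]]]] [E' [th' [lt' [e' [et' the' ->]]]]].
  have [n [b hb]] := fgproj_basis hk (@rmodP _ _ E).
  have [n' [b' hb']] := fgproj_basis hk (@rmodP _ _ E').
  (* A finite stable module of functions containing those of both [E] and [E'] receives morphisms
     from both, so the two values can be compared in it. *)
  have [F [tF [lF iF eF hF]]] := stable_rep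
    ([seq th (b i) : O | i <- enum 'I_n] ++ [seq th' (b' i) : O | i <- enum 'I_n']).
  have im (X : rep G) (tX : X -> amod O) (lX : linear tX) m (c : 'I_m -> X) : isbasis c ->
      (forall i, exists y, tF y = tX (c i)) -> forall x, exists y, tF y = tX x.
    move=> hc h x; have [al ->] := hc.2 x; have [y hy] := choice h.
    exists (\sum_i al i *: y i); rewrite (linear_sum' _ _ _ lF) (linear_sum' _ _ _ lX).
    by apply: eq_bigr => i _; rewrite (linearZ' _ _ lF) (linearZ' _ _ lX) hy.
  have [|u [[lu mu] uE]] := factor_rep lt lF et eF iF.
    apply: (im _ _ lt _ _ hb) => i; apply: hF; rewrite mem_cat; apply/orP; left.
    by apply: (map_f (fun i => th (b i) : O)); rewrite mem_enum.
  have [|u' [[lu' mu'] uE']] := factor_rep lt' lF et' eF iF.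
    apply: (im _ _ lt' _ _ hb') => i; apply: hF; rewrite mem_cat; apply/orP; right.
    by apply: (map_f (fun i => th' (b' i) : O)); rewrite mem_enum.
  have uu : u e = u' e' by apply: iF; rewrite uE uE' the the'.
  rewrite -(evmap E F th tF lt lF u lu uE) -(evmap E' F th' tF lt' lF u' lu' uE').
  by rewrite -!nphi // !bcmap_in // uu.
have rel_ex f : exists s, rel f s.
  have [E [th [lt _ et hx]]] := stable_rep [:: f].
  have [y hy] := hx f (mem_head _ _).
  by exists (evx th (gone G S) (phi E (bc_in S y))), E, th, lt, y.
have [s hs] := choice rel_ex.
have sE (E : rep G) (th : E -> amod O) (lt : linear th) e : equivar th ->
    s (th e) = evx th (gone G S) (phi E (bc_in S e)).
  by move=> et; apply: (rel_fun (th e)) => //; exists E, th, lt, e.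
have [sD sM] : (forall x y, s (x + y) = s x + s y) /\ (forall x y, s (x * y) = s x * s y).
  split=> x y; have [E [th [lt _ et hx]]] := stable_rep [:: x; y].
    have [u xE] := hx x (mem_head _ _).
    have [|v yE] := hx y; first by rewrite !inE eqxx orbT.
    rewrite -xE -yE; transitivity (s (th (u + v))); first by rewrite (linearD' _ _ lt).
    rewrite !(sE _ _ lt) // bc_inD (linearD' _ _ (lphi E)).
    exact: (linearD' _ _ (evx_linear lt S _)).
  have [u xE] := hx x (mem_head _ _).
  have [|v yE] := hx y; first by rewrite !inE eqxx orbT.
  rewrite -xE -yE; have eM := thetaM_equivar lt lt et et.
  rewrite -[th u * th v]/(thetaM_bil th th u v) -(thetaM_in lt lt) (sE _ _ (thetaM_linear lt lt) _ eM).
  have -> : bc_in S (tens_in u v) = bctens (bc_in S u) (bc_in S v) :> bc (rep_tens E E) S.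
    by rewrite /bctens bcbilin_in //; apply: tens_inP.
  by rewrite tphi (evx_tens lt lt) -!(sE _ _ lt _ et).
have s1 b : s (kstr O b) = kstr S b.
  transitivity (evx theta1 (gone G S) (phi (rep_unit G) (bc_in S (b : rep_unit G)))).
    exact: (sE (rep_unit G) theta1 theta1_linear b theta1_equivar).
  by rewrite uphi (evx_in theta1_linear); apply: khomP.
have s11 : s 1 = 1 by rewrite -(rmorph1 (kstr O)) s1 rmorph1.
pose f : khom O S := @KHom k O S (@rhom O S s sD sM s11) s1.
exists (gmap f a) => X z.
have [n [b hb]] := fgproj_basis hk (@rmodP _ _ X).
apply: (@linear_bc_eq k X S (bc X S) (ract X S (gmap f a)) (phi X)) => [||x].
- exact: Defs.lfunP.
- exact: lphi.
apply: (bcr_inj (he := hb)); apply/rowP => j.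
pose xi (x : X) : k := crd hb x 0 j.
have lxi : linear (xi : X -> k^o).
  by move=> c u v; rewrite /xi crd_linear !mxE.
have extE S' (t : bc X S') : @ext X xi S' t = bcr hb t 0 j.
  apply: (@linear_bc_eq k X S' (S'^o) (@ext X xi S') (fun t => bcr hb t 0 j)).
  - exact: ext_linear.
  - by move=> c u v; rewrite bcr_linear !mxE.
  - by move=> u; rewrite ext_in // bcr_in mxE.
rewrite -!extE -(evx_thetaC lxi) (evx_in (thetaC_linear lxi)) kh_of.
transitivity (s (thetaC xi x)); first by [].
by rewrite (sE _ _ (thetaC_linear lxi) _ (thetaC_equivar lxi)) (evx_thetaC lxi) ghom1.
Qed.
End Tannaka.

(** * Actions of diagonalizable groups *)

Lemma malg_expand (k : comPzRingType) (M : nmodType) (z : malg k M) (cs : seq M) :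
  uniq cs -> (forall c, c \notin cs -> mcoef c z = 0) -> z = \sum_(c <- cs) mcoef c z *: me c.
Proof.
move=> ucs h; apply: mcoef_inj => m; rewrite mcoef_sum.
have [mcs|mcs] := boolP (m \in cs); last first.
  rewrite h // big_seq big1 // => c ccs; rewrite mcoefZ mcoef_e.
  by case: eqP ccs => [->|_]; rewrite ?(negPf mcs) ?mulr0.
rewrite (bigD1_seq m) //= mcoefZ mcoef_e eqxx mulr1 big1 ?addr0 // => c /negPf cm.
by rewrite mcoefZ mcoef_e cm mulr0.
Qed.

Section GroupAlgebra.
Variables (k : comPzRingType) (M : zmodType).
(** The group algebra of [M] over [S] is the coordinate ring of the diagonalizable group, with
    universal point [univ_char]. Identities for all points [d] are obtained by comparing
    coefficients of characters at this point. *)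
Definition galg (S : kalg k) : kalg k := @KAlg k (malg S M) (mconst M \o kstr S).
Definition ginc (S : kalg k) : khom S (galg S) :=
  @KHom k S (galg S) (mconst M) (fun a => erefl).
Lemma univ_charP (S : kalg k) : is_char (R := galg S) (fun c : M => me c : malg S M).
Proof. by split=> [//|x y]; rewrite meM. Qed.
Definition univ_char (S : kalg k) : Dgrp k M (galg S) :=
  exist _ (fun c : M => me c : malg S M) (univ_charP S).
Lemma galg_lift (S B : kalg k) (f : khom S B) (d : Dgrp k M B) :
  exists h : khom (galg S) B, [/\ forall c, h (me c : malg S M) = sval d c,
    forall s, h (ginc S s) = f s & gmap h (univ_char S) = d].
Proof.
pose h := mhom (f : {rmorphism S -> B}) (svalP d).1 (svalP d).2.
have hk a : h (kstr (galg S) a) = kstr B a by rewrite -(khomP f); apply: mhomC.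
exists (@KHom k (galg S) B h hk); split=> [c|s|]; first exact: mhom_e.
  exact: mhomC.
by apply: sig_eq; apply: funext => c; apply: mhom_e.
Qed.
End GroupAlgebra.
Arguments ginc {k} M S.
Arguments univ_char {k} M S.

Section GroupAlgebraModule.
Variables (k : comPzRingType) (N : lmodType k) (n : nat) (e : 'I_n -> N) (he : isbasis e).
Variables (M : zmodType) (S : kalg k).
Definition gcf (c : M) (z : bc N (galg M S)) : bc N S :=
  bcv e (map_mx (mcoef c : malg S M -> S) (bcr he z)).
Lemma gcfD c x y : gcf c (x + y) = gcf c x + gcf c y.
Proof.
rewrite /gcf -(linearD' _ _ (bcv_linear S)) (linearD' _ _ (bcr_linear he _)).
by congr bcv; apply/rowP => i; rewrite !mxE mcoefD.
Qed.
Lemma gcf0 c : gcf c 0 = 0.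
Proof. by apply: (addrI (gcf c 0)); rewrite -gcfD !addr0. Qed.
Lemma gcf_sum c I (r : seq I) (P : pred I) F :
  gcf c (\sum_(i <- r | P i) F i) = \sum_(i <- r | P i) gcf c (F i).
Proof. exact: (big_morph _ (gcfD c) (gcf0 c)). Qed.
Lemma gcfE c s z : gcf c (s *: bcpush (ginc M S) z) = mcoef c (s : malg S M) *: z.
Proof.
apply: (bcr_inj (he := he)); rewrite /gcf bcvK (linearZ' _ _ (bcr_linear he _)).
rewrite (linearZ' _ _ (bcr_linear he _)) bcr_push; apply/rowP => i; rewrite !mxE.
by rewrite mulrC [X in mcoef c X]mconstM mcoefZ mulrC.
Qed.
Lemma gcf_char c c' z : gcf c ((me c' : malg S M) *: bcpush (ginc M S) z) =
  if c' == c then z else 0.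
Proof. by rewrite gcfE mcoef_e; case: eqP => _; rewrite ?scale1r ?scale0r. Qed.
Lemma gcf_chars (cs : seq M) (z : M -> bc N S) c : uniq cs -> c \in cs ->
  gcf c (\sum_(c' <- cs) (me c' : malg S M) *: bcpush (ginc M S) (z c')) = z c.
Proof.
move=> ucs ccs; rewrite gcf_sum (bigD1_seq c) //= gcf_char eqxx big1 ?addr0 //.
by move=> c' /negPf h; rewrite gcf_char h.
Qed.
End GroupAlgebraModule.

Section Decomposition.
Variables (k : comNzRingType) (N : lmodType k) (n : nat) (e : 'I_n -> N) (he : isbasis e).
Variables (M : zmodType) (rho : ghom (Dgrp k M) (GL N)).

Definition isw (c : M) (x : N) : Prop := forall S (d : Dgrp k M S),
  rho S d (bc_in S x) = sval d c *: bc_in S x.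
Lemma isw0 c : isw c 0.
Proof. by move=> S d; rewrite bc_in0 scaler0 (linear0' (Defs.lfunP _)). Qed.
Lemma iswL c b x y : isw c x -> isw c y -> isw c (b *: x + y).
Proof.
move=> hx hy S d; rewrite bc_inD bc_inZ (Defs.lfunP (rho S d)) hx hy scalerDr !scalerA.
by rewrite mulrC.
Qed.

Definition cfk (M' : zmodType) (m : M') (z : bc N (galg M' (kself k))) : N :=
  \sum_j mcoef m (bcr he z 0 j : malg k M') *: e j.
Lemma cfkD (M' : zmodType) (m : M') x y : cfk m (x + y) = cfk m x + cfk m y.
Proof.
rewrite /cfk -big_split (linearD' _ _ (bcr_linear he _)); apply: eq_bigr => j _ /=.
by rewrite mxE mcoefD scalerDl.
Qed.
Lemma cfk0 (M' : zmodType) (m : M') : cfk m 0 = 0.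
Proof. by apply: (addrI (cfk m 0)); rewrite -cfkD !addr0. Qed.
Lemma cfk_sum (M' : zmodType) (m : M') I (r : seq I) (P : pred I) F :
  cfk m (\sum_(i <- r | P i) F i) = \sum_(i <- r | P i) cfk m (F i).
Proof. exact: (big_morph _ (cfkD m) (cfk0 m)). Qed.
Lemma cfkE (M' : zmodType) (m : M') s x :
  cfk m (s *: bc_in _ x) = mcoef m (s : malg k M') *: x.
Proof.
rewrite [x in RHS](crdE he) scaler_sumr; apply: eq_bigr => j _.
rewrite (linearZ' _ _ (bcr_linear he _)) bcr_in !mxE mulrC.
by rewrite [X in mcoef m X]mconstM mcoefZ scalerA mulrC.
Qed.

(** The coefficient of the character [c] in the coaction on [x]; it is the projection to the weight
    space of [c]. *)
Definition dP (c : M) (x : N) : N :=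
  cfk c (rho (galg M (kself k)) (univ_char M (kself k)) (bc_in _ x)).
Lemma dP_linear c : linear (dP c).
Proof.
move=> b x y; rewrite /dP bc_inD bc_inZ (Defs.lfunP (rho _ _)) cfkD; congr (_ + _).
elim/bc_ind: (rho _ _ _) => [s z t IH|]; last by rewrite scaler0 cfk0 scaler0.
rewrite scalerDr cfkD scalerA cfkE IH cfkD scalerDr cfkE; congr (_ + _).
by rewrite [kstr _ b * s]mconstM mcoefZ scalerA.
Qed.

Lemma dP_supp : exists cs : seq M, [/\ uniq cs, forall c x, c \notin cs -> dP c x = 0 &
  forall S d z, rho S d z = \sum_(c <- cs) sval d c *: bcmap (dP c) z].
Proof.
pose U i := bcr he (rho (galg M (kself k)) (univ_char M (kself k)) (bc_in _ (e i))).
have /choice[s hs] : forall ij : 'I_n * 'I_n, exists s : seq M,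
    (U ij.1 0 ij.2 : malg k M) = \sum_(m <- s) mcoef m (U ij.1 0 ij.2 : malg k M) *: me m.
  by move=> ij; have [s [_ h]] := malg_supp (U ij.1 0 ij.2 : malg k M); exists s.
pose cs := undup (flatten [seq s ij | ij <- enum {: 'I_n * 'I_n}]).
have cU c i j : c \notin cs -> mcoef c (U i 0 j : malg k M) = 0.
  move=> ccs; rewrite (hs (i, j)) mcoef_sum big_seq big1 // => m ms.
  rewrite mcoefZ mcoef_e; case: eqP => [mc|_]; last by rewrite mulr0.
  case/negP: ccs; rewrite mem_undup -mc; apply/flatten_mapP.
  by exists (i, j); rewrite ?mem_enum.
have cs0 c x : c \notin cs -> dP c x = 0.
  move=> ccs; rewrite [x](crdE he) (linear_sum' _ _ _ (dP_linear c)) big1 // => i _.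
  rewrite (linearZ' _ _ (dP_linear c)) /dP /cfk big1 ?scaler0 // => j _.
  by rewrite [mcoef _ _](cU c i j ccs) scale0r.
exists cs; split=> //; first exact: undup_uniq.
move=> S d z; apply: (@linear_bc_basis k N n e he S (bc N S) (rho S d)
  (fun z => \sum_(c <- cs) sval d c *: bcmap (dP c) z)).
- exact: Defs.lfunP.
- move=> b x y; rewrite scaler_sumr -big_split; apply: eq_bigr => c _ /=.
  by rewrite (bcmap_linear (dP_linear c)) scalerDr !scalerA mulrC.
move=> i.
pose i0 : khom (kself k) S := @KHom k (kself k) S (kstr S) (fun=> erefl).
have [f [f1 f2 f3]] := galg_lift i0 d.
rewrite -[in LHS]f3 ghom_nat -[in LHS](bcpush_in f).
have -> : gmap f (rho _ (univ_char M (kself k))) (bcpush f (bc_in _ (e i))) =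
   bcpush f (rho _ (univ_char M (kself k)) (bc_in _ (e i))) by apply: gl_mapE.
apply: (bcr_inj (he := he)); rewrite bcr_push -/(U i).
rewrite [RHS](linear_sum' _ _ _ (bcr_linear he _)); apply/rowP => j.
transitivity (f (U i 0 j)); first by rewrite mxE.
have UE : U i 0 j = \sum_(c <- cs) mcoef c (U i 0 j : malg k M) *: me c.
  exact: (@malg_expand k M _ cs (undup_uniq _) (fun c => cU c i j)).
rewrite UE [LHS]rmorph_sum [RHS]summxE; apply: eq_bigr => c _; rewrite (linearZ' _ _ (bcr_linear he _)) mxE.
rewrite bcmap_in; last exact: dP_linear.
rewrite bcr_in mxE /dP /cfk (crd_sum he) mxE -/(U i).
rewrite -mconstM rmorphM f1 mulrC; congr (_ * _).
exact: f2.
Qed.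

Lemma bc_in_self_inj : injective (@bc_in k N (kself k)).
Proof.
move=> x y h; have := congr1 (bcr he (S := kself k)) h; rewrite !bcr_in => /rowP h'.
rewrite [x](crdE he) [y](crdE he); apply: eq_bigr => i _; congr (_ *: _).
by have := h' i; rewrite !mxE.
Qed.

Lemma dP_sum cs : uniq cs -> (forall c x, c \notin cs -> dP c x = 0) ->
  forall x, \sum_(c <- cs) dP c x = x.
Proof.
move=> ucs h x; have [cs' [u' h' hrho]] := dP_supp.
have e1 : \sum_(c <- cs') dP c x = x.
  apply: bc_in_self_inj; rewrite bc_in_sum.
  have := hrho (kself k) (gone (Dgrp k M) (kself k)) (bc_in _ x).
  rewrite ghom1 => rE; rewrite -[RHS]/(gone (GL N) (kself k) (bc_in (kself k) x)) rE; apply: eq_bigr => c _.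
  by rewrite bcmap_in; [rewrite [RHS]scale1r|apply: dP_linear].
rewrite -[RHS]e1 (bigID (mem cs')) /= [X in _ + X]big1 ?addr0; last by move=> c /h'.
rewrite [RHS](bigID (mem cs)) /= [X in _ = _ + X]big1 ?addr0; last by move=> c /h.
rewrite -[LHS]big_filter -[RHS]big_filter; apply: perm_big; apply: uniq_perm; rewrite ?filter_uniq //.
by move=> c; rewrite !mem_filter andbC.
Qed.

Lemma isw_dP c x : isw c x -> forall d, dP d x = if c == d then x else 0.
Proof.
move=> hx d; rewrite /dP hx cfkE mcoef_e.
by case: eqP => _; rewrite ?scale1r ?scale0r.
Qed.

Lemma dP_isw c x : isw c (dP c x).
Proof.
have [cs [ucs h0 hrho]] := dP_supp.
have [ccs|ccs] := boolP (c \in cs); last by rewrite h0 //; apply: isw0.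
have idem c' : c' \in cs -> dP c' (dP c x) = if c' == c then dP c x else 0.
  (* Orthogonality of the projections: two independent universal characters live over the group
     algebra of the square of [M], and the coefficients at [(c', c)] of the action of their product
     and of the composite of their actions are compared. *)
  move=> c'cs; pose M2 : zmodType := (M * M)%type; pose S2 := galg M2 (kself k).
  have [d1P d2P] : is_char (R := S2) (fun c : M => me ((c, 0) : M2) : malg k M2) /\
     is_char (R := S2) (fun c : M => me ((0, c) : M2) : malg k M2).
    split; split=> [//|u v]; rewrite meM; congr me.
      by rewrite -[RHS]/((u + v, 0 + 0) : M2) addr0.
    by rewrite -[RHS]/((0 + 0, u + v) : M2) addr0.
  pose d1 : Dgrp k M S2 := exist _ _ d1P; pose d2 : Dgrp k M S2 := exist _ _ d2P.
  have e1 : rho S2 (gmul d1 d2) (bc_in S2 x) = rho S2 d1 (rho S2 d2 (bc_in S2 x)).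
    by rewrite ghomM.
  pose m : M2 := (c', c); have bl u := bcmap_linear (R := S2) (dP_linear u).
  have mE u v : ((u, v) == m :> M2) = (u == c') && (v == c) by rewrite xpair_eqE.
  have L v : cfk m (sval (gmul d1 d2) v *: bcmap (dP v) (bc_in S2 x)) =
      if (v == c') && (v == c) then dP v x else 0.
    have dE : sval (gmul d1 d2) v = me ((v, v) : M2) :> malg k M2.
      rewrite -[LHS]/((me ((v, 0) : M2) : malg k M2) * (me ((0, v) : M2) : malg k M2)) meM.
      by congr me; rewrite -[LHS]/((v + 0, 0 + v) : M2) addr0 add0r.
    rewrite bcmap_in; last exact: dP_linear.
    by rewrite cfkE dE mcoef_e mE; case: ifP; rewrite ?scale1r ?scale0r.
  have RR u v : cfk m (sval d1 u *: bcmap (dP u) (sval d2 v *: bcmap (dP v) (bc_in S2 x))) =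
      if (u == c') && (v == c) then dP u (dP v x) else 0.
    have dE : sval d1 u * sval d2 v = me ((u, v) : M2) :> malg k M2.
      rewrite -[LHS]/((me ((u, 0) : M2) : malg k M2) * (me ((0, v) : M2) : malg k M2)) meM.
      by congr me; rewrite -[LHS]/((u + 0, 0 + v) : M2) addr0 add0r.
    rewrite (linearZ' _ _ (bl u)) (bcmap_in _ _ (dP_linear v)) (bcmap_in _ _ (dP_linear u)).
    by rewrite scalerA cfkE dE mcoef_e mE; case: ifP; rewrite ?scale1r ?scale0r.
  have pick (w : M) (F : M -> N) : w \in cs -> \sum_(v <- cs) (if v == w then F v else 0) = F w.
    move=> wcs; rewrite (bigD1_seq w) //= eqxx big1 ?addr0 // => v /negPf vw.
    by rewrite vw.
  have sL : cfk m (rho S2 (gmul d1 d2) (bc_in S2 x)) = if c == c' then dP c x else 0.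
    rewrite hrho cfk_sum (eq_bigr _ (fun v _ => L v)) -(pick c (fun v => if v == c' then dP v x else 0) ccs).
    by apply: eq_bigr => v _; rewrite andbC; case: eqP => // ->.
  have sR : cfk m (rho S2 d1 (rho S2 d2 (bc_in S2 x))) = dP c' (dP c x).
    rewrite !hrho cfk_sum -(pick c' (fun u => dP u (dP c x)) c'cs); apply: eq_bigr => u _.
    rewrite (linear_sum' _ _ _ (bl u)) scaler_sumr cfk_sum (eq_bigr _ (fun v _ => RR u v)).
    case: (u == c'); last by rewrite big1.
    exact: (pick c (fun v => dP u (dP v x))).
  by rewrite -sR -e1 sL eq_sym; case: ifP => // /eqP ->.
move=> S d; rewrite hrho (bigD1_seq c) //= bcmap_in; last exact: dP_linear.
rewrite idem // eqxx big_seq_cond big1 ?addr0 // => c' /andP[c'cs cc'].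
by rewrite bcmap_in ?idem // ?(negPf cc') ?bc_in0 ?scaler0 //; apply: dP_linear.
Qed.

(** Each weight space is spanned by the projections of the basis [e] and is torsion-free, hence has
    a basis; the union over the finitely many weights is a basis because the projections separate
    the weights. *)
Lemma weight_basis (p : k) (hk : is_dvr p) : tf p N ->
  exists m (b : 'I_m -> N) (v : 'I_m -> M), isbasis b /\ forall j, isw (v j) (b j).
Proof.
move=> tN; have [cs [ucs h0 _]] := dP_supp.
suff [m [b [v [hb hw hv hs]]]] : exists m (b : 'I_m -> N) (v : 'I_m -> M),
    [/\ indep b, forall j, isw (v j) (b j), forall j, v j \in cs &
        forall c x, c \in cs -> inspan b (dP c x)].
  exists m, b, v; split=> //; split=> // x; rewrite -(dP_sum ucs h0 x) big_seq.
  by apply: inspan_sum => c ccs; apply: hs.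
elim: cs ucs {h0} => [|c cs IH] /=.
  by exists 0%N, (fun=> 0), (fun=> 0); split=> [a _ []|[]|[]|].
case/andP=> ccs /IH[m [b [v [hb hw hv hs]]]].
have [r [f [hf f1 f2]]] := tf_span_basis hk tN (fun i => dP c (e i)).
have fw j : isw c (f j).
  have [a ->] := f2 j; apply: big_ind => [|x y hx hy|i _]; first exact: isw0.
    by rewrite -[x]scale1r; apply: iswL.
  by rewrite -[_ *: _]addr0; apply: iswL; [apply: dP_isw|apply: isw0].
exists (r + m)%N, (fun j => match split j with inl i => f i | inr i => b i end),
  (fun j => match split j with inl i => c | inr i => v i end); split.
- move=> a; rewrite big_split_ord /=.
  under eq_bigr do rewrite (unsplitK (inl _)).
  under [X in _ + X]eq_bigr do rewrite (unsplitK (inr _)).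
  move=> h; have fz : \sum_i a (lshift m i) *: f i = 0.
    have := congr1 (dP c) h; rewrite (linear0' (dP_linear c)) (linearD' _ _ (dP_linear c)).
    rewrite !(linear_sum' _ _ _ (dP_linear c)) [X in _ + X]big1 ?addr0 => [e0|i _].
      by rewrite -[RHS]e0; apply: eq_bigr => i _; rewrite (linearZ' _ _ (dP_linear c)) (isw_dP (fw i)) eqxx.
    rewrite (linearZ' _ _ (dP_linear c)) (isw_dP (hw i)).
    by case: eqP => [vc|_]; [case/negP: ccs; rewrite -vc|rewrite scaler0].
  move: h; rewrite fz add0r => bz j.
  by case: (split_ordP j) => i ->; [apply: (hf _ fz)|apply: (hb _ bz)].
- by move=> j; case: (split j).
- by move=> j; case: (split j) => i; rewrite inE ?eqxx // hv orbT.
move=> d x; rewrite inE => /orP[/eqP ->|/hs hd].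
  rewrite [x](crdE he) (linear_sum' _ _ _ (dP_linear c)); apply: inspan_sum => i _.
  rewrite (linearZ' _ _ (dP_linear c)); apply: inspanZ; apply: inspan_trans (f1 i) _ => j.
  have := @inspan_mem _ _ _ (fun j => match split j with inl i => f i | inr i => b i end) (lshift m j).
  by rewrite (unsplitK (inl j)).
apply: inspan_trans (hd x) _ => j.
have := @inspan_mem _ _ _ (fun j => match split j with inl i => f i | inr i => b i end) (rshift r j).
by rewrite (unsplitK (inr j)).
Qed.
End Decomposition.

Section DecompositionMaps.
Variables (k : comNzRingType) (M : zmodType).
Variables (N N' : lmodType k) (n n' : nat) (e : 'I_n -> N) (e' : 'I_n' -> N').
Variables (he : isbasis e) (he' : isbasis e').
Variables (rho : ghom (Dgrp k M) (GL N)) (rho' : ghom (Dgrp k M) (GL N')).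

Lemma isw_map (u : N -> N') c x : linear u ->
  (forall S d z, rho' S d (bcmap u z) = bcmap u (rho S d z)) ->
  isw rho c x -> isw rho' c (u x).
Proof.
move=> lu hu hx S d; rewrite -bcmap_in // hu hx (linearZ' _ _ (bcmap_linear lu)).
by rewrite bcmap_in.
Qed.

End DecompositionMaps.

Lemma crd_isw (k : comNzRingType) (N : lmodType k) (M : zmodType)
    (rho : ghom (Dgrp k M) (GL N)) m (b : 'I_m -> N) (hb : isbasis b) (v : 'I_m -> M) w x :
  (forall j, isw rho (v j) (b j)) -> isw rho w x -> forall j, v j <> w -> crd hb x 0 j = 0.
Proof.
move=> hv hx j vw; have dl := @dP_linear _ _ _ _ hb _ rho.
have := isw_dP hb hx (v j); rewrite eq_sym (introF eqP vw).
rewrite {1}[x](crdE hb) (linear_sum' _ _ _ (dl _)) => h.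
have := congr1 (fun y => crd hb y 0 j) h; cbv beta.
have c0 i : crd hb 0 0 i = 0 by rewrite (linear0' (crd_linear hb)) [LHS]mxE.
rewrite c0 (linear_sum' _ _ _ (crd_linear hb)) summxE (bigD1 j) //= => <-.
rewrite (linearZ' _ _ (dl _)) (isw_dP hb (hv j)) eqxx.
rewrite (linearZ' _ _ (crd_linear hb)) crd_e [X in _ = X + _]mxE [delta_mx 0 j 0 j]mxE.
rewrite !eqxx mulr1 big1 ?addr0 // => i ij.
rewrite (linearZ' _ _ (dl _)) (isw_dP hb (hv i)) (linearZ' _ _ (crd_linear hb)) [LHS]mxE.
case: (v i == v j); last by rewrite c0 mulr0.
by rewrite crd_e [delta_mx 0 i 0 j]mxE eq_sym (negPf ij) andbF mulr0.
Qed.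

Lemma isw_crd (k : comNzRingType) (N : lmodType k) (M : zmodType)
    (rho : ghom (Dgrp k M) (GL N)) m (b : 'I_m -> N) (hb : isbasis b) (v : 'I_m -> M)
    (Q : lmodType k) (f g : N -> Q) w x : linear f -> linear g ->
  (forall j, isw rho (v j) (b j)) -> isw rho w x ->
  (forall j, v j = w -> f (b j) = g (b j)) -> f x = g x.
Proof.
move=> lf lg hv hx h; rewrite [x](crdE hb) (linear_sum' _ _ _ lf) (linear_sum' _ _ _ lg).
apply: eq_bigr => j _; rewrite (linearZ' _ _ lf) (linearZ' _ _ lg).
have [/h -> //|vw] := eqVneq (v j) w.
by rewrite (crd_isw hb hv hx (elimN eqP vw)) !scale0r.
Qed.

(** * Discretely valued fields and norms *)

Section Uniformizer.
Variables (R : realType) (l : nafield R) (pi : l).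
Hypotheses (pi0 : 0 < nabs pi) (pi1 : nabs pi < 1)
  (piP : forall x : l, x <> 0 -> exists n : int, nabs x = nabs pi ^ n).
Local Notation t := (nabs pi).

Lemma t_neq0 : t != 0. Proof. by rewrite gt_eqF. Qed.
Lemma pi_neq0 : pi != 0.
Proof. by apply: contraTneq pi0 => ->; rewrite nabs0 ltxx. Qed.
Lemma texp_gt0 (n : int) : 0 < t ^ n. Proof. exact: exprz_gt0. Qed.
Lemma nabsV (x : l) : nabs x^-1 = (nabs x)^-1.
Proof.
have [->|x0] := eqVneq x 0; first by rewrite invr0 nabs0 invr0.
have h : nabs x != 0 by apply: contra x0 => /eqP/nabs_eq0 ->.
by apply: (mulfI h); rewrite -nabsM !mulfV // nabs1.
Qed.
Lemma nabsX (x : l) (n : nat) : nabs (x ^+ n) = nabs x ^+ n.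
Proof. by elim: n => [|n IH]; rewrite ?expr0 ?nabs1 // !exprS nabsM IH. Qed.
Lemma nabs_piz (n : int) : nabs (pi ^ n) = t ^ n.
Proof. by case: n => n; rewrite /exprz ?nabsV nabsX. Qed.
Lemma piz_neq0 (n : int) : pi ^ n != 0. Proof. exact: expfz_neq0 pi_neq0. Qed.
Lemma pizD (m n : int) : pi ^ (m + n) = pi ^ m * pi ^ n.
Proof. exact: expfzDr pi_neq0. Qed.
Lemma texpD (m n : int) : t ^ (m + n) = t ^ m * t ^ n.
Proof. exact: expfzDr t_neq0. Qed.
Lemma texp_le (m n : int) : (t ^ m <= t ^ n) = (n <= m).
Proof.
rewrite -[m](subrK n) texpD ger_pMl ?texp_gt0 // lerDr.
case: (m - n) => j; first by rewrite exprn_ile1 // ltW.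
have -> : t ^ (Negz j) = t^-1 ^+ j.+1 by rewrite exprVn.
by rewrite leNgt exprn_egt1 // invf_gt1.
Qed.
Lemma texp_lt (m n : int) : (t ^ m < t ^ n) = (n < m).
Proof. by rewrite !ltNge texp_le. Qed.

Lemma archi_texp (e : R) : 0 < e -> exists n : nat, t ^+ n <= e.
Proof.
move=> e0; have d0 : 0 < t^-1 - 1 by rewrite subr_gt0 invf_gt1.
have bern (n : nat) : 1 + (t^-1 - 1) *+ n <= t^-1 ^+ n.
  elim: n => [|n IH]; first by rewrite mulr0n addr0 expr0.
  rewrite exprS -[X in X * _](subrK 1) mulrDl mul1r mulrS addrCA lerD //.
  apply: le_trans (_ : (t^-1 - 1) * 1 <= _); first by rewrite mulr1.
  by rewrite ler_pM2l // exprn_ege1 // ltW // invf_gt1.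
have [n hn] : exists n : nat, e^-1 <= (t^-1 - 1) *+ n.
  exists (Num.Def.archi_bound (e^-1 / (t^-1 - 1))).
  have q0 : 0 <= e^-1 / (t^-1 - 1) by rewrite divr_ge0 ?invr_ge0 ?ltW.
  by rewrite -mulr_natl -ler_pdivrMr //; apply/ltW/archi_boundP.
exists n; rewrite -[t ^+ n]invrK -exprVn -[e]invrK lef_pV2 ?posrE ?invr_gt0 ?exprn_gt0 ?invr_gt0 //.
by apply: le_trans hn (le_trans _ (bern n)); rewrite lerDr ler01.
Qed.

Lemma kap_ex (w : Gamma R) : exists n : int, forall m : int, (t ^ m * val w <= 1) = (n <= m).
Proof.
have w0 : 0 < val w := valP w.
have [a ha] : exists a : nat, t ^+ a <= (val w)^-1 by apply: archi_texp; rewrite invr_gt0.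
have [b hb] : exists b : nat, t ^+ b < val w.
  have [b hb] := archi_texp (divr_gt0 w0 (ltr0n _ 2)).
  exists b; apply: le_lt_trans hb _.
  by rewrite ltr_pdivrMr // ltr_pMr // ltr1n.
(* Shifting by [b] turns the search for the least exponent into one over natural numbers: exponents
   below [-b] cannot satisfy the bound. *)
pose P (j : nat) := t ^ (j%:Z - b%:Z) * val w <= 1.
have exP : exists j, P j.
  by exists (a + b)%N; rewrite /P PoszD addrK -ler_pdivlMr // mul1r.
have [j Pj jmin] := ex_minnP exP.
exists (j%:Z - b%:Z) => m; apply/idP/idP => [hm|hm]; last first.
  by apply: le_trans Pj; rewrite ler_pM2r // texp_le.
have mb : 0 <= m + b%:Z.
  rewrite leNgt; apply/negP => h; have : t ^ (- b%:Z) < t ^ m.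
    by rewrite texp_lt -subr_lt0 opprK.
  rewrite -(ltr_pM2r w0) => /lt_le_trans/(_ hm); rewrite -invr_expz.
  by rewrite mulrC ltr_pdivrMr ?exprn_gt0 // mul1r ltNge ltW.
have := jmin (absz (m + b%:Z)); rewrite /P gez0_abs // addrK => /(_ hm) h.
by rewrite lerBlDr -(gez0_abs mb) lez_nat.
Qed.
(** The least power of the uniformizer that brings a vector of norm [w] into the unit ball, in other
    words the ceiling of the negative of the logarithm of [w] to the base [t]. It is subadditive,
    and additive when one argument is in the value group of [l] ([kap_shift]). *)
Definition kap (w : Gamma R) : int := sval (cid (kap_ex w)).
Lemma kapP (w : Gamma R) (m : int) : (t ^ m * val w <= 1) = (kap w <= m).
Proof. by rewrite /kap; case: (cid _). Qed.
Lemma kap_le1 (w : Gamma R) : t ^ (kap w) * val w <= 1. Proof. by rewrite kapP. Qed.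
Lemma kapB (w g : Gamma R) (m : int) : (t ^ m * val w <= val g) = (kap (w - g) <= m).
Proof. by rewrite -kapP mulrA ler_pdivrMr ?(valP g) // mul1r. Qed.
Lemma kap_subadd (v w : Gamma R) : kap (v + w) <= kap v + kap w.
Proof.
rewrite -kapP texpD mulrACA mulr_ile1 ?kap_le1 // mulr_ge0 ?ltW ?texp_gt0 //.
  exact: (valP v).
exact: (valP w).
Qed.
Lemma kap_shift (v w : Gamma R) (n : int) : val w = val v * t ^ n -> kap w = kap v - n.
Proof.
move=> e; apply/le_anti/andP; split; rewrite ?lerBlDr -kapP ?e.
  by rewrite mulrC -mulrA -texpD addrC subrK mulrC kap_le1.
rewrite texpD -mulrA [X in _ * X]mulrC -e; exact: kap_le1.
Qed.
Lemma kap_unit (w : Gamma R) (n : int) : val w = t ^ n -> kap w = - n.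
Proof.
move=> e; rewrite (@kap_shift 0 w n) ?[val 0]/1 ?mul1r // -[RHS]add0r; congr (_ + _).
apply/le_anti/andP; split; first by rewrite -kapP expr0z mulr1.
by have := kap_le1 0; rewrite mulr1 -[1](expr0z t) texp_le.
Qed.

Lemma gamma_classP (v w : Gamma R) : gamma_class l v = gamma_class l w <->
  exists n : int, val w = val v * t ^ n.
Proof.
have v0 : 0 < val v := valP v.
have cE : gamma_class l v = gamma_class l w <-> exists x : l, nabs x = val v / val w.
  split=> [/eqP|h]; first by rewrite -Quotient.idealrBE => /asboolP.
  by apply/eqP; rewrite -Quotient.idealrBE; apply/asboolP.
rewrite cE; split=> [[x hx]|[n e]]; last first.
  by exists (pi ^ (- n)); rewrite nabs_piz e invfM mulrA mulfV ?gt_eqF // mul1r invr_expz.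
have x0 : x <> 0.
  move=> x0; move: hx; rewrite x0 nabs0 => /esym/eqP; rewrite gt_eqF ?divr_gt0 //.
  exact: (valP w).
have [n e] := piP x0; exists (- n); rewrite -invr_expz -e hx invf_div mulrCA mulfV ?mulr1 //.
by rewrite gt_eqF.
Qed.

Definition mkoint (x : l) (h : nabs x <= 1) : oint l := exist (fun x => oint_pred x) x h.
Definition ppi : oint l := mkoint (ltW pi1).
Lemma oint_unit (x : oint l) : nabs (val x) = 1 -> is_unit x.
Proof.
move=> h; have hV : oint_pred (val x)^-1 by rewrite /oint_pred nabsV h invr1.
exists (mkoint hV); apply: val_inj; rewrite [LHS]mulfV //.
by apply/eqP => e; move: h; rewrite e nabs0 => /eqP; rewrite eq_sym oner_eq0.
Qed.
Lemma oint_unitP (x : oint l) : is_unit x -> nabs (val x) = 1.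
Proof.
move=> [y xy]; apply/le_anti; rewrite [_ <= 1](valP x) /=.
have := congr1 (fun z => nabs (val z)) xy; rewrite nabsM nabs1 => <-.
by apply: ler_piMr; [apply: nabs_ge0|apply: (valP y)].
Qed.
Lemma oint_dvr : is_dvr ppi.
Proof.
split.
- move=> x y /(congr1 val)/eqP; rewrite mulf_eq0 => /orP[]/eqP h; [left|right]; exact: val_inj.
- move=> x x0; have vx0 : val x <> 0 by move=> h; apply: x0; apply: val_inj.
  have [n e] := piP vx0.
  have n0 : 0 <= n by rewrite -(texp_le n 0) -e expr0z; apply: (valP x).
  have hu : oint_pred (val x * pi ^ (- n)).
    by rewrite /oint_pred nabsM nabs_piz e -texpD subrr expr0z.
  exists (mkoint hu), `|n|%N; split.
    by apply: oint_unit; rewrite nabsM nabs_piz e -texpD subrr expr0z.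
  apply: val_inj; rewrite rmorphM rmorphXn /= -[pi ^+ _]/(pi ^ `|n|%N) gez0_abs //.
  by rewrite -mulrA -pizD addNr expr0z mulr1.
- by move=> /oint_unitP/eqP; rewrite lt_eqF.
by move=> /(congr1 val)/eqP; apply/negP; apply: pi_neq0.
Qed.
Lemma oint_lt1 (x : oint l) : nabs (val x) < 1 -> exists y, x = ppi * y.
Proof.
move=> h; have [/oint_unitP e|//] := dvr_local oint_dvr x.
by move: h; rewrite e ltxx.
Qed.
Lemma nabs_dvd (x : l) (n : int) : nabs x <= t ^ n -> exists y : oint l, x = val y * pi ^ n.
Proof.
move=> h; have hy : oint_pred (x * pi ^ (- n)).
  rewrite /oint_pred nabsM nabs_piz -[_ ^ (- n)]/(t ^ (- n)) -(mulrV (_ : t ^ n \is a GRing.unit)).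
    by rewrite invr_expz ler_pM2r ?texp_gt0.
  by rewrite unitfE gt_eqF ?texp_gt0.
by exists (mkoint hy); rewrite /= -mulrA -pizD addNr expr0z mulr1.
Qed.
End Uniformizer.

Lemma lalg1_neq0 (R : realType) (l : nafield R) : (1 : lalg l) <> 0.
Proof. by apply/eqP; apply: (oner_neq0 l). Qed.

Section LatticeNorm.
Variables (R : realType) (l : nafield R).
Variables (N : lmodType (oint l)) (m : nat) (b : 'I_m -> N) (hb : isbasis b).

Lemma max_ideal_spanP (v : N) :
  max_ideal_span v <-> forall j, nabs (val (crd hb v 0 j) : l) < 1.
Proof.
split=> [[s [hs ->]] j|h].
  rewrite (linear_sum' _ _ _ (crd_linear hb)) summxE.
  elim: s hs => [|q s IH] hs; first by rewrite big_nil nabs0.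
  rewrite big_cons; apply: le_lt_trans (nabsD _ _) _; rewrite gt_max; apply/andP; split; last first.
    by apply: IH => q' q's; apply: hs; rewrite inE q's orbT.
  rewrite (linearZ' _ _ (crd_linear hb)) mxE nabsM; apply: le_lt_trans (hs q (mem_head _ _)).
  by rewrite ler_piMr ?nabs_ge0 //; apply: (valP (crd hb q.2 0 j)).
exists [seq (crd hb v 0 j, b j) | j <- enum 'I_m]; split=> [q /mapP[j _ ->]|]; first exact: h.
by rewrite big_map big_enum /=; apply: crdE.
Qed.

Lemma lattice_normE (z : bc N (lalg l)) :
  lattice_norm z = \big[Num.max/0]_j nabs (bcr hb z 0 j : l).
Proof.
have crd_le (v : N) j : nabs (val (crd hb v 0 j) : l) <= 1 by apply: (valP (crd hb v 0 j)).
have bcrZ (c : l) v j : bcr hb ((c : lalg l) *: bc_in (lalg l) v) 0 j = c * val (crd hb v 0 j).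
  by rewrite (linearZ' _ _ (bcr_linear hb _)) bcr_in !mxE.
apply: xget_unique => [|r [[-> ->]|[c [v [hv -> ->]]]]].
- have [->|z0] := EM (z = 0).
    left; split=> //; rewrite (linear0' (bcr_linear hb _)); apply/le_anti/andP; split.
      by apply: bigmax_le => // j _; rewrite mxE nabs0.
    exact: bigmax_ge_id.
  have [j0 hj0] : exists j0, bcr hb z 0 j0 <> 0.
    apply: contrapT => h; apply: z0; apply: (bcr_inj (he := hb)).
    rewrite (linear0' (bcr_linear hb _)); apply/rowP => j; rewrite mxE.
    by apply: contrapT => h'; apply: h; exists j.
  pose F j := nabs (bcr hb z 0 j : l).
  case: (@Order.TotalTheory.arg_maxP _ _ _ j0 xpredT F isT) => i _ hi0; have hi j : F j <= F i := hi0 j isT.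
  have ci : bcr hb z 0 i <> 0.
    move=> e; have := hi j0; rewrite /F e nabs0 leNgt lt_def nabs_ge0 andbT.
    by rewrite negbK => /eqP/nabs_eq0.
  have cp : 0 < F i by rewrite lt_def nabs_ge0 andbT; apply/eqP => /nabs_eq0.
  have q1 j : nabs (bcr hb z 0 j / bcr hb z 0 i : l) <= 1.
    by rewrite nabsM nabsV ler_pdivrMr // mul1r; apply: hi.
  (* Dividing by the coordinate of largest absolute value leaves an integral vector with one
     coordinate equal to 1, which is not in the span of the maximal ideal. *)
  right; exists (bcr hb z 0 i), (\sum_j mkoint (q1 j) *: b j); split.
  + move=> /max_ideal_spanP/(_ i); rewrite crd_sum mxE /= mulfV ?nabs1 ?ltxx //.
    exact/eqP.
  + apply: (bcr_inj (he := hb)); apply/rowP => j; rewrite bcrZ crd_sum mxE /=.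
    by rewrite mulrCA mulfV ?mulr1 //; apply/eqP.
  + apply/le_anti/andP; split; last exact: (le_bigmax _ F).
    by apply: bigmax_le => [|j _]; [apply: nabs_ge0|apply: hi].
- rewrite (linear0' (bcr_linear hb _)); apply/le_anti/andP; split; first exact: bigmax_ge_id.
  by apply: bigmax_le => // j _; rewrite mxE nabs0.
have [j hj] : exists j, nabs (val (crd hb v 0 j) : l) = 1.
  apply: contrapT => h; apply: hv; apply/max_ideal_spanP => j.
  by rewrite lt_neqAle crd_le andbT; apply/eqP => e; apply: h; exists j.
apply/le_anti/andP; split.
  by apply: (bigmax_sup j) => //; rewrite bcrZ nabsM hj mulr1.
apply: bigmax_le => [|i _]; first exact: nabs_ge0.
by rewrite bcrZ nabsM ler_piMr ?nabs_ge0.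
Qed.
End LatticeNorm.

(** * The norm in a basis of weight vectors *)

Section WeightNorm.
Variables (R : realType) (l : nafield R).
Variables (G : grpfun (oint l)) (theta : norm_family G) (Tint : subgrp G).
Variables (chi : ghom (Dgrp (oint l) (Gamma R)) (subfun Tint)) (hchi : is_theta chi theta).

Definition wact (X : rep G) : ghom (Dgrp (oint l) (Gamma R)) (GL X) :=
  ghom_comp (ract X) (ghom_comp (subincl Tint) chi).

Variables (X : rep G) (m : nat) (b : 'I_m -> X) (v : 'I_m -> Gamma R).
Hypotheses (hb : isbasis b) (hv : forall j, isw (wact X) (v j) (b j)).

Lemma wt_mem j : b j \in smod_pred (weight_sub chi X (v j)).
Proof. by apply/asboolP; apply: hv. Qed.

(** The basis vectors of weight [w] form a basis of that weight space, whose lattice norm is thus a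
    maximum of coordinates. Removing duplicates from the weights gives the list without repetition
    which [is_theta] requires. *)
Lemma theta_sum (a : 'I_m -> l) : exists F : Gamma R -> R,
  theta X (\sum_j (a j : lalg l) *: bc_in (lalg l) (b j)) =
    \big[Num.max/0]_(w <- undup (codom v)) (F w * val w) /\
  forall w, F w = \big[Num.max/0]_(j | v j == w) nabs (a j).
Proof.
pose W w := weight_space chi X w.
pose elt w j : W w := insubd (0 : W w) (b j).
have eltE j : val (elt (v j) j) = b j by apply: insubdK; apply: wt_mem.
pose z w : bc (W w) (lalg l) := \sum_(j | v j == w) (a j : lalg l) *: bc_in (lalg l) (elt w j).
have li w : linear (@weight_incl _ _ _ _ chi X w) by [].
exists (fun w => lattice_norm (z w)); split.
  rewrite -(hchi (X := X) z (undup_uniq _)); congr (theta X _).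
  transitivity (\sum_j \sum_(w <- undup (codom v) | v j == w) (a j : lalg l) *: bc_in (lalg l) (b j)).
    apply: eq_bigr => j _; rewrite -big_filter.
    have -> : [seq w <- undup (codom v) | v j == w] = [:: v j].
      apply/perm_small_eq; rewrite // uniq_perm ?filter_uniq ?undup_uniq // => w.
      rewrite mem_filter mem_undup inE eq_sym andb_idr // => /eqP ->.
      exact: codom_f.
    by rewrite big_seq1.
  rewrite (exchange_big_dep xpredT) //=; apply: eq_bigr => w _.
  rewrite (linear_sum' _ _ _ (bcmap_linear (li w))); apply: eq_bigr => j /eqP <-.
  rewrite (linearZ' _ _ (bcmap_linear (li _))) bcmap_in; last exact: li.
  by rewrite /weight_incl eltE.
move=> w; pose A := [pred j | v j == w].
pose e (i : 'I_#|A|) : W w := elt w (enum_val i).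
have vA (i : 'I_#|A|) : v (enum_val i) = w by have := enum_valP i; rewrite inE => /eqP.
have valE (i : 'I_#|A|) : val (e i) = b (enum_val i).
  by apply: insubdK; have := wt_mem (enum_val i); rewrite vA.
have val_sum I (r : seq I) (P : pred I) (F : I -> W w) :
    val (\sum_(i <- r | P i) F i) = \sum_(i <- r | P i) val (F i).
  by apply: (big_morph val).
have he : isbasis e.
  split=> [c h i|x].
    have := congr1 val h; rewrite val_sum /=.
    under eq_bigr do rewrite valE.
    move=> h'; pose c' j := \sum_(i | enum_val i == j :> 'I_m) c i.
    have h2 : \sum_j c' j *: b j = 0.
      rewrite -[RHS]h'; under [LHS]eq_bigr do rewrite /c' scaler_suml.
      rewrite (exchange_big_dep xpredT) //=; apply: eq_bigr => i' _.
      by rewrite (big_pred1 (enum_val i')) // => j /=; rewrite eq_sym.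
    have := hb.1 _ h2 (enum_val i); rewrite /c' (big_pred1 i) // => i'.
    by rewrite (inj_eq enum_val_inj).
  exists (fun i => crd hb (val x) 0 (enum_val i)); apply: val_inj; rewrite val_sum /=.
  under eq_bigr do rewrite valE.
  rewrite -(big_enum_val (fun j => crd hb (val x) 0 j *: b j)).
  have hx : isw (wact X) w (val x) by have /asboolP := valP x.
  have hb' j : v j <> w -> crd hb (val x) 0 j = 0 by apply: crd_isw hv hx j.
  rewrite [LHS](crdE hb) big_mkcond [RHS]big_mkcond; apply: eq_bigr => j _ /=.
  rewrite inE; case: (v j =P w) => // vw; rewrite (hb' _ vw) scale0r //.
rewrite (lattice_normE he).
have zE : z w = \sum_i (a (enum_val i) : lalg l) *: bc_in (lalg l) (e i).
  by rewrite -(big_enum_val (fun j => (a j : lalg l) *: bc_in (lalg l) (elt w j))).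
have zc i : bcr he (z w) 0 i = a (enum_val i).
  rewrite zE (linear_sum' _ _ _ (bcr_linear he _)) summxE (bigD1 i) //=.
  rewrite (linearZ' _ _ (bcr_linear he _)) bcr_in_e !mxE !eqxx mulr1 big1 ?addr0 // => j ji.
  by rewrite (linearZ' _ _ (bcr_linear he _)) bcr_in_e !mxE eq_sym (negPf ji) andbF mulr0.
under eq_bigr do rewrite zc.
apply/le_anti/andP; split; apply: bigmax_le; rewrite ?bigmax_ge_id // => j.
  by move=> _; apply: (bigmax_sup (enum_val j)); rewrite ?vA.
move=> vj; have jA : j \in A by rewrite inE.
by apply: (bigmax_sup (enum_rank_in jA j)) => //; rewrite enum_rankK_in.
Qed.

Lemma theta_le (z : Xl X) (g : Gamma R) :
  theta X z <= val g <-> forall j, nabs (bcr hb z 0 j : l) * val (v j) <= val g.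
Proof.
have g0 : 0 < val g := valP g.
pose a j : l := bcr hb z 0 j.
have zE : z = \sum_j (a j : lalg l) *: bc_in (lalg l) (b j) by rewrite -[LHS](bcrK hb).
have [F [tE FE]] := theta_sum a; rewrite [in theta X z]zE tE; split=> [h j|h].
  apply: le_trans h; apply: le_trans (_ : F (v j) * val (v j) <= _).
    rewrite ler_pM2r; last exact: (valP (v j)).
    by rewrite FE; apply: (bigmax_sup j).
  apply: (@le_bigmax_seq _ _ _ _ _ (v j) xpredT (fun w => F w * val w)) => //.
  by rewrite mem_undup codom_f.
rewrite big_seq; apply: bigmax_le => [|w]; first exact: ltW.
rewrite mem_undup => /codomP[j0 ->]; rewrite -ler_pdivlMr; last exact: (valP (v j0)).
rewrite FE; apply: bigmax_le => [|j /eqP vj].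
  by rewrite divr_ge0 ?ltW //; apply: (valP (v j0)).
by rewrite ler_pdivlMr -?vj //; apply: (valP (v j)).
Qed.

Lemma theta_lt (z : Xl X) (g : Gamma R) : theta X z < val g ->
  forall j, nabs (bcr hb z 0 j : l) * val (v j) < val g.
Proof.
move=> h j; have [->|z0] := EM (bcr hb z 0 j = 0).
  by rewrite nabs0 mul0r; apply: (valP g).
have h0 : 0 < theta X z.
  rewrite lt_def nval_ge0 andbT; apply/eqP => /nval_eq0 e; apply: z0.
  by rewrite e (linear0' (bcr_linear hb _)) mxE.
pose g' : Gamma R := exist _ (theta X z) h0.
by apply: le_lt_trans h; apply: (theta_le z g').1; apply: lexx.
Qed.
End WeightNorm.

(** * From a conjugation over an étale cover to inner forms *)

Lemma id_cover_bij (S : comPzRingType) (A : kalg S) (f : {rmorphism A -> S}) (M : lmodType S) :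
  (forall a, kstr A (f a) = a) -> (forall s, f (kstr A s) = s) ->
  bijective (@bc_in S M A).
Proof.
move=> fK Kf; pose T : lmodType A := resmod f M.
have sl : @semilin S A M T (fun x => x).
  by split=> [//|s x]; rewrite -[RHS]/(f (kstr A s) *: (x : M)) Kf.
exists (uext (P := T) (fun x : M => x)) => [x|z]; first exact: (uext_gen _ sl).
elim/bc_ind: z => [s x z IH|]; last first.
  by rewrite (linear0' (uext_linear sl)) -[0 : T](scale0r (0 : M)) (bc_inP M A).2 rmorph0 scale0r.
rewrite (uext_linear sl) -{2}IH (uext_gen _ sl) -[s *: (x : T)]/(f s *: (x : M)).
by rewrite -[LHS]/(bc_in A (f s *: x + _ : M)) (bc_inP M A).1 (bc_inP M A).2 fK.
Qed.

(** [inner_descent] asks for a cover even when the conjugating section already exists over [S], as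
    it does below. *)
Lemma id_fppf_cover (k : comPzRingType) (S : kalg k) : fppf_cover (kover (khom_id S)).
Proof.
set A := kover _; split.
  exists 0%N, [::], (fun i : 'I_0 => 0); split=> // B b _.
  have hk a : kstr B (kstr A a) = kstr B a by [].
  exists (@KHom S A B (kstr B) hk); split=> [[]//|f' _ x]; rewrite -(khomP f').
  by [].
have bij (M : lmodType S) : bijective (@bc_in S M A) by apply: (@id_cover_bij S A idfun).
split=> [M N u lu iu z t e|M h x]; last first.
  apply: (bij_inj (bij M)); rewrite (h (bc_in A x)) (h (bc_in A 0)) //.
have [g gK Kg] := bij M; rewrite -[z]Kg -[t]Kg; congr bc_in; apply: iu.
apply: (bij_inj (bij N)).
have zt : bcmap u (bc_in A (g z)) = bcmap u (bc_in A (g t)) by rewrite (Kg z) (Kg t).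
by rewrite !bcmap_in in zt.
Qed.

Section Conjugation.
Variables (k : comPzRingType) (M : zmodType) (H Gc : grpfun k).
Variables (chi chi0 : ghom (Dgrp k M) H) (b : ghom (Dgrp k M) Gc).
Variables (iota : ghom Gc (subfun (cent chi0))).
Hypotheses (ibij : forall S, bijective (iota S))
  (ib : forall S d, iota S (b S d) = into_cent chi0 S d).
Variables (A : kalg k) (a : H A) (hA : etale_cover A).
Hypothesis ha : forall B (f : khom A B) d,
  gmul (gmap f a) (chi0 B d) = gmul (chi B d) (gmap f a).

Definition cj B (f : khom A B) (x : H B) : H B := gmul (gmul (ginv (gmap f a)) x) (gmap f a).
Lemma cjM B (f : khom A B) x y : cj f (gmul x y) = gmul (cj f x) (cj f y).
Proof. by rewrite /cj -!gmulA; do 2 congr gmul; rewrite gmulA gmulxV gmul1. Qed.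
Lemma cj_chi B (f : khom A B) d : cj f (chi B d) = chi0 B d.
Proof. by rewrite /cj -gmulA -ha gmulA gmulV gmul1. Qed.
Lemma cj_map B C (f : khom A B) (g : khom B C) x : cj (khom_comp g f) (gmap g x) = gmap g (cj f x).
Proof. by rewrite /cj gmap_comp !gmapM gmapV. Qed.
Lemma cj_cent B (f : khom A B) x : cent chi B x -> cent chi0 B (cj f x).
Proof.
move=> hx S c d; rewrite -cj_map -(cj_chi (khom_comp c f)) -!cjM.
by rewrite hx.
Qed.
Lemma iota_onto S (y : subfun (cent chi0) S) : exists x, iota S x = y.
Proof. by have [g gK Kg] := ibij S; exists (g y). Qed.
Definition iotaV S (y : subfun (cent chi0) S) : Gc S := sval (cid (iota_onto y)).
Lemma iotaVK S y : iota S (iotaV y) = y.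
Proof. exact: svalP (cid (iota_onto y)). Qed.
Lemma iota_eq S (x y : Gc S) : sval (iota S x) = sval (iota S y) -> x = y.
Proof. by move=> e; apply: (bij_inj (ibij S)); apply: sig_eq. Qed.
Definition psi_f B (f : khom A B) (x : subfun (cent chi) B) : Gc B :=
  iotaV (exist _ (cj f (sval x)) (cj_cent f (svalP x))).
Lemma psi_fE B (f : khom A B) x : sval (iota B (psi_f f x)) = cj f (sval x).
Proof. by rewrite /psi_f iotaVK. Qed.
Lemma psi_bij B (f : khom A B) : bijective (@psi_f B f).
Proof.
have cjV_cent (y : H B) : cent chi0 B y -> cent chi B (gmul (gmul (gmap f a) y) (ginv (gmap f a))).
  move=> hy S c d; have hcf := ha (khom_comp c f) d; rewrite gmap_comp in hcf.
  apply: (@gmulIr k H S (gmap c (gmap f a))); rewrite !gmapM gmapV -!gmulA -hcf gmulV gmulx1.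
  by rewrite [gmul (ginv _) (gmul _ _)]gmulA gmulV gmul1 hy !gmulA hcf.
exists (fun y => exist _ _ (cjV_cent _ (svalP (iota B y)))) => [x|y].
  apply: sig_eq; rewrite [LHS]/= psi_fE /cj -!gmulA gmulxV gmulx1 gmulA gmulxV.
  by rewrite gmul1.
apply: iota_eq; rewrite psi_fE [sval (exist _ _ _)]/= /cj -!gmulA gmulV gmulx1 gmulA gmulV.
by rewrite gmul1.
Qed.
Definition psi : giso_over A (subfun (cent chi)) Gc.
refine (@GIsoOver k A (subfun (cent chi)) Gc psi_f _ _ psi_bij).
- by move=> B f x y; apply: iota_eq; rewrite psi_fE ghomM [RHS]/= !psi_fE -cjM.
- by move=> B C f g x; apply: iota_eq; rewrite psi_fE ghom_nat [RHS]/= psi_fE -cj_map.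
Defined.

(** The comparison is conjugation by [a] followed by the inverse of [iota]. Its two pullbacks along
    [p] and [q] differ by conjugation with the inverse of [q^* a] times [p^* a]. Both factors
    conjugate [chi0] to the same [chi], so this element centralizes [chi0] and comes from [Gc] over
    [S] itself. *)
Lemma inner_forms_of_conj : inner_forms_matching (into_cent chi) b.
Proof.
exists A, psi; split=> //; last first.
  exists (gone Gc A) => B f d; rewrite !gmap1 ginv1 gmul1 gmulx1.
  apply: iota_eq; rewrite [LHS]psi_fE ib; exact: cj_chi.
move=> S p q; exists S, (khom_id S).
have hc : cent chi0 S (gmul (ginv (gmap q a)) (gmap p a)).
  move=> S' c d; rewrite gmapM gmapV -!gmap_comp -gmulA ha.
  apply: (@gmulI k H S' (gmap (khom_comp c q) a)).
  rewrite [LHS]gmulA gmulxV gmul1 [RHS]gmulA ha -[RHS]gmulA; congr gmul.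
  by rewrite gmulA gmulxV gmul1.
exists (iotaV (exist _ _ hc)); split=> [|B f x]; first exact: id_fppf_cover.
apply: iota_eq; rewrite !ghomM ghomV ghom_nat iotaVK.
rewrite [LHS]psi_fE -[RHS]/(gmul (gmul (gmap f (gmul (ginv (gmap q a)) (gmap p a)))
  (sval (iota B (psi_f (khom_comp f (khom_comp (khom_id S) p)) x))))
  (ginv (gmap f (gmul (ginv (gmap q a)) (gmap p a))))).
rewrite psi_fE /cj !gmap_comp !gmap_id gmapM gmapV ginvM.
set u := gmap f (gmap q a); set v := gmap f (gmap p a).
have -> : ginv (ginv u) = u by apply: (@gmulI k H B (ginv u)); rewrite gmulxV gmulV.
rewrite -!gmulA; congr gmul; rewrite [gmul v (gmul (ginv v) _)]gmulA gmulxV gmul1; congr gmul.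
by rewrite [gmul v (gmul (ginv v) _)]gmulA gmulxV gmul1.
Qed.
End Conjugation.

(** * Equations of a translate of the group *)

Lemma mon_ind n (K : mon n -> Prop) :
  K 0 -> (forall i m, K m -> K (mvar i + m)) -> forall m, K m.
Proof.
move=> K0 KD m; rewrite [m]mon_sum.
elim: (index_enum _) => [|i s IH]; first by rewrite big_nil.
rewrite big_cons; elim: (m i) => [|r IHr]; first by rewrite mulr0n add0r.
by rewrite mulrS -addrA; apply: KD.
Qed.

Lemma monval_var (B : comPzRingType) n (x : 'I_n -> B) i : monval x (mvar i) = x i.
Proof.
rewrite /monval (bigD1 i) //= ffunE eqxx big1 ?mulr1 // => j /negPf ij.
by rewrite ffunE ij.
Qed.

Lemma malg_expand' (k : comPzRingType) (M : nmodType) (z : malg k M) :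
  exists s : seq M, z = \sum_(m <- s) mcoef m z *: me m.
Proof. by have [s [_ h]] := malg_supp z; exists s. Qed.

Section Twist.
Variables (k : comNzRingType) (B : comPzRingType) (M : zmodType) (n : nat) (deg : 'I_n -> M).
Variables (phi : {rmorphism k -> B}) (x : 'I_n -> B).
(** Multiplying each coordinate by the universal character of its degree separates the homogeneous
    components. If the zero locus of [Q] contains this twisted point, each component of [Q] vanishes
    at [x]. *)
Lemma twist_coef (Q : mpol k n) w :
  mcoef w (pev (mconst M \o phi) (fun t => me (deg t) * mconst M (x t)) Q) =
  pev phi x (homc deg w Q).
Proof.
have mv m : monval (fun t => (me (deg t) : malg B M) * mconst M (x t)) m =
    (me (mdegr deg m) : malg B M) * mconst M (monval x m).
  elim/mon_ind: m => [|i m IH]; last first.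
    by rewrite !monvalD IH !monval_var mdegrD mdegr_var -meM rmorphM mulrACA.
  by rewrite !monval0 rmorph1 mulr1 /mdegr big1 // => i _; rewrite ffunE mulr0n.
elim/malg_ind: Q => [a m z IH|]; last first.
  by rewrite rmorph0 mcoef0 (linear0' (homc_linear _ _)) rmorph0.
rewrite homc_linear !rmorphD mcoefD IH !pevZ pev_e mv homc_e; congr (_ + _).
rewrite [X in mcoef w X]mconstM mcoefZ [me _ * _]mulrC [X in mcoef w X]mconstM mcoefZ mcoef_e.
by case: eqP => _; rewrite ?rmorph0 ?pev_e ?mulr0 ?mulr1.
Qed.
End Twist.

Lemma homc_total (k : comNzRingType) n (M : zmodType) (deg : 'I_n -> M) (K : mpol k n -> Prop) Q :
  K 0 -> (forall x y, K x -> K y -> K (x + y)) -> (forall c, K (homc deg c Q)) -> K Q.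
Proof.
move=> K0 KD h; have [s sE] := homc_sum deg Q; rewrite sE.
by apply: big_ind => // c _; apply: h.
Qed.

Definition mvec (B : Type) n (Z : 'M[B]_n) (t : 'I_(n * n)) : B := mxvec Z 0 t.
Lemma mvecE (B : Type) n (Z : 'M[B]_n) j i : mvec Z (mxvec_index j i) = Z j i.
Proof. exact: mxvecE. Qed.

Section Core.
Variables (R : realType) (l : nafield R) (pi : l).
Hypotheses (pi0 : 0 < nabs pi) (pi1 : nabs pi < 1)
  (piP : forall x : l, x <> 0 -> exists n : int, nabs x = nabs pi ^ n).
Variables (n : nat) (v : 'I_n -> Gamma R).
Local Notation k := (oint l).
Local Notation kap := (kap pi0 pi1).
Local Notation p := (ppi pi1).
Local Notation t := (nabs pi).
Let hk := oint_dvr pi0 pi1 piP.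

(** The weight of the matrix coordinate [(j, i)] is the ratio of [v j] by [v i], written additively;
    it is the character by which conjugation with diagonal matrices of weights [v] scales this
    coordinate. Only its class [degM] survives for the translate. *)
Definition nu : 'I_(n * n) -> Gamma R := mvec (\matrix_(j, i) (v j - v i)).
Lemma nuE j i : nu (mxvec_index j i) = v j - v i. Proof. by rewrite /nu mvecE mxE. Qed.
Definition degM (s : 'I_(n * n)) : Gamma_quot l := gamma_class l (nu s).
Local Notation wt := (mdegr nu).
Local Notation homM := (homc degM).
Lemma mdegrM m : mdegr degM m = gamma_class l (wt m).
Proof. by rewrite /mdegr raddf_sum; apply: eq_bigr => i _; rewrite raddfMn. Qed.

(** Integral polynomials are sent onto the unit ball of the Gauss norm over [l] in which a monomial
    [m] has norm [wt m]. The map is linear but not multiplicative, [kap] being only subadditive. *)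
Definition tau (q : mpol k (n * n)) : mpol l (n * n) :=
  mlin (P := resmod (val : {rmorphism k -> l}) (mpol l (n * n)))
    (fun m => pi ^ kap (wt m) *: me m) q.
Lemma tauL a x y : tau (a *: x + y) = val a *: tau x + tau y.
Proof.
exact: (@mlin_linear k _ (resmod (val : {rmorphism k -> l}) (mpol l (n * n)))
  (fun m => pi ^ kap (wt m) *: me m) a x y).
Qed.
Lemma tau_e m : tau (me m) = pi ^ kap (wt m) *: me m.
Proof.
exact: (@mlin_e k _ (resmod (val : {rmorphism k -> l}) (mpol l (n * n)))
  (fun m => pi ^ kap (wt m) *: me m) m).
Qed.
Lemma tau0 : tau 0 = 0.
Proof. by have := tauL (-1) 0 0; rewrite scaler0 addr0 rmorphN1 scaleN1r addNr. Qed.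
Lemma tauD x y : tau (x + y) = tau x + tau y.
Proof. by have := tauL 1 x y; rewrite rmorph1 !scale1r. Qed.
Lemma tauZ a x : tau (a *: x) = val a *: tau x.
Proof. by have := tauL a x 0; rewrite tau0 !addr0. Qed.
Lemma tau_coef m q : mcoef m (tau q) = val (mcoef m q) * pi ^ kap (wt m).
Proof.
elim/malg_ind: q => [a m' z IH|]; last by rewrite tau0 !mcoef0 rmorph0 mul0r.
rewrite tauL tau_e !mcoefD IH !mcoefZ !mcoef_e rmorphD rmorphM mulrDl; congr (_ + _).
by case: eqP => [->|_]; rewrite ?rmorph1 ?rmorph0 ?mulr1 ?mulr0 ?mul0r.
Qed.
Lemma tau_homM c q : tau (homM c q) = homM c (tau q).
Proof. by apply: mcoef_inj => m; rewrite tau_coef !homc_coef tau_coef; case: eqP; rewrite ?rmorph0 ?mul0r. Qed.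
Lemma tau_lift Q : exists (E : nat) q, tau q = pi ^+ E *: Q.
Proof.
elim/malg_ind: Q => [a m z [E [q IH]]|]; last by exists 0%N, 0; rewrite tau0 scaler0.
have [E' [y hy]] : exists (E' : nat) (y : k), pi ^+ E' * a = val y * pi ^ kap (wt m).
  have [->|a0] := EM (a = 0); first by exists 0%N, 0; rewrite mulr0 mul0r.
  have [r ar] := piP a0; exists (absz (kap (wt m) - r)).
  apply: (nabs_dvd pi0); rewrite nabsM nabsX ar -[_ ^+ _]/(t ^ (absz _)%:Z) -(texpD pi0).
  by rewrite (texp_le pi0 pi1) -lerBlDr lez_abs.
exists (E' + E)%N, ((p ^+ E * y) *: me m + p ^+ E' *: q).
rewrite tauD !tauZ tau_e IH scalerDr !scalerA; congr (_ *: _ + _ *: _).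
  by rewrite exprD rmorphM rmorphXn [pi ^+ E' * _]mulrC -!mulrA; congr (_ * _); rewrite hy.
by rewrite exprD rmorphXn.
Qed.
(** By discreteness, a coefficient strictly below the bound is divisible by one more factor [p]. *)
Lemma tau_small E : (forall m, nabs (mcoef m E) < t ^ kap (wt m)) -> exists z, E = tau (p *: z).
Proof.
move=> h; have [s sE] := malg_expand' E; rewrite sE.
elim: s {sE} => [|m s [z IH]]; first by exists 0; rewrite big_nil scaler0 tau0.
rewrite big_cons IH; have [y hy] := nabs_dvd pi0 (ltW (h m)).
have [|y' yE] := oint_lt1 pi0 pi1 piP (x := y).
  have := h m; rewrite hy nabsM nabs_piz; rewrite -[X in _ < X]mul1r ltr_pM2r //.
  exact: texp_gt0.
exists (y' *: me m + z); rewrite scalerDr tauD scalerA -yE [tau (y *: _)]tauZ tau_e scalerA -hy.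
by [].
Qed.
Lemma kap_cls (w w' d : Gamma R) : gamma_class l w = gamma_class l w' ->
  kap (w + d) - kap w = kap (w' + d) - kap w'.
Proof.
move=> /(gamma_classP piP)[r e].
rewrite (kap_shift pi0 pi1 e) (@kap_shift _ _ _ pi0 pi1 (w + d) (w' + d) r).
  by rewrite opprB addrA subrK.
by rewrite [LHS]/= e mulrAC.
Qed.
(** By [kap_cls] the defect of additivity of [kap] depends only on the class [c], so on one
    component multiplication by a monomial commutes with [tau] up to a single power of [pi]. This is
    what makes [tvan] an ideal. *)
Lemma tau_mulM c m q : exists r : int,
  tau (me m * homM c q) = pi ^ r *: (me m * tau (homM c q)).
Proof.
have [wc wcE] : exists wc : Gamma R, gamma_class l wc = c.
  by exists (repr c); apply: reprK.
exists (kap (wc + wt m) - kap wc).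
elim/malg_ind: q => [a m' z IH|]; last first.
  by rewrite !(linear0' (homc_linear _ _)) mulr0 !tau0 mulr0 scaler0.
rewrite homc_linear mulrDr !tauD IH mulrDr scalerDr; congr (_ + _); rewrite homc_e mdegrM.
case: eqP => [mc|_]; last by rewrite !(scaler0, tau0, mulr0).
rewrite malgZr meM !tauZ !tau_e malgZr malgZr meM !scalerA mdegrD addrC; congr (_ *: _).
rewrite [RHS]mulrCA; congr (_ * _); rewrite -(pizD pi0); congr (_ ^ _).
by rewrite (kap_cls (w' := wt m')) ?subrK ?mc // addrC.
Qed.

Section Vanishing.
Variables (B : comPzRingType) (phi : {rmorphism l -> B}) (x : 'I_(n * n) -> B).
Hypothesis hom_x : forall c Q, pev phi x Q = 0 -> pev phi x (homM c Q) = 0.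
Definition tvan (q : mpol k (n * n)) : Prop := pev phi x (tau q) = 0.
Lemma tvan_hom c q : tvan q -> tvan (homM c q).
Proof. by rewrite /tvan tau_homM; apply: hom_x. Qed.
Lemma tvan0 : tvan 0. Proof. by rewrite /tvan tau0 rmorph0. Qed.
Lemma tvanD q r : tvan q -> tvan r -> tvan (q + r).
Proof. by rewrite /tvan tauD rmorphD => -> ->; rewrite addr0. Qed.
Lemma tvanM a q : tvan q -> tvan (a * q).
Proof.
move=> hq; elim/malg_ind: a => [c m z IH|]; last by rewrite mul0r; apply: tvan0.
rewrite mulrDl; apply: tvanD => //; rewrite malgZl /tvan tauZ pevZ.
suff -> : pev phi x (tau (me m * q)) = 0 by rewrite mulr0.
rewrite -/(tvan _); apply: (@homc_total _ _ _ degM (fun q' => tvan (me m * q')) q).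
- by rewrite mulr0; apply: tvan0.
- by move=> y y'; rewrite mulrDr; apply: tvanD.
move=> d; have [r rE] := tau_mulM d m q; rewrite /tvan rE pevZ rmorphM.
by rewrite [pev phi x (tau _)]tvan_hom // !mulr0.
Qed.
Definition tvan_ideal : ideal (mpol k (n * n)) := mk_ideal tvan0 tvanD tvanM.
Lemma tvan_sat q : tvan (p *: q) -> tvan q.
Proof.
rewrite /tvan tauZ pevZ => h; have := congr1 (fun y => phi pi^-1 * y) h.
by rewrite mulr0 mulrA -rmorphM mulVf ?rmorph1 ?mul1r // pi_neq0.
Qed.
End Vanishing.

(** Weak and strict bounds for the Gauss norm in which the monomial [m] has norm [wt m]; the norm
    itself is never formed. *)
Definition gb (mu : R) (Q : mpol l (n * n)) : Prop := forall m, nabs (mcoef m Q) * val (wt m) <= mu.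
Definition gs (mu : R) (Q : mpol l (n * n)) : Prop := forall m, nabs (mcoef m Q) * val (wt m) < mu.
Lemma wt_gt0 m : 0 < val (wt m). Proof. exact: (valP (wt m)). Qed.
Lemma gb0 mu : 0 <= mu -> gb mu 0. Proof. by move=> h m; rewrite mcoef0 nabs0 mul0r. Qed.
Lemma gs0 mu : 0 < mu -> gs mu 0. Proof. by move=> h m; rewrite mcoef0 nabs0 mul0r. Qed.
Lemma gbD mu x y : gb mu x -> gb mu y -> gb mu (x + y).
Proof.
move=> hx hy m; rewrite mcoefD -ler_pdivlMr ?wt_gt0 //; apply: le_trans (nabsD _ _) _.
by rewrite ge_max !ler_pdivlMr ?wt_gt0 // hx hy.
Qed.
Lemma gsD mu x y : gs mu x -> gs mu y -> gs mu (x + y).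
Proof.
move=> hx hy m; rewrite mcoefD -ltr_pdivlMr ?wt_gt0 //; apply: le_lt_trans (nabsD _ _) _.
by rewrite gt_max !ltr_pdivlMr ?wt_gt0 // hx hy.
Qed.
Lemma gb_e mu c m : 0 <= mu -> nabs c * val (wt m) <= mu -> gb mu (c *: me m).
Proof.
move=> m0 h m'; rewrite mcoefZ mcoef_e; case: eqP => [<-|_]; first by rewrite mulr1.
by rewrite mulr0 nabs0 mul0r.
Qed.
Lemma gs_e mu c m : 0 < mu -> nabs c * val (wt m) < mu -> gs mu (c *: me m).
Proof.
move=> m0 h m'; rewrite mcoefZ mcoef_e; case: eqP => [<-|_]; first by rewrite mulr1.
by rewrite mulr0 nabs0 mul0r.
Qed.
Lemma gsb mu x : gs mu x -> gb mu x. Proof. by move=> h m; apply/ltW. Qed.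
Lemma gsM a b x y : 0 < a -> 0 < b -> gs a x -> gb b y -> gs (a * b) (x * y).
Proof.
move=> a0 b0 hx hy; have [s sE] := malg_expand' x; have [s' sE'] := malg_expand' y.
rewrite sE sE' mulr_suml; apply: big_ind => [|u u'|m _]; [exact/gs0/mulr_gt0|exact: gsD|].
rewrite mulr_sumr; apply: big_ind => [|u u'|m' _]; [exact/gs0/mulr_gt0|exact: gsD|].
rewrite malgZl malgZr meM scalerA; apply: gs_e; first exact: mulr_gt0.
rewrite mdegrD nabsM [val _](_ : _ = val (wt m) * val (wt m')) // mulrACA.
apply: le_lt_trans (_ : nabs (mcoef m x) * val (wt m) * b < _).
  by rewrite ler_wpM2l ?hy // mulr_ge0 ?nabs_ge0 // ltW ?wt_gt0.
by rewrite ltr_pM2r.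
Qed.
Lemma gbM a b x y : 0 < a -> 0 < b -> gb a x -> gb b y -> gb (a * b) (x * y).
Proof.
move=> a0 b0 hx hy; have [s sE] := malg_expand' x; have [s' sE'] := malg_expand' y.
have ab0 : 0 <= a * b by rewrite ltW ?mulr_gt0.
rewrite sE sE' mulr_suml; apply: big_ind => [|u u'|m _]; [exact: gb0|exact: gbD|].
rewrite mulr_sumr; apply: big_ind => [|u u'|m' _]; [exact: gb0|exact: gbD|].
rewrite malgZl malgZr meM scalerA; apply: gb_e => //.
rewrite mdegrD nabsM [val _](_ : _ = val (wt m) * val (wt m')) // mulrACA.
by apply: ler_pM; rewrite ?hx ?hy // mulr_ge0 ?nabs_ge0 // ltW ?wt_gt0.
Qed.

Section NearIdentity.
Variables (W : 'M[l]_n) (hW : forall j i, nabs (W j i - (j == i)%:R) * val (v i) < val (v j)).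
Definition subW : {rmorphism mpol l (n * n) -> mpol l (n * n)} :=
  pev (mconst (mon (n * n)))
    (mvec (map_mx (mconst (mon (n * n))) W *m (\matrix_(j, i) mX l (mxvec_index j i)))).
Let near a x x' := gb a x /\ gs a (x' - x).
Let nearM a b x y x' y' : 0 < a -> 0 < b -> near a x x' -> near b y y' ->
  near (a * b) (x * y) (x' * y').
Proof.
move=> a0 b0 [x1 x2] [y1 y2]; split; first exact: gbM.
have -> : x' * y' - x * y = (x' - x) * y' + (y' - y) * x.
  by rewrite !mulrBl [y' * x]mulrC [y * x]mulrC addrA subrK.
have y3 : gb b y' by rewrite -[y'](subrK y); apply: gbD => //; apply: gsb.
by apply: gsD; [apply: gsM|rewrite [a * b]mulrC; apply: gsM].
Qed.
Lemma subW_near m : near (val (wt m)) (me m) (subW (me m)).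
Proof.
elim/mon_ind: m => [|s m IH].
  have -> : wt 0 = 0 by rewrite /mdegr big1 // => i _; rewrite ffunE mulr0n.
  rewrite /near pev_e monval0 me0 subrr; split; last by apply: gs0; apply: ltr01.
  rewrite -me0 -[me 0]scale1r; apply: gb_e => //; rewrite nabs1 mul1r.
  by have -> : wt 0 = 0 by rewrite /mdegr big1 // => i _; rewrite ffunE mulr0n.
rewrite mdegrD mdegr_var -meM rmorphM; apply: nearM => //; [exact: (valP (nu s))|exact: wt_gt0|].
split.
  rewrite -[me _]scale1r; apply: gb_e; first exact/ltW/(valP (nu s)).
  by rewrite nabs1 mul1r mdegr_var.
have -> : me (mvar s) = mX l s by []; rewrite /subW pevX.
case/mxvec_indexP: s => j i; rewrite mvecE mxE nuE.
have -> : mX l (mxvec_index j i) = \sum_r (j == r)%:R *: mX l (mxvec_index r i).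
  rewrite (bigD1 j) //= eqxx scale1r big1 ?addr0 // => r /negPf rj.
  by rewrite eq_sym rj scale0r.
rewrite -sumrB; apply: big_ind => [|u u'|r _]; [exact/gs0/(valP (v j - v i))|exact: gsD|].
rewrite !mxE mconstM -scalerBl; apply: gs_e; first exact: (valP (v j - v i)).
rewrite mdegr_var nuE [val (v r - v i)](_ : _ = val (v r) / val (v i)) // mulrA.
by rewrite ltr_pM2r ?hW // invr_gt0; apply: (valP (v i)).
Qed.
(** Each variable is moved by something strictly smaller than its weight; by the ultrametric
    inequality this passes to products, then to monomials and to sums. *)
Lemma subW_gs mu Q : 0 < mu -> gb mu Q -> gs mu (subW Q - Q).
Proof.
move=> m0 hQ; have [s sE] := malg_expand' Q.
rewrite {1}sE [X in _ - X]sE rmorph_sum -sumrB.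
apply: big_ind => [|u u'|m _]; [exact: gs0|exact: gsD|].
have -> : subW (mcoef m Q *: me m) = mcoef m Q *: subW (me m) by rewrite pevZ mconstM.
rewrite -scalerBr; have [->|c0] := EM (mcoef m Q = 0); first by rewrite scale0r; apply: gs0.
move=> m'; rewrite mcoefZ nabsM -mulrA; apply: lt_le_trans (hQ m).
rewrite ltr_pM2l; first exact: (subW_near m).2.
by rewrite lt_def nabs_ge0 andbT; apply/eqP => /nabs_eq0.
Qed.
Variables (B : comPzRingType) (phi : {rmorphism l -> B}) (Z : 'M[B]_n).
Lemma pev_subW Q : pev phi (mvec Z) (subW Q) = pev phi (mvec (map_mx phi W *m Z)) Q.
Proof.
rewrite /subW rmorph_pev; apply: pev_eq => [a|s]; first exact: pevC.
case/mxvec_indexP: s => j i; rewrite !mvecE !mxE rmorph_sum; apply: eq_bigr => r _.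
by rewrite !mxE rmorphM pevC pevX mvecE.
Qed.
Hypotheses (h1 : forall c Q, pev phi (mvec (map_mx phi W *m Z)) Q = 0 ->
    pev phi (mvec (map_mx phi W *m Z)) (homM c Q) = 0)
  (h2 : forall c Q, pev phi (mvec Z) Q = 0 -> pev phi (mvec Z) (homM c Q) = 0).
(** On the component of class [c], the rescaling bounds all monomials by one constant [mu] ([muE]).
    There the substitution of [W] changes [tau q] by less than [mu], hence by the image of a
    multiple of [p], and the changed polynomial vanishes at [Z]. Homogeneity of both ideals allows
    this work class by class. *)
Lemma tvan_cong q : tvan phi (mvec (map_mx phi W *m Z)) q ->
  exists q' z, tvan phi (mvec Z) q' /\ q = q' + p *: z.
Proof.
move=> hq; pose K q := exists q' z, tvan phi (mvec Z) q' /\ q = q' + p *: z.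
apply: (@homc_total _ _ _ degM K q).
- by exists 0, 0; rewrite scaler0 addr0; split=> //; apply: tvan0.
- move=> x y [x' [z [hx' ->]]] [y' [z' [hy' ->]]]; exists (x' + y'), (z + z').
  by split; [apply: tvanD|rewrite scalerDr addrACA].
move=> c; have := tvan_hom h1 c hq; set q1 := homM c q => hq1.
have [wc wcE] : exists wc : Gamma R, gamma_class l wc = c.
  by exists (repr c); apply: reprK.
pose mu := t ^ kap wc * val wc.
have mu0 : 0 < mu by rewrite mulr_gt0 ?texp_gt0 //; apply: (valP wc).
have muE m : mdegr degM m = c -> t ^ kap (wt m) * val (wt m) = mu.
  rewrite mdegrM -wcE => /esym/(gamma_classP piP)[r e].
  by rewrite (kap_shift pi0 pi1 e) e (texpD pi0) mulrACA -(texpD pi0) addNr expr0z mulr1.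
have b1 : gb mu (tau q1).
  move=> m; rewrite tau_coef homc_coef; case: eqP => [mc|_]; last first.
    by rewrite rmorph0 mul0r nabs0 mul0r ltW.
  rewrite nabsM nabs_piz -mulrA muE //; apply: ler_piMl; [exact: ltW|exact: (valP (mcoef m q : oint l))].
have b2 := subW_gs mu0 b1.
pose E := homM c (subW (tau q1) - tau q1).
have [|z Ez] := tau_small (E := E).
  move=> m; rewrite homc_coef; case: eqP => [mc|_]; last by rewrite nabs0 texp_gt0.
  by rewrite -(ltr_pM2r (wt_gt0 m)) muE.
exists (q1 + p *: z), (- z); split; last by rewrite scalerN addrK.
have q1c : homM c (tau q1) = tau q1 by rewrite -tau_homM /q1 homc_id.
rewrite /tvan tauD -Ez /E (linearB' _ _ (homc_linear degM c)) q1c addrC subrK.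
by apply: h2; rewrite pev_subW.
Qed.
End NearIdentity.
End Core.

(** * The matrix of a representation in a basis *)

Section MatrixOf.
Variables (k : comNzRingType) (G : grpfun k) (X : rep G) (n : nat) (b : 'I_n -> X).
Variable hb : isbasis b.
Definition Cm (S : kalg k) (g : G S) : 'M[S]_n :=
  \matrix_(j, i) bcr hb (ract X S g (bc_in S (b j))) 0 i.
Lemma Cm_act S (g : G S) z : bcr hb (ract X S g z) = bcr hb z *m Cm g.
Proof.
have lr := bcr_linear hb S.
move: z; apply: (@linear_bc_basis k X n b hb S ('rV[S]_n)
  (fun z => bcr hb (ract X S g z)) (fun z => bcr hb z *m Cm g)).
- by move=> a x y; rewrite (Defs.lfunP (ract X S g)) lr.
- by move=> a x y; rewrite lr mulmxDl scalemxAl.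
move=> j; rewrite bcr_in_e -rowE; apply/rowP => i.
by rewrite [RHS]mxE [RHS]mxE.
Qed.
Lemma CmM S (g h : G S) : Cm (gmul g h) = Cm h *m Cm g.
Proof.
apply/row_matrixP => j; rewrite row_mul; apply/rowP => i.
have -> : row j (Cm h) = bcr hb (ract X S h (bc_in S (b j))) by apply/rowP => i'; rewrite !mxE.
rewrite -Cm_act [LHS]mxE [LHS]mxE; congr (bcr hb _ 0 i).
by rewrite ghomM.
Qed.
Lemma Cm1 S : Cm (gone G S) = 1%:M.
Proof.
apply/matrixP => j i; rewrite [LHS]mxE ghom1 -[laut1 _ _]/(bc_in S (b j)) bcr_in_e.
by rewrite [LHS]mxE [RHS]mxE eqxx /= eq_sym.
Qed.
Lemma Cm_map S S' (f : khom S S') (g : G S) : Cm (gmap f g) = map_mx f (Cm g).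
Proof.
apply/matrixP => j i; rewrite [LHS]mxE [RHS]mxE [X in f X]mxE ghom_nat -(bcpush_in f).
have -> : gmap f (ract X S g) (bcpush f (bc_in S (b j))) = bcpush f (ract X S g (bc_in S (b j))).
  exact: gl_mapE.
by rewrite bcr_push [LHS]mxE.
Qed.
Lemma Cm_isw (M : zmodType) (lam : ghom (Dgrp k M) G) (v : 'I_n -> M) :
  (forall j, isw (ghom_comp (ract X) lam) (v j) (b j)) ->
  forall S (d : Dgrp k M S), Cm (lam S d) = diag_mx (\row_j sval d (v j)).
Proof.
move=> hv S d; apply/matrixP => j i; rewrite [LHS]mxE.
have -> : ract X S (lam S d) (bc_in S (b j)) = sval d (v j) *: bc_in S (b j) by apply: hv.
rewrite (linearZ' _ _ (bcr_linear hb _)) bcr_in_e [LHS]mxE [X in _ * X]mxE [RHS]mxE mxE eqxx /=.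
by rewrite eq_sym mulr_natr.
Qed.
End MatrixOf.

(** * Matrices close to the identity for a weighted norm *)

Section NearInverse.
Variables (R : realType) (l : nafield R) (n : nat) (v : 'I_n -> Gamma R).
Definition near1 (W : 'M[l]_n) : Prop :=
  forall j i, nabs (W j i - (j == i)%:R) * val (v i) < val (v j).

Lemma nabs_sum_lt I (r : seq I) (F : I -> l) (c : R) : 0 < c ->
  (forall i, nabs (F i) < c) -> nabs (\sum_(i <- r) F i) < c.
Proof.
move=> c0 h; apply: (big_ind (fun x => nabs x < c)) => [|x y hx hy|i _]; [by rewrite nabs0| |exact: h].
by apply: le_lt_trans (nabsD _ _) _; rewrite gt_max hx.
Qed.

(** At a coordinate where the weighted absolute value of [x] is largest, the contribution of [W - 1]
    is strictly smaller than this maximum, so the product with [W] cannot be smaller than [x]. *)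
Lemma near1_expand (W : 'M[l]_n) (x : 'rV[l]_n) (c : R) : near1 W -> 0 < c ->
  (forall i, nabs ((x *m W) 0 i) * val (v i) < c) -> forall i, nabs (x 0 i) * val (v i) < c.
Proof.
move=> hW c0 h i1; pose F i := nabs (x 0 i) * val (v i).
case: (@Order.TotalTheory.arg_maxP _ _ _ i1 xpredT F isT) => i0 _ hi0.
have hi i : F i <= F i0 := hi0 i isT.
have v0 i : 0 < val (v i) := valP (v i).
apply: le_lt_trans (hi i1) _; rewrite ltNge; apply/negP => cF.
have F0 : 0 < F i0 := lt_le_trans c0 cF.
suff : F i0 < F i0 by rewrite ltxx.
rewrite {1}/F -ltr_pdivlMr ?v0 //.
have -> : x 0 i0 = (x *m W) 0 i0 + \sum_j x 0 j * ((j == i0)%:R - W j i0).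
  rewrite [X in X + _]mxE -big_split /= (bigD1 i0) //= eqxx -mulrDr [W i0 i0 + _]addrC subrK mulr1.
  by rewrite big1 ?addr0 // => j /negPf ji; rewrite ji -mulrDr sub0r subrr mulr0.
apply: le_lt_trans (nabsD _ _) _; rewrite gt_max ltr_pdivlMr ?v0 // (lt_le_trans (h i0) cF) /=.
apply: nabs_sum_lt => [|j]; first exact: divr_gt0 F0 (v0 i0).
rewrite ltr_pdivlMr ?v0 // nabsM -mulrA; have [->|x0] := EM (x 0 j = 0).
  by rewrite nabs0 mul0r.
apply: lt_le_trans (hi j); rewrite ltr_pM2l; first by rewrite -nabsN opprB hW.
by rewrite lt_def nabs_ge0 andbT; apply/eqP => /nabs_eq0.
Qed.

(** A nonzero vector in the kernel would contradict [near1_expand] with its own weighted coordinate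
    as the bound. The same lemma bounds the rows of [W^-1 - 1], whose product with [W] is
    [1 - W]. *)
Lemma near1_inv (W : 'M[l]_n) : near1 W -> exists W', [/\ near1 W', W' *m W = 1%:M & W *m W' = 1%:M].
Proof.
move=> hW; have uW : W \in unitmx.
  rewrite -row_free_unit; apply/row_freeP; apply: contrapT => nr.
  have : ~~ row_free W by apply/negP => /row_freeP.
  rewrite -kermx_eq0 => /eqP; apply; apply/row_matrixP => j; rewrite row0.
  have e : row j (kermx W) *m W = 0 by rewrite -row_mul mulmx_ker row0.
  apply/rowP => i; rewrite [RHS]mxE; apply: contrapT => x0.
  have c0 : 0 < nabs (row j (kermx W) 0 i) * val (v i).
    rewrite mulr_gt0 ?(valP (v i)) // lt_def nabs_ge0 andbT.
    by apply/eqP => /nabs_eq0.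
  have := near1_expand hW c0 (x := row j (kermx W)); rewrite e => /(_ _ i).
  by rewrite ltxx => h; suff : false by []; apply: h => i'; rewrite mxE nabs0 mul0r.
exists (invmx W); split; [|exact: mulVmx|exact: mulmxV].
move=> j i; have h := @near1_expand W (row j (invmx W - 1%:M)) (val (v j)) hW (valP (v j)).
have -> : invmx W j i - (j == i)%:R = row j (invmx W - 1%:M) 0 i by rewrite !mxE.
apply: h => i'; rewrite -row_mul mulmxBl mulVmx // mul1mx !mxE -nabsN opprB.
exact: hW.
Qed.
End NearInverse.

Lemma diag_conj_mx (B : comPzRingType) n (x y : 'I_n -> B) (Z : 'M[B]_n) j i :
  (diag_mx (\row_j x j) *m Z *m diag_mx (\row_j y j)) j i = x j * y i * Z j i.
Proof.
rewrite mul_diag_mx mul_mx_diag !mxE [RHS]mulrAC; congr (_ * _).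
Qed.

Local Notation gCm := Cm.

(** * The slice in the translated group and its bounded points *)

Section SliceData.
Variables (R : realType) (l : nafield R) (pi : l).
Hypotheses (pi0 : 0 < nabs pi) (pi1 : nabs pi < 1)
  (piP : forall x : l, x <> 0 -> exists n : int, nabs x = nabs pi ^ n).
Local Notation k := (oint l).
Local Notation p := (ppi pi1).
Local Notation M := (Gamma_quot l).
Local Notation cl := (gamma_class l).
Let hk := oint_dvr pi0 pi1 piP.

Lemma lalg_tf : tf p (amod (lalg l)).
Proof.
move=> x /eqP; rewrite -[_ *: _]/(pi * (x : l)) mulf_eq0 (negPf (pi_neq0 pi0)).
by move=> /eqP.
Qed.
Lemma galg_tf (M' : zmodType) (A : kalg k) : tf p (amod A) -> tf p (amod (galg M' A)).
Proof.
move=> tA x hx; apply: mcoef_inj => m; rewrite mcoef0; apply: tA.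
transitivity (mcoef m (mconst M' (kstr A p) * x)); first by rewrite mconstM mcoefZ.
by rewrite [_ * _]hx mcoef0.
Qed.

Variables (G : grpfun k) (lam : ghom (Dgrp k (Gamma R)) G).
Variables (O : kalg k) (a0 : G O) (ha : represents a0) (hfp : finitely_presented O)
  (hfs : formally_smooth O).
Let tO : tf p (amod O) := fsmooth_tf hk hfp hfs.
Variables (V : rep G) (n : nat) (b : 'I_n -> V) (hb : isbasis b) (v : 'I_n -> Gamma R).
Hypothesis hv : forall j, isw (ghom_comp (ract V) lam) (v j) (b j).
Local Notation Cm := (Cm hb).
Hypothesis gen : forall x : O, exists q, pev (kstr O) (mvec (Cm a0)) q = x.
Variables (U : 'M[l]_n) (hU : near1 v U).
(** The rows of [U] are weight vectors for the action of the other homomorphism on the generic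
    fibre, with the classes of the weights [v]; [g] stands for its value at [d]. *)
Hypothesis hchi : forall (B : kalg k) (f : khom (lalg l) B) (d : Dgrp k M B), exists g : G B,
  map_mx f U *m Cm g = diag_mx (\row_j sval d (cl (v j))) *m map_mx f U.

Local Notation Ol := (ctens O (lalg l)).
Let phi : {rmorphism l -> Ol} := ctR O (lalg l).
Let g0 : G Ol := gmap (ctL O (lalg l)) a0.
Let van (Q : mpol l (n * n)) : Prop := pev phi (mvec (Cm g0)) Q = 0.
Local Notation homM := (homc (degM l v)).

Lemma point_van (S : kalg k) (f : khom (lalg l) S) (g : G S) Q :
  van Q -> pev (f : {rmorphism l -> S}) (mvec (Cm g)) Q = 0.
Proof.
move=> hQ; have [h [h1 h2]] := ctens_lift (kh ha g) f.
rewrite -(rmorph0 h) -hQ rmorph_pev; apply: pev_eq => [a|s]; first by rewrite /= h2.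
case/mxvec_indexP: s => j i; rewrite !mvecE.
transitivity (Cm (gmap h g0) j i); last by rewrite Cm_map mxE.
congr (Cm _ j i); rewrite -[LHS](khP ha g) /g0 -gmap_comp; congr (gmap _ a0).
by apply: khom_eq => x /=; rewrite h1.
Qed.

(** The group is stable under conjugation by [lam], which multiplies each matrix coordinate by its
    weight; the universal character then separates the components of an equation. *)
Lemma van_homG w Q : van Q -> van (homc (nu v) w Q).
Proof.
move=> hQ; pose S := galg (Gamma R) Ol; pose inc := ginc (Gamma R) Ol.
pose d : Dgrp k (Gamma R) S := univ_char (Gamma R) Ol.
have := @point_van S (khom_comp inc (ctR O (lalg l)))
  (gmul (gmul (lam S (ginv d)) (gmap inc g0)) (lam S d)) Q hQ.
rewrite !CmM !(Cm_isw hb hv) Cm_map mulmxA => e.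
rewrite /van -(twist_coef (nu v)) -[RHS](mcoef0 _ w); congr (mcoef w _).
rewrite -[RHS]e; apply: pev_eq => [//|s]; case/mxvec_indexP: s => j i.
rewrite nuE !mvecE [RHS]diag_conj_mx [X in _ = _ * X]mxE; congr (_ * _).
by rewrite -meM.
Qed.
Lemma van_homM c Q : van Q -> van (homM c Q).
Proof.
move=> hQ; apply: (@homc_total _ _ _ (nu v) (fun Q => van (homM c Q)) Q).
- by rewrite (linear0' (homc_linear _ _)) /van rmorph0.
- move=> x y; rewrite /van (linearD' _ _ (homc_linear _ _)) rmorphD => -> ->.
  by rewrite addr0.
move=> w; suff -> : homM c (homc (nu v) w Q) = if cl w == c then homc (nu v) w Q else 0.
  by case: eqP => _; [apply: van_homG|rewrite /van rmorph0].
apply: mcoef_inj => m; rewrite homc_coef mdegrM homc_coef.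
case: (eqVneq (mdegr (nu v) m) w) => [<-|mw].
  by case: eqP => _; rewrite ?mcoef0 // homc_coef eqxx.
by case: (_ == c); case: (cl w == c); rewrite ?mcoef0 // homc_coef (negPf mw).
Qed.

Let ZF := map_mx phi U *m Cm g0.
(** By [hchi], left multiplication of the translate by diagonal matrices amounts to left
    multiplication inside it by the matrices of points of the group, and on the right [bar_chi]
    acts. Only characters of the value classes occur, so the translate is homogeneous for [M] but in
    general not for [Gamma]. *)
Lemma vanF_homM c Q : pev phi (mvec ZF) Q = 0 -> pev phi (mvec ZF) (homM c Q) = 0.
Proof.
rewrite -(pev_subW U) => hQ; pose S := galg M Ol; pose inc := ginc M Ol.
pose d : Dgrp k M S := univ_char M Ol.
pose f : khom (lalg l) S := khom_comp inc (ctR O (lalg l)).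
have [g hg] := hchi f d.
pose lb := ghom_comp lam (Dmap k (gamma_class l)).
have hvb j : isw (ghom_comp (ract V) lb) (cl (v j)) (b j).
  by move=> S' d'; apply: (@hv j S' (Dmap k (gamma_class l) S' d')).
have := @point_van S f (gmul (gmul (lb S (ginv d)) (gmap inc g0)) g) (subW U Q) hQ.
rewrite pev_subW !CmM !mulmxA hg (Cm_isw hb hvb) Cm_map => e.
rewrite -(twist_coef (degM l v)) -[RHS](mcoef0 _ c); congr (mcoef c _).
rewrite -[RHS]e; apply: pev_eq => [//|s]; case/mxvec_indexP: s => j i.
rewrite /degM nuE !mvecE -[diag_mx _ *m _ *m _]mulmxA [RHS]diag_conj_mx.
have -> : map_mx f U *m map_mx inc (Cm g0) = map_mx inc ZF.
  rewrite /ZF map_mxM; congr (_ *m _); apply/matrixP => j' i'; rewrite !mxE.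
  by [].
by rewrite [X in _ = _ * X]mxE; congr (_ * _); rewrite raddfB -meM.
Qed.

Definition ml : {rmorphism mpol k (n * n) -> mpol l (n * n)} :=
  pev (mconst (mon (n * n)) \o (val : {rmorphism k -> l})) (@mX l (n * n)).
Lemma ml_coef m r : mcoef m (ml r) = val (mcoef m r).
Proof.
elim/malg_ind: r => [a m' z IH|]; last by rewrite rmorph0 !mcoef0 rmorph0.
rewrite rmorphD !mcoefD IH pevZ pev_e mconstM !mcoefZ rmorphD rmorphM; congr (_ * _ + _).
have -> : monval (@mX l (n * n)) m' = me m' by rewrite me_prod.
by rewrite !mcoef_e; case: eqP; rewrite ?rmorph1 ?rmorph0.
Qed.
Lemma pev_ml (B : kalg k) (f : khom (lalg l) B) x q :
  pev (f : {rmorphism l -> B}) x (ml q) = pev (kstr B) x q.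
Proof.
rewrite /ml rmorph_pev; apply: pev_eq => [a|s]; last exact: pevX.
by transitivity (f (kstr (lalg l) a)); [exact: pevC|exact: khomP].
Qed.
Lemma van_ml q : van (ml q) <-> pev (kstr O) (mvec (Cm a0)) q = 0.
Proof.
have -> : van (ml q) <-> ctL O (lalg l) (pev (kstr O) (mvec (Cm a0)) q) = 0.
  rewrite /van [pev phi _ _](@pev_ml Ol (ctR O (lalg l))) pev_khom.
  suff -> : pev (kstr Ol) (mvec (Cm g0)) q =
    pev (kstr Ol) (fun s => ctL O (lalg l) (mvec (Cm a0) s)) q by [].
  apply: pev_eq => // s; rewrite /g0 Cm_map; case/mxvec_indexP: s => j i.
  by rewrite !mvecE mxE.
split=> [|->]; last by rewrite rmorph0.
exact: (ctL_inj hk tO lalg_tf (@lalg1_neq0 _ l)).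
Qed.
(** On a component of weight [w] in [Gamma] the rescaling is multiplication by the single power
    [pi ^ kap w]. Since the equations of the group are homogeneous for [Gamma], rescaling does not
    change its integral ideal. *)
Lemma van_tau q : tvan pi0 pi1 v phi (mvec (Cm g0)) q <->
  pev (kstr O) (mvec (Cm a0)) q = 0.
Proof.
have hw w : homc (nu v) w (tau pi0 pi1 v q) = pi ^ kap pi0 pi1 w *: homc (nu v) w (ml q).
  apply: mcoef_inj => m; rewrite mcoefZ !homc_coef tau_coef ml_coef.
  by case: eqP => [->|_]; rewrite ?mulr0 // mulrC.
rewrite -van_ml.
have van0 : van 0 by rewrite /van rmorph0.
have vanD x y : van x -> van y -> van (x + y).
  by rewrite /van rmorphD => -> ->; rewrite addr0.
split=> h.
  apply: (@homc_total _ _ _ (nu v) van) => // w.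
  have := van_homG w h; rewrite hw /van pevZ => /(congr1 (fun y => phi (pi ^ (- kap pi0 pi1 w)) * y)).
  by rewrite mulr0 mulrA -rmorphM -(pizD pi0) addNr expr0z rmorph1 mul1r.
apply: (@homc_total _ _ _ (nu v) van (tau pi0 pi1 v q)) => // w.
by rewrite hw /van pevZ [pev phi _ _](van_homG w h) mulr0.
Qed.

Lemma gen_lift (B : kalg k) (x : 'I_(n * n) -> B) :
  (forall q, pev (kstr O) (mvec (Cm a0)) q = 0 -> pev (kstr B) x q = 0) ->
  exists f : khom O B, forall s, f (mvec (Cm a0) s) = x s.
Proof.
move=> keyx; have [h hE] := choice gen.
have eqx q q' : pev (kstr O) (mvec (Cm a0)) q = pev (kstr O) (mvec (Cm a0)) q' ->
    pev (kstr B) x q = pev (kstr B) x q'.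
  move=> e; apply/eqP; rewrite -subr_eq0 -rmorphB; apply/eqP/keyx.
  by rewrite rmorphB e subrr.
pose F y := pev (kstr B) x (h y).
have FE q : F (pev (kstr O) (mvec (Cm a0)) q) = pev (kstr B) x q by apply: eqx; rewrite hE.
have FD y z : F (y + z) = F y + F z by rewrite -rmorphD; apply: eqx; rewrite rmorphD !hE.
have FM y z : F (y * z) = F y * F z by rewrite -rmorphM; apply: eqx; rewrite rmorphM !hE.
have F1 : F 1 = 1 by rewrite -(rmorph1 (pev (kstr O) (mvec (Cm a0)))) FE rmorph1.
have Fk c : rhom FD FM F1 (kstr O c) = kstr B c.
  by rewrite rhomE -(pevC (kstr O) (mvec (Cm a0))) FE pevC.
exists (@KHom k O B (rhom FD FM F1) Fk) => s.
transitivity (F (mvec (Cm a0) s)); first by [].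
by rewrite -(pevX (kstr O) (mvec (Cm a0))) FE pevX.
Qed.
Lemma kh_Cm (X : rep G) r (bX : 'I_r -> X) (hbX : isbasis bX) S (g : G S) j i :
  kh ha g (gCm hbX a0 j i) = gCm hbX g j i.
Proof.
transitivity (gCm hbX (gmap (kh ha g) a0) j i); first by rewrite Cm_map [RHS]mxE.
by rewrite khP.
Qed.
Lemma point_eq S (g g' : G S) : Cm g = Cm g' -> g = g'.
Proof.
move=> e; apply: (kh_inj (ha := ha)) => x; have [q <-] := gen x.
rewrite !pev_khom; apply: pev_eq => // s; case/mxvec_indexP: s => j i; rewrite !mvecE.
by rewrite !kh_Cm e.
Qed.

Lemma slice_data : exists (A : kalg k) (Xi : 'M[A]_n),
  [/\ etale_cover A, tf p (amod A), forall j i, cl (v j) <> cl (v i) -> Xi j i = 0,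
      forall q, tvan pi0 pi1 v phi (mvec ZF) q -> pev (kstr A) (mvec Xi) q = 0 &
      is_unit (\det Xi)].
Proof.
have [U' [hU' U'U UU']] := near1_inv hU.
pose JR := @tvan_ideal _ _ _ pi0 pi1 piP n v _ phi (mvec (Cm g0)) van_homM.
pose JF := @tvan_ideal _ _ _ pi0 pi1 piP n v _ phi (mvec ZF) vanF_homM.
have [r [gg [hg1 hg2]]] := noeth_span JR (mpol_noeth (n := n * n) (dvr_noeth hk)).
have JRspan q : JR q <-> spani gg q by split; [apply: hg2|apply: spani_sub].
have pres : presents (mvec (Cm a0)) gg.
  split=> [|q|B x hx]; first exact: gen.
    by rewrite -JRspan; apply: iff_sym; apply: van_tau.
  apply: gen_lift => q /van_tau/hg2[c ->].
  by rewrite rmorph_sum big1 // => i _; rewrite rmorphM hx mulr0.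
have [y' [hy' hsq]] := smooth_lift (J := JR) (y := fun s => mX k s) pres hfs
  (fun q hq => eq_ind_r (fun z => JR z) ((JRspan q).2 hq) (pev_id q)).
pose rr s := mX k s - y' s.
have hrr s : JR (rr s) by rewrite /rr -opprB; apply: submodN; apply: hy'.
have hsm q : JR q -> isq JR (q - \sum_s pd s q * rr s).
  move=> hq; have := hsq q ((JRspan q).1 hq); set z := pev _ y' q => hz.
  (* Modulo the square of [JR] the products of the [rr s] vanish, so [q] at [y' = X - rr] is given
     by the Taylor expansion of order one. This is the required splitting. *)
  suff e : isq JR (z - (q - \sum_s pd s q * rr s)).
    by have := submodB hz e; rewrite opprB addrCA subrr addr0.
  apply/(rpi_eq (isq JR)); pose f : {rmorphism mpol k (n * n) -> rquot (isq JR)} := rpi (isq JR).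
  have fz : f z = pev (f \o mconst (mon (n * n))) (fun s => f (mX k s) + f (- rr s)) q.
    rewrite /z rmorph_pev; apply: pev_eq => // s.
    by rewrite -rmorphD /rr opprB addrC subrK.
  rewrite -/f fz taylor => [|s s']; last first.
    rewrite -rmorphM -(rmorph0 f); apply/(rpi_eq (isq JR)); rewrite subr0.
    by apply: isqM; apply: submodN.
  rewrite rmorphB rmorph_sum -sumrN -(rmorph_pev _ f) pev_id; congr (_ + _).
  apply: eq_bigr => s _; rewrite -(rmorph_pev _ f) pev_id rmorphN mulrN.
  by congr (- _); rewrite -rmorphM.
(* The base point is the identity matrix: it satisfies the equations of the group, and its entries
   between different classes vanish. Taking [h] to be the determinant keeps the matrix of the slice
   invertible. *)
pose x0 : 'I_(n * n) -> k := mvec (1%:M).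
pose h : mpol k (n * n) := \det (\matrix_(j, i) mX k (mxvec_index j i)).
have det_ev (B : comPzRingType) (f : {rmorphism k -> B}) (Z : 'M[B]_n) :
    pev f (mvec Z) h = \det Z.
  rewrite -det_map_mx; congr (\det _); apply/matrixP => j i.
  by rewrite !mxE pevX mvecE.
have JFR q : JF q -> exists q' z, JR q' /\ q = q' + p *: z.
  by move=> hq; apply: (@tvan_cong R l pi pi0 pi1 piP n v U hU Ol phi (Cm g0) vanF_homM van_homM q hq).
(* The group is in turn the translate of [ZF] by the inverse of [U], which is again close to the
   identity. *)
have JRF q : JR q -> exists q' z, JF q' /\ q = q' + p *: z.
  move=> hq; have e : map_mx phi U' *m ZF = Cm g0 by rewrite /ZF mulmxA -map_mxM U'U map_mx1 mul1mx.
  apply: (@tvan_cong R l pi pi0 pi1 piP n v U' hU' Ol phi ZF) => [c Q|c Q|]; rewrite ?e;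
    [exact: van_homM|exact: vanF_homM|exact: hq].
have hx0 q : JR q -> exists y, pev idfun x0 q = p * y.
  move=> /van_tau hq; exists 0; rewrite mulr0.
  pose e := kh ha (gone G (kself k)); rewrite -[RHS](rmorph0 e) -hq pev_khom.
  apply: pev_eq => // s; case/mxvec_indexP: s => j i; rewrite /x0 !mvecE -(Cm1 hb (kself k)).
  by rewrite -(khP ha (gone G (kself k))) Cm_map mxE.
have hdeg s : degM l v s <> 0 -> x0 s = 0.
  case/mxvec_indexP: s => j i; rewrite /degM nuE /x0 mvecE mxE.
  by case: eqP => // ->; rewrite subrr raddf0.
have hh : is_unit (pev idfun x0 h) by rewrite det_ev det1; exists 1; rewrite mulr1.
have [A [xi [h1 h2 h3 h4 h5]]] := @twisted_slice k p hk (n * n) M (degM l v) JR JF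
  (@tvan_sat _ _ _ pi0 pi1 n v _ phi (mvec ZF)) JFR JRF
  (fun c q => @tvan_hom _ _ _ pi0 pi1 n v _ phi (mvec ZF) vanF_homM c q) rr hrr hsm x0 h hx0 hdeg hh.
pose Xi : 'M[A]_n := \matrix_(j, i) xi (mxvec_index j i).
have xiE : xi =1 mvec Xi by move=> s; case/mxvec_indexP: s => j i; rewrite mvecE mxE.
exists A, Xi; split=> // [j i ji|q hq|].
- by rewrite mxE; apply: h3; rewrite /degM nuE raddfB => /eqP; rewrite subr_eq0 => /eqP.
- by rewrite -[RHS](h4 q hq); apply: pev_eq.
by rewrite -(det_ev _ (kstr A)) -(pev_eq h (fun=> erefl) xiE).
Qed.

Section Point.
Variables (A : kalg k) (Xi : 'M[A]_n) (tA : tf p (amod A)).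
Hypotheses (hXi0 : forall j i, cl (v j) <> cl (v i) -> Xi j i = 0)
  (hXiF : forall q, tvan pi0 pi1 v phi (mvec ZF) q -> pev (kstr A) (mvec Xi) q = 0)
  (hdet : is_unit (\det Xi)).
Local Notation Al := (ctens A (lalg l)).
Local Notation inA := (ctL A (lalg l)).
Let psi : {rmorphism l -> Al} := ctR A (lalg l).
Local Notation kap := (kap pi0 pi1).
Local Notation t := (nabs pi).

Lemma ee_ex : exists e : 'I_n -> int, forall j i, cl (v j) = cl (v i) ->
  val (v j) = val (v i) * t ^ (e j - e i).
Proof.
have /choice[e he] : forall j, exists r : int, val (v j) = val (repr (cl (v j))) * t ^ r.
  by move=> j; apply/(gamma_classP piP); apply: reprK.
exists e => j i ji; rewrite (he j) (he i) ji -mulrA -(texpD pi0) addrC subrK.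
by [].
Qed.
Let ee := sval (cid ee_ex).
Lemma eeP j i : cl (v j) = cl (v i) -> val (v j) = val (v i) * t ^ (ee j - ee i).
Proof. exact: (svalP (cid ee_ex)). Qed.
(** This undoes the rescaling in degree 0: for equal classes the ratio of [v j] by [v i] is
    [t ^ (ee j - ee i)], whose [kap] is the opposite exponent. Being conjugation by the diagonal
    matrix of the [pi ^ ee j], it is multiplicative. *)
Definition tw (Y : 'M[A]_n) : 'M[Al]_n := \matrix_(j, i) (psi (pi ^ (ee j - ee i)) * inA (Y j i)).
Lemma twM (Y Z : 'M[A]_n) : tw Y *m tw Z = tw (Y *m Z).
Proof.
apply/matrixP => j i; rewrite !mxE rmorph_sum mulr_sumr; apply: eq_bigr => r _.
rewrite !mxE mulrACA -rmorphM -(pizD pi0) rmorphM; congr (psi (pi ^ _) * _).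
by rewrite addrA subrK.
Qed.
Lemma tw1 : tw 1%:M = 1%:M.
Proof.
apply/matrixP => j i; rewrite !mxE; case: eqP => [->|_]; last by rewrite rmorph0 mulr0.
by rewrite subrr expr0z !rmorph1 mulr1.
Qed.

Lemma pev_tw Q : pev phi (mvec ZF) Q = 0 -> pev psi (mvec (tw Xi)) Q = 0.
Proof.
move=> hQ; have [E [q qE]] := tau_lift pi0 pi1 piP v Q.
have hq : pev (kstr A) (mvec Xi) q = 0 by apply: hXiF; rewrite /tvan qE pevZ hQ mulr0.
have key : pev psi (mvec (tw Xi)) (tau pi0 pi1 v q) = inA (pev (kstr A) (mvec Xi) q).
  have mE m : psi (pi ^ kap (mdegr (nu v) m)) * monval (mvec (tw Xi)) m = inA (monval (mvec Xi) m).
    elim/mon_ind: m => [|s m IH].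
      have -> : mdegr (nu v) 0 = 0 by rewrite /mdegr big1 // => i _; rewrite ffunE mulr0n.
      have kap0 : kap 0 = 0 by rewrite -[RHS]oppr0; apply: (kap_unit pi0 pi1); rewrite expr0z.
      by rewrite !monval0 kap0 expr0z !rmorph1 mulr1.
    rewrite !monvalD !monval_var [inA _]rmorphM -IH mdegrD mdegr_var.
    case/mxvec_indexP: s => j i; rewrite nuE !mvecE mxE.
    have [ji|ji] := EM (cl (v j) = cl (v i)); last by rewrite hXi0 // rmorph0 !(mulr0, mul0r).
    rewrite (@kap_shift _ _ _ pi0 pi1 (mdegr (nu v) m) _ (ee j - ee i)); last first.
      rewrite /= (eeP ji) [_ * t ^ _ / _]mulrAC mulfV ?mul1r; first by rewrite mulrC.
      by rewrite gt_eqF // (valP (v i)).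
    rewrite -[psi _ * _ * _]mulrA mulrA -rmorphM -(pizD pi0) subrK.
    by rewrite mulrCA.
  elim/malg_ind: {hq qE} q => [a m z IH|]; last by rewrite tau0 !rmorph0.
  rewrite tauL !rmorphD IH !pevZ tau_e pevZ !pev_e [inA (_ * _)]rmorphM -mE; congr (_ * _ + _).
  by rewrite khomP; apply: (khomP (ctR A (lalg l)) a).
have := key; rewrite hq rmorph0 qE pevZ => /(congr1 (fun y => psi (pi ^+ E)^-1 * y)).
by rewrite mulr0 mulrA -rmorphM mulVf ?rmorph1 ?mul1r // expf_neq0 // pi_neq0.
Qed.

(** Integrality of an element of the generic fibre after scaling by a weight [w]. For [bdm], the
    entry [(j, i)] of a matrix is bounded as it must be in order to preserve the balls. *)
Definition bd (w : Gamma R) (x : Al) : Prop := exists y, x = psi (pi ^ kap w) * inA y.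
Lemma bd0 w : bd w 0. Proof. by exists 0; rewrite rmorph0 mulr0. Qed.
Lemma bdD w x y : bd w x -> bd w y -> bd w (x + y).
Proof. by move=> [a ->] [c ->]; exists (a + c); rewrite rmorphD mulrDr. Qed.
Lemma bd_sum w I (r : seq I) (P : pred I) F : (forall i, bd w (F i)) -> bd w (\sum_(i <- r | P i) F i).
Proof. by move=> h; apply: big_ind => //; [exact: bd0|exact: bdD]. Qed.
Lemma bd_mul_oint w (c : k) x : bd w x -> bd w (psi (val c) * x).
Proof.
move=> [y ->]; exists (kstr A c * y); rewrite rmorphM khomP mulrCA; congr (_ * (_ * _)).
exact: (khomP (ctR A (lalg l)) c).
Qed.
Lemma bdM w w' x y : bd w x -> bd w' y -> bd (w + w') (x * y).
Proof.
move=> [a ->] [c ->].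
have [z hz] : exists z : k, pi ^ (kap w + kap w') = val z * pi ^ kap (w + w').
  by apply: (nabs_dvd pi0); rewrite nabs_piz (texp_le pi0 pi1) kap_subadd.
have -> : psi (pi ^ kap w) * inA a * (psi (pi ^ kap w') * inA c) =
    psi (val z) * (psi (pi ^ kap (w + w')) * inA (a * c)).
  by rewrite mulrACA -[psi _ * psi _]rmorphM -(pizD pi0) hz [psi (val z * _)]rmorphM [inA (_ * _)]rmorphM -mulrA.
by apply: bd_mul_oint; exists (a * c).
Qed.
Lemma bd_const w z : nabs z * val w <= 1 -> bd w (psi z).
Proof.
move=> h; have [c hc] : exists c : k, z = val c * pi ^ kap w.
  apply: (nabs_dvd pi0); have [->|z0] := EM (z = 0); first by rewrite nabs0 ltW ?texp_gt0.
  by have [r zr] := piP z0; rewrite zr (texp_le pi0 pi1) -kapP -zr.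
by exists (kstr A c); rewrite khomP hc rmorphM mulrC; congr (_ * _); apply: (khomP (ctR A (lalg l)) c).
Qed.
Lemma bd_tw (Y : 'M[A]_n) j i : (cl (v j) <> cl (v i) -> Y j i = 0) -> bd (v i - v j) (tw Y j i).
Proof.
move=> h; rewrite mxE; have [ji|/h ->] := EM (cl (v j) = cl (v i)); last first.
  by rewrite rmorph0 mulr0; apply: bd0.
exists (Y j i); congr (psi (pi ^ _) * _).
rewrite (@kap_unit _ _ _ pi0 pi1 _ (ee i - ee j)) ?opprB //= (eeP (esym ji)).
by rewrite mulrAC mulfV ?mul1r // gt_eqF // (valP (v j)).
Qed.
Definition bdm (Z : 'M[Al]_n) : Prop := forall j i, bd (v i - v j) (Z j i).
Lemma bdmM Z Z' : bdm Z -> bdm Z' -> bdm (Z *m Z').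
Proof.
move=> h h' j i; rewrite mxE; apply: bd_sum => r.
have -> : v i - v j = (v r - v j) + (v i - v r) by rewrite [RHS]addrC [RHS]addrA subrK.
exact: bdM.
Qed.
Lemma near1_bdm W : near1 v W -> bdm (map_mx psi W).
Proof.
move=> hW j i; rewrite mxE -[W j i](subrK ((j == i)%:R)) rmorphD; apply: bdD; apply: bd_const.
  rewrite [val _]/(val (v i) / val (v j)) mulrA ler_pdivrMr ?(valP (v j)) // mul1r ltW //.
case: eqP => [->|_]; last by rewrite nabs0 mul0r.
by rewrite nabs1 mul1r subrr.
Qed.

(** The point [s] has matrix [U^-1 n] with [n = tw Xi]. It lies in the group because [n] satisfies
    the equations of the translate. Both factors are bounded, as are their inverses, and [n] is
    block diagonal for the value classes, so it commutes with [D]. *)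
Lemma conj_point : exists s : G Al, [/\ bdm (Cm s), bdm (Cm (ginv s)) &
  forall (B : kalg k) (F : khom Al B) (d : Dgrp k M B),
    let f := khom_comp F (ctR A (lalg l)) in let D := diag_mx (\row_j sval d (cl (v j))) in
    D *m (map_mx f U *m Cm (gmap F s)) = (map_mx f U *m Cm (gmap F s)) *m D].
Proof.
have [U' [hU' U'U UU']] := near1_inv hU.
have [f hf] : exists f : khom O Al, forall s, f (mvec (Cm a0) s) = mvec (map_mx psi U' *m tw Xi) s.
  apply: gen_lift => q /van_ml hq.
  rewrite -(@pev_ml Al (ctR A (lalg l))) -[LHS](pev_subW U'); apply: pev_tw.
  by rewrite pev_subW /ZF mulmxA -map_mxM U'U map_mx1 mul1mx.
pose s := gmap f a0.
have Cs : Cm s = map_mx psi U' *m tw Xi.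
  rewrite /s Cm_map; apply/matrixP => j i; rewrite mxE.
  by have := hf (mxvec_index j i); rewrite !mvecE.
have UCs : map_mx psi U *m Cm s = tw Xi by rewrite Cs mulmxA -map_mxM UU' map_mx1 mul1mx.
have [dV hdV] := hdet; pose Xi' := dV *: \adj Xi.
have XiV : Xi' *m Xi = 1%:M by rewrite /Xi' -scalemxAl mul_adj_mx scale_scalar_mx mulrC hdV.
have XiV' : Xi *m Xi' = 1%:M by rewrite /Xi' -scalemxAr mul_mx_adj scale_scalar_mx mulrC hdV.
have diagC (B : comPzRingType) (Z : 'M[B]_n) (x : 'I_n -> B) :
    (forall j i, Z j i = 0 \/ x j = x i) -> diag_mx (\row_j x j) *m Z = Z *m diag_mx (\row_j x j).
  move=> h; apply/matrixP => j i; rewrite mul_diag_mx mul_mx_diag !mxE.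
  by case: (h j i) => ->; rewrite ?mulr0 ?mul0r // mulrC.
have Xi'0 j i : cl (v j) <> cl (v i) -> Xi' j i = 0.
  (* The inverse is block diagonal too: it commutes with the diagonal idempotent selecting the class
     of [v j], because [Xi] does. *)
  move=> ji; pose x r : A := (cl (v r) == cl (v j))%:R.
  have e1 : diag_mx (\row_j x j) *m Xi = Xi *m diag_mx (\row_j x j).
    apply: diagC => r q; have [e|/hXi0] := EM (cl (v r) = cl (v q)); last by left.
    by right; rewrite /x e.
  have e2 : diag_mx (\row_j x j) *m Xi' = Xi' *m diag_mx (\row_j x j).
    by rewrite -[LHS]mul1mx -XiV -!mulmxA [Xi *m (_ *m _)]mulmxA -e1 -[(_ *m Xi) *m _]mulmxA XiV' mulmx1.
  have := congr1 (fun Z : 'M_n => Z j i) e2; rewrite mul_diag_mx mul_mx_diag !mxE /x eqxx mul1r => ->.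
  by rewrite (introF eqP (nesym ji)) mulr0.
exists s; split.
- rewrite Cs; apply: bdmM; first exact: near1_bdm.
  by move=> j i; apply: bd_tw => ji; apply: hXi0.
- have -> : Cm (ginv s) = tw Xi' *m map_mx psi U.
    rewrite -[RHS]mulmx1 -(Cm1 hb Al) -(gmulV s) CmM !mulmxA -[tw Xi' *m _ *m Cm s]mulmxA UCs twM XiV tw1.
    by rewrite mul1mx.
  by apply: bdmM; [move=> j i; apply: bd_tw; apply: Xi'0|apply: near1_bdm].
move=> B F d f' D.
have -> : map_mx f' U *m Cm (gmap F s) = map_mx F (tw Xi).
  rewrite Cm_map -UCs map_mxM; congr (_ *m _); apply/matrixP => j i; rewrite !mxE.
  by [].
apply: diagC => j i; rewrite !mxE; have [->|ji] := EM (cl (v j) = cl (v i)); first by right.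
by left; rewrite hXi0 // rmorph0 mulr0 rmorph0.
Qed.

(** An entry of the matrix of [X] is an integral polynomial in the entries for [V]. Conjugation by
    [lam] scales it by [vX j - vX i], so this polynomial can be replaced by its component of that
    weight, all of whose monomials satisfy the bound. *)
Lemma bounded_rep (g : G Al) : bdm (Cm g) ->
  forall (X : rep G) (r : nat) (bX : 'I_r -> X) (hbX : isbasis bX) (vX : 'I_r -> Gamma R),
  (forall j, isw (ghom_comp (ract X) lam) (vX j) (bX j)) ->
  forall j i, bd (vX i - vX j) (gCm hbX g j i).
Proof.
move=> hg X r bX hbX vX hvX j i.
have [q0 q0E] := gen (gCm hbX a0 j i).
set w := vX j - vX i; pose q := homc (nu v) w q0.
have qE : pev (kstr O) (mvec (Cm a0)) q = gCm hbX a0 j i.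
  pose S := galg (Gamma R) O; pose inc := ginc (Gamma R) O.
  pose d : Dgrp k (Gamma R) S := univ_char (Gamma R) O.
  pose g' := gmul (gmul (lam S (ginv d)) (gmap inc a0)) (lam S d).
  have e1 : kh ha g' (gCm hbX a0 j i) = (me w : malg O (Gamma R)) * mconst _ (gCm hbX a0 j i).
    transitivity (gCm hbX g' j i); first exact: kh_Cm.
    rewrite /g' !CmM !(Cm_isw hbX hvX) Cm_map mulmxA diag_conj_mx [X in _ * X]mxE; congr (_ * _).
    by rewrite /w -meM.
  have e2 : kh ha g' (pev (kstr O) (mvec (Cm a0)) q0) =
      pev (mconst (Gamma R) \o kstr O) (fun s => me (nu v s) * mconst (Gamma R) (mvec (Cm a0) s)) q0.
    rewrite pev_khom; apply: pev_eq => [//|s]; case/mxvec_indexP: s => j' i'.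
    rewrite nuE !mvecE; transitivity (Cm g' j' i'); first exact: kh_Cm.
    rewrite /g' !CmM !(Cm_isw hb hv) Cm_map mulmxA diag_conj_mx [X in _ * X]mxE; congr (_ * _).
    by rewrite -meM.
  have := congr1 (mcoef w) e2; rewrite q0E e1 mulrC mconstM mcoefZ mcoef_e eqxx mulr1 => ->.
  by rewrite twist_coef.
have -> : gCm hbX g j i = pev (kstr Al) (mvec (Cm g)) q.
  transitivity (kh ha g (gCm hbX a0 j i)); first exact/esym/kh_Cm.
  rewrite -qE pev_khom; apply: pev_eq => // s; case/mxvec_indexP: s => j' i'; rewrite !mvecE.
  exact: kh_Cm.
have hm m : bd (- mdegr (nu v) m) (monval (mvec (Cm g)) m).
  elim/mon_ind: m => [|s m IH].
    rewrite monval0 -(rmorph1 psi); apply: bd_const; rewrite nabs1 mul1r.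
    have -> : mdegr (nu v) 0 = 0 by rewrite /mdegr big1 // => i' _; rewrite ffunE mulr0n.
    by rewrite oppr0.
  rewrite monvalD monval_var mdegrD mdegr_var opprD; apply: bdM => //.
  by case/mxvec_indexP: s => j' i'; rewrite nuE mvecE opprB; apply: hg.
have [s sE] := malg_expand' q; rewrite sE rmorph_sum; apply: bd_sum => m; rewrite pevZ pev_e.
rewrite homc_coef; case: eqP => [mw|_]; last by rewrite rmorph0 mul0r; apply: bd0.
rewrite -(khomP (ctR A (lalg l))); apply: bd_mul_oint.
by rewrite -opprB -/w -mw; apply: hm.
Qed.
End Point.
End SliceData.

(** * Balls of a norm and tensor automorphisms *)

Lemma bcmap_id (k : comPzRingType) (M : lmodType k) (S : kalg k) (z : bc M S) : bcmap id z = z.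
Proof.
move: z; apply: (@linear_bc_eq k M S (bc M S) (bcmap (R := S) id) id) => //; first exact: bcmap_linear.
by move=> x; rewrite bcmap_in.
Qed.

Section Levels.
Variables (R : realType) (l : nafield R) (pi : l).
Hypotheses (pi0 : 0 < nabs pi) (pi1 : nabs pi < 1)
  (piP : forall x : l, x <> 0 -> exists n : int, nabs x = nabs pi ^ n).
Variables (G : grpfun (oint l)) (theta : norm_family G) (Tint : subgrp G).
Variables (chi : ghom (Dgrp (oint l) (Gamma R)) (subfun Tint)) (hchi : is_theta chi theta).
Local Notation k := (oint l).
Local Notation kap := (kap pi0 pi1).
Local Notation wact := (wact chi).
Implicit Types (X Y : rep G) (g h : Gamma R).
Let hk := oint_dvr pi0 pi1 piP.

Lemma basis_tf (N : lmodType k) n (e : 'I_n -> N) : isbasis e -> tf (ppi pi1) N.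
Proof.
move=> he x hx; rewrite [x](crdE he) big1 // => i _.
have := congr1 (crd he) hx; rewrite (linearZ' _ _ (crd_linear he)) (linear0' (crd_linear he)).
move=> /rowP/(_ i); rewrite mxE [RHS]mxE => /(dvr_dom hk)[/(dvr_p0 hk)//|->].
by rewrite scale0r.
Qed.

Lemma wbasis_ex X : exists q : {m : nat & (('I_m -> X) * ('I_m -> Gamma R))%type},
  isbasis (tagged q).1 /\ forall j, isw (wact X) ((tagged q).2 j) ((tagged q).1 j).
Proof.
have [n [e he]] := fgproj_basis hk (@rmodP _ _ X).
have [m [b [v [hb hv]]]] := weight_basis he (wact X) hk (basis_tf he).
by exists (existT _ m (b, v)).
Qed.
Definition wm X : nat := tag (sval (cid (wbasis_ex X))).
Definition wb X : 'I_(wm X) -> X := (tagged (sval (cid (wbasis_ex X)))).1.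
Definition wv X : 'I_(wm X) -> Gamma R := (tagged (sval (cid (wbasis_ex X)))).2.
Lemma wbP X : isbasis (@wb X). Proof. exact: (svalP (cid (wbasis_ex X))).1. Qed.
Lemma wvP X j : isw (wact X) (@wv X j) (@wb X j).
Proof. exact: (svalP (cid (wbasis_ex X))).2. Qed.

Lemma lev_val_inj X g : injective (@lev_val _ _ _ theta X g).
Proof. by move=> x y h; apply/val_inj. Qed.
Lemma lev_valL X g (a : k) (x y : lev theta X g) :
  lev_val (a *: x + y) = (val a : l) *: lev_val x + lev_val y.
Proof. by []. Qed.
Lemma lev_val0 X g : lev_val (0 : lev theta X g) = 0. Proof. by []. Qed.
Lemma lev_valZ X g (a : k) (x : lev theta X g) : lev_val (a *: x) = (val a : l) *: lev_val x.
Proof. by []. Qed.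
Lemma lev_val_sum X g I (r : seq I) (P : pred I) (F : I -> lev theta X g) :
  lev_val (\sum_(i <- r | P i) F i) = \sum_(i <- r | P i) lev_val (F i).
Proof. by apply: (big_morph (@lev_val _ _ _ theta X g)). Qed.
Definition mklev X g (z : Xl X) (hz : theta X z <= val g) : lev theta X g :=
  exist (fun z => smod_pred (ball_le (theta X) g) z) z (asboolT hz).
Lemma mklevE X g (z : Xl X) (hz : theta X z <= val g) : lev_val (mklev hz) = z.
Proof. by []. Qed.
Lemma levP X g (x : lev theta X g) : theta X (lev_val x) <= val g.
Proof. by have /asboolP := valP x. Qed.
Lemma bcr_lev X (z : Xl X) (c : l) j : bcr (@wbP X) (c *: z) 0 j = c * bcr (@wbP X) z 0 j.
Proof. by rewrite (linearZ' _ _ (bcr_linear (@wbP X) _)) [LHS]mxE. Qed.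

Lemma theta_isw X w x (c : l) g : isw (wact X) w x -> nabs c * val w <= val g ->
  theta X ((c : lalg l) *: bc_in (lalg l) x) <= val g.
Proof.
move=> hx hc; apply/(theta_le hchi (@wbP X) (@wvP X)) => j; rewrite bcr_lev bcr_in [_ 0 j]mxE.
have [<-|vw] := eqVneq w (wv j); last first.
  rewrite (crd_isw (@wbP X) (@wvP X) hx); first by rewrite rmorph0 mulr0 nabs0 mul0r ltW ?(valP g).
  by apply/eqP; rewrite eq_sym.
apply: le_trans hc; rewrite ler_pM2r; last exact: (valP w).
by rewrite nabsM ler_piMr ?nabs_ge0 //; apply: (valP (crd (@wbP X) x 0 j)).
Qed.

Lemma lb_le X g (j : 'I_(wm X)) :
  theta X ((pi ^ kap (wv j - g) : lalg l) *: bc_in (lalg l) (wb j)) <= val g.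
Proof.
apply: (theta_isw (@wvP X j)); rewrite nabs_piz // kapB //.
Qed.
Definition lb X g j : lev theta X g := mklev (@lb_le X g j).

Lemma lbP X g : isbasis (@lb X g).
Proof.
have bl := bcr_linear (@wbP X) (lalg l).
split=> [a ha i|x].
  have := congr1 (fun x => bcr (@wbP X) (lev_val x) 0 i) ha.
  rewrite lev_val_sum (linear_sum' _ _ _ bl) lev_val0 (linear0' bl) [RHS]mxE summxE.
  rewrite (bigD1 i) //= lev_valZ mklevE !bcr_lev bcr_in_e [delta_mx 0 i 0 i]mxE !eqxx mulr1.
  rewrite big1 ?addr0 => [|j ji]; last first.
    rewrite lev_valZ mklevE !bcr_lev bcr_in_e [delta_mx 0 j 0 i]mxE eq_sym (negPf ji) andbF.
    by rewrite !mulr0.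
  move=> /eqP; rewrite mulf_eq0 (negPf (piz_neq0 pi0 _)) orbF => /eqP h.
  exact: val_inj.
have hx := (theta_le hchi (@wbP X) (@wvP X) (lev_val x) g).1 (levP x).
have /choice[a ha] : forall j, exists y : k,
    bcr (@wbP X) (lev_val x) 0 j = val y * pi ^ kap (wv j - g) :> l.
  move=> j; apply: (nabs_dvd pi0).
  have [->|z0] := EM (bcr (@wbP X) (lev_val x) 0 j = 0).
    by rewrite nabs0 ltW // texp_gt0.
  by have [n e] := piP z0; move: (hx j); rewrite e kapB // texp_le.
exists a; apply: lev_val_inj; rewrite lev_val_sum -[LHS](bcrK (@wbP X)).
apply: eq_bigr => j _; rewrite lev_valZ mklevE ha [RHS]scalerA; congr (_ *: _).
Qed.

(** The rescaling isomorphism from [X] to the ball of radius [g], matching the basis [wb] with [lb].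
    It is not compatible with inclusions and tensor products, but the resulting factors depend only
    on the classes of the weights. *)
Definition levT X g (x : X) : lev theta X g := \sum_j crd (@wbP X) x 0 j *: lb g j.
Definition levV X g (x : lev theta X g) : X := \sum_j crd (@lbP X g) x 0 j *: wb j.
Lemma levT_linear X g : linear (@levT X g).
Proof.
move=> a x y; rewrite /levT (crd_linear (@wbP X)) scaler_sumr -big_split.
by apply: eq_bigr => j _; rewrite [_ 0 j]mxE [X in X + _]mxE scalerDl scalerA.
Qed.
Lemma levV_linear X g : linear (@levV X g).
Proof.
move=> a x y; rewrite /levV (crd_linear (@lbP X g)) scaler_sumr -big_split.
by apply: eq_bigr => j _; rewrite [_ 0 j]mxE [X in X + _]mxE scalerDl scalerA.
Qed.
Lemma levTK X g : cancel (@levT X g) (@levV X g).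
Proof.
move=> x; rewrite /levV /levT crd_sum [RHS](crdE (@wbP X)).
by apply: eq_bigr => j _; rewrite [_ 0 j]mxE.
Qed.
Lemma levVK X g : cancel (@levV X g) (@levT X g).
Proof.
move=> x; rewrite /levV /levT crd_sum [RHS](crdE (@lbP X g)).
by apply: eq_bigr => j _; rewrite [_ 0 j]mxE.
Qed.
Lemma levT_b X g j : levT g (@wb X j) = lb g j.
Proof.
rewrite /levT crd_e (bigD1 j) //= [delta_mx 0 j 0 j]mxE !eqxx scale1r big1 ?addr0 // => i ij.
by rewrite [delta_mx 0 j 0 i]mxE (negPf ij) andbF scale0r.
Qed.
Lemma levT_wt X g w x : isw (wact X) w x ->
  lev_val (levT g x) = (pi ^ kap (w - g) : lalg l) *: bc_in (lalg l) x.
Proof.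
move=> hx; rewrite {2}[x](crdE (@wbP X)) bc_in_sum scaler_sumr lev_val_sum.
apply: eq_bigr => j _; rewrite lev_valZ mklevE bc_inZ.
have [-> |vw] := eqVneq (wv j) w; first by rewrite scalerA mulrC -scalerA.
by rewrite (crd_isw (@wbP X) (@wvP X) hx (elimN eqP vw)) rmorph0 !scale0r scaler0.
Qed.

Lemma isw_tens X Y v w (x : X) (y : Y) : isw (wact X) v x -> isw (wact Y) w y ->
  isw (wact (rep_tens X Y)) (v + w) (tens_in x y).
Proof.
move=> hx hy S d; have hb := tens_inP X Y.
have tE : bc_in S (tens_in x y) = bctens (bc_in S x) (bc_in S y) by rewrite /bctens bcbilin_in.
rewrite tE [LHS]glt_tens; [|exact: Defs.lfunP|exact: Defs.lfunP].
transitivity (bctens (sval d v *: bc_in S x) (sval d w *: bc_in S y)).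
  by congr bctens; [apply: hx|apply: hy].
rewrite /bctens (linearZ' _ _ (bcbilin_linear1 _ hb)) (linearZ' _ _ (bcbilin_linear2 _ hb)).
by rewrite scalerA (svalP d).2.
Qed.

Lemma Xl_tens_le X Y g h (x : lev theta X g) (y : lev theta Y h) :
  theta (rep_tens X Y) (Xl_tens (lev_val x) (lev_val y)) <= val (g + h).
Proof.
have hb := tens_inP X Y.
have sum_le (Z : rep G) I (r : seq I) (F : I -> Xl Z) (c : Gamma R) :
    (forall i, theta Z (F i) <= val c) -> theta Z (\sum_(i <- r) F i) <= val c.
  move=> hF; apply: (big_ind (fun z => theta Z z <= val c)) => [|u u' hu hu'|i _]; last exact: hF.
    by rewrite nval0; apply/ltW/(valP c).
  by apply: le_trans (nvalD _ _ _) _; rewrite ge_max hu.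
rewrite -[lev_val x](bcrK (@wbP X)) -[lev_val y](bcrK (@wbP Y)) /bcv /Xl_tens /bctens.
rewrite (linear_sum' _ _ _ (bcbilin_linear1 _ hb)); apply: (sum_le (rep_tens X Y)) => i.
rewrite (linear_sum' _ _ _ (bcbilin_linear2 _ hb)); apply: (sum_le (rep_tens X Y)) => j.
rewrite (linearZ' _ _ (bcbilin_linear1 _ hb)) (linearZ' _ _ (bcbilin_linear2 _ hb)).
rewrite bcbilin_in // scalerA.
apply: (@theta_isw (rep_tens X Y) (wv i + wv j) (tens_in (wb i) (wb j))).
  by apply: isw_tens; apply: wvP.
rewrite nabsM mulrACA ler_pM //.
- by rewrite mulr_ge0 ?nabs_ge0 ?ltW //; apply: (valP (wv i)).
- by rewrite mulr_ge0 ?nabs_ge0 ?ltW //; apply: (valP (wv j)).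
- exact: (theta_le hchi (@wbP X) (@wvP X) (lev_val x) g).1 (levP x) i.
exact: (theta_le hchi (@wbP Y) (@wvP Y) (lev_val y) h).1 (levP y) j.
Qed.
Definition ltens X Y g h (x : lev theta X g) (y : lev theta Y h) :
  lev theta (rep_tens X Y) (g + h) := mklev (Xl_tens_le x y).
Lemma ltensE X Y g h (x : lev theta X g) (y : lev theta Y h) :
  lev_val (ltens x y) = Xl_tens (lev_val x) (lev_val y).
Proof. by []. Qed.
Lemma ltens_bilin X Y g h : bilin (@ltens X Y g h).
Proof.
have hb := tens_inP X Y.
split=> [y a x x'|x a y y']; apply: lev_val_inj; rewrite ltensE !lev_valL !ltensE /Xl_tens /bctens.
  exact: (bcbilin_linear1 _ hb).
exact: (bcbilin_linear2 _ hb).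
Qed.

Lemma incl_le X g h (x : lev theta X g) : val g <= val h -> theta X (lev_val x) <= val h.
Proof. exact: le_trans (levP x). Qed.
Definition lincl X g h (gh : val g <= val h) (x : lev theta X g) : lev theta X h :=
  mklev (incl_le x gh).
Lemma lincl_linear X g h gh : linear (@lincl X g h gh).
Proof. by move=> a x y; apply: lev_val_inj; rewrite lev_valL !mklevE lev_valL. Qed.

Hypothesis hN : in_Ntens theta.
Lemma mor_le X Y g (f : X -> Y) (x : lev theta X g) : rep_mor f ->
  theta Y (Xl_map f (lev_val x)) <= val g.
Proof. by move=> hf; apply: le_trans (Nt_functor hN hf _) (levP x). Qed.
Definition lmor X Y g (f : X -> Y) (hf : rep_mor f) (x : lev theta X g) : lev theta Y g :=
  mklev (mor_le x hf).
Lemma lmor_linear X Y g (f : X -> Y) (hf : rep_mor f) : linear (@lmor X Y g f hf).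
Proof.
move=> a x y; apply: lev_val_inj; rewrite lev_valL !mklevE lev_valL.
exact: (bcmap_linear hf.1).
Qed.
Lemma scale_le X g h (c : l) (x : lev theta X g) : val h = val g * nabs c ->
  theta X (c *: lev_val x) <= val h.
Proof. by move=> ->; rewrite nvalZ mulrC ler_wpM2r ?nabs_ge0 ?levP. Qed.
Definition lscal X g h (c : l) (e : val h = val g * nabs c) (x : lev theta X g) :
  lev theta X h := mklev (scale_le x e).
Lemma lscal_linear X g h (c : l) (e : val h = val g * nabs c) : linear (@lscal X g h c e).
Proof.
move=> a x y; apply: lev_val_inj; rewrite lev_valL !mklevE lev_valL scalerDr !scalerA.
by rewrite mulrC.
Qed.

(** * Balls and tensor automorphisms on the generic fibre *)

Section Generic.
Variables (B : kalg k) (f : khom (lalg l) B).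

Lemma eps_semilin X g : semilin (R := B) (fun x : lev theta X g => bcpush f (lev_val x)).
Proof.
split=> [x y|a x].
  rewrite -[x in LHS]scale1r lev_valL (bcpush_linear f) -[val 1]/(1 : lalg l).
  by rewrite rmorph1 scale1r.
by rewrite lev_valZ bcpushZ -(khomP f).
Qed.
(** Over an [l]-algebra the inclusion of a ball becomes an isomorphism, with inverse [epsV]; all
    radii are then identified. *)
Definition eps X g : bc (lev theta X g) B -> bc X B :=
  uext (fun x : lev theta X g => bcpush f (lev_val x)).
Lemma eps_in X g (x : lev theta X g) : eps (bc_in B x) = bcpush f (lev_val x).
Proof. exact: (uext_gen _ (eps_semilin X g)). Qed.
Lemma eps_linear X g : linear (@eps X g).
Proof. exact: (uext_linear (eps_semilin X g)). Qed.

Definition epsV X g (z : bc X B) : bc (lev theta X g) B :=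
  \sum_j (f (pi ^ (- kap (wv j - g)) : lalg l) * bcr (@wbP X) z 0 j) *: bc_in B (lb g j).
Lemma epsV_linear X g : linear (@epsV X g).
Proof.
move=> a x y; rewrite /epsV (bcr_linear (@wbP X)) [X in _ = X + _]scaler_sumr -big_split.
apply: eq_bigr => j _; 
have -> : (a *: bcr (@wbP X) x + bcr (@wbP X) y) 0 j = a * bcr (@wbP X) x 0 j + bcr (@wbP X) y 0 j.
  by rewrite [LHS]mxE [X in X + _]mxE.
rewrite mulrDr scalerDl scalerA.
by congr (_ *: _ + _); rewrite mulrCA.
Qed.
Lemma pizK (n : int) : f (pi ^ n : lalg l) * f (pi ^ (- n) : lalg l) = 1.
Proof. by rewrite -rmorphM -(pizD pi0) subrr expr0z rmorph1. Qed.
Lemma eps_lb X g j : eps (bc_in B (@lb X g j)) =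
  f (pi ^ kap (wv j - g) : lalg l) *: bc_in B (wb j).
Proof. by rewrite eps_in mklevE bcpushZ bcpush_in. Qed.
Lemma epsVK X g : cancel (@epsV X g) (@eps X g).
Proof.
apply: (@linear_bc_basis _ _ _ _ (@wbP X) B (bc X B) (@eps X g \o @epsV X g) id) => //.
  by move=> a x y /=; rewrite epsV_linear eps_linear.
move=> j /=; rewrite /epsV bcr_in_e (linear_sum' _ _ _ (@eps_linear X g)) (bigD1 j) //=.
rewrite (linearZ' _ _ (@eps_linear X g)) eps_lb [delta_mx 0 j 0 j]mxE !eqxx mulr1 scalerA.
rewrite mulrC pizK scale1r big1 ?addr0 // => i ij.
by rewrite [delta_mx 0 j 0 i]mxE (negPf ij) andbF mulr0 scale0r (linear0' (@eps_linear X g)).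
Qed.
Lemma epsK X g : cancel (@eps X g) (@epsV X g).
Proof.
apply: (@linear_bc_basis _ _ _ _ (@lbP X g) B (bc (lev theta X g) B) (@epsV X g \o @eps X g) id) => //.
  by move=> a x y /=; rewrite eps_linear epsV_linear.
move=> j /=; rewrite eps_lb (linearZ' _ _ (@epsV_linear X g)) /epsV bcr_in_e (bigD1 j) //=.
rewrite [delta_mx 0 j 0 j]mxE !eqxx mulr1 big1 ?addr0 => [|i ij].
  by rewrite scalerA pizK scale1r.
by rewrite [delta_mx 0 j 0 i]mxE (negPf ij) andbF mulr0 scale0r.
Qed.
Lemma eps_inj X g : injective (@eps X g). Proof. exact: can_inj (@epsK X g). Qed.

Lemma eps_mor X Y g (h : X -> Y) (u : lev theta X g -> lev theta Y g) : linear h -> linear u ->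
  (forall x, lev_val (u x) = Xl_map h (lev_val x)) ->
  forall z, eps (bcmap u z) = bcmap h (eps z).
Proof.
move=> lh lu hu; apply: (@linear_bc_eq _ (lev theta X g) B (bc Y B)
  (fun z => eps (bcmap u z)) (fun z => bcmap h (eps z))).
- by move=> a x y; rewrite (bcmap_linear lu) eps_linear.
- by move=> a x y; rewrite eps_linear (bcmap_linear lh).
by move=> x; rewrite bcmap_in // !eps_in hu /Xl_map bcpush_map.
Qed.
Lemma eps_scale X g h (c : l) (u : lev theta X g -> lev theta X h) : linear u ->
  (forall x, lev_val (u x) = c *: lev_val x) ->
  forall z, eps (bcmap u z) = f (c : lalg l) *: eps z.
Proof.
move=> lu hu; apply: (@linear_bc_eq _ (lev theta X g) B (bc X B)
  (fun z => eps (bcmap u z)) (fun z => f (c : lalg l) *: eps z)).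
- by move=> a x y; rewrite (bcmap_linear lu) eps_linear.
- by move=> a x y; rewrite eps_linear scalerDr !scalerA mulrC.
by move=> x; rewrite bcmap_in // !eps_in hu bcpushZ.
Qed.
Lemma eps_incl X g h (u : lev theta X g -> lev theta X h) : linear u ->
  (forall x, lev_val (u x) = lev_val x) -> forall z, eps (bcmap u z) = eps z.
Proof.
move=> lu hu z; rewrite (@eps_scale X g h 1 u lu) ?[f _]rmorph1 ?scale1r // => x.
by rewrite scale1r.
Qed.
Lemma eps_tens X Y g h (b : lev theta X g -> lev theta Y h -> lev theta (rep_tens X Y) (g + h)) :
  bilin b -> (forall x y, lev_val (b x y) = Xl_tens (lev_val x) (lev_val y)) ->
  forall z t, eps (bcbilin b z t) = bctens (eps z) (eps t).
Proof.
move=> hb eb z t; have ht := tens_inP X Y; move: z.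
apply: (@linear_bc_eq _ (lev theta X g) B (bc (rep_tens X Y) B)
  (fun z => eps (bcbilin b z t)) (fun z => bctens (eps z) (eps t))).
- by move=> a x y; rewrite (bcbilin_linear1 _ hb) eps_linear.
- by move=> a x y; rewrite eps_linear /bctens (bcbilin_linear1 _ ht).
move=> x; move: t; apply: (@linear_bc_eq _ (lev theta Y h) B (bc (rep_tens X Y) B)
  (fun t => eps (bcbilin b (bc_in B x) t)) (fun t => bctens (eps (bc_in B x)) (eps t))).
- by move=> a t t'; rewrite (bcbilin_linear2 _ hb) eps_linear.
- by move=> a t t'; rewrite eps_linear /bctens (bcbilin_linear2 _ ht).
by move=> y; rewrite bcbilin_in // !eps_in eb /Xl_tens /bctens bcpush_bilin.
Qed.
End Generic.

Lemma eps_push (B B' : kalg k) (f : khom (lalg l) B) (c : khom B B') X g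
    (z : bc (lev theta X g) B) : eps (khom_comp c f) (bcpush c z) = bcpush c (eps f z).
Proof.
elim/bc_ind: z => [a x z IH|].
  rewrite bcpush_linear !eps_linear bcpush_linear IH bcpush_in !eps_in; congr (_ *: _ + _).
  elim/bc_ind: (lev_val x) => [a' y t IH'|]; last by rewrite !bcpush0.
  by rewrite !bcpush_linear IH' !bcpush_in.
by rewrite bcpush0 !(linear0' (@eps_linear _ _ _ _)) bcpush0.
Qed.

(* An automorphism which extends to the generic fibre as the action of a point of G
   is automatically compatible with all the structure. *)
Lemma aut_of_point (A B : kalg k) (c : khom A B) (f : khom (lalg l) B) (x : G B)
    (phi : lev_family theta A) : injective c ->
  (forall X g z, eps f (bcpush c (phi (X, g) z)) = ract X B x (eps f (bcpush c z))) ->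
  aut_tensor_mem phi.
Proof.
move=> ci h.
have inj X g : injective (fun z : bc (lev theta X g) A => eps f (bcpush c z)).
  move=> z t /eps_inj e; apply: (bcr_inj (he := @lbP X g)); apply/rowP => j; apply: ci.
  have := congr1 (bcr (@lbP X g) (S := B)) e; rewrite !bcr_push => /rowP/(_ j).
  by rewrite mxE [RHS]mxE.
have lx X := Defs.lfunP (ract X B x).
split=> [X Y u hu g u' lu' eu z|X g h' gh u lu eu z|X g h' a a0 gh u lu eu z|X Y g h' b hb eb z t];
  apply: inj; cbv beta.
- by rewrite h !(bcpush_map _ _ lu') !(eps_mor _ hu.1 lu' eu) h hu.2.
- by rewrite h !(bcpush_map _ _ lu) !(eps_incl _ lu eu) h.
- by rewrite h !(bcpush_map _ _ lu) !(eps_scale _ lu eu) h (linearZ' _ _ (lx X)).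
rewrite h !(bcpush_bilin _ _ _ hb) !(eps_tens _ hb eb) !h; exact: glt_tens (lx X) (lx Y).
Qed.

Section Points.
Variables (O : kalg k) (a0 : G O) (ha : represents a0) (tO : tf (ppi pi1) (amod O)).
Variables (B : kalg k) (f : khom (lalg l) B) (phi : lev_family theta B).
Hypothesis hphi : aut_tensor_mem phi.

Let gen X g (z : bc X B) : bc X B := eps f (phi (X, g) (epsV f g z)).
Lemma gen_linear X g : linear (@gen X g).
Proof.
by move=> a x y; rewrite /gen epsV_linear (Defs.lfunP (phi (X, g))) eps_linear.
Qed.
Lemma gen_indep X g h z : @gen X g z = @gen X h z.
Proof.
wlog gh : g h / val g <= val h.
  by move=> W; case/orP: (le_total (val g) (val h)) => /W // ->.
have li := @lincl_linear X g h gh.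
have eE : epsV f h z = bcmap (@lincl X g h gh) (epsV f g z).
  by apply: (eps_inj (f := f)); rewrite (eps_incl _ li) // !epsVK.
by rewrite /gen eE (at_incl hphi gh li) // (eps_incl _ li).
Qed.
(** The inclusions between balls show that, seen through [eps], the automorphism does not depend on
    the radius. Tannaka reconstruction then applies at level [0], the ball of radius 1. *)
Lemma point_of_aut : exists x : G B, forall X g (z : bc (lev theta X g) B),
  eps f (phi (X, g) z) = ract X B x (eps f z).
Proof.
have [|X Y u hu z|X Y z t|z t|x hx] := @tannaka _ _ hk G O a0 ha tO B (fun X => @gen X 0).
- exact: (fun X => @gen_linear X 0).
- have lm := @lmor_linear X Y 0 u hu.
  have eE : epsV f 0 (bcmap u z) = bcmap (@lmor X Y 0 u hu) (epsV f 0 z).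
    by apply: (eps_inj (f := f)); rewrite (eps_mor _ hu.1 lm) // !epsVK.
  by rewrite /gen eE (at_mor hphi hu lm) // (eps_mor _ hu.1 lm).
- have bl := @ltens_bilin X Y 0 0.
  have eE : epsV f (0 + 0) (bctens z t : bc (rep_tens X Y) B) = bcbilin (@ltens X Y 0 0) (epsV f 0 z) (epsV f 0 t).
    by apply: (eps_inj (f := f)); rewrite (eps_tens _ bl) // !epsVK.
  by rewrite (@gen_indep (rep_tens X Y) 0 (0 + 0)) /gen eE (at_tens hphi bl) // (eps_tens _ bl).
- move=> e; apply: (can_inj (epsVK f 0)); apply: (can_inj (lfunK (phi (rep_unit G, 0)))).
  exact: eps_inj e.
by exists x => X g z; rewrite hx (gen_indep 0 g) /gen epsK.
Qed.
End Points.

(** * Transport of the centralizer along the rescaling *)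

Section Transport.
Variable S : kalg k.
Definition lT X g : bc X S -> bc (lev theta X g) S := bcmap (R := S) (@levT X g).
Definition lV X g : bc (lev theta X g) S -> bc X S := bcmap (R := S) (@levV X g).
Lemma lT_linear X g : linear (@lT X g). Proof. exact: (bcmap_linear (@levT_linear X g)). Qed.
Lemma lV_linear X g : linear (@lV X g). Proof. exact: (bcmap_linear (@levV_linear X g)). Qed.
Lemma lTK X g : cancel (@lT X g) (@lV X g).
Proof.
apply: (@linear_bc_eq k X S (bc X S) (@lV X g \o @lT X g) id) => // [a x y|x] /=.
  by rewrite lT_linear lV_linear.
by rewrite /lT /lV !bcmap_in ?levTK //; [apply: levV_linear|apply: levT_linear].
Qed.
Lemma lVK X g : cancel (@lV X g) (@lT X g).
Proof.
apply: (@linear_bc_eq k _ S (bc (lev theta X g) S) (@lT X g \o @lV X g) id) => // [a x y|x] /=.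
  by rewrite lV_linear lT_linear.
by rewrite /lT /lV !bcmap_in ?levVK //; [apply: levT_linear|apply: levV_linear].
Qed.
Definition tr_fun X g (u : bc X S -> bc X S) (z : bc (lev theta X g) S) := lT g (u (lV z)).
Lemma tr_linear X g u : linear u -> linear (@tr_fun X g u).
Proof. by move=> lu a x y; rewrite /tr_fun lV_linear lu lT_linear. Qed.
Lemma trK X g u v : cancel u v -> cancel (@tr_fun X g u) (@tr_fun X g v).
Proof. by move=> uv z; rewrite /tr_fun lTK uv lVK. Qed.
Definition tr X g (u : GL X S) : GL (lev theta X g) S :=
  LAut (@tr_linear X g u (Defs.lfunP u)) (@trK X g u (linv u) (lfunK u)) (@trK X g _ _ (linvK u)).
Lemma trE X g (u : GL X S) z : tr g u (lT g z) = lT g (u z).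
Proof. by rewrite /= /tr_fun lTK. Qed.
End Transport.
Lemma tr_map S S' (c : khom S S') X g (u : GL X S) : gmap c (tr g u) = tr g (gmap c u).
Proof.
apply: laut_eq => z; rewrite -[z](lVK (S := S')); move: (lV z) => {}z; rewrite [RHS]trE.
move: z; apply: (@linear_bc_eq k X S' (bc (lev theta X g) S') (fun z => gmap c (tr g u) (lT g z))
  (fun z => lT g (gmap c u z))).
- by move=> a x y; rewrite lT_linear (Defs.lfunP (gmap c (tr g u))).
- by move=> a x y; rewrite (Defs.lfunP (gmap c u)) lT_linear.
move=> x; rewrite -(bcpush_in c) [gmap c u _]gl_mapE /lT -!bcpush_map; try exact: levT_linear.
by rewrite [LHS]gl_mapE; congr bcpush; apply: trE.
Qed.

Definition bact X : ghom (Dgrp k (Gamma_quot l)) (GL X) := ghom_comp (ract X) (bar_chi chi).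
Lemma wact_bact X w x : isw (wact X) w x -> isw (bact X) (gamma_class l w) x.
Proof. by move=> hx S d; apply: (hx S (Dmap k (gamma_class l) S d)). Qed.
Definition cP X c : X -> X := dP (@wbP X) (bact X) c.
Lemma cP_linear X c : linear (@cP X c). Proof. exact: dP_linear. Qed.
Lemma bwP X j : isw (bact X) (gamma_class l (@wv X j)) (@wb X j).
Proof. by apply: wact_bact; apply: wvP. Qed.
Lemma cP_wb X j : cP (gamma_class l (@wv X j)) (@wb X j) = wb j.
Proof. by rewrite /cP (isw_dP _ (bwP j)) eqxx. Qed.

Lemma commute_cP S X (u : GL X S) :
  (forall S' (c : khom S S') d z, gmap c u (bact X S' d z) = bact X S' d (gmap c u z)) ->
  forall c z, u (bcmap (@cP X c) z) = bcmap (@cP X c) (u z).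
Proof.
move=> h c z; have [cs [ucs h0 hr]] := dP_supp (@wbP X) (bact X).
have [ccs|ccs] := boolP (c \in cs); last first.
  have z0 (t : bc X S) : bcmap (@cP X c) t = 0.
    apply: (@linear_bc_eq k X S (bc X S) (bcmap (R := S) (@cP X c)) (fun=> 0)).
    - exact: (bcmap_linear (@cP_linear X c)).
    - by move=> a x y; rewrite scaler0 addr0.
    by move=> x; rewrite bcmap_in ?[cP c x]h0 ?bc_in0 //; apply: cP_linear.
  by rewrite !z0 (linear0' (Defs.lfunP u)).
pose inc := ginc (Gamma_quot l) S; pose B := galg (Gamma_quot l) S.
pose d := univ_char (Gamma_quot l) S : Dgrp k (Gamma_quot l) B.
have e := h B inc d (bcpush inc z).
have push_sum (t : bc X S) : bact X B d (bcpush inc t) =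
    \sum_(c <- cs) (me c : malg S (Gamma_quot l)) *: bcpush inc (bcmap (@cP X c) t).
  by rewrite hr; apply: eq_bigr => c' _; rewrite bcpush_map //; apply: cP_linear.
have uE t : gmap inc u (bcpush inc t) = bcpush inc (u t) by apply: gl_mapE.
have lu := Defs.lfunP (gmap inc u).
rewrite push_sum (linear_sum' _ _ _ lu) uE push_sum in e.
have := congr1 (gcf (@wbP X) c) e; rewrite (gcf_chars _ _ ucs ccs) => <-.
under eq_bigr do rewrite (linearZ' _ _ lu) uE.
by rewrite (gcf_chars _ (fun c => u (bcmap (@cP X c) z)) ucs ccs).
Qed.

Lemma cP_ext X (S : kalg k) (Q : lmodType S) (f g : bc X S -> Q) : linear f -> linear g ->
  (forall j z, f (bcmap (@cP X (gamma_class l (@wv X j))) z) =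
               g (bcmap (@cP X (gamma_class l (@wv X j))) z)) -> f =1 g.
Proof.
move=> lf lg h; apply: (linear_bc_basis (@wbP X) lf lg) => j.
by have := h j (bc_in S (wb j)); rewrite bcmap_in ?cP_wb //; apply: cP_linear.
Qed.

Definition class_fun (s : Gamma R -> k) : Prop :=
  forall w w', gamma_class l w = gamma_class l w' -> s w = s w'.

Lemma class_op X Y (D h : X -> Y) (s : Gamma R -> k) : linear D -> linear h ->
  (forall j, D (@wb X j) = s (wv j) *: h (wb j)) -> class_fun s ->
  forall j y, D (cP (gamma_class l (@wv X j)) y) =
              s (wv j) *: h (cP (gamma_class l (wv j)) y).
Proof.
move=> lD lh hD hs j0 y; have lz : linear (fun x => s (wv j0) *: h x).
  by move=> a x x'; rewrite lh scalerDr !scalerA mulrC.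
apply: (@isw_crd _ _ _ (bact X) _ _ (@wbP X) _ Y D _ _ _ lD lz (@bwP X)); first exact: dP_isw.
by move=> j e; rewrite hD; congr (_ *: _); apply: hs.
Qed.

Lemma class_op2 X Y (Z : lmodType k) (D h : X -> Y -> Z) (s : Gamma R -> Gamma R -> k) :
  bilin D -> bilin h ->
  (forall i j, D (@wb X i) (@wb Y j) = s (wv i) (wv j) *: h (wb i) (wb j)) ->
  (forall w, class_fun (s w)) -> (forall w, class_fun (s^~ w)) ->
  forall i j x y, D (cP (gamma_class l (@wv X i)) x) (cP (gamma_class l (@wv Y j)) y) =
    s (wv i) (wv j) *: h (cP (gamma_class l (wv i)) x) (cP (gamma_class l (wv j)) y).
Proof.
move=> [lD1 lD2] [lh1 lh2] hD hs1 hs2 i0 j0 x y; set y' := cP _ y.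
have lz : linear (fun x => s (wv i0) (wv j0) *: h x y').
  by move=> a u u'; rewrite lh1 scalerDr !scalerA mulrC.
apply: (@isw_crd _ _ _ (bact X) _ _ (@wbP X) _ Z (D^~ y') _ _ _ (lD1 y') lz (@bwP X)).
  exact: dP_isw.
move=> i ei; have lz2 : linear (fun y => s (wv i0) (wv j0) *: h (wb i) y).
  by move=> a u u'; rewrite lh2 scalerDr !scalerA mulrC.
apply: (@isw_crd _ _ _ (bact Y) _ _ (@wbP Y) _ Z (D (wb i)) _ _ _ (lD2 _) lz2 (@bwP Y)).
  exact: dP_isw.
by move=> j ej; rewrite hD (hs1 _ _ _ ej) (hs2 _ _ _ ei).
Qed.

Definition cP_comm (S : kalg k) X (u : GL X S) : Prop := forall c z, u (bcmap (@cP X c) z) = bcmap (@cP X c) (u z).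

Lemma bc_class (S : kalg k) X Y (D h : X -> Y) (s : Gamma R -> k) : linear D -> linear h ->
  (forall j, D (@wb X j) = s (wv j) *: h (wb j)) -> class_fun s ->
  forall j (z : bc X S), bcmap D (bcmap (@cP X (gamma_class l (@wv X j))) z) =
    kstr S (s (wv j)) *: bcmap h (bcmap (@cP X (gamma_class l (@wv X j))) z).
Proof.
move=> lD lh hD hs j; apply: (@linear_bc_eq k X S (bc Y S)
    (fun z => bcmap D (bcmap (@cP X (gamma_class l (@wv X j))) z))
    (fun z => kstr S (s (wv j)) *: bcmap h (bcmap (@cP X (gamma_class l (@wv X j))) z))).
- by move=> a x y; rewrite (bcmap_linear (@cP_linear X _)) (bcmap_linear lD).
- move=> a x y; rewrite (bcmap_linear (@cP_linear X _)) (bcmap_linear lh).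
  by rewrite scalerDr !scalerA mulrC.
move=> x; rewrite (bcmap_in _ _ (@cP_linear X _)) (bcmap_in _ _ lD) (bcmap_in _ _ lh).
by rewrite -bc_inZ (class_op lD lh hD hs).
Qed.

(** On each class component [D] is a scalar multiple of [h]. An operator that respects these
    components and intertwines [h] therefore intertwines [D]. *)
Lemma op_comm (S : kalg k) X Y (D h : X -> Y) (s : Gamma R -> k) (u : GL X S) (v : GL Y S) :
  linear D -> linear h -> (forall j, D (@wb X j) = s (wv j) *: h (wb j)) -> class_fun s ->
  cP_comm u -> (forall z, v (bcmap h z) = bcmap h (u z)) ->
  forall z, v (bcmap D z) = bcmap D (u z).
Proof.
move=> lD lh hD hs hu hv; apply: cP_ext.
- by move=> a x y; rewrite (bcmap_linear lD) (Defs.lfunP v).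
- by move=> a x y; rewrite (Defs.lfunP u) (bcmap_linear lD).
by move=> j z; rewrite hu !(bc_class lD lh hD hs) (linearZ' _ _ (Defs.lfunP v)) hv hu.
Qed.

Lemma bc_class2 (S : kalg k) X Y (Z : lmodType k) (D h : X -> Y -> Z)
    (s : Gamma R -> Gamma R -> k) : bilin D -> bilin h ->
  (forall i j, D (@wb X i) (@wb Y j) = s (wv i) (wv j) *: h (wb i) (wb j)) ->
  (forall w, class_fun (s w)) -> (forall w, class_fun (s^~ w)) ->
  forall i j (z : bc X S) (t : bc Y S),
  bcbilin D (bcmap (@cP X (gamma_class l (@wv X i))) z)
      (bcmap (@cP Y (gamma_class l (@wv Y j))) t) =
    kstr S (s (wv i) (wv j)) *: bcbilin h (bcmap (@cP X (gamma_class l (@wv X i))) z)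
      (bcmap (@cP Y (gamma_class l (@wv Y j))) t).
Proof.
move=> lD lh hD hs1 hs2 i j z t; move: z; apply: (@linear_bc_eq k X S (bc Z S)
    (fun z => bcbilin D (bcmap (@cP X (gamma_class l (@wv X i))) z) _)
    (fun z => _ *: bcbilin h (bcmap (@cP X (gamma_class l (@wv X i))) z) _)).
- by move=> a x y; rewrite (bcmap_linear (@cP_linear X _)) (bcbilin_linear1 _ lD).
- move=> a x y; rewrite (bcmap_linear (@cP_linear X _)) (bcbilin_linear1 _ lh).
  by rewrite scalerDr !scalerA mulrC.
move=> x; rewrite (bcmap_in _ _ (@cP_linear X _)); move: t.
apply: (@linear_bc_eq k Y S (bc Z S)
  (fun t => bcbilin D _ (bcmap (@cP Y (gamma_class l (@wv Y j))) t))
  (fun t => _ *: bcbilin h _ (bcmap (@cP Y (gamma_class l (@wv Y j))) t))).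
- by move=> a y y'; rewrite (bcmap_linear (@cP_linear Y _)) (bcbilin_linear2 _ lD).
- move=> a y y'; rewrite (bcmap_linear (@cP_linear Y _)) (bcbilin_linear2 _ lh).
  by rewrite scalerDr !scalerA mulrC.
move=> y; rewrite (bcmap_in _ _ (@cP_linear Y _)) (bcbilin_in _ _ _ lD) (bcbilin_in _ _ _ lh).
by rewrite -bc_inZ (class_op2 lD lh hD hs1 hs2).
Qed.

Lemma op_comm2 (S : kalg k) X Y (Z : lmodType k) (D h : X -> Y -> Z)
    (s : Gamma R -> Gamma R -> k) (u : GL X S) (v : GL Y S) (w : GL Z S) :
  bilin D -> bilin h ->
  (forall i j, D (@wb X i) (@wb Y j) = s (wv i) (wv j) *: h (wb i) (wb j)) ->
  (forall w, class_fun (s w)) -> (forall w, class_fun (s^~ w)) ->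
  cP_comm u -> cP_comm v -> (forall z t, w (bcbilin h z t) = bcbilin h (u z) (v t)) ->
  forall z t, w (bcbilin D z t) = bcbilin D (u z) (v t).
Proof.
move=> lD lh hD hs1 hs2 hu hv hw z t; move: z; apply: cP_ext.
- by move=> a x y; rewrite (bcbilin_linear1 _ lD) (Defs.lfunP w).
- by move=> a x y; rewrite (Defs.lfunP u) (bcbilin_linear1 _ lD).
move=> i z; move: t; apply: cP_ext.
- by move=> a x y; rewrite (bcbilin_linear2 _ lD) (Defs.lfunP w).
- by move=> a x y; rewrite (Defs.lfunP v) (bcbilin_linear2 _ lD).
move=> j t; rewrite hu hv !(bc_class2 lD lh hD hs1 hs2) (linearZ' _ _ (Defs.lfunP w)) hw.
by rewrite hu hv.
Qed.

(** The absolute value is only a default: [pin] represents a power of [pi] at nonnegative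
    exponents. *)
Definition pin (n : int) : k := ppi pi1 ^+ absz n.
Lemma pinE n : 0 <= n -> val (pin n) = pi ^ n.
Proof. by move=> n0; rewrite /pin rmorphXn -[RHS](congr1 (exprz pi) (gez0_abs n0)). Qed.

(** Multiplying [w] by a power of [t] shifts both exponents equally. This is why the factors by
    which inclusions differ from the identity are functions of the class. *)
Lemma kap_class (w w' g h : Gamma R) : gamma_class l w = gamma_class l w' ->
  kap (w - g) - kap (w - h) = kap (w' - g) - kap (w' - h).
Proof.
move=> /(gamma_classP piP)[n e].
have sh (v : Gamma R) : kap (w' - v) = kap (w - v) - n.
  by apply: (kap_shift pi0 pi1); rewrite [RHS]mulrAC -e.
by rewrite !sh opprB addrA subrK.
Qed.

Lemma lT_op (S : kalg k) X Y (g h : Gamma R) (u : lev theta X g -> lev theta Y h) (D : X -> Y) :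
  linear u -> linear D -> (forall j, u (@lb X g j) = levT h (D (wb j))) ->
  forall z : bc X S, bcmap u (lT g z) = lT h (bcmap D z).
Proof.
move=> lu lD hu; apply: (linear_bc_basis (@wbP X)).
- by move=> a x y; rewrite lT_linear (bcmap_linear lu).
- by move=> a x y; rewrite (bcmap_linear lD) lT_linear.
move=> j; rewrite /lT (bcmap_in _ _ (@levT_linear X g)) (bcmap_in _ _ lu) levT_b hu.
by rewrite (bcmap_in _ _ lD) (bcmap_in _ _ (@levT_linear Y h)).
Qed.

Section Ops.
Variables (X Y : rep G) (g h : Gamma R).
Variables (u : lev theta X g -> lev theta X h) (lu : linear u).
Definition op_of (x : X) : X := levV (u (levT g x)).
Lemma op_of_linear : linear op_of.
Proof. by move=> a x y; rewrite /op_of levT_linear lu levV_linear. Qed.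
Lemma op_of_wb (s : Gamma R -> k) : (forall j, u (lb g j) = s (wv j) *: lb h j) ->
  forall j, op_of (wb j) = s (wv j) *: wb j.
Proof.
move=> hu j; rewrite /op_of levT_b hu (linearZ' _ _ (@levV_linear X h)) -levT_b.
by rewrite levTK.
Qed.
Lemma lT_op_of (S : kalg k) (z : bc X S) : bcmap u (lT g z) = lT h (bcmap op_of z).
Proof. by apply: lT_op op_of_linear _ _ => // j; rewrite /op_of levVK levT_b. Qed.
Variables (v : lev theta X g -> lev theta Y h -> lev theta (rep_tens X Y) (g + h)) (lv : bilin v).
Definition op2_of (x : X) (y : Y) : rep_tens X Y := levV (v (levT g x) (levT h y)).
Lemma op2_of_bilin : bilin op2_of.
Proof.
by split=> [y a x x'|x a y y']; rewrite /op2_of levT_linear ?lv.1 ?lv.2 levV_linear.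
Qed.
Lemma op2_of_wb (s : Gamma R -> Gamma R -> k) :
  (forall i j, v (lb g i) (lb h j) = s (wv i) (wv j) *: @levT (rep_tens X Y) (g + h) (tens_in (wb i) (wb j))) ->
  forall i j, op2_of (wb i) (wb j) = s (wv i) (wv j) *: tens_in (wb i) (wb j).
Proof.
move=> hv i j; rewrite /op2_of !levT_b hv (linearZ' _ _ (@levV_linear (rep_tens X Y) (g + h))).
by rewrite (@levTK (rep_tens X Y)).
Qed.
Lemma lT_op2_of (S : kalg k) (z : bc X S) (t : bc Y S) :
  bcbilin v (lT g z) (lT h t) = lT (g + h) (bcbilin op2_of z t).
Proof.
move: z; apply: (@linear_bc_eq k X S (bc (lev theta (rep_tens X Y) (g + h)) S)
  (fun z => bcbilin v (lT g z) (lT h t)) (fun z => lT (g + h) (bcbilin op2_of z t))).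
- by move=> a x y; rewrite lT_linear (bcbilin_linear1 _ lv).
- by move=> a x y; rewrite (bcbilin_linear1 _ op2_of_bilin) (@lT_linear S (rep_tens X Y)).
move=> x; rewrite /lT (bcmap_in _ _ (@levT_linear X g)); move: t.
apply: (@linear_bc_eq k Y S (bc (lev theta (rep_tens X Y) (g + h)) S)
  (fun t => bcbilin v _ (lT h t)) (fun t => lT (g + h) (bcbilin op2_of _ t))).
- by move=> a y y'; rewrite lT_linear (bcbilin_linear2 _ lv).
- by move=> a y y'; rewrite (bcbilin_linear2 _ op2_of_bilin) (@lT_linear S (rep_tens X Y)).
move=> y; rewrite /lT (bcmap_in _ _ (@levT_linear Y h)) (bcbilin_in _ _ _ lv).
rewrite (bcbilin_in _ _ _ op2_of_bilin) (bcmap_in _ _ (@levT_linear (rep_tens X Y) (g + h))).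
by rewrite /op2_of levVK.
Qed.
End Ops.

Lemma kap_antitone (w g h : Gamma R) : val g <= val h -> kap (w - h) <= kap (w - g).
Proof. by move=> gh; rewrite -kapB; apply: le_trans gh; rewrite kapB. Qed.
Lemma lev_val_lb X g j : lev_val (@lb X g j) = (pi ^ kap (wv j - g) : lalg l) *: bc_in (lalg l) (wb j).
Proof. exact: mklevE. Qed.

Lemma lb_incl X g h (u : lev theta X g -> lev theta X h) : val g <= val h ->
  (forall x, lev_val (u x) = lev_val x) ->
  forall j, u (lb g j) = pin (kap (wv j - g) - kap (wv j - h)) *: lb h j.
Proof.
move=> gh hu j; apply: lev_val_inj; rewrite hu lev_valZ !lev_val_lb.
by rewrite pinE ?subr_ge0 ?kap_antitone // scalerA -(pizD pi0) subrK.
Qed.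
Lemma pin_class (g h : Gamma R) : class_fun (fun w => pin (kap (w - g) - kap (w - h))).
Proof. by move=> w w' e; rewrite (kap_class g h e). Qed.
Lemma lb_scale X g h (c : l) (u : lev theta X g -> lev theta X h) :
  c <> 0 -> val h = val g * nabs c -> (forall x, lev_val (u x) = c *: lev_val x) ->
  exists s : k, is_unit s /\ forall j, u (lb g j) = s *: lb h j.
Proof.
move=> c0 gh hu; have [n cn] := piP c0.
have s1 : nabs (c * pi ^ (- n)) = 1 by rewrite nabsM nabs_piz cn -(texpD pi0) subrr expr0z.
have s1' : nabs (c * pi ^ (- n)) <= 1 by rewrite s1.
exists (mkoint s1'); split=> [|j]; first exact: oint_unit.
 apply: lev_val_inj; rewrite hu lev_valZ !lev_val_lb !scalerA.
have -> : kap (wv j - h) = kap (wv j - g) + n.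
  rewrite -[n]opprK; apply: (kap_shift pi0 pi1); rewrite /= gh cn invfM mulrA.
  by rewrite invr_expz.
congr (_ *: _); rewrite /= (pizD pi0) [pi ^ kap _ * _]mulrC mulrA -[c * _ * _]mulrA.
by rewrite -(pizD pi0) addNr expr0z mulr1.
Qed.
Lemma lb_tens X Y g h (b : lev theta X g -> lev theta Y h -> lev theta (rep_tens X Y) (g + h)) :
  (forall x y, lev_val (b x y) = Xl_tens (lev_val x) (lev_val y)) ->
  forall i j, b (lb g i) (lb h j) =
    pin (kap (wv i - g) + kap (wv j - h) - kap (wv i + wv j - (g + h))) *:
    @levT (rep_tens X Y) (g + h) (tens_in (wb i) (wb j)).
Proof.
move=> hb i j; have ht := tens_inP X Y; apply: lev_val_inj; rewrite hb lev_valZ !lev_val_lb.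
have hw := isw_tens (wvP i) (wvP j); rewrite (levT_wt (X := rep_tens X Y) _ hw).
rewrite /Xl_tens /bctens (linearZ' _ _ (bcbilin_linear1 _ ht)).
rewrite (linearZ' _ _ (bcbilin_linear2 _ ht)) bcbilin_in // !scalerA pinE.
  by rewrite -!(pizD pi0) subrK.
by rewrite subr_ge0 opprD addrACA kap_subadd.
Qed.
Lemma kap_class2 (w w' v g h : Gamma R) : gamma_class l w = gamma_class l w' ->
  kap (w - g) - kap (w + v - h) = kap (w' - g) - kap (w' + v - h).
Proof.
by move=> e; have := kap_class g (h - v) e; rewrite !opprB !addrA ![_ + v - h]addrAC ![_ - h + v]addrAC.
Qed.
Lemma pin2_class (g h : Gamma R) :
  let s w w' := pin (kap (w - g) + kap (w' - h) - kap (w + w' - (g + h))) in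
  (forall w, class_fun (s w)) /\ (forall w, class_fun (s^~ w)).
Proof.
split=> [v w w' e|v w w' e]; congr pin; cbv beta.
  by rewrite -[LHS]addrA -[RHS]addrA; congr (_ + _); rewrite ![v + _]addrC; apply: kap_class2.
by rewrite [LHS]addrAC [RHS]addrAC; congr (_ + _); apply: kap_class2.
Qed.

(** Pulled back along [levT], a morphism of representations is unchanged, as it preserves weights.
    Inclusions, scalings and tensor products acquire factors that are functions of the classes, and
    operators commuting with the projections [cP] do not see them. *)
Lemma tr_mem S (psi : forall X, GL X S) : (forall X, cP_comm (psi X)) ->
  (forall X Y (u : X -> Y), rep_mor u -> forall z, psi Y (bcmap u z) = bcmap u (psi X z)) ->
  (forall X Y z t, psi (rep_tens X Y) (bctens z t) = bctens (psi X z) (psi Y t)) ->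
  aut_tensor_mem (theta := theta) (fun p => tr p.2 (psi p.1)).
Proof.
move=> cpsi npsi tpsi.
have zE X g (z : bc (lev theta X g) S) : exists z', z = lT g z' by exists (lV z); rewrite lVK.
split=> [X Y f hf g u lu hu z|X g h gh u lu hu z|X g h c c0 gh u lu hu z|X Y g h b hb eb z t].
- have [z' ->] := zE _ _ z.
  have uT j : u (lb g j) = levT g (f (wb j)).
    have hw := isw_map (rho := wact X) (rho' := wact Y) hf.1
      (fun S d z => esym (hf.2 S (sval (chi S d)) z)) (@wvP X j).
    apply: lev_val_inj; rewrite hu lev_val_lb (levT_wt _ hw) /Xl_map.
    by rewrite (linearZ' _ _ (bcmap_linear hf.1)) (bcmap_in _ _ hf.1).
  by rewrite [tr _ _ (lT _ _)]trE !(lT_op lu hf.1 uT) [LHS]trE npsi.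
- have [z' ->] := zE _ _ z; rewrite [tr _ _ (lT _ _)]trE !(lT_op_of lu) [LHS]trE.
  congr lT; pose s w := pin (kap (w - g) - kap (w - h)).
  apply: (op_comm (h := id) (s := s)); [exact: op_of_linear| by []| | |exact: cpsi|].
  + exact: (op_of_wb (s := s) (lb_incl gh hu)).
  + exact: (pin_class g h).
  by move=> y; apply: npsi; split=> // S' x y'; rewrite !bcmap_id.
- have [z' ->] := zE _ _ z; rewrite [tr _ _ (lT _ _)]trE !(lT_op_of lu) [LHS]trE.
  have [s [_ us]] := lb_scale c0 gh hu.
  congr lT; apply: (op_comm (h := id) (s := fun=> s)); [exact: op_of_linear| by []| | by []|exact: cpsi|].
  + exact: (op_of_wb (s := fun=> s) us).
  by move=> y; apply: npsi; split=> // S' x y'; rewrite !bcmap_id.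
have [z' ->] := zE _ _ z; have [t' ->] := zE _ _ t.
rewrite [tr _ _ (lT g _)]trE [tr _ _ (lT h _)]trE !(lT_op2_of hb) [LHS]trE.
have [c1 c2] := pin2_class g h.
congr (lT (X := rep_tens X Y)); apply: (op_comm2 (h := @tens_in k X Y) (op2_of_bilin hb) (tens_inP X Y)
   (op2_of_wb (lb_tens eb)) c1 c2) => //; exact: tpsi.
Qed.

Lemma cent_cP S (x : G S) : cent (bar_chi chi) S x -> forall X, cP_comm (ract X S x).
Proof.
move=> hx X; apply: commute_cP => S' c d z.
have := congr1 (fun y => ract X S' y z) (hx S' c d).
by rewrite !ghomM -ghom_nat.
Qed.

Definition iota_f S (x : G S) : lev_family theta S := fun p => tr p.2 (ract p.1 S x).
Lemma iota_mem S (x : G S) : cent (bar_chi chi) S x -> aut_tensor_mem (iota_f x).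
Proof.
move=> hx; apply: (tr_mem (psi := fun X => ract X S x)) => [|X Y u hu z|X Y z t].
- exact: cent_cP.
- by rewrite hu.2.
exact: glt_tens (Defs.lfunP _) (Defs.lfunP _).
Qed.
Lemma tr_inj S X g (u v : GL X S) : tr g u = tr g v -> u = v.
Proof.
by move=> e; apply: laut_eq => z; apply: (can_inj (@lTK S X g)); rewrite -!trE e.
Qed.
Lemma iota_fM S (x y : G S) : iota_f (gmul x y) = gmul (iota_f x) (iota_f y).
Proof.
apply: functional_extensionality_dep => p; apply: laut_eq => z.
rewrite -[z](lVK (S := S)); rewrite [LHS]trE ghomM -[RHS]/(iota_f x p (iota_f y p _)).
by rewrite [iota_f y p _]trE [RHS]trE.
Qed.
Lemma iota_f_map S S' (c : khom S S') (x : G S) : iota_f (gmap c x) = gmap c (iota_f x).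
Proof.
by apply: functional_extensionality_dep => p; rewrite /iota_f ghom_nat -tr_map.
Qed.

Definition chi0 : ghom (Dgrp k (Gamma_quot l)) (aut_tensor theta).
refine (@GHom k (Dgrp k (Gamma_quot l)) (aut_tensor theta)
  (fun S d => exist _ (iota_f (bar_chi chi S d)) (iota_mem (into_centP (bar_chi chi) d))) _ _).
- by move=> S d d'; apply: sig_eq; apply: etrans (iota_fM _ _); congr iota_f; apply: ghomM.
- by move=> S S' c d; apply: sig_eq; apply: etrans (iota_f_map _ _); congr iota_f; apply: ghom_nat.
Defined.

Definition iota : ghom (subfun (cent (bar_chi chi))) (subfun (cent chi0)).
unshelve refine (@GHom k (subfun (cent (bar_chi chi))) (subfun (cent chi0))
  (fun S x => exist _ (exist _ (iota_f (sval x)) (iota_mem (svalP x))) _) _ _).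
- move=> S' c d; apply: sig_eq.
  transitivity (iota_f (gmul (gmap c (sval x)) (bar_chi chi S' d))).
    by rewrite iota_fM iota_f_map.
  by rewrite (svalP x) iota_fM iota_f_map.
- by move=> S x y; apply: sig_eq; apply: sig_eq; apply: iota_fM.
- by move=> S S' c x; apply: sig_eq; apply: sig_eq; apply: iota_f_map.
Defined.
Lemma iota_into S (d : Dgrp k (Gamma_quot l) S) :
  iota S (into_cent (bar_chi chi) S d) = into_cent chi0 S d.
Proof. by apply: sig_eq; apply: sig_eq. Qed.

(** * Bijectivity of the transport *)

Section IotaBijective.
Variables (O : kalg k) (a0 : G O) (ha : represents a0) (tO : tf (ppi pi1) (amod O)).

Lemma iota_f_inj S (x y : G S) : iota_f x = iota_f y -> x = y.
Proof.
move=> e; apply: (rep_ext hk ha tO) => X z; congr (lfun _ z).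
by apply: (@tr_inj S X 0); apply: (congr1 (fun phi : lev_family theta S => phi (X, 0)) e).
Qed.

Section Converse.
Variables (S : kalg k) (phi : lev_family theta S) (hphi : aut_tensor_mem phi).
Definition untr X g : GL X S.
refine (@LAut S (bc X S) (fun z => lV (phi (X, g) (lT g z))) (fun z => lV (linv (phi (X, g)) (lT g z))) _ _ _).
- by move=> a x y; rewrite lT_linear (Defs.lfunP (phi (X, g))) lV_linear.
- by move=> z; rewrite lVK lfunK lTK.
- by move=> z; rewrite lVK linvK lTK.
Defined.
Lemma untrE X g z : phi (X, g) (lT g z) = lT g (untr X g z). Proof. by rewrite lVK. Qed.
Hypothesis hcP : forall X g, cP_comm (untr X g).

(** Multiplication by [pi ^ n] matches the rescaled bases of the two balls up to a unit. *)
Lemma untr_scale X g h (n : int) z : val h = val g * nabs pi ^ n -> untr X h z = untr X g z.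
Proof.
move=> e; have e' : val h = val g * nabs (pi ^ n) by rewrite nabs_piz.
have lu := @lscal_linear X g h (pi ^ n) e'; set u := lscal _ in lu.
have [s [[t st] us]] := @lb_scale X g h (pi ^ n) u (elimN eqP (piz_neq0 pi0 n)) e' (fun=> erefl).
have uT (t' : bc X S) : bcmap u (lT g t') = lT h (kstr S s *: t').
  rewrite (lT_op (D := fun x => s *: x) lu) => [|a x y|j].
  - congr lT; move: t'; apply: (@linear_bc_eq k X S (bc X S) (bcmap (R := S) (fun x => s *: x))
      (fun z => kstr S s *: z)) => [a x y|a x y|x].
    + by apply: bcmap_linear => c v w; rewrite scalerDr !scalerA mulrC.
    + by rewrite scalerDr !scalerA mulrC.
    rewrite bcmap_in ?bc_inZ // => c v w; by rewrite scalerDr !scalerA mulrC.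
  - by rewrite scalerDr !scalerA mulrC.
  by rewrite us (linearZ' _ _ (@levT_linear X h)) levT_b.
have := at_scale hphi (elimN eqP (piz_neq0 pi0 n)) e' lu (fun=> erefl) (lT g z).
rewrite untrE !uT untrE => /(can_inj (@lTK S X h)).
rewrite (linearZ' _ _ (Defs.lfunP (untr X h))) => /(congr1 (fun y => kstr S t *: y)).
by rewrite !scalerA -rmorphM mulrC st rmorph1 !scale1r.
Qed.

(** A basis vector [wb j] is treated at the level of its own weight. The radius [d], a power of [t]
    times [wv j], is the largest such radius not exceeding [g]: scaling relates it to [wv j], and
    its inclusion in [g] acts as the identity on the class of [wb j]. *)
Lemma untr_indep X g z : untr X g z = untr X 0 z.
Proof.
suff H g' j : untr X g' (bc_in S (wb j)) = untr X (wv j) (bc_in S (wb j)).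
  move: z; apply: (linear_bc_basis (@wbP X)) => [||j]; try exact: Defs.lfunP.
  by rewrite (H g) (H 0).
move: g' => {}g; set n := kap (wv j - g).
pose d : Gamma R := exist _ (val (wv j) * nabs pi ^ n) (mulr_gt0 (valP (wv j)) (texp_gt0 pi0 n)).
rewrite -(@untr_scale X (wv j) d n _ erefl).
have dg : val d <= val g by rewrite [val d]mulrC kapB.
have lu := @lincl_linear X d g dg; set u := lincl _ in lu.
pose s w := pin (kap (w - d) - kap (w - g)).
have us := op_of_wb (s := s) (lb_incl dg (u := u) (fun=> erefl)).
have s1 : s (wv j) = 1.
  rewrite /s [kap (wv j - d)](kap_unit pi0 pi1 (n := - n)) ?opprK ?subrr //.
  by rewrite -invr_expz [LHS]/= invfM mulrA mulfV ?mul1r // gt_eqF // (valP (wv j)).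
have Did z0 : bcmap (op_of u) (bcmap (@cP X (gamma_class l (@wv X j))) z0) =
    bcmap (@cP X (gamma_class l (@wv X j))) z0 :> bc X S.
  rewrite (bc_class (h := id) (op_of_linear lu) _ us (pin_class d g)) // bcmap_id.
  by rewrite -/(s _) s1 rmorph1 scale1r.
have bE : bc_in S (@wb X j) = bcmap (@cP X (gamma_class l (@wv X j))) (bc_in S (wb j)).
  by rewrite bcmap_in ?cP_wb //; apply: cP_linear.
have := at_incl hphi dg lu (fun=> erefl) (lT d (bc_in S (wb j))).
rewrite untrE !(lT_op_of lu) untrE => /(can_inj (@lTK S X g)).
by rewrite bE (hcP d) !Did -(hcP d).
Qed.

Lemma iota_surj : exists x : G S, phi = iota_f x.
Proof.
have [|X Y u hu z|X Y z t|z t|x hx] := @tannaka _ _ hk G O a0 ha tO S (fun X => untr X 0).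
- by move=> X; apply: Defs.lfunP.
- apply: (can_inj (@lTK S Y 0)).
  have lm := @lmor_linear X Y 0 u hu; set v := lmor _ in lm.
  have uT j : v (lb 0 j) = levT 0 (u (wb j)).
    have hw := isw_map (rho := wact X) (rho' := wact Y) hu.1
      (fun S d z => esym (hu.2 S (sval (chi S d)) z)) (@wvP X j).
    apply: lev_val_inj; rewrite (levT_wt _ hw) mklevE lev_val_lb /Xl_map.
    by rewrite (linearZ' _ _ (bcmap_linear hu.1)) (bcmap_in _ _ hu.1).
  by rewrite -untrE -!(lT_op lm hu.1 uT) (at_mor hphi hu lm) // untrE.
- move: z; apply: (linear_bc_basis (@wbP X)) => [a x y|a x y|i].
  + by rewrite /bctens (bcbilin_linear1 _ (tens_inP X Y)) (Defs.lfunP (untr (rep_tens X Y) 0)).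
  + by rewrite (Defs.lfunP (untr X 0)) /bctens (bcbilin_linear1 _ (tens_inP X Y)).
  move: t; apply: (linear_bc_basis (@wbP Y)) => [a x y|a x y|j].
  + by rewrite /bctens (bcbilin_linear2 _ (tens_inP X Y)) (Defs.lfunP (untr (rep_tens X Y) 0)).
  + by rewrite (Defs.lfunP (untr Y 0)) /bctens (bcbilin_linear2 _ (tens_inP X Y)).
  (* At the levels [wv i] and [wv j] the three exponents in the factor [s] vanish, so on the
     corresponding class components the multiplication map is the tensor product itself. *)
  set g := wv i; set h := wv j; have lb2 := @ltens_bilin X Y g h; set b := @ltens _ _ _ _ in lb2.
  pose s w w' := pin (kap (w - g) + kap (w' - h) - kap (w + w' - (g + h))).
  have us := op2_of_wb (s := s) (lb_tens (b := b) (fun _ _ => erefl)).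
  have [c1 c2] := pin2_class g h.
  have kap0 (v : Gamma R) : kap (v - v) = 0.
    by rewrite (kap_unit pi0 pi1 (n := 0)) ?oppr0 // subrr expr0z.
  have s1 : s g h = 1 by rewrite /s !kap0 subrr.
  have zi : bc_in S (@wb X i) = bcmap (@cP X (gamma_class l g)) (bc_in S (wb i)).
    by rewrite bcmap_in ?cP_wb //; apply: cP_linear.
  have zj : bc_in S (@wb Y j) = bcmap (@cP Y (gamma_class l h)) (bc_in S (wb j)).
    by rewrite bcmap_in ?cP_wb //; apply: cP_linear.
  have bE z t : bcbilin (op2_of b) (bcmap (@cP X (gamma_class l g)) z)
      (bcmap (@cP Y (gamma_class l h)) t) =
      bctens (bcmap (@cP X (gamma_class l g)) z) (bcmap (@cP Y (gamma_class l h)) t) :> bc (rep_tens X Y) S.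
    rewrite (bc_class2 (op2_of_bilin lb2) (tens_inP X Y) us c1 c2 i j z t).
    by rewrite [s _ _]s1 rmorph1 scale1r.
  have := at_tens hphi lb2 (fun _ _ => erefl) (lT g (bc_in S (wb i))) (lT h (bc_in S (wb j))).
  rewrite !untrE !(lT_op2_of lb2) untrE => /(can_inj (@lTK S (rep_tens X Y) (g + h))).
  rewrite !untr_indep zi zj !(hcP 0) !bE; exact.
- by move=> e; apply: (can_inj (lfunK (untr (rep_unit G) 0))).
exists x; apply: functional_extensionality_dep => -[X g]; apply: laut_eq => z.
by rewrite -[z](lVK (S := S)) untrE [RHS]trE hx untr_indep.
Qed.
End Converse.

Lemma iota_bij S : bijective (iota S).
Proof.
have inj : injective (iota S).
  by move=> x y e; apply: sig_eq; apply: iota_f_inj; have := congr1 (fun z => sval (sval z)) e.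
have surj y : exists x, iota S x = y.
  have hy := svalP y.
  (* Centralizing [chi0] means, after undoing the transport, commuting with [bar_chi], and hence
     with its weight projections. *)
  have hcP X g : cP_comm (untr (sval (sval y)) X g).
    apply: commute_cP => S' c d z.
    have untr_tr : tr g (untr (sval (sval y)) X g) = sval (sval y) (X, g).
      by apply: laut_eq => t; rewrite -[t](lVK (S := S)) trE untrE.
    apply: (can_inj (@lTK S' X g)).
    rewrite -(trE g (gmap c _)) -tr_map untr_tr -(trE g (bact X S' d)).
    rewrite -(trE g (bact X S' d)) -(trE g (gmap c _)) -tr_map untr_tr.
    have := congr1 (fun phi => sval phi (X, g)) (hy S' c d).
    by move=> /(congr1 (fun f : GL (lev theta X g) S' => f (lT g z))).
  have [x hx] := iota_surj (svalP (sval y)) hcP.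
  have xc : cent (bar_chi chi) S x.
    move=> S' c d; apply: iota_f_inj; rewrite !iota_fM iota_f_map -hx.
    exact: (congr1 sval (hy S' c d)).
  by exists (exist _ x xc); apply: sig_eq; apply: sig_eq.
have [f hf] := choice surj; exists f => [x|//].
by apply: inj; rewrite hf.
Qed.
End IotaBijective.

(** * Conjugating the transported homomorphism to the given one *)

Section Final.
Variables (O : kalg k) (a0 : G O) (ha : represents a0) (hfp : finitely_presented O)
  (hfs : formally_smooth O).
Let tO := fsmooth_tf hk hfp hfs.
Variables (chiA : ghom (Dgrp k (Gamma_quot l)) (aut_tensor theta)) (hsp : splits chiA).
Local Notation M := (Gamma_quot l).
Local Notation cl := (gamma_class l).
Let lam := ghom_comp (subincl Tint) chi.

(** A finite stable module of functions contains generators of [O]. Each of its functions is a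
    combination of matrix entries: evaluate it at the identity after acting by the universal
    point. *)
Lemma gen_rep : exists E : rep G, forall x : O, exists q,
  pev (kstr O) (mvec (Cm (@wbP E) a0)) q = x.
Proof.
have [n [a [m [g pres]]]] := fp_presents hfp.
have [E [th [lt _ et hx]]] := stable_rep hk ha tO [seq a i | i <- enum 'I_n].
exists E; pose K x := exists q, pev (kstr O) (mvec (Cm (@wbP E) a0)) q = x.
have Kk c : K (kstr O c) by exists (mconst _ c); rewrite pevC.
have KD x y : K x -> K y -> K (x + y).
  by move=> [q <-] [q' <-]; exists (q + q'); rewrite rmorphD.
have KM x y : K x -> K y -> K (x * y).
  by move=> [q <-] [q' <-]; exists (q * q'); rewrite rmorphM.
have K0 : K 0 by rewrite -(rmorph0 (kstr O)).
have Kc j i : K (Cm (@wbP E) a0 j i) by exists (mX k (mxvec_index j i)); rewrite pevX mvecE.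
have Ka i : K (a i).
  have [|e eE] := hx (a i); first by apply: map_f; rewrite mem_enum.
  have -> : a i = evx ha th (gone G O) (ract E O a0 (bc_in O e)).
    rewrite et gmul1 (evx_in ha lt) -eE (kh_uniq ha (f := khom_id O)) //.
    exact: gmap_id.
  rewrite -[ract E O a0 _](bcrK (@wbP E)) (Cm_act (@wbP E)) /bcv.
  rewrite [evx _ _ _ _](linear_sum' _ _ _ (evx_linear ha lt _)).
  apply: (big_ind K) => // i' _; rewrite (linearZ' _ _ (evx_linear ha lt _)) mxE.
  apply: (KM); last first.
    rewrite (evx_in ha lt) -(gmap1 G (@KHom k (kself k) O (kstr O) (fun=> erefl))) kh_gmap.
    exact: Kk.
  by apply: (big_ind K) => // j _; rewrite bcr_in mxE; apply: KM.
have [hs _ _] := pres; move=> x; have [q <-] := hs x; rewrite -/(K _).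
elim/mpol_ind: q => [c|i|y z hy hz|y z hy hz].
- by rewrite pevC.
- by rewrite pevX.
- by rewrite rmorphD; apply: KD.
by rewrite rmorphM; apply: KM.
Qed.

Definition chi_at X g : ghom (Dgrp k M) (GL (lev theta X g)).
refine (@GHom k (Dgrp k M) (GL (lev theta X g)) (fun S d => sval (chiA S d) (X, g)) _ _).
- by move=> S d d'; rewrite ghomM.
- by move=> S S' f d; rewrite ghom_nat.
Defined.
Lemma kap0 (w : Gamma R) : kap (w - w) = 0.
Proof. by rewrite subrr -[RHS]oppr0; apply: (kap_unit pi0 pi1); rewrite expr0z. Qed.
Lemma lev_ltP X g (x : lev_lt theta X g) : theta X (lev_lt_val x) < val g.
Proof. by have /asboolP := valP x. Qed.
Definition lincl_lt X g (x : lev_lt theta X g) : lev theta X g :=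
  mklev (ltW (lev_ltP x)).
Lemma lincl_lt_linear X g : linear (@lincl_lt X g).
Proof. by move=> a x y; apply: lev_val_inj; rewrite lev_valL !mklevE. Qed.

(* The projection of a weight vector of [chi'] to the corresponding weight space of [chi]
   differs from it by a vector of smaller norm. *)
Definition ywt X j : lev theta X (@wv X j) :=
  dP (@lbP X (wv j)) (chi_at X (wv j)) (cl (wv j)) (lb (wv j) j).
Lemma ywt_lt X j : theta X (lev_val (ywt j) - bc_in (lalg l) (@wb X j)) < val (wv j).
Proof.
set g := wv j; set x := @lb X g j; have li := @lincl_lt_linear X g.
have xE : lev_val x = bc_in (lalg l) (wb j) by rewrite lev_val_lb kap0 expr0z scale1r.
(* At the universal character, [splits] puts the action on [x] minus the character times [x] in the
   image of the open ball. The coefficient at the class of [g] of this difference is [ywt j - x]. *)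
have [y yE] := hsp li (fun=> erefl) (univ_char M (kself k)) (bc_in _ x).
have [y' y'E] : exists y', cfk (@lbP X g) (cl g) (bcmap (@lincl_lt X g) y) = lincl_lt y'.
  elim/bc_ind: {yE} y => [s u z [y' IH]|]; last first.
    by exists 0; rewrite (linear0' (bcmap_linear li)) cfk0 (linear0' li).
  exists (mcoef (cl g) (s : malg k M) *: u + y').
  by rewrite (bcmap_linear li) cfkD (bcmap_in _ _ li) cfkE IH li.
have -> : lev_val (ywt j) - bc_in (lalg l) (wb j) = lev_lt_val y'.
  rewrite -xE; apply/eqP; rewrite subr_eq; apply/eqP.
  rewrite -[lev_lt_val y']/(lev_val (lincl_lt y')) -[X in _ = X + _]scale1r.
  rewrite -[1 : l]/(val (1 : k)) -lev_valL scale1r; congr lev_val.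
  rewrite /ywt /dP -/g -/x -y'E -[X in cfk _ _ X](subrK (sval (univ_char M (kself k)) (cl g) *: bc_in _ x)).
  rewrite cfkD; congr (_ + _); first by congr cfk; rewrite -yE.
  by rewrite cfkE mcoef_e eqxx scale1r.
exact: lev_ltP.
Qed.
Definition Umx X : 'M[l]_(wm X) := \matrix_(j, i) bcr (@wbP X) (lev_val (ywt j)) 0 i.
Lemma Umx_near X : near1 (@wv X) (Umx X).
Proof.
move=> j i; rewrite mxE.
have h := theta_lt hchi (@wbP X) (@wvP X) (ywt_lt j) i.
move: h; rewrite (linearB' _ _ (bcr_linear (@wbP X) _)) bcr_in_e [X in nabs X]mxE.
by rewrite [X in _ + X]mxE [X in - X]mxE eqxx /= [i == j]eq_sym.
Qed.
Lemma Umx_chi X (B : kalg k) (f : khom (lalg l) B) (d : Dgrp k M B) (x : G B) :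
  (forall g z, eps f (sval (chiA B d) (X, g) z) = ract X B x (eps f z)) ->
  map_mx f (Umx X) *m Cm (@wbP X) x = diag_mx (\row_j sval d (cl (wv j))) *m map_mx f (Umx X).
Proof.
move=> h; apply/row_matrixP => j; rewrite row_mul.
have -> : row j (diag_mx (\row_j sval d (cl (wv j))) *m map_mx f (Umx X)) =
    sval d (cl (wv j)) *: row j (map_mx f (Umx X)).
  by apply/rowP => i; rewrite mul_diag_mx [LHS]mxE [LHS]mxE [X in X * _]mxE [RHS]mxE [X in _ = _ * X]mxE.
have rE : row j (map_mx f (Umx X)) = bcr (@wbP X) (eps f (bc_in B (ywt j))).
  by rewrite eps_in bcr_push; apply/rowP => i; rewrite [LHS]mxE [LHS]mxE [X in f X]mxE [RHS]mxE.
rewrite rE -Cm_act -h.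
have -> : sval (chiA B d) (X, wv j) (bc_in B (ywt j)) = sval d (cl (wv j)) *: bc_in B (ywt j).
  exact: (dP_isw (@lbP X (wv j)) (chi_at X (wv j)) (cl (wv j)) (lb (wv j) j) d).
by rewrite (linearZ' _ _ (@eps_linear _ f X _)) (linearZ' _ _ (bcr_linear (@wbP X) _)).
Qed.

Lemma eps_crd (B : kalg k) (f : khom (lalg l) B) X g z :
  bcr (@wbP X) (eps f z) =
  bcr (@lbP X g) z *m diag_mx (\row_j f (pi ^ kap (wv j - g) : lalg l)).
Proof.
move: z; apply: (@linear_bc_basis _ _ _ _ (@lbP X g) B ('rV[B]_(wm X))
  (fun z => bcr (@wbP X) (eps f z)) (fun z => bcr (@lbP X g) z *m _)).
- by move=> a x y; rewrite eps_linear (bcr_linear (@wbP X)).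
- by move=> a x y; rewrite (bcr_linear (@lbP X g)) mulmxDl scalemxAl.
move=> j; rewrite eps_lb (linearZ' _ _ (bcr_linear (@wbP X) _)) !bcr_in_e.
apply/rowP => i; rewrite mul_mx_diag !mxE.
by case: (i =P j) => [->|_]; rewrite ?andbT ?andbF ?mulr0 ?mul0r ?mulr1 ?mul1r.
Qed.

(** * Extending bounded points of the generic fibre *)

Section Extension.
Variables (A : kalg k) (tA : tf (ppi pi1) (amod A)).
Local Notation Al := (ctens A (lalg l)).
Local Notation inA := (ctL A (lalg l)).
Local Notation inl := (ctR A (lalg l)).
Definition Jmap X g (z : bc (lev theta X g) A) : bc X Al := eps inl (bcpush inA z).
Lemma inA_inj : injective inA.
Proof.
move=> x y e; have h := ctL_inj hk tA (@lalg_tf _ _ _ pi0 pi1) (@lalg1_neq0 _ l).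
have /h/eqP : inA (x - y) = 0 by rewrite rmorphB e subrr.
by rewrite subr_eq0 => /eqP.
Qed.
Lemma Jmap_inj X g : injective (@Jmap X g).
Proof.
move=> z t /eps_inj e; apply: (bcr_inj (he := @lbP X g)); apply/rowP => j; apply: inA_inj.
have := congr1 (bcr (@lbP X g) (S := Al)) e; rewrite !bcr_push => /rowP/(_ j).
by rewrite mxE [RHS]mxE.
Qed.
Definition bounded (x : G Al) : Prop := forall X j i,
  bd pi0 pi1 (@wv X i - wv j) (Cm (@wbP X) x j i).
(** In the basis [lb] the entry [(j, i)] is multiplied by [pi] to the power
    [kap (wv j - g) - kap (wv i - g)]. Subadditivity of [kap] shows that the bound on the entry
    makes the result integral, whatever the radius. *)
Lemma bounded_lin (x : G Al) : bounded x -> forall X g,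
  exists L : bc (lev theta X g) A -> bc (lev theta X g) A,
  linear L /\ forall z, Jmap (L z) = ract X Al x (Jmap z).
Proof.
move=> hx X g.
have /choice[K hK] : forall ji : 'I_(wm X) * 'I_(wm X), exists y : A,
    inl (pi ^ kap (wv ji.1 - g) : lalg l) * Cm (@wbP X) x ji.1 ji.2 =
    inA y * inl (pi ^ kap (wv ji.2 - g) : lalg l).
  move=> [j i] /=; have [y ->] := hx X j i.
  have [z hz] : exists z : k, pi ^ (kap (wv j - g) + kap (wv i - wv j)) =
      val z * pi ^ kap (wv i - g).
    apply: (nabs_dvd pi0); rewrite nabs_piz (texp_le pi0 pi1) [X in _ <= X]addrC.
    by apply: le_trans (kap_subadd pi0 pi1 _ _); rewrite addrA subrK.
  exists (kstr A z * y); rewrite mulrA -[inl _ * inl _]rmorphM -(pizD pi0) hz.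
  rewrite [inl (val z * _)]rmorphM [inA (_ * _)]rmorphM khomP -!mulrA; congr (_ * _).
    exact: (khomP inl z).
  by rewrite mulrC.
pose L z := bcv (@lb X g) (bcr (@lbP X g) z *m (\matrix_(j, i) K (j, i))).
exists L; split=> [a z t|z].
  by rewrite /L (bcr_linear (@lbP X g)) mulmxDl -scalemxAl bcv_linear.
apply: (bcr_inj (he := @wbP X)); rewrite (Cm_act (@wbP X)) /Jmap !eps_crd !bcr_push /L bcvK.
rewrite map_mxM -!mulmxA; congr (_ *m _); apply/matrixP => j i.
by rewrite mul_mx_diag mul_diag_mx !mxE -(hK (j, i)) /= mxE.
Qed.
Lemma bounded_aut (x : G Al) : bounded x -> bounded (ginv x) ->
  exists phi : aut_tensor theta A, forall X g z,
    Jmap (sval phi (X, g) z) = ract X Al x (Jmap z).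
Proof.
move=> hx hx'.
have ex : forall p : rep G * Gamma R, exists L : GL (lev theta p.1 p.2) A,
    forall z, Jmap (L z) = ract p.1 Al x (Jmap z).
  move=> [X g]; have [L [lL LE]] := bounded_lin hx X g.
  have [L' [lL' L'E]] := bounded_lin hx' X g.
  have mulE (y y' : G Al) z : gmul y y' = gone G Al -> ract X Al y (ract X Al y' z) = z.
    move=> e; rewrite -[LHS]/(gmul (ract X Al y) (ract X Al y') z) -ghomM e ghom1.
    by [].
  have LL' : cancel L L'.
    by move=> z; apply: Jmap_inj; rewrite L'E LE mulE // gmulV.
  have L'L : cancel L' L.
    by move=> z; apply: Jmap_inj; rewrite LE L'E mulE // gmulxV.
  by exists (LAut lL LL' L'L).
pose L : lev_family theta A := fun p => sval (cid (ex p)).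
have hL p : forall z, Jmap (L p z) = ract p.1 Al x (Jmap z) := svalP (cid (ex p)).
have hm : aut_tensor_mem (theta := theta) (S := A) L.
  apply: (@aut_of_point A Al inA inl x L inA_inj) => X g z; exact: (hL (X, g)).
by exists (exist _ L hm) => X g z; apply: (hL (X, g)).
Qed.
End Extension.

Lemma chi0_point (B : kalg k) (f : khom (lalg l) B) d X g z :
  eps f (sval (chi0 B d) (X, g) z) = ract X B (bar_chi chi B d) (eps f z).
Proof.
move: z; apply: (@linear_bc_basis _ _ _ _ (@lbP X g) B (bc X B)
  (fun z => eps f (sval (chi0 B d) (X, g) z)) (fun z => ract X B (bar_chi chi B d) (eps f z))).
- by move=> a x y; rewrite (Defs.lfunP (sval (chi0 B d) (X, g))) eps_linear.
- by move=> a x y; rewrite eps_linear (Defs.lfunP (ract X B _)).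
move=> j; have hw : ract X B (bar_chi chi B d) (bc_in B (wb j)) =
    sval d (cl (wv j)) *: bc_in B (@wb X j) by apply: (@bwP X j B d).
have lbE : bc_in B (@lb X g j) = lT g (bc_in B (wb j)).
  by rewrite /lT bcmap_in ?levT_b //; apply: levT_linear.
rewrite eps_lb (linearZ' _ _ (Defs.lfunP (ract X B _))) hw.
have -> : sval (chi0 B d) (X, g) (bc_in B (lb g j)) = sval d (cl (wv j)) *: bc_in B (lb g j).
  by rewrite lbE [LHS]trE hw (linearZ' _ _ (@lT_linear B X g)).
by rewrite (linearZ' _ _ (@eps_linear _ f X g)) eps_lb !scalerA mulrC.
Qed.

(** The point [s] of the slice and its inverse are bounded in all representations, so [s^-1] extends
    to an automorphism [a] over [A]. The conjugation identity for [a] is checked on the generic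
    fibre. *)
Lemma conj_exists : exists (A : kalg k) (a : aut_tensor theta A), etale_cover A /\ forall B (f : khom A B) d,
    gmul (gmap f a) (chi0 B d) = gmul (chiA B d) (gmap f a).
Proof.
have [E gen] := gen_rep.
have hUchi B (f : khom (lalg l) B) (d : Dgrp k M B) : exists x : G B,
    map_mx f (Umx E) *m Cm (@wbP E) x = diag_mx (\row_j sval d (cl (wv j))) *m map_mx f (Umx E).
  have [x hx] := point_of_aut ha tO f (svalP (chiA B d)).
  by exists x; apply: Umx_chi => g z; apply: hx.
have [A [Xi [h1 tA h3 h4 h5]]] :=
  slice_data pi0 pi1 piP (lam := lam) ha hfp hfs (@wvP E) gen (@Umx_near E) hUchi.
have [s [bs bs' hs]] := conj_point piP hfp hfs gen (@Umx_near E) h3 h4 h5.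
have bd1 : bounded s.
  by move=> X j i; apply: (bounded_rep piP (lam := lam) ha (@wvP E) gen bs (@wbP X) (@wvP X)).
have bd2 : bounded (ginv s).
  by move=> X j i; apply: (bounded_rep piP (lam := lam) ha (@wvP E) gen bs' (@wbP X) (@wvP X)).
have ss : ginv (ginv s) = s by apply: (@gmulI k G _ (ginv s)); rewrite gmulxV gmulV.
have [|a aE] := bounded_aut tA bd2 _; first by rewrite ss.
exists A, a; split=> // B f d.
(* Every [(B, f, d)] is a specialization of the universal character over the group algebra of [A].
   That algebra is torsion-free, so the identity there can be tested on its generic fibre. *)
pose A' := galg M A; pose inc : khom A A' := ginc M A; pose d0 : Dgrp k M A' := univ_char M A.
have [h [_ hh2 hh3]] := galg_lift f d.
suff E0 : gmul (gmap inc a) (chi0 A' d0) = gmul (chiA A' d0) (gmap inc a).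
  have := congr1 (gmap h) E0; rewrite !gmapM -!ghom_nat hh3 -gmap_comp.
  by rewrite (khom_eq (f := khom_comp h inc) (g := f) hh2).
have tA' := galg_tf (M' := M) tA.
pose A'l := ctens A' (lalg l); pose inA' := ctL A' (lalg l); pose f' := ctR A' (lalg l).
have [F [F1 F2]] := ctens_lift (khom_comp inA' inc) f'.
have FinA : khom_comp F (ctL A (lalg l)) = khom_comp inA' inc by apply: khom_eq => x; apply: F1.
have Finl : khom_comp F (ctR A (lalg l)) = f' by apply: khom_eq => x; apply: F2.
pose d1 := gmap inA' d0.
have [g1 hg1] := point_of_aut ha tO f' (svalP (chiA A'l d1)).
have Jchi X g z : Jmap (sval (chiA A' d0) (X, g) z) = ract X A'l g1 (Jmap z).
  rewrite -[RHS]hg1 /d1 ghom_nat; congr (eps f' _).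
  by rewrite -[RHS]/(gmap inA' (sval (chiA A' d0) (X, g)) (bcpush inA' z)) [RHS]gl_mapE.
have Jchi0 X g z : Jmap (sval (chi0 A' d0) (X, g) z) = ract X A'l (bar_chi chi A'l d1) (Jmap z).
  rewrite -[RHS]chi0_point /d1 ghom_nat; congr (eps f' _).
  by rewrite -[RHS]/(gmap inA' (sval (chi0 A' d0) (X, g)) (bcpush inA' z)) [RHS]gl_mapE.
have Jpush X g (z : bc (lev theta X g) A) : Jmap (bcpush inc z) = bcpush F (Jmap z).
  rewrite /Jmap -eps_push Finl; congr (eps f' _).
  have pc (B1 B2 B3 : kalg k) (c2 : khom B2 B3) (c1 : khom B1 B2) (y : bc (lev theta X g) B1) :
      bcpush c2 (bcpush c1 y) = bcpush (khom_comp c2 c1) y.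
    elim/bc_ind: y => [b x y IH|]; last by rewrite !bcpush0.
    by rewrite !bcpush_linear IH !bcpush_in.
  by rewrite !pc FinA.
have Ja X g z : Jmap (sval (gmap inc a) (X, g) z) = ract X A'l (gmap F (ginv s)) (Jmap z).
  have lJ X' g' c (x y : bc (lev theta X' g') A') : Jmap (c *: x + y) = inA' c *: Jmap x + Jmap y.
    by rewrite /Jmap bcpush_linear eps_linear.
  elim/bc_ind: z => [c x z IH|]; last first.
    by rewrite (linear0' (Defs.lfunP _)) /Jmap bcpush0 (linear0' (@eps_linear _ _ _ _)) (linear0' (Defs.lfunP _)).
  rewrite (Defs.lfunP (sval (gmap inc a) (X, g))) !lJ IH (Defs.lfunP (ract X A'l _)); congr (_ *: _ + _).
  have gE : sval (gmap inc a) (X, g) (bcpush inc (bc_in A x)) =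
      bcpush inc (sval a (X, g) (bc_in A x)) by apply: gl_mapE.
  rewrite -(bcpush_in inc) gE !Jpush aE ghom_nat; symmetry; exact: gl_mapE.
have key : gmul (gmap F (ginv s)) (bar_chi chi A'l d1) = gmul g1 (gmap F (ginv s)).
  have D1 := hs A'l F d1; rewrite Finl in D1.
  have D2 := Umx_chi (X := E) (fun g z => hg1 E g z).
  have D3 : Cm (@wbP E) (bar_chi chi A'l d1) = diag_mx (\row_j sval d1 (cl (wv j))).
    exact: (Cm_isw (@wbP E) (lam := bar_chi chi) (@bwP E)).
  (* On matrices in [E], multiplied on the left by [U]: the rows of [U] are weight vectors for [g1]
     ([D2]), and [U] times the matrix of [s] commutes with the diagonal matrix of [d1] ([D1]). Then
     [U] is cancelled. *)
  have e : gmul (bar_chi chi A'l d1) (gmap F s) = gmul (gmap F s) g1.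
    apply: (point_eq ha gen); rewrite !CmM D3.
    have [U' [_ U'U _]] := near1_inv (@Umx_near E).
    have cancelU (Z Z' : 'M[A'l]_(wm E)) : map_mx f' (Umx E) *m Z = map_mx f' (Umx E) *m Z' -> Z = Z'.
      move=> /(congr1 (fun W0 => map_mx f' U' *m W0)); rewrite !mulmxA -map_mxM U'U.
      by rewrite map_mx1 !mul1mx.
    by apply: cancelU; rewrite !mulmxA D2 -[in RHS]mulmxA D1.
  apply: (@gmulI k G _ (gmap F s)); rewrite gmapV !gmulA gmulxV gmul1.
  apply: (@gmulIr k G _ (gmap F s)); rewrite e -!gmulA gmulV gmulx1.
  by [].
apply: sig_eq; apply: functional_extensionality_dep => -[X g]; apply: laut_eq => z.
apply: (Jmap_inj tA').
rewrite -[sval (gmul (gmap inc a) _) _ z]/(sval (gmap inc a) (X, g) (sval (chi0 A' d0) (X, g) z)).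
rewrite -[sval (gmul (chiA A' d0) _) _ z]/(sval (chiA A' d0) (X, g) (sval (gmap inc a) (X, g) z)).
rewrite Ja Jchi0 Jchi Ja.
rewrite -[LHS]/(gmul (ract X A'l _) (ract X A'l _) (Jmap z)) -ghomM key ghomM.
by [].
Qed.

Lemma inner_forms : inner_forms_matching (into_cent chiA) (into_cent (bar_chi chi)).
Proof.
have [A [a [hA hc]]] := conj_exists.
exact: (inner_forms_of_conj (iota_bij ha tO) iota_into hA hc).
Qed.
End Final.
End Levels.

Theorem theorem4p23 (R : realType) (l : nafield R)
  (hdisc : discretely_valued l) (hhens : henselian l)
  (G : grpfun (oint l)) (hsmooth : smooth_affine G)
  (hred : reductive_geometric_fibers G)
  (theta : norm_family G) (htheta : in_Ntens theta)
  (chi : ghom (Dgrp (oint l) (Gamma_quot l)) (aut_tensor theta))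
  (hchi : splits chi)
  (T : subgrp (gbc (lalg l) G)) (Tint : subgrp G) (hT : in_SG T Tint)
  (chi' : ghom (Dgrp (oint l) (Gamma R)) (subfun Tint))
  (hchi' : is_theta chi' theta) :
  inner_forms_matching (into_cent chi) (into_cent (bar_chi chi')).
Proof.
have [pi [pi0 pi1 piP]] := hdisc; have [O [a0 [ha hfp hfs]]] := hsmooth.
exact: (inner_forms pi0 pi1 piP hchi' htheta ha hfp hfs hchi).
Qed.
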